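(* Let $n\geq 2$ and let $r\in\{0,1,2,\dots,\infty\}$ with $r\neq n+1$. Then any group homomorphism from $\mathrm{Diff}^r_c(\mathbb{R}^n)_0$ to $\mathrm{Diff}^1(S^1)$ or to $\mathrm{Diff}^1(\mathbb{R})$ is trivial.
   Context: $\mathrm{Diff}^r_c(\mathbb{R}^n)_0$ denotes the identity component of the group of compactly supported $C^r$ diffeomorphisms (homeomorphisms for $r=0$) of $\mathbb{R}^n$, in the standard sense: the diffeomorphisms isotopic to the identity through $C^r$ diffeomorphisms supported in a common compact set. $\mathrm{Diff}^1(S^1)$ and $\mathrm{Diff}^1(\mathbb{R})$ are the groups of all $C^1$ diffeomorphisms of $S^1$ and $\mathbb{R}$. Homomorphisms are abstract group homomorphisms (no continuity is assumed); trivial means that every element is sent to the identity. *)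

(* Defs.v *)
From mathcomp Require Import all_boot all_order all_algebra.
From mathcomp Require Import all_classical all_reals all_analysis.
Set Implicit Arguments.
Unset Strict Implicit.
Unset Printing Implicit Defensive.
Import Order.TTheory GRing.Theory Num.Theory numFieldNormedType.Exports.
Local Open Scope classical_set_scope.
Local Open Scope ring_scope.

(* Regularity classes 0, 1, 2, ..., oo : [Some k] is C^k and [None] is
   C^infinity. *)
Definition regularity := option nat.

Definition le_reg (k : nat) (r : regularity) : bool :=
  if r is Some m then (k <= m)%N else true.

(* [iter_derive [:: v1; ..; vk] f] is the iterated directional derivative
   D_v1 (... (D_vk f)). *)
Definition iter_derive (R : realType) (V W : normedModType R)
    (vs : seq V) (f : V -> W) : V -> W :=
  foldr (fun v (g : V -> W) => ('D_v g : V -> W)) f vs.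

(* [V] is meant to be finite dimensional. There, f is C^r iff the directional
   derivatives of order <= r are continuous and those of order < r are
   differentiable. *)
Definition Cr (R : realType) (V W : normedModType R) (r : regularity)
    (f : V -> W) : Prop :=
  forall vs : seq V,
    (le_reg (size vs) r -> continuous (iter_derive vs f)) /\
    (le_reg (size vs).+1 r -> forall x, differentiable (iter_derive vs f) x).

Definition diffeo (R : realType) (V : normedModType R) (r : regularity)
    (f : V -> V) : Prop :=
  Cr r f /\ exists g : V -> V, [/\ cancel f g, cancel g f & Cr r g].

Definition supported_in (V : Type) (K : set V) (f : V -> V) : Prop :=
  forall x, ~ K x -> f x = x.

(* A path of C^r diffeomorphisms of R^n, indexed by [0, 1], supported in the
   common compact set K and continuous for the C^r topology: because of the
   common compact support this means that every space derivative of order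
   <= r is jointly continuous in (t, x). Values of F outside [0, 1] are
   irrelevant. *)
Definition isotopy_in (R : realType) (n : nat) (r : regularity)
    (K : set 'rV[R]_n) (F : R -> 'rV[R]_n -> 'rV[R]_n) : Prop :=
  (forall t, 0 <= t <= 1 -> diffeo r (F t) /\ supported_in K (F t)) /\
  (forall vs : seq 'rV[R]_n, le_reg (size vs) r ->
     {within [set p : R * 'rV[R]_n | 0 <= p.1 <= 1],
        continuous (fun p : R * 'rV[R]_n => iter_derive vs (F p.1) p.2)}).

Definition Diffc0 (R : realType) (n : nat) (r : regularity) :
    set ('rV[R]_n -> 'rV[R]_n) :=
  [set f | exists (K : set 'rV[R]_n) (F : R -> 'rV[R]_n -> 'rV[R]_n),
     [/\ compact K, isotopy_in r K F, F 0 = id & F 1 = f]].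

Definition Diff1_line (R : realType) : set (R -> R) :=
  [set f | diffeo (Some 1) f].

Definition circle (R : realType) : Type :=
  {z : R * R | z.1 ^+ 2 + z.2 ^+ 2 == 1}.

Lemma circle_param_subproof (R : realType) (t : R) :
  (cos t, sin t).1 ^+ 2 + (cos t, sin t).2 ^+ 2 == 1 :> R.
Proof. by rewrite /= cos2Dsin2. Qed.

Definition circle_param (R : realType) (t : R) : circle R :=
  exist _ (cos t, sin t) (circle_param_subproof t).

(* The covering R -> S^1 is a local diffeomorphism and S^1 is embedded in the
   plane, so a self-map of S^1 is C^1 iff the curve t |-> f(cos t, sin t) in
   the plane is. *)
Definition C1_circle (R : realType) (f : circle R -> circle R) : Prop :=
  Cr (Some 1) (fun t : R => (sval (f (circle_param t)) : R * R)).

Definition Diff1_circle (R : realType) : set (circle R -> circle R) :=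
  [set f | C1_circle f /\
     exists g, [/\ cancel f g, cancel g f & C1_circle g]].

(* Homomorphisms between groups G and H of transformations, with composition
   as group law; the values of phi outside G are irrelevant. *)
Definition group_hom (X Y : Type) (G : set (X -> X)) (H : set (Y -> Y))
    (phi : (X -> X) -> (Y -> Y)) : Prop :=
  set_fun G H phi /\
  (forall f g, G f -> G g -> phi (f \o g) = phi f \o phi g).

Definition trivial_hom (X Y : Type) (G : set (X -> X))
    (phi : (X -> X) -> (Y -> Y)) : Prop :=
  forall f, G f -> phi f = id.

(* Main.v *)
(* The group G of the theorem is perfect. After Mather, a homomorphism chi from G to an abelian group
   satisfies chi (id + Th f) = chi (id + f) for an operator Th that contracts small displacements f of
   class C^r: fragment and rescale if r < n + 1, roll up if r > n + 1. A Schauder fixed point u of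
   f |-> Th (f + v o (id + f)) yields chi (id + v) = 0. If r = 0, elements supported in a shell are
   commutators, by an infinite product.
   If a homomorphism phi kills some b <> id then phi is trivial: if f and k have supports in a ball
   disjoint from its image under b, then b f^-1 b^-1 has the same image as f^-1 and commutes with k,
   so phi has an abelian image. To find b, cut off linear maps of a plane: this gives a, b, k, k', g in
   G with a b = b^4 a, a k a = k, g k' g = k', and with g^2 commuting with a and b and g b g^-1 with a.
   An action of G on the circle lifts to the line up to translations. For C^1 diffeomorphisms of the
   line these relations force b = id: k and k' provide fixed points of a and g, and near a common fixed
   point of a and b the map b^4 moves points almost four times as far as b. *)
Require Import Defs.
From HB Require Import structures.
From mathcomp Require Import all_boot all_order all_algebra.
From mathcomp Require Import all_classical all_reals all_analysis.
From mathcomp Require Import ring lra zify.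
Set Implicit Arguments.
Unset Strict Implicit.
Unset Printing Implicit Defensive.
Import Order.TTheory GRing.Theory Num.Theory numFieldNormedType.Exports.
Local Open Scope classical_set_scope.
Local Open Scope ring_scope.

Ltac nonneg := solve [repeat first [done | apply: mulr_ge0 | apply: addr_ge0 | apply: exprn_ge0 | apply: divr_ge0
 | rewrite invr_ge0 | apply: mulr_gt0 | apply: divr_gt0 | apply: exprn_gt0 | rewrite invr_gt0 | apply: ltW]].

Lemma eq_ler (R : numDomainType) (x y : R) : x = y -> x <= y.
Proof. by move=> ->. Qed.

Section coordinates.
Context {R : realType} {n : nat}.
Local Notation V := 'rV[R]_n.

Definition basis_vec (i : 'I_n) : V := delta_mx 0 i.
Local Notation e := basis_vec.

Lemma coord_le (x : V) i : `|x 0 i| <= `|x|.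
Proof.
rewrite [leRHS]/Num.Def.normr /= mx_normrE.
by apply/bigmax_geP; right => /=; exists (0, i).
Qed.

Lemma le_coord (x : V) (M : R) : 0 <= M -> (forall i, `|x 0 i| <= M) -> `|x| <= M.
Proof.
move=> M0 h; rewrite [leLHS]/Num.Def.normr /= mx_normrE; apply: bigmax_le => // -[i j] _ /=.
by rewrite ord1.
Qed.

Lemma norm_basis_vec i : `|e i| <= 1.
Proof.
apply: le_coord => // j; rewrite mxE /=.
by case: (j == i); rewrite ?normr1 // normr0.
Qed.

Lemma basis_vec_sum (v : V) : v = \sum_i v 0 i *: e i.
Proof. exact: row_sum_delta. Qed.

Lemma sum_coord_le (h : V) (a : 'I_n -> R) (M : R) : (forall i, `|a i| <= M) -> `|\sum_i h 0 i * a i| <= n%:R * M * `|h|.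
Proof.
move=> aM; apply: le_trans (ler_norm_sum _ _ _) _.
have -> : n%:R * M * `|h| = \sum_(i < n) `|h| * M by rewrite sumr_const card_ord -mulr_natl; ring.
by apply: ler_sum => i _; rewrite normrM ler_pM // coord_le.
Qed.

Lemma derive_coords (f : V -> R) (x v : V) : differentiable f x -> 'D_v f x = \sum_i v 0 i * 'D_(e i) f x.
Proof.
move=> df; rewrite deriveE // {1}(basis_vec_sum v) linear_sum.
by apply: eq_bigr => i _; rewrite linearZ deriveE.
Qed.

Lemma diff_expansion (f : V -> R) (x : V) : differentiable f x ->
 forall eps : R, 0 < eps -> exists2 d : R, 0 < d & forall h : V, `|h| < d ->
  `|f (x + h) - f x - \sum_i h 0 i * 'D_(e i) f x| <= eps * `|h|.
Proof.
move=> df eps eps0; have /diff_locallyP[_] := df.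
move=> /eqaddoP /(_ _ eps0) /nbhs_ballP[d /= d0 H]; exists d => // h hd.
have := H h; rewrite -ball_normE /= sub0r normrN => /(_ hd) /=.
by rewrite -(derive_coords h df) deriveE // -addrA -opprD [x + h]addrC.
Qed.

Lemma diff_of_expansion (f : V -> R) (x a : V) : (forall eps : R, 0 < eps -> exists2 d : R, 0 < d & forall h : V, `|h| < d ->
  `|f (x + h) - f x - \sum_i h 0 i * a 0 i| <= eps * `|h|) -> differentiable f x /\ forall i, 'D_(e i) f x = a 0 i.
Proof.
move=> H; pose df0 (h : V) : R := \sum_i h 0 i * a 0 i.
have lin : linear df0.
 move=> k u v; rewrite /df0 scaler_sumr -big_split /=; apply: eq_bigr => i _.
 by rewrite !mxE /GRing.scale /=; ring.
pose dfL := GRing.isLinear.Build R V R _ df0 lin.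
pose df : {linear V -> R} := HB.pack df0 dfL.
have dfc : continuous df.
 move=> h; apply: differentiable_continuous.
 have -> : (df : V -> R) = \sum_i (a 0 i *: (fun y : V => y 0 i)).
  apply/funext => y; rewrite fct_sumE; apply: eq_bigr => i _. by rewrite mulrC.
 apply: differentiable_sum => i; apply: differentiableZ. exact: differentiable_coord.
have ball_bound (eps : R) : 0 < eps -> \forall h \near (0 : V), `|(f \o shift x - (cst (f x) + df)) h : R| <= eps * `|h|.
 move=> /H[d d0 Hd]; apply/nbhs_ballP; exists d => //= h. rewrite -ball_normE /= sub0r normrN => /Hd.
 by rewrite [x + h]addrC -addrA -opprD.
have dE : 'd f x = df :> (V -> R) by apply: diff_unique => //; apply/eqaddoP => eps; exact: ball_bound.
have dif : differentiable f x.
 apply/diff_locallyP; rewrite dE; split => //. by apply/eqaddoP => eps; exact: ball_bound.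
split=> // i; rewrite deriveE // dE /df /= /df0 (bigD1 i) //= big1.
 by rewrite !mxE !eqxx /= mul1r addr0.
by move=> j ji; rewrite !mxE /= (negbTE ji) mul0r.
Qed.

Lemma diff_row (u : V -> V) (x : V) : (forall i, differentiable (fun y => u y 0 i : R) x) -> differentiable u x.
Proof.
move=> H; have -> : u = \sum_i (fun y => u y 0 i *: e i).
 by apply/funext => y; rewrite fct_sumE; exact: basis_vec_sum.
by apply: differentiable_sum => i; exact: differentiableZl.
Qed.

Lemma derive_row (u : V -> V) (x v : V) i : differentiable u x -> ('D_v u x) 0 i = 'D_v (fun y => u y 0 i : R) x.
Proof.
by move=> du; rewrite derive_mx ?mxE //; exact: diff_derivable.
Qed.

Lemma derive_comp (f : V -> R) (u : V -> V) (x v : V) : differentiable u x -> differentiable f (u x) ->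
 'D_v (f \o u) x = \sum_l 'D_v (fun y => u y 0 l : R) x * 'D_(e l) f (u x).
Proof.
move=> du df; rewrite deriveE; last exact: differentiable_comp.
rewrite diff_comp //= -deriveE // derive_coords //.
by apply: eq_bigr => l _; rewrite -deriveE // derive_row.
Qed.

Lemma mvt_row (f : V -> R) (x y : V) : (forall t : R, 0 <= t <= 1 -> differentiable f (x + t *: (y - x))) ->
 exists2 t : R, 0 < t < 1 & f y - f x = \sum_i (y - x) 0 i * 'D_(e i) f (x + t *: (y - x)).
Proof.
move=> df; pose g (t : R) := f (x + t *: (y - x)).
have dl (t : R) : is_diff t (fun s : R => x + s *: (y - x)) ( *:%R^~ (y - x)).
 have -> : (fun s : R => x + s *: (y - x)) = cst x + ( *:%R^~ (y - x)) by [].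
 apply: (is_diff_eq (is_diffD (is_diff_cst x t) (is_diff_scalel t (y - x)))). by rewrite add0r.
have dg (t : R) : 0 <= t <= 1 -> is_derive t 1 (g : R -> R) ('D_(y - x) f (x + t *: (y - x))).
 move=> t01; have dft := df _ t01. have dgt : differentiable g t by apply: differentiable_comp.
 apply: DeriveDef; first exact: diff_derivable.
 rewrite deriveE // /g (@diff_comp _ _ _ _ (fun s : R => x + s *: (y - x)) f) //=.
 by rewrite diff_val /= scale1r -deriveE.
have [||t + E] := @MVT R g (fun t => 'D_(y - x) f (x + t *: (y - x))) 0 1 ltr01.
- by move=> t; rewrite in_itv /= => /andP[t0 t1]; apply: dg; rewrite !ltW.
- apply: (@continuous_in_subspaceT R R `[0, 1]%classic) => t; rewrite inE /= in_itv /= => t01.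
 apply: differentiable_continuous; apply/derivable1_diffP. by have := dg t t01; case.
rewrite in_itv /= => t01; exists t => //.
have t01' : 0 <= t <= 1 by lra.
move: E; rewrite /g scale1r scale0r addr0 subrKC subr0 mulr1 => ->.
by rewrite derive_coords //; exact: df.
Qed.

End coordinates.

Section leibniz_convolution.
Context {R : realType}.

(* [lconv w v j] bounds the order j derivatives of a product, when w and v
  bound the derivatives (and their moduli) of the factors; the recursion is
  the Leibniz rule. *)
Fixpoint lconv (w v : nat -> R) (j : nat) : R := if j is j'.+1 then lconv (w \o succn) v j' + lconv w (v \o succn) j'
 else 2 * w 0%N * v 0%N.

Lemma lconv_mono (w w' v v' : nat -> R) j : (forall i, 0 <= w i <= w' i) ->
 (forall i, 0 <= v i <= v' i) -> 0 <= lconv w v j <= lconv w' v' j.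
Proof.
elim: j w w' v v' => [|j IH] w w' v v' hw hv /=.
 have /andP[a b] := hw 0%N; have /andP[c d] := hv 0%N.
 by rewrite !mulr_ge0 //= ler_pM ?mulr_ge0 // ler_pM2l.
have /andP[a b] := IH (w \o succn) (w' \o succn) _ _ (fun i => hw i.+1) hv.
have /andP[c d] := IH _ _ (v \o succn) (v' \o succn) hw (fun i => hv i.+1).
by lra.
Qed.

Lemma lconv_geom (w v : nat -> R) a b s j : lconv (fun i => a * s ^+ i * w i) (fun i => b * s ^+ i * v i) j =
 a * b * s ^+ j * lconv w v j.
Proof.
elim: j a b w v => [|j IH] a b w v; first by rewrite /= !expr0; ring.
rewrite /=; have := IH (a * s) b (w \o succn) v.
have := IH a (b * s) w (v \o succn).
have -> : (fun i => a * s * s ^+ i * (w \o succn) i) =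
 (fun i => a * s ^+ i * w i) \o succn. by apply/funext => i /=; rewrite exprS; ring.
have -> : (fun i => b * s * s ^+ i * (v \o succn) i) =
 (fun i => b * s ^+ i * v i) \o succn. by apply/funext => i /=; rewrite exprS; ring.
by move=> -> ->; rewrite exprS; ring.
Qed.

End leibniz_convolution.

Section bounded_functions.
Context {R : realType} {n : nat}.
Local Notation V := 'rV[R]_n.
Local Notation e := (@basis_vec R n).
Implicit Types (D : set V) (om : R -> R) (w : nat -> R) (f g : V -> R).

(* The derivatives of order j <= k of f are bounded on D by w j and have there
  the modulus of continuity w j * om. *)
Fixpoint Nb D om (k : nat) w f : Prop := [/\ forall x, D x -> `|f x| <= w 0%N,
   forall x y, D x -> D y -> `|f x - f y| <= w 0%N * om `|x - y| & if k is k'.+1 then (forall x, D x -> differentiable f x) /\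
      forall i, Nb D om k' (w \o succn) ('D_(e i) f) else True].

Lemma Nb0 D om k w f : Nb D om k w f -> forall x, D x -> `|f x| <= w 0%N.
Proof. by case: k => [|k] []. Qed.

Lemma Nb_mod D om k w f : Nb D om k w f -> forall x y, D x -> D y -> `|f x - f y| <= w 0%N * om `|x - y|.
Proof. by case: k => [|k] []. Qed.

Lemma Nb_le D om k k' w f : (k' <= k)%N -> Nb D om k w f -> Nb D om k' w f.
Proof.
elim: k k' w f => [|k IH] [|k'] w f //= le; first by case.
by case=> a b [c d]; split=> //; split=> // i; apply: IH (d i).
Qed.

Lemma near_open_eq D f g (x : V) : open D -> D x -> (forall y, D y -> f y = g y) -> \near x, f x = g x.
Proof.
by move=> oD Dx fg; apply: filterS (open_nbhs_nbhs (conj oD Dx)) => y /fg.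
Qed.

Lemma near_diffble f g (x : V) : (\near x, f x = g x) -> differentiable f x -> differentiable g x.
Proof.
move=> fg df.
have [|//] := @diff_of_expansion R n g x (\row_i 'D_(e i) f x).
move=> eps eps0; have [d d0 H] := diff_expansion df eps0.
have /nbhs_ballP[d' /= d'0 H'] := fg.
exists (Num.min d d'); first by rewrite lt_min d0.
move=> h; rewrite lt_min => /andP[hd hd'].
rewrite -(H' x (ballxx _ d'0)) -(H' (x + h)); last first.
 by rewrite -ball_normE /= opprD addNKr normrN.
under eq_bigr do rewrite mxE; exact: H.
Qed.

Lemma Nb_ext D om k w f g : open D -> (forall x, D x -> f x = g x) -> Nb D om k w f -> Nb D om k w g.
Proof.
move=> oD; elim: k w f g => [|k IH] w f g fg /= [a b c]; split.
- by move=> x Dx; rewrite -fg //; exact: a.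
- by move=> x y Dx Dy; rewrite -!fg //; exact: b.
- by [].
- by move=> x Dx; rewrite -fg //; exact: a.
- by move=> x y Dx Dy; rewrite -!fg //; exact: b.
- case: c => c d; split=> [x Dx|i].
  by apply: near_diffble (c x Dx); exact: near_open_eq oD Dx fg.
 apply: IH (d i) => x Dx; apply: near_eq_derive; exact: near_open_eq oD Dx fg.
Qed.

Lemma Nb_mono D om k w w' f : (forall t, 0 <= om t) -> (forall j, (j <= k)%N -> w j <= w' j) -> Nb D om k w f -> Nb D om k w' f.
Proof.
move=> om0; elim: k w w' f => [|k IH] w w' f ww' /= [a b c].
 split=> // [x /a H|x y Dx Dy]; first exact: le_trans (ww' _ _).
 by apply: le_trans (b _ _ Dx Dy) _; rewrite ler_wpM2r // ww'.
split=> // [x /a H|x y Dx Dy|]; first exact: le_trans (ww' _ _).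
 by apply: le_trans (b _ _ Dx Dy) _; rewrite ler_wpM2r // ww'.
case: c => c d; split=> // i; apply: IH (d i) => j jk; exact: ww'.
Qed.

Lemma Nb_subset D D' om k w f : D' `<=` D -> Nb D om k w f -> Nb D' om k w f.
Proof.
move=> DD'; elim: k w f => [|k IH] w f /= [a b c]; split=> //.
- by move=> x /DD'; exact: a.
- by move=> x y /DD' ? /DD' ?; exact: b.
- by move=> x /DD'; exact: a.
- by move=> x y /DD' ? /DD' ?; exact: b.
- by case: c => c d; split=> [x /DD'|i]; [exact: c|exact: IH].
Qed.

Lemma Nb_add D om k w v f g : open D -> Nb D om k w f -> Nb D om k v g -> Nb D om k (fun j => w j + v j) (f \+ g).
Proof.
move=> oD; elim: k w v f g => [|k IH] w v f g /= [a b c] [a' b' c']; split.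
- by move=> x Dx; apply: le_trans (ler_normD _ _) _; rewrite lerD ?a ?a'.
- move=> x y Dx Dy; rewrite opprD addrACA mulrDl.
 by apply: le_trans (ler_normD _ _) _; rewrite lerD ?b ?b'.
- by [].
- by move=> x Dx; apply: le_trans (ler_normD _ _) _; rewrite lerD ?a ?a'.
- move=> x y Dx Dy; rewrite opprD addrACA mulrDl.
 by apply: le_trans (ler_normD _ _) _; rewrite lerD ?b ?b'.
- case: c => c d; case: c' => c' d'; split=> [x Dx|i].
  by apply: differentiableD; [exact: c|exact: c'].
 apply: (@Nb_ext _ _ _ _ ('D_(e i) f \+ 'D_(e i) g)) => //.
  move=> x Dx /=; rewrite deriveD //; apply: diff_derivable.
   exact: c.
  exact: c'.
 exact: IH.
Qed.

Lemma Nb_scale D om k w a f : open D -> Nb D om k w f -> Nb D om k (fun j => `|a| * w j) (fun x => a * f x).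
Proof.
move=> oD; elim: k w f => [|k IH] w f /= [p q c]; split.
- by move=> x Dx; rewrite normrM ler_wpM2l ?p.
- by move=> x y Dx Dy; rewrite -mulrBr normrM -mulrA ler_wpM2l ?q.
- by [].
- by move=> x Dx; rewrite normrM ler_wpM2l ?p.
- by move=> x y Dx Dy; rewrite -mulrBr normrM -mulrA ler_wpM2l ?q.
- case: c => c d; split=> [x Dx|i].
  by apply: (@differentiableZ _ _ _ f a x); exact: c.
 apply: (@Nb_ext _ _ _ _ (fun x => a * 'D_(e i) f x)) => //.
  move=> x Dx /=; rewrite (@deriveZ _ _ _ f a) //. by apply: diff_derivable; exact: c.
 exact: IH.
Qed.

Lemma Nb_zero D om k w : (forall t, 0 <= om t) -> (forall j, 0 <= w j) -> Nb D om k w (fun=> 0).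
Proof.
move=> om0; elim: k w => [|k IH] w w0 /=.
 by split=> // *; rewrite ?subrr normr0 ?mulr_ge0.
split=> [*|*|]; rewrite ?subrr ?normr0 ?mulr_ge0 //; split=> [x _|i].
 by [].
have -> : 'D_(e i) (fun=> 0) = (fun=> 0) :> (V -> R) by apply/funext => x; exact: derive_cst.
by apply: IH => j; exact: w0.
Qed.

Lemma Nb_sum (I : Type) (s : seq I) D om k (w : I -> nat -> R) (f : I -> V -> R) :
 (forall t, 0 <= om t) -> open D -> (forall i, Nb D om k (w i) (f i)) ->
 Nb D om k (fun j => \sum_(i <- s) w i j) (fun x => \sum_(i <- s) f i x).
Proof.
move=> om0 oD H; elim: s => [|i s IH].
 under eq_fun do rewrite big_nil. by under [X in Nb _ _ _ _ X]eq_fun do rewrite big_nil; exact: Nb_zero.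
under eq_fun do rewrite big_cons.
under [X in Nb _ _ _ _ X]eq_fun do rewrite big_cons.
exact: Nb_add.
Qed.

Lemma Nb_mul D om k w v f g : open D -> (forall t, 0 <= om t) -> Nb D om k w f -> Nb D om k v g -> Nb D om k (lconv w v) (f \* g).
Proof.
move=> oD om0; elim: k w v f g => [|k IH] w v f g.
 move=> /= [a b _] [a' b' _]; have w0 x : D x -> 0 <= w 0%N by move=> Dx; exact: le_trans (a x Dx).
 split=> // [x Dx|x y Dx Dy]; have w0x := w0 _ Dx.
  rewrite normrM; apply: le_trans (ler_pM _ _ (a _ Dx) (a' _ Dx)) _ => //.
  have := mulr_ge0 w0x (le_trans (normr_ge0 _) (a' _ Dx)); lra.
 have -> : f x * g x - f y * g y = f x * (g x - g y) + g y * (f x - f y) by ring.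
 apply: le_trans (ler_normD _ _) _; rewrite !normrM.
 apply: le_trans (lerD (ler_pM _ _ (a _ Dx) (b' _ _ Dx Dy)) (ler_pM _ _ (a' _ Dy) (b _ _ Dx Dy))) _ => //.
 by lra.
move=> Nf Ng; have [a b [c d]] := Nf; have [a' b' [c' d']] := Ng.
have [p q _] : Nb D om 0 (lconv w v) (f \* g).
 clear IH c d c' d'; have w0 x : D x -> 0 <= w 0%N by move=> Dx; exact: le_trans (a x Dx).
 split=> // [x Dx|x y Dx Dy]; have w0x := w0 _ Dx.
  rewrite normrM; apply: le_trans (ler_pM _ _ (a _ Dx) (a' _ Dx)) _ => //=.
  have := mulr_ge0 w0x (le_trans (normr_ge0 _) (a' _ Dx)); lra.
 have -> : (f \* g) x - (f \* g) y = f x * (g x - g y) + g y * (f x - f y) by rewrite /=; ring.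
 apply: le_trans (ler_normD _ _) _; rewrite !normrM.
 apply: le_trans (lerD (ler_pM _ _ (a _ Dx) (b' _ _ Dx Dy)) (ler_pM _ _ (a' _ Dy) (b _ _ Dx Dy))) _ => //=.
 by lra.
split=> //; split=> [x Dx|i].
 by apply: differentiableM; [exact: c|exact: c'].
apply: (@Nb_ext _ _ _ _ (('D_(e i) f \* g) \+ (f \* 'D_(e i) g))) => //.
 move=> x Dx /=; rewrite deriveM /GRing.scale /=; last 2 first.
 - by apply: diff_derivable; exact: (c x Dx).
 - by apply: diff_derivable; exact: (c' x Dx).
 by rewrite addrC; congr (_ + _); rewrite mulrC.
have Nf' := Nb_le (leqnSn k) Nf; have Ng' := Nb_le (leqnSn k) Ng.
apply: (@Nb_add _ _ _ (lconv (w \o succn) v) (lconv w (v \o succn))) => //.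
 by apply: IH => //; exact: d.
by apply: IH => //; exact: d'.
Qed.

End bounded_functions.

Lemma Nb_eq (R : realType) (n : nat) (D : set 'rV[R]_n) om k (w w' : nat -> R) (f f' : 'rV[R]_n -> R) :
 (forall j, w j = w' j) -> (forall x, f x = f' x) -> Nb D om k w f -> Nb D om k w' f'.
Proof. by move=> /funext -> /funext ->. Qed.

Section composition.
Context {R : realType} {n : nat}.
Local Notation V := 'rV[R]_n.
Local Notation e := (@basis_vec R n).
Implicit Types (D : set V) (om : R -> R) (w : nat -> R) (f g : V -> R).

Record modulus om (L : R) : Prop := Modulus { modulus_ge0 : forall t, 0 <= om t;
 modulus_mono : forall s t, 0 <= s -> s <= t -> om s <= om t; modulus_scale : forall t, 0 <= t -> om (L * t) <= 2 * om t;
 modulus_min : forall t, 0 <= t -> Num.min 1 t <= om t }.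

Lemma modulus_dilate om (L a t : R) : modulus om L -> 0 <= a <= L -> 0 <= t -> om (a * t) <= 2 * om t.
Proof.
move=> mo /andP[a0 aL] t0; apply: le_trans (modulus_scale mo t0).
by apply: (modulus_mono mo); rewrite ?mulr_ge0 ?ler_wpM2r.
Qed.

(* The first part says that the numbers B j are submultiplicative enough for
  weighted Leibniz sums to be bounded, the second is the shifted version
  needed for the chain rule. *)
Definition leib_weights (C : R) (B : nat -> R) : Prop := [/\ forall j, 1 <= B j, forall j, lconv B B j <= C * B j &
   forall m j, lconv (B \o succn) (fun i => B (m + i).+1) j <= C * B (m + j).+1].

Definition Nbv D om k w (eta : V -> V) : Prop := forall l, Nb D om k w (fun x => eta x 0 l).

Lemma diff_shift_id (eta : V -> V) (x : V) : (forall l, differentiable (fun y => eta y 0 l : R) x) ->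
 differentiable (fun y => y + eta y) x.
Proof.
by move=> H; apply: (@differentiableD _ _ _ id) => //; exact: diff_row.
Qed.

Lemma derive_shift_id g (eta : V -> V) (x : V) i : (forall l, differentiable (fun y => eta y 0 l : R) x) ->
 (forall y, differentiable g y) -> 'D_(e i) (fun y => g (y + eta y)) x = 'D_(e i) g (x + eta x) +
 \sum_l 'D_(e i) (fun y => eta y 0 l : R) x * 'D_(e l) g (x + eta x).
Proof.
move=> deta dg; rewrite (@derive_comp R n g (fun y => y + eta y)) //; last first.
 exact: diff_shift_id.
have dc l : 'D_(e i) (fun y : V => y 0 l : R) x = (l == i)%:R.
 rewrite -(@derive_row _ _ id) //. rewrite derive_id mxE eqxx /=; congr (_ _).
have -> : 'D_(e i) g (x + eta x) = \sum_l (l == i)%:R * 'D_(e l) g (x + eta x).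
 rewrite (bigD1 i) //= eqxx mul1r big1 ?addr0 // => j /negbTE ->. by rewrite mul0r.
rewrite -big_split /=; apply: eq_bigr => l _; rewrite -mulrDl; congr (_ * _).
have -> : (fun y => (y + eta y) 0 l : R) = (fun y : V => y 0 l : R) \+ (fun y => eta y 0 l).
 by apply/funext => y; rewrite mxE.
rewrite deriveD ?dc //; apply: diff_derivable => //.
exact: differentiable_coord.
Qed.

Lemma Nb_comp (L C d q rho1 K : R) om B D k (eta : V -> V) m G g : open D -> modulus om L -> 2 <= L -> leib_weights C B ->
 0 <= d -> 0 < rho1 -> 1 + n%:R * C * d * (rho1 * q) <= q -> 1 <= q -> Nbv D om k (fun j => d * B j * (rho1 * q) ^+ j) eta ->
 (forall x y, D x -> D y -> `|x + eta x - (y + eta y)| <= 2 * `|x - y|) ->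
 (forall j, 0 <= G (m + j)%N <= K * B (m + j)%N * rho1 ^+ (m + j)) -> Nb setT om k (fun j => G (m + j)%N) g ->
 Nb D om k (fun j => 2 * G (m + j)%N + 2 * K * (q ^+ j - 1) * B (m + j)%N * rho1 ^+ (m + j)) (fun x => g (x + eta x)).
Proof.
move=> oD mo L2 [B1 _ BC] d0 r0 qC q1 Neta lip.
have om0 := modulus_ge0 mo.
have B0 j : 0 <= B j by apply: le_trans (B1 j).
have base k' m' g' : (forall j, 0 <= G (m' + j)%N <= K * B (m' + j)%N * rho1 ^+ (m' + j)) ->
  Nb setT om k' (fun j => G (m' + j)%N) g' ->
  Nb D om 0 (fun j => 2 * G (m' + j)%N + 2 * K * (q ^+ j - 1) * B (m' + j)%N * rho1 ^+ (m' + j)) (fun x => g' (x + eta x)).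
 move=> HG Ng; split=> //= [x Dx|x y Dx Dy]; rewrite expr0 subrr !(mulr0, mul0r) addr0.
  apply: le_trans (Nb0 Ng I) _; have /andP[] := HG 0%N; lra.
 apply: le_trans (Nb_mod Ng I I) _; rewrite -mulrA mulrCA.
 have /andP[G0 _] := HG 0%N; apply: ler_wpM2l => //.
 apply: le_trans (modulus_mono mo _ (lip x y Dx Dy)) _ => //.
 by apply: (modulus_dilate mo) => //; rewrite L2 andbT.
elim: k m g Neta => [|k IH] m g Neta HG Ng; first exact: base HG Ng.
have Neta' : Nbv D om k (fun j => d * B j * (rho1 * q) ^+ j) eta by move=> l; exact: Nb_le (Neta l).
have K0 : 0 <= K.
 have /andP[a b] := HG 0%N; have := le_trans a b.
 by rewrite addn0 -mulrA pmulr_lge0 // mulr_gt0 ?exprn_gt0 // (lt_le_trans _ (B1 _)).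
case: (base _ _ _ HG Ng) => pa pb _; case: Ng => [_ _ [dg Ng]].
have deta x l : D x -> differentiable (fun y => eta y 0 l : R) x.
 by move=> Dx; have [_ _ [H _]] := Neta l; exact: H.
split=> //; split=> [x Dx|i].
 apply: (@differentiable_comp _ _ _ _ (fun y => y + eta y) g); last exact: dg.
 by apply: diff_shift_id => l; exact: deta.
pose T m j := 2 * G (m + j)%N + 2 * K * (q ^+ j - 1) * B (m + j)%N * rho1 ^+ (m + j).
have HG' j : 0 <= G (m.+1 + j)%N <= K * B (m.+1 + j)%N * rho1 ^+ (m.+1 + j) by rewrite addSnnS.
have NT l : Nb D om k (T m.+1) (fun x => 'D_(e l) g (x + eta x)).
 apply: (IH m.+1 ('D_(e l) g)) => //; have := Ng l; congr (Nb _ _ _ _ _).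
 by apply/funext => j /=; rewrite addSnnS.
pose vS : nat -> R := (fun j => d * B j * (rho1 * q) ^+ j) \o succn.
apply: (@Nb_ext _ _ _ _ _ _ (fun x => 'D_(e i) g (x + eta x) +
 \sum_l 'D_(e i) (fun y => eta y 0 l : R) x * 'D_(e l) g (x + eta x))) => //.
 move=> x Dx; rewrite derive_shift_id //; first by move=> l; exact: deta. by move=> y; exact: dg.
apply: (@Nb_mono _ _ _ _ _ (fun j => T m.+1 j + \sum_(l <- index_enum 'I_n) lconv vS (T m.+1) j)) => //; last first.
 apply: Nb_add => //; apply: Nb_sum => // l; apply: Nb_mul => //.
 by have [_ _ [_ H]] := Neta l; exact: H.
have q0 : 0 < q by lra.
have qn i' : 1 <= q ^+ i' by exact: exprn_ege1.
have rn i' : 0 < rho1 ^+ i' by nonneg.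
set s := rho1 * q in qC vS *; have s0 : 0 < s by nonneg.
move=> j _; rewrite sumr_const card_ord -[_ *+ n]mulr_natl.
have le1 i' : 0 <= vS i' <= d * s * s ^+ i' * (B \o succn) i'.
 rewrite /vS /=; apply/andP; split.
  by nonneg.
 by rewrite exprS; apply: eq_ler; ring.
have le2 i' : 0 <= T m.+1 i' <= 2 * K * rho1 ^+ m.+1 * s ^+ i' * B (m + i').+1.
 have /andP[g0 gK] := HG' i'; rewrite /T; apply/andP; split.
  by rewrite addr_ge0 // !mulr_ge0 ?subr_ge0 // ltW.
 rewrite exprMn [X in _ <= X](_ : _ = 2 * K * q ^+ i' * B (m.+1 + i')%N * rho1 ^+ (m.+1 + i')). by lra.
 by rewrite exprD addSn; ring.
have /andP[_ le3] := lconv_mono j le1 le2.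
rewrite lconv_geom in le3.
have BCj := BC m j.
have : d * s * (2 * K * rho1 ^+ m.+1) * s ^+ j * lconv (B \o succn) (fun i0 => B (m + i0).+1) j <=
  d * s * (2 * K * rho1 ^+ m.+1) * s ^+ j * (C * B (m + j).+1).
 apply: ler_wpM2l BCj; have r0' := ltW r0; have q0' := ltW q0. by nonneg.
move=> /(le_trans le3) le4.
apply: le_trans (lerD (lexx _) (ler_wpM2l (ler0n R n) le4)) _.
rewrite /T /= addnS addSn -addrA lerD2l.
have -> : n%:R * (d * s * (2 * K * rho1 ^+ m.+1) * s ^+ j * (C * B (m + j).+1)) =
  (n%:R * C * d * s) * (2 * K * q ^+ j * B (m + j).+1 * rho1 ^+ (m + j).+1).
 by rewrite exprMn -addSn exprD; ring.
have X0 : 0 <= 2 * K * q ^+ j * B (m + j).+1 * rho1 ^+ (m + j).+1 by nonneg.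
rewrite -subr_ge0; move: X0; rewrite -subr_ge0 in qC.
move=> /(mulr_ge0 qC); congr (0 <= _); rewrite /s (exprS q); ring.
Qed.

End composition.

Section ultrafilter_limits.
Context {R : realType} {I : Type} (U : set_system I) {UU : UltraFilter U}.

Lemma ultra_fmap (T : Type) (h : I -> T) : UltraFilter (h @ U).
Proof.
split=> [|G PG hG]; first exact: fmap_proper_filter.
apply/seteqP; split=> // A GA.
have [//|hA] := in_ultra_setVsetC (h @^-1` A) UU.
have G0 : G set0 by rewrite -(setICr A); apply: filterI GA _; exact: hG.
by case: (@filter_not_empty _ _ PG G0).
Qed.

Lemma cvg_sum_fun (J : Type) (s : seq J) (f : J -> I -> R) (l : J -> R) : (forall j, f j @ U --> l j) ->
 (fun i => \sum_(j <- s) f j i) @ U --> \sum_(j <- s) l j.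
Proof.
move=> H; elim: s => [|j s IH].
 by under eq_fun do rewrite big_nil; rewrite big_nil; exact: cvg_cst.
by under eq_fun do rewrite big_cons; rewrite big_cons; exact: cvgD.
Qed.

Lemma ultra_cvg (h : I -> R) (M : R) : (\forall i \near U, `|h i| <= M) -> exists l : R, h @ U --> l.
Proof.
move=> hM; have := @segment_compact R (- M) M.
rewrite compact_ultra => /(_ (h @ U)) [].
- exact: ultra_fmap.
- by apply: filterS hM => i /=; rewrite in_itv /= -ler_norml.
- by move=> l [_ hl]; exists l.
Qed.

Lemma cvg_norm_le (h : I -> R) (l M : R) : h @ U --> l -> (\forall i \near U, `|h i| <= M) -> `|l| <= M.
Proof.
move=> hl hM; rewrite leNgt; apply/negP => Ml.
have e0 : 0 < `|l| - M by lra.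
have /cvgrPdist_lt/(_ _ e0) hl' := hl.
have [i [h1 h2]] := filter_ex (filterI hM hl').
have := ler_normD (l - h i) (h i); rewrite subrK => h3.
have : `|l| < `|l| by lra.
by rewrite ltxx.
Qed.

End ultrafilter_limits.

Section function_spaces.
Context {R : realType} {n : nat}.
Local Notation V := 'rV[R]_n.
Local Notation e := (@basis_vec R n).
Implicit Types (D : set V) (om : R -> R) (w : nat -> R) (f g : V -> R).

Definition segment_closed D : Prop := forall x y (t : R), D x -> D y -> 0 <= t <= 1 -> D (y + t *: (x - y)).

Lemma Nb_derive D om k w f i : Nb D om k.+1 w f -> Nb D om k (w \o succn) ('D_(e i) f).
Proof. by move=> [_ _ [_ H]]; exact: H. Qed.

Lemma Nb_lipschitz D om k w f x y : segment_closed D -> Nb D om k.+1 w f -> D x -> D y -> `|f x - f y| <= n%:R * w 1%N * `|x - y|.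
Proof.
move=> cD [_ _ [df Nf]] Dx Dy.
have Dt (t : R) : 0 <= t <= 1 -> D (y + t *: (x - y)).
 exact: cD.
have [|t /andP[t0 t1] ->] := @mvt_row R n f y x.
 by move=> t t01; apply: df; exact: Dt.
have Dyt : D (y + t *: (x - y)) by apply: Dt; rewrite !ltW.
by apply: sum_coord_le => i; exact: Nb0 (Nf i) _ Dyt.
Qed.

Lemma Nb_affine om k w f (a c : R) (b : V) : (forall t, 0 <= om t) -> 1 <= c -> (forall t, 0 <= t -> om (`|a| * t) <= c * om t) ->
 (forall j, 0 <= w j) -> Nb setT om k w f -> Nb setT om k (fun j => c * `|a| ^+ j * w j) (fun x => f (a *: x + b)).
Proof.
move=> om0 c1 omc; elim: k w f => [|k IH] w f w0 Nf.
 case: Nf => [p q _]; split=> // [x _|x y _ _]; rewrite expr0 mulr1.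
  by apply: le_trans (p _ I) _; rewrite ler_peMl.
 apply: le_trans (q _ _ I I) _; rewrite (mulrC c) -mulrA ler_wpM2l //.
 by rewrite opprD addrACA subrr addr0 -scalerBr normrZ omc.
have [p q _] : Nb setT om 0 (fun j => c * `|a| ^+ j * w j) (fun x => f (a *: x + b)).
 case: Nf => [p q _]; split=> // [x _|x y _ _]; rewrite expr0 mulr1.
  by apply: le_trans (p _ I) _; rewrite ler_peMl.
 apply: le_trans (q _ _ I I) _; rewrite (mulrC c) -mulrA ler_wpM2l //.
 by rewrite opprD addrACA subrr addr0 -scalerBr normrZ omc.
have [_ _ [df Nf']] := Nf.
have da (x : V) : is_diff x (fun x : V => a *: x + b) ( *:%R a).
 apply: (is_diff_eq (is_diffD (is_diffZ a (is_diff_id x)) (is_diff_cst b x))). by rewrite addr0.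
split=> //; split=> [x _|i].
 by apply: (@differentiable_comp _ _ _ _ (fun x : V => a *: x + b) f); [exact: ex_diff|exact: df].
have -> : 'D_(e i) (fun x => f (a *: x + b)) = (fun x => a * 'D_(e i) f (a *: x + b)) :> (V -> R).
 apply/funext => x; rewrite deriveE; last first.
  by apply: (@differentiable_comp _ _ _ _ (fun x : V => a *: x + b) f); [exact: ex_diff|exact: df].
 rewrite (@diff_comp _ _ _ _ (fun x : V => a *: x + b) f) //; last exact: df.
 by rewrite /= diff_val linearZ /= deriveE //; exact: df.
have -> : (fun j => c * `|a| ^+ j * w j) \o succn = (fun j => `|a| * (c * `|a| ^+ j * (w \o succn) j)).
 by apply/funext => j /=; rewrite exprS; ring.
apply: Nb_scale; first exact: openT.
apply: (IH (w \o succn) ('D_(e i) f)) => [j|]; first exact: w0.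
exact: Nf'.
Qed.

Lemma Nb_sup D om k w f : (forall x, D x -> 0 <= w 0%N) -> Nb D om k w f -> Nb D (fun=> 2) k w f.
Proof.
elim: k w f => [|k IH] w f w0 Nf; have [p _ c] := Nf.
 split=> // x y Dx Dy; apply: le_trans (ler_normB _ _) _. by have := p _ Dx; have := p _ Dy; lra.
split=> // [x y Dx Dy|].
 apply: le_trans (ler_normB _ _) _. by have := p _ Dx; have := p _ Dy; lra.
case: c => c d; split=> // i; apply: IH; last exact: d.
move=> x Dx /=; exact: le_trans (Nb0 (d i) Dx).
Qed.

Lemma Nb_upgrade D om k w f : open D -> segment_closed D -> (forall t, 0 <= t -> Num.min 1 t <= om t) ->
 Nb D (fun=> 2) k.+1 w f -> Nb D om k (fun j => 2 * w j + n%:R * w j.+1) f.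
Proof.
move=> oD cD omin.
have key k' w' f' : Nb D (fun=> 2) k'.+1 w' f' -> Nb D om 0 (fun j => 2 * w' j + n%:R * w' j.+1) f'.
 move=> Nf; have [p _ [_ d]] := Nf. have w1 x : D x -> 0 <= n%:R * w' 1%N.
  move=> Dx; have [->|n0] := posnP n; first by lra.
  rewrite mulr_ge0 //; exact: le_trans (Nb0 (d (Ordinal n0)) Dx).
 split=> // [x Dx|x y Dx Dy].
  have := p _ Dx; have := w1 _ Dx; have := normr_ge0 (f' x); lra.
 have w00 : 0 <= w' 0%N by apply: le_trans (p _ Dx).
 apply: (@le_trans _ _ ((2 * w' 0%N + n%:R * w' 1%N) * Num.min 1 `|x - y|)).
  have [h|h] := leP 1 `|x - y|.
   rewrite mulr1; apply: le_trans (ler_normB _ _) _.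
   by have := p _ Dx; have := p _ Dy; have := w1 _ Dx; lra.
  apply: le_trans (Nb_lipschitz cD Nf Dx Dy) _. by rewrite mulrDl lerDr !mulr_ge0.
 apply: ler_wpM2l; last exact: omin. by apply: addr_ge0; [rewrite mulr_ge0|exact: w1 Dx].
elim: k w f => [|k IH] w f Nf; have [p q _] := key _ _ _ Nf; first by [].
have [_ _ [c d]] := Nf; split=> //; split=> // i.
by have := IH _ _ (d i).
Qed.

Lemma Nb_merge D om k k' w w' f : Nb D om k w f -> Nb D om k' w' f ->
 (k' <= k)%N -> Nb D om k (fun j => if (j <= k')%N then w' j else w j) f.
Proof.
elim: k k' w w' f => [|k IH] k' w w' f; first by case: k' => // -[].
move=> [p q [c d]] Nf kk; have p' := Nb0 Nf; have q' := Nb_mod Nf.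
split=> //; split=> // i; case: k' kk Nf => [|k'] kk.
 by move=> _; have := d i; congr (Nb _ _ _ _ _); apply/funext.
by move=> [_ _ [_ d']]; have := IH k' _ _ _ (d i) (d' i) kk.
Qed.

Lemma Nb_ultra (J : Type) (U : set_system J) {UU : UltraFilter U} om k w (f : J -> V -> R) g :
 (forall s t, 0 <= s -> s <= t -> om s <= om t) -> (forall eps : R, 0 < eps -> exists2 d : R, 0 < d &
   forall t, 0 <= t < d -> om t <= eps) -> (\forall i \near U, Nb setT om k w (f i)) ->
 (forall x, f ^~ x @ U --> g x) -> Nb setT om k w g.
Proof.
move=> om_mono om_cvg; elim: k w f g => [|k IH] w f g Nf fg.
 split=> // [x _|x y _ _].
  by apply: cvg_norm_le (fg x) _; apply: filterS Nf => i /Nb0; exact.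
 apply: cvg_norm_le (cvgB (fg x) (fg y)) _. by apply: filterS Nf => i /Nb_mod; exact.
have [p q _] : Nb setT om 0 w g.
 split=> // [x _|x y _ _].
  by apply: cvg_norm_le (fg x) _; apply: filterS Nf => i /Nb0; exact.
 apply: cvg_norm_le (cvgB (fg x) (fg y)) _. by apply: filterS Nf => i /Nb_mod; exact.
have NDf l : \forall i \near U, Nb setT om k (w \o succn) ('D_(e l) (f i)).
 by apply: filterS Nf => i [_ _ [_]]; exact.
have /choice[dg Hdg] : forall lx : 'I_n * V, exists d : R, (fun i => 'D_(e lx.1) (f i) lx.2) @ U --> d.
 move=> [l x]; apply: (@ultra_cvg _ _ _ _ _ (w 1%N)).
 by apply: filterS (NDf l) => i /Nb0; exact.
have taylor (x h : V) : `|g (x + h) - g x - \sum_l h 0 l * dg (l, x)| <= n%:R * (w 1%N * om `|h|) * `|h|.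
 apply: (@cvg_norm_le _ _ _ _ (fun i => f i (x + h) - f i x - \sum_l h 0 l * 'D_(e l) (f i) x)). apply: cvgB; first exact: cvgB.
  by apply: cvg_sum_fun => l; apply: cvgM; [exact: cvg_cst|exact: (Hdg (l, x))].
 apply: filterS Nf => i [_ _ [df Df]]. have [t _|t /andP[t0 t1]] := @mvt_row R n (f i) x (x + h).
  exact: df.
 rewrite addrAC subrr add0r => ->; rewrite -sumrB. under eq_bigr do rewrite -mulrBr.
 apply: sum_coord_le => l.
 have w1 : 0 <= w 1%N by exact: le_trans (normr_ge0 _) (Nb0 (Df l) (I : setT x)).
 apply: le_trans (Nb_mod (Df l) I I) _ => /=; rewrite ler_wpM2l // om_mono //.
 rewrite addrAC subrr add0r normrZ (ger0_norm (ltW t0)). by rewrite ler_piMl // ltW.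
have isd (x : V) : differentiable g x /\ forall l, 'D_(e l) g x = dg (l, x).
 have [|dgx Dg] := @diff_of_expansion R n g x (\row_l dg (l, x)).
  move=> eps eps0; pose M := n%:R * `|w 1%N| + 1. have M0 : 0 < M by rewrite ltr_wpDl ?mulr_ge0.
  have [d d0 Hd] := om_cvg (eps / M) (divr_gt0 eps0 M0).
  exists d => // h hd; under eq_bigr do rewrite mxE.
  apply: le_trans (taylor x h) _; rewrite ler_wpM2r //.
  have oh : om `|h| <= eps / M by apply: Hd; rewrite normr_ge0. have oh0 : 0 <= eps / M by nonneg.
  apply: (@le_trans _ _ (n%:R * (`|w 1%N| * (eps / M)))); last first.
   rewrite mulrA -[leRHS](divfK (lt0r_neq0 M0)) mulrC ler_wpM2l //. by rewrite /M lerDl.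
  have [n0|n0] := posnP n; first by rewrite (_ : n%:R = 0) ?mul0r // {1}n0.
  apply: ler_wpM2l => //; apply: le_trans (ler_wpM2l _ oh) _.
   by have [i [_ _ [_ Df]]] := filter_ex Nf; exact: le_trans (normr_ge0 _) (Nb0 (Df (Ordinal n0)) (I : setT x)).
  by rewrite ler_wpM2r // ler_norm.
 by split=> // l; rewrite Dg mxE.
split=> //; split=> [x _|l]; first by have [] := isd x.
apply: (IH (w \o succn) (fun i => 'D_(e l) (f i)) _ (NDf l)) => x.
by have [_ ->] := isd x; exact: (Hdg (l, x)).
Qed.

End function_spaces.

Section near_identity.
Context {R : realType} {n : nat}.
Local Notation V := 'rV[R]_n.

Definition vanishing (om : R -> R) : Prop := forall eps : R, 0 < eps ->
 exists2 d : R, 0 < d & forall t, 0 <= t < d -> om t <= eps.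

Record calculus (L C : R) (om : R -> R) (B : nat -> R) : Prop := Calculus { calc_mod : modulus om L; calc_L : 2 <= L;
 calc_van : vanishing om; calc_wt : leib_weights C B; calc_B0 : B 0%N = 1; calc_B1 : B 1%N = 1 }.

(* The map id + eta is thought of as a diffeomorphism close to the identity;
  rho absorbs the factors (1 + delta) ^ j which compositions produce in the
  derivatives of order j. *)
Definition disp (r : regularity) om (B : nat -> R) (K rho : R) (eta : V -> V) := forall k l, le_reg k r ->
  Nb setT om k (fun j => K * B j * rho ^+ j) (fun x => eta x 0 l).

Definition inv_disp (psi : V -> V) (y : V) : V := xget 0 [set h | h = - psi (y + h)].

Context (r : regularity) (L C : R) (om : R -> R) (B : nat -> R).
Hypotheses (r1 : le_reg 1 r) (cal : calculus L C om B).

Let B1 j : 1 <= B j. Proof. by case: (calc_wt cal) => + _ _; apply. Qed.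
Let B0 j : 0 <= B j. Proof. by apply: le_trans (B1 j). Qed.
Let om0 := modulus_ge0 (calc_mod cal).

Lemma disp_mono K K' rho rho' eta : 0 <= rho -> rho <= rho' -> K <= K' ->
 0 <= K -> disp r om B K rho eta -> disp r om B K' rho' eta.
Proof.
move=> r0 rr KK K0 H k l kr; apply: Nb_mono (H k l kr) => // j _.
have a : K * B j <= K' * B j by rewrite ler_wpM2r.
apply: le_trans (ler_wpM2r (exprn_ge0 j r0) a) _.
apply: ler_wpM2l; first by rewrite mulr_ge0 // (le_trans K0).
by rewrite lerXn2r ?nnegrE //; exact: le_trans rr.
Qed.

Lemma disp_norm K rho eta x : 0 <= K -> disp r om B K rho eta -> `|eta x| <= K.
Proof.
move=> K0 H; apply: le_coord => // l.
have r0 : le_reg 0 r by case: (r) => [[]|].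
have := Nb0 (H 0%N l r0) (I : setT x).
by rewrite (calc_B0 cal) expr0 !mulr1.
Qed.

Lemma segment_closedT : segment_closed (setT : set V). Proof. by []. Qed.

Lemma disp_lip K rho eta x y : 0 <= K -> 0 <= rho -> disp r om B K rho eta -> `|eta x - eta y| <= n%:R * (K * rho) * `|x - y|.
Proof.
move=> K0 r0 H; apply: le_coord => [|l]; first by nonneg.
rewrite !mxE; have := Nb_lipschitz segment_closedT (H 1%N l r1) I I (x := x) (y := y).
by rewrite (calc_B1 cal) expr1 mulr1.
Qed.

Lemma disp_shift_lip K rho eta x y : 0 <= K -> 0 <= rho -> n%:R * (K * rho) <= 1 -> disp r om B K rho eta ->
 `|x + eta x - (y + eta y)| <= 2 * `|x - y|.
Proof.
move=> K0 r0 K1 H; rewrite opprD addrACA; apply: le_trans (ler_normD _ _) _.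
rewrite mulr_natl mulr2n lerD2l; apply: le_trans (disp_lip _ _ K0 r0 H) _.
by rewrite ler_piMl.
Qed.

Lemma disp0 rho K : 0 <= K -> 0 <= rho -> disp r om B K rho (fun=> 0).
Proof.
move=> K0 r0 k l _; under [X in Nb _ _ _ _ X]eq_fun do rewrite mxE.
by apply: Nb_zero => // j; rewrite !mulr_ge0 ?exprn_ge0.
Qed.

Lemma disp_add K K' rho eta eta' : disp r om B K rho eta -> disp r om B K' rho eta' -> disp r om B (K + K') rho (eta \+ eta').
Proof.
move=> H H' k l kr; have := Nb_add openT (H k l kr) (H' k l kr).
apply: Nb_eq => // x; rewrite ?mxE //; ring.
Qed.

Lemma disp_scale a K rho eta : disp r om B K rho eta -> disp r om B (`|a| * K) rho (fun x => a *: eta x).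
Proof.
move=> H k l kr; have := Nb_scale a openT (H k l kr).
by apply: Nb_eq => // x; rewrite ?mxE ?mulrA.
Qed.

Lemma Nb_comp_disp k m G K d q rho1 eta g : le_reg k r -> 0 <= d -> 0 < rho1 -> 1 <= q -> 1 + n%:R * C * d * (rho1 * q) <= q ->
 n%:R * (d * (rho1 * q)) <= 1 -> disp r om B d (rho1 * q) eta ->
 (forall j, 0 <= G (m + j)%N <= K * B (m + j)%N * rho1 ^+ (m + j)) -> Nb setT om k (fun j => G (m + j)%N) g ->
 Nb setT om k (fun j => 2 * G (m + j)%N + 2 * K * (q ^+ j - 1) * B (m + j)%N * rho1 ^+ (m + j)) (fun x => g (x + eta x)).
Proof.
move=> kr d0 r0 q1 qC d1 He GK Ng.
apply: (Nb_comp openT (calc_mod cal) (calc_L cal) (calc_wt cal) d0 r0 qC q1) => //.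
 by move=> l; exact: He.
have rq0 : 0 <= rho1 * q by rewrite mulr_ge0 ?ltW // (lt_le_trans _ q1).
by move=> x y _ _; exact: (disp_shift_lip _ _ d0 rq0 d1 He).
Qed.

Lemma disp_comp K d q rho1 eta f : 0 <= K -> 0 <= d -> 0 < rho1 -> 1 <= q -> 1 + n%:R * C * d * (rho1 * q) <= q ->
 n%:R * (d * (rho1 * q)) <= 1 -> disp r om B K rho1 f -> disp r om B d (rho1 * q) eta ->
 disp r om B (2 * K) (rho1 * q) (fun x => f (x + eta x)).
Proof.
move=> K0 d0 r0 q1 qC d1 Hf He k l kr.
have := @Nb_comp_disp k 0 (fun j => K * B j * rho1 ^+ j) K d q rho1 eta (fun x => f x 0 l) kr d0 r0 q1 qC d1 He.
move=> H; apply: Nb_mono (H _ _) => // [j _||].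
- by rewrite !add0n exprMn -subr_ge0 (_ : _ - _ = 0) //; ring.
- by move=> j; rewrite lexx andbT !mulr_ge0 // exprn_ge0 // ltW.
- exact: Hf.
Qed.

Section inverse.
Context (psi : V -> V) (d q rho1 : R).
Hypotheses (d0 : 0 <= d) (rho10 : 0 < rho1) (q1 : 1 <= q)
 (qC : 1 + n%:R * C * (2 * d) * (rho1 * q) <= q) (dsmall : n%:R * (2 * d * (rho1 * q)) <= 2^-1) (Hpsi : disp r om B d rho1 psi).

Let psi_lip x y : `|psi x - psi y| <= 2^-1 * `|x - y|.
Proof.
apply: le_trans (disp_lip x y d0 (ltW rho10) Hpsi) _.
apply: ler_wpM2r => //; apply: le_trans dsmall; apply: ler_wpM2l => //.
have q0 : 0 <= q - 1 by rewrite subr_ge0.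
have := mulr_ge0 d0 (ltW rho10); move=> dr.
have := mulr_ge0 dr q0; nra.
Qed.

Lemma inv_disp_unique y h : h = - psi (y + h) -> inv_disp psi y = h.
Proof.
move=> hE; have : inv_disp psi y = - psi (y + inv_disp psi y) by rewrite /inv_disp; case: xgetP => [h' _|/(_ h)].
set h' := inv_disp psi y => h'E; apply/eqP; rewrite -subr_eq0 -normr_le0.
have : `|h' - h| <= 2^-1 * `|h' - h|.
 rewrite {1}h'E {1}hE opprK addrC -[X in _ <= _ * X]normrN opprB.
 have := psi_lip (y + h) (y + h'); congr (_ <= _ * `|_|). by rewrite opprD addrACA subrr add0r.
have := normr_ge0 (h' - h); lra.
Qed.

Let it (m : nat) : V -> V := iter m (fun eta y => - psi (y + eta y)) (fun=> 0).

Let it_disp m : disp r om B (2 * d) (rho1 * q) (it m).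
Proof.
have rq0 : 0 <= rho1 * q by rewrite mulr_ge0 ?ltW // (lt_le_trans _ q1).
elim: m => [|m IH]; first by apply: disp0 => //; rewrite mulr_ge0.
have := @disp_comp d (2 * d) q rho1 (it m) psi d0 (mulr_ge0 (ler0n _ _) d0) rho10 q1 qC _ Hpsi IH.
move=> /(_ _)/(disp_scale (-1)); rewrite normrN1 mul1r.
have -> : (fun x => -1 *: psi (x + it m x)) = it m.+1 by apply/funext => x; rewrite scaleN1r.
by apply; apply: le_trans dsmall _; lra.
Qed.

Let it_step m y : `|it m.+1 y - it m y| <= 2^-1 ^+ m * d.
Proof.
elim: m => [|m IH].
 by rewrite /= addr0 subr0 normrN expr0 mul1r; exact: (disp_norm _ d0 Hpsi).
rewrite exprS -mulrA; apply: le_trans (ler_wpM2l _ IH) => //.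
have := psi_lip (y + it m y) (y + it m.+1 y).
rewrite [X in _ <= _ * `|X|](_ : _ = - (it m.+1 y - it m y)) ?normrN; last first.
 by rewrite opprD addrACA subrr add0r opprB.
by rewrite (_ : it m.+2 y - _ = psi (y + it m y) - psi (y + it m.+1 y)) //= opprK addrC.
Qed.

Lemma disp_inv : disp r om B (2 * d) (rho1 * q) (inv_disp psi) /\ forall y, inv_disp psi y = - psi (y + inv_disp psi y).
Proof.
have [U [UU Usub]] := @ultraFilterLemma nat \oo _.
have bnd m y : `|it m y| <= 2 * d by apply: (disp_norm _ _ (it_disp m)); rewrite mulr_ge0.
have /choice[eta Heta] : forall y, exists h : V, forall l, (fun m => it m y 0 l : R) @ U --> (h 0 l : R).
 move=> y; have /choice[h Hh] : forall l, exists a : R, (fun m => it m y 0 l : R) @ U --> a.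
  move=> l; apply: (@ultra_cvg _ _ _ _ _ (2 * d)).
  by apply: nearW => m; exact: le_trans (coord_le _ _) (bnd _ _).
 by exists (\row_l h l) => l; rewrite mxE.
have Neta : disp r om B (2 * d) (rho1 * q) eta.
 move=> k l kr. apply: (@Nb_ultra _ _ _ U _ _ _ _ (fun m x => it m x 0 l)).
 - exact: modulus_mono (calc_mod cal).
 - exact: calc_van cal.
 - by apply: nearW => m; exact: it_disp.
 - by [].
have conv y (eps : R) : 0 < eps -> \forall m \near U, `|eta y - it m y| <= eps.
 move=> eps0; have : \forall m \near U, forall l, `|eta y 0 l - it m y 0 l| <= eps.
  apply: filter_forall => l. by have /cvgrPdist_le/(_ _ eps0) := Heta y l.
 apply: filterS => m H; apply: le_coord (ltW eps0) _ => l. by rewrite !mxE.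
have E y : eta y = - psi (y + eta y).
 apply/eqP; rewrite -subr_eq0 -normr_le0 opprK; apply/ler_addgt0Pr => eps eps0.
 rewrite add0r; have e3 : 0 < eps / 3 by nonneg.
 have stepU : \forall m \near U, 2^-1 ^+ m * d <= eps / 3.
  apply: Usub. have : (fun m => 2^-1 ^+ m * d : R) @ \oo --> (0 * d : R).
   apply: cvgMl; apply: cvg_expr; rewrite ger0_norm //. by lra.
  rewrite mul0r => /cvgr0Pnorm_le /(_ _ e3); apply: filterS => m. exact: le_trans (ler_norm _).
 have [m [H1 H2]] := filter_ex (filterI (conv y _ e3) stepU).
 have H3 := it_step m y; have H4 := psi_lip (y + eta y) (y + it m y).
 rewrite opprD addrACA subrr add0r in H4.
 have -> : eta y + psi (y + eta y) = (eta y - it m y) - (it m.+1 y - it m y) + (psi (y + eta y) - psi (y + it m y)).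
  rewrite (_ : it m.+1 y = - psi (y + it m y)) //. by apply/rowP => l; rewrite !mxE; ring.
 apply: le_trans (ler_normD _ _) _. apply: le_trans (lerD (ler_normB _ _) (lexx _)) _.
 have := le_trans H3 H2; lra.
have -> : inv_disp psi = eta by apply/funext => y; apply: inv_disp_unique; exact: E.
by [].
Qed.

End inverse.

End near_identity.

Section parametric_smoothness.
Context {R : realType} {n : nat}.
Local Notation V := 'rV[R]_n.
Local Notation e := (@basis_vec R n).
Implicit Types (A : set R) (F G : R -> V -> R).

Definition jcont A F : Prop := forall t x (eps : R), A t -> 0 < eps ->
 exists2 d : R, 0 < d & forall s y, A s -> `|t - s| < d -> `|x - y| < d -> `|F t x - F s y| <= eps.

(* C^k functions of x depending on a parameter t in A, all derivatives in x of
  order <= k being jointly continuous. *)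
Fixpoint Ckp A (k : nat) F : Prop := jcont A F /\ if k is k'.+1 then (forall t x, A t -> differentiable (F t) x) /\
    forall i, Ckp A k' (fun t => 'D_(e i) (F t)) else True.

Lemma Ckp_cont A k F : Ckp A k F -> jcont A F.
Proof. by case: k => [|k] []. Qed.

Lemma Ckp_le A k k' F : (k' <= k)%N -> Ckp A k F -> Ckp A k' F.
Proof.
elim: k k' F => [|k IH] [|k'] F //= le; first by case.
by case=> a [c d]; split=> //; split=> // i; apply: IH (d i).
Qed.

Lemma Ckp_ext A k F G : (forall t, A t -> F t = G t) -> Ckp A k F -> Ckp A k G.
Proof.
elim: k F G => [|k IH] F G FG /= [jc H].
 split=> // t x eps At e0; have [d d0 Hd] := jc t x eps At e0.
 by exists d => // s y As ts xy; rewrite -!FG // Hd.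
split=> [t x eps At e0|].
 have [d d0 Hd] := jc t x eps At e0. by exists d => // s y As ts xy; rewrite -!FG // Hd.
case: H => c d; split=> [t x At|i]; first by rewrite -FG //; exact: c.
by apply: IH (d i) => t At; rewrite FG.
Qed.

Lemma Ckp_reparam A A' k F (ph : R -> R) : continuous ph ->
 (forall t, A' t -> A (ph t)) -> Ckp A k F -> Ckp A' k (fun t => F (ph t)).
Proof.
move=> cph AA; have jcr F' : jcont A F' -> jcont A' (fun t => F' (ph t)).
 move=> jc t x eps At e0; have [d d0 Hd] := jc (ph t) x eps (AA t At) e0.
 have /cvgrPdist_lt/(_ _ d0)/nbhs_ballP[d' /= d'0 Hd'] := cph t.
 exists (Num.min d d'); first by rewrite lt_min d0.
 move=> s y As; rewrite !lt_min => /andP[_ ts] /andP[xy _]. by apply: Hd => //; [exact: AA|exact: Hd'].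
elim: k F => [|k IH] F /= [jc H]; split=> //; try exact: jcr.
case: H => c d; split=> [t x At|i]; first by apply: c; exact: AA.
exact: (IH _ (d i)).
Qed.

Lemma Ckp_cst A k (c : R) : Ckp A k (fun _ _ => c).
Proof.
elim: k c => [|k IH] c /=; split=> //.
- by move=> t x eps _ e0; exists 1 => // *; rewrite subrr normr0 ltW.
- by move=> t x eps _ e0; exists 1 => // *; rewrite subrr normr0 ltW.
split=> [t x _|i]; first exact: differentiable_cst.
apply: (Ckp_ext _ (IH 0)) => t _.
by apply/funext => x; rewrite derive_cst.
Qed.

Lemma Ckp_param A k : Ckp A k (fun t _ => t).
Proof.
have jc : jcont A (fun t _ => t) by move=> t x eps At e0; exists eps => // s y _ /ltW.
case: k => [|k]; split=> //; split=> [t x _|i]; first exact: differentiable_cst.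
apply: (Ckp_ext _ (Ckp_cst A k 0)) => t _.
by apply/funext => x; rewrite derive_cst.
Qed.

Lemma derive_coord i l (x : V) : 'D_(e i) (fun y : V => y 0 l : R) x = (l == i)%:R.
Proof. by rewrite -(@derive_row _ _ id) // derive_id mxE eqxx. Qed.

Lemma Ckp_coord A k l : Ckp A k (fun _ x => x 0 l).
Proof.
have jc : jcont A (fun _ x => x 0 l).
 move=> t x eps At e0; exists eps => // s y _ _ /ltW; apply: le_trans.
 by have := coord_le (x - y) l; rewrite !mxE.
case: k => [|k]; split=> //; split=> [t x _|i]; first exact: differentiable_coord.
apply: (Ckp_ext _ (Ckp_cst A k (l == i)%:R)) => t _.
by apply/funext => x; rewrite derive_coord.
Qed.

Lemma Ckp_add A k F G : Ckp A k F -> Ckp A k G -> Ckp A k (fun t => F t \+ G t).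
Proof.
have jca F' G' : jcont A F' -> jcont A G' -> jcont A (fun t => F' t \+ G' t).
 move=> jf jg t x eps At e0; have e2 : 0 < eps / 2 by nonneg.
 have [d d0 Hd] := jf t x _ At e2; have [d' d'0 Hd'] := jg t x _ At e2.
 exists (Num.min d d'); first by rewrite lt_min d0.
 move=> s y As; rewrite !lt_min => /andP[? ?] /andP[? ?] /=.
 rewrite opprD addrACA (splitr eps); apply: le_trans (ler_normD _ _) _.
 by apply: lerD; [exact: Hd|exact: Hd'].
elim: k F G => [|k IH] F G /= [jf H] [jg H']; split=> //; try exact: jca.
case: H => c d; case: H' => c' d'; split=> [t x At|i].
 by apply: differentiableD; [exact: c|exact: c'].
apply: Ckp_ext (IH _ _ (d i) (d' i)) => t At; apply/funext => x /=.
by rewrite deriveD //; apply: diff_derivable; [exact: c|exact: c'].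
Qed.

Lemma Ckp_mul A k F G : Ckp A k F -> Ckp A k G -> Ckp A k (fun t => F t \* G t).
Proof.
have jcm F' G' : jcont A F' -> jcont A G' -> jcont A (fun t => F' t \* G' t).
 move=> jf jg t x eps At e0. pose M := `|F' t x| + `|G' t x| + 1. have M0 : 0 < M by rewrite ltr_wpDl.
 pose e' := Num.min 1 (eps / (2 * M)). have e'0 : 0 < e' by rewrite lt_min ltr01 divr_gt0 // mulr_gt0.
 have e'1 : e' <= 1 by rewrite ge_min lexx.
 have e'2 : 2 * M * e' <= eps by rewrite mulrC -ler_pdivlMr ?mulr_gt0 // ge_min lexx orbT.
 have [d d0 Hd] := jf t x _ At e'0; have [d' d'0 Hd'] := jg t x _ At e'0.
 exists (Num.min d d'); first by rewrite lt_min d0.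
 move=> s y As; rewrite !lt_min => /andP[t1 t2] /andP[x1 x2] /=.
 have h1 := Hd s y As t1 x1; have h2 := Hd' s y As t2 x2. have -> : F' t x * G' t x - F' s y * G' s y =
  (F' t x - F' s y) * G' t x + (G' t x - G' s y) * F' t x - (F' t x - F' s y) * (G' t x - G' s y) by ring.
 apply: le_trans (ler_normB _ _) _. apply: le_trans (lerD (ler_normD _ _) (lexx _)) _; rewrite !normrM.
 apply: le_trans e'2; rewrite /M. move: h1 h2 e'0 e'1; move: (normr_ge0 (F' t x - F' s y)).
 move: (normr_ge0 (G' t x - G' s y)) (normr_ge0 (F' t x)) (normr_ge0 (G' t x)).
 move: `|F' t x - F' s y| `|G' t x - G' s y| `|F' t x| `|G' t x| => a b c d1.
 move=> b0 c0 d10 a0 ae be e'0 e'1. have := ler_wpM2r d10 ae; have := ler_wpM2r c0 be.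
 have := ler_pM a0 b0 ae (le_trans be e'1); nra.
elim: k F G => [|k IH] F G; first by move=> [jf _] [jg _]; split=> //; exact: jcm.
move=> CF CG; have [jf [c d]] := CF; have [jg [c' d']] := CG.
split; first exact: jcm.
split=> [t x At|i].
 by apply: differentiableM; [exact: c|exact: c'].
have CF' := Ckp_le (leqnSn k) CF; have CG' := Ckp_le (leqnSn k) CG.
apply: Ckp_ext (Ckp_add (IH _ _ CF' (d' i)) (IH _ _ CG' (d i))) => t At.
apply/funext => x /=.
by rewrite deriveM //; apply: diff_derivable; [exact: c|exact: c'].
Qed.

Lemma Ckp_sum A k (I : Type) (s : seq I) (F : I -> R -> V -> R) :
 (forall i, Ckp A k (F i)) -> Ckp A k (fun t x => \sum_(i <- s) F i t x).
Proof.
move=> H; elim: s => [|i s IH].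
 apply: (Ckp_ext _ (Ckp_cst A k 0)) => t _. by apply/funext => x; rewrite big_nil.
apply: (Ckp_ext _ (Ckp_add (H i) IH)) => t _.
by apply/funext => x; rewrite big_cons.
Qed.

Lemma Ckp_scale A k a F : Ckp A k F -> Ckp A k (fun t x => a * F t x).
Proof. by move=> CF; apply: Ckp_mul CF; exact: Ckp_cst. Qed.

Lemma Ckp_derive A k F (v : V) : Ckp A k.+1 F -> Ckp A k (fun t => 'D_v (F t)).
Proof.
move=> [_ [c d]]; apply: (Ckp_ext _ (@Ckp_sum A k _ (index_enum 'I_n) (fun i t x => v 0 i * 'D_(e i) (F t) x) _)) => [t At|i].
 by apply/funext => x; rewrite derive_coords //; exact: c.
by apply: Ckp_scale; exact: d.
Qed.

Lemma Ckp_iter A k (vs : seq V) F : Ckp A (k + size vs) F -> Ckp A k (fun t => iter_derive vs (F t)).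
Proof.
elim: vs k => [|v vs IH] k; first by rewrite addn0.
by rewrite /= addnS -addSn => CF; apply: Ckp_derive; exact: IH.
Qed.

Definition Ckpv A k (F : R -> V -> V) := forall l, Ckp A k (fun t x => F t x 0 l).

Lemma Ckpv_differentiable A k (F : R -> V -> V) t x : Ckpv A k.+1 F -> A t -> differentiable (F t) x.
Proof.
by move=> CF At; apply: diff_row => l; have [_ [+ _]] := CF l; exact.
Qed.

Lemma iter_derive_coord A (vs : seq V) (F : R -> V -> V) t x l : A t -> Ckpv A (size vs) F ->
 iter_derive vs (F t) x 0 l = iter_derive vs (fun y => F t y 0 l : R) x.
Proof.
move=> At; elim: vs x l => [//|v vs IH] x l CF /=.
have CF' : Ckpv A (size vs) F by move=> m; exact: Ckp_le (CF m).
rewrite derive_row.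
 by congr ('D_v _ x); apply/funext => y; rewrite IH.
apply: diff_row => m.
have -> : (fun y => iter_derive vs (F t) y 0 m) = iter_derive vs (fun y => F t y 0 m : R) by apply/funext => y; rewrite IH.
by have [_ [+ _]] := @Ckp_iter A 1 vs _ (CF m); exact.
Qed.

Lemma Ckp_of_iter A r (F : R -> V -> V) : (forall vs, le_reg (size vs) r -> forall l,
   jcont A (fun t x => iter_derive vs (F t) x 0 l)) -> (forall vs, le_reg (size vs).+1 r -> forall t x, A t ->
   differentiable (iter_derive vs (F t)) x) -> forall k, le_reg k r -> Ckpv A k F.
Proof.
move=> H1 H2 k kr l.
suff H vs : le_reg (k + size vs) r -> Ckp A k (fun t x => iter_derive vs (F t) x 0 l) by apply: (H [::]); rewrite addn0.
elim: k {kr} vs => [|k IH] vs le; first by split=> //; exact: H1.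
have le1 m : (m <= k.+1 + size vs)%N -> le_reg m r by case: (r) le => [a|] //=; lia.
split; first by apply: H1; apply: le1; lia.
have dF t x : A t -> differentiable (iter_derive vs (F t)) x by apply: H2; apply: le1; lia.
split=> [t x At|i].
 apply: (@differentiable_comp _ _ _ _ _ (fun v : V => v 0 l : R)); first exact: dF.
 exact: differentiable_coord.
apply: Ckp_ext (IH (e i :: vs) _); last by apply: le1; rewrite /=; lia.
by move=> t At; apply/funext => x /=; rewrite derive_row //; exact: dF.
Qed.

Lemma jcont_comp A F (G : R -> V -> V) : jcont A F -> (forall l, jcont A (fun t x => G t x 0 l)) ->
 jcont A (fun t x => F t (G t x)).
Proof.
move=> jf jg t x eps At e0; have [d d0 Hd] := jf t (G t x) eps At e0.
have d20 : 0 < d / 2 by nonneg.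
have /choice[dl Hdl] : forall l, exists d' : R, 0 < d' /\ forall s y, A s ->
  `|t - s| < d' -> `|x - y| < d' -> `|G t x 0 l - G s y 0 l| <= d / 2.
 by move=> l; have [d' ? ?] := jg l t x _ At d20; exists d'.
exists (\big[Num.min/d]_l dl l).
 by apply: lt_bigmin => // l _; have [] := Hdl l.
have H l : \big[Num.min/d]_l dl l <= dl l by exact: bigmin_le_cond.
move=> s y As ts xy; apply: Hd => //.
 by apply: lt_le_trans ts _; exact: bigmin_le_id.
apply: (@le_lt_trans _ _ (d / 2)); last by rewrite ltr_pdivrMr // ltr_pMr // ltr1n.
apply: le_coord (ltW d20) _ => l; rewrite !mxE.
by have [_ HH] := Hdl l; apply: HH => //; [apply: lt_le_trans ts _|apply: lt_le_trans xy _].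
Qed.

Lemma Ckp_comp A k F (G : R -> V -> V) : Ckp A k F -> Ckpv A k G -> Ckp A k (fun t x => F t (G t x)).
Proof.
elim: k F => [|k IH] F CF CG.
 by split=> //; apply: jcont_comp; [exact: Ckp_cont CF|move=> l; exact: Ckp_cont (CG l)].
have [jf [c d]] := CF.
have dG t x : A t -> differentiable (G t) x by exact: Ckpv_differentiable.
have CG' : Ckpv A k G by move=> l; exact: Ckp_le (CG l).
split; first by apply: jcont_comp => // l; exact: Ckp_cont (CG l).
split=> [t x At|i].
 by apply: (@differentiable_comp _ _ _ _ (G t) (F t)); [exact: dG|exact: c].
apply: (Ckp_ext _ (@Ckp_sum A k _ (index_enum 'I_n)
 (fun l t x => 'D_(e i) (fun y => G t y 0 l : R) x * 'D_(e l) (F t) (G t x)) _)).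
 move=> t At; apply/funext => x. by rewrite (@derive_comp _ _ (F t) (G t)) //; [exact: dG|exact: c].
move=> l; apply: Ckp_mul; first by have [_ [_]] := CG l; exact.
by apply: (IH _ (d l)).
Qed.

Lemma Ckp_Nb A om k w (f : V -> R) : vanishing om -> 0 <= w 0%N -> Nb setT om k w f -> Ckp A k (fun=> f).
Proof.
move=> vom; elim: k w f => [|k IH] w f w0 Nf.
 split=> // t x eps At e0. have e' : 0 < eps / (w 0%N + 1) by rewrite divr_gt0 // ltr_wpDl.
 have [d d0 Hd] := vom _ e'; exists d => // s y _ _ xy. apply: le_trans (Nb_mod Nf I I) _.
 apply: le_trans (ler_wpM2l w0 (Hd _ _)) _; first by rewrite normr_ge0.
 rewrite mulrA ler_pdivrMr ?ltr_wpDl // mulrC ler_wpM2l ?ltW //. by lra.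
have [jc _] : Ckp A 0 (fun=> f).
 split=> // t x eps At e0. have e' : 0 < eps / (w 0%N + 1) by rewrite divr_gt0 // ltr_wpDl.
 have [d d0 Hd] := vom _ e'; exists d => // s y _ _ xy. apply: le_trans (Nb_mod Nf I I) _.
 apply: le_trans (ler_wpM2l w0 (Hd _ _)) _; first by rewrite normr_ge0.
 rewrite mulrA ler_pdivrMr ?ltr_wpDl // mulrC ler_wpM2l ?ltW //. by lra.
have [_ _ [df Nf']] := Nf; split=> //; split=> [t x _|i]; first exact: df.
apply: (IH (w \o succn)); last exact: Nf'.
exact: le_trans (normr_ge0 _) (Nb0 (Nf' i) (I : setT (0 : V))).
Qed.

End parametric_smoothness.

Lemma Ckp_opp (R : realType) (n : nat) (A : set R) k (F : R -> 'rV[R]_n -> R) : Ckp A k F -> Ckp A k (fun t x => - F t x).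
Proof. by move=> CF; apply: Ckp_ext (Ckp_scale (-1) CF) => t _; apply/funext => x; rewrite mulN1r. Qed.

Lemma Ckp_onem (R : realType) (n : nat) (A : set R) k (F : R -> 'rV[R]_n -> R) : Ckp A k F -> Ckp A k (fun t x => 1 - F t x).
Proof. by move=> CF; apply: Ckp_add (Ckp_cst _ _ 1) (Ckp_opp CF). Qed.

Section diffeomorphism_group.
Context {R : realType} {n : nat}.
Local Notation V := 'rV[R]_n.
Implicit Types (r : regularity) (f g : V -> V).

Definition Crv r f : Prop := forall k, le_reg k r -> Ckpv [set 0] k (fun=> f).

Lemma jcont_continuous (f : V -> R) : continuous f <-> jcont [set (0 : R)] (fun=> f).
Proof.
split=> [cf t x eps _ e0|jc x].
 have /(@cvgrPdist_le _ _ _ _ (nbhs_filter x))/(_ _ e0)/nbhs_ballP[d /= d0 Hd] := cf x.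
 by exists d => // s y _ _ xy; apply: Hd; rewrite -ball_normE.
apply/(@cvgrPdist_le _ _ _ _ (nbhs_filter x)) => eps e0.
have [d d0 Hd] := jc 0 x eps erefl e0.
apply/nbhs_ballP; exists d => //= y xy; apply: (Hd 0 y erefl).
 by rewrite subr0 normr0.
by move: xy; rewrite -ball_normE.
Qed.

Lemma continuous_coords (f : V -> V) : (forall l, continuous (fun x => f x 0 l : R)) -> continuous f.
Proof.
move=> H x; apply/(@cvgrPdist_le _ _ _ _ (nbhs_filter x)) => eps e0.
have : \forall y \near x, forall l, `|f x 0 l - f y 0 l| <= eps.
 apply: (@filter_forall _ _ _ _ (nbhs_filter x)) => l.
 by have /(@cvgrPdist_le _ _ _ _ (nbhs_filter x))/(_ _ e0) := H l x.
by apply: filterS => y Hy; apply: le_coord (ltW e0) _ => l; rewrite !mxE.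
Qed.

Lemma coord_cont (f : V -> V) l : continuous f -> continuous (fun x => f x 0 l : R).
Proof.
move=> cf x; apply: (@continuous_comp _ _ _ f (fun v : V => v 0 l : R)) (cf x) _.
exact: coord_continuous.
Qed.

Lemma CrvP r f : Cr r f <-> Crv r f.
Proof.
split=> [cf k kr|H vs].
 apply: Ckp_of_iter kr => [vs le l|vs le t x _]; last by have [_] := cf vs; exact.
 apply/jcont_continuous; apply: coord_cont. by have [+ _] := cf vs; exact.
split=> le.
 apply: continuous_coords => l; apply/jcont_continuous.
 have -> : (fun x => iter_derive vs f x 0 l) = iter_derive vs (fun y => f y 0 l : R).
  by apply/funext => x; apply: (@iter_derive_coord _ _ [set 0] vs (fun=> f) 0) => //; exact: H.
 by apply: Ckp_cont (@Ckp_iter _ _ _ 0 vs _ (H _ le l)).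
move=> x; apply: diff_row => l.
have -> : (fun x => iter_derive vs f x 0 l) = iter_derive vs (fun y => f y 0 l : R).
 apply/funext => y; apply: (@iter_derive_coord _ _ [set 0] vs (fun=> f) 0) => // m.
 by apply: Ckp_le (H _ le m).
by have [_ [+ _]] := @Ckp_iter _ _ _ 1 vs _ (H _ le l); move=> /(_ 0); exact.
Qed.

Lemma Crv_id r : Crv r id.
Proof. by move=> k _ l; exact: Ckp_coord. Qed.

Lemma Crv_comp r f g : Crv r f -> Crv r g -> Crv r (f \o g).
Proof.
move=> cf cg k kr l; apply: (@Ckp_comp _ _ [set 0] k (fun _ x => f x 0 l) (fun=> g)).
 exact: cf.
exact: cg.
Qed.

Lemma diffeoP r f : diffeo r f <-> Crv r f /\ exists g, [/\ cancel f g, cancel g f & Crv r g].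
Proof.
split=> [[/CrvP cf [g [a b /CrvP c]]]|[cf [g [a b c]]]].
 by split=> //; exists g; split.
by split; [exact/CrvP|exists g; split=> //; exact/CrvP].
Qed.

Lemma diffeo_comp r f g : diffeo r f -> diffeo r g -> diffeo r (f \o g).
Proof.
move=> /diffeoP[cf [f' [a b c]]] /diffeoP[cg [g' [a' b' c']]]; apply/diffeoP; split.
 exact: Crv_comp.
exists (g' \o f'); split; [exact: can_comp|exact: can_comp|exact: Crv_comp].
Qed.

Definition unit_itv : set R := [set t | 0 <= t <= 1].

Lemma within_joint_cont (F : R -> V -> V) : {within [set p : R * V | 0 <= p.1 <= 1], continuous (fun p => F p.1 p.2)} <->
 forall l, jcont unit_itv (fun t x => F t x 0 l).
Proof.
rewrite subspace_continuousP; split=> [H l t x eps t01 e0|H [t x] /= t01].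
 have := H (t, x) t01 => /cvgrPdist_le/(_ _ e0); rewrite /within /= => -[[Q1 Q2] /=].
 move=> [/nbhs_ballP[d1 /= d10 H1] /nbhs_ballP[d2 /= d20 H2]] H3.
 exists (Num.min d1 d2); first by rewrite lt_min d10.
 move=> s y s01; rewrite !lt_min => /andP[ts _] /andP[_ xy].
 have := H3 (s, y) (conj (H1 _ ts) _) s01; rewrite /=. have xy' : ball x d2 y by rewrite -ball_normE.
 move=> /(_ (H2 _ xy')); apply: le_trans. by have := coord_le (F t x - F s y) l; rewrite !mxE.
apply/cvgrPdist_le => eps e0.
have /choice[d Hd] : forall l, exists d : R, 0 < d /\ forall s y, 0 <= s <= 1 ->
  `|t - s| < d -> `|x - y| < d -> `|F t x 0 l - F s y 0 l| <= eps.
 by move=> l; have [d' ? ?] := H l t x eps t01 e0; exists d'.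
pose d0 := \big[Num.min/1]_l d l.
have d00 : 0 < d0 by apply: lt_bigmin => // l _; have [] := Hd l.
have d0l l : d0 <= d l by exact: bigmin_le_cond.
exists (ball t d0, ball x d0); first by split; apply: nbhsx_ballx.
move=> [s y] /= [ts xy] s01; rewrite -ball_normE /= in xy.
apply: le_coord (ltW e0) _ => l; rewrite !mxE.
have [_ HH] := Hd l; apply: HH => //; [exact: lt_le_trans ts _|exact: lt_le_trans xy _].
Qed.

Lemma isotopyP r (K : set V) (F : R -> V -> V) : isotopy_in r K F <->
 (forall t, 0 <= t <= 1 -> diffeo r (F t) /\ supported_in K (F t)) /\ (forall k, le_reg k r -> Ckpv unit_itv k F).
Proof.
split=> [[dF cF]|[dF cF]]; split=> //.
 apply: Ckp_of_iter => [vs le l|vs le t x t01]; last first.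
  by have [[+ _] _] := dF t t01; move=> /(_ vs)[_]; exact.
 exact: ((within_joint_cont (fun t => iter_derive vs (F t))).1 (cF vs le) l).
move=> vs le.
apply/(within_joint_cont (fun t x => iter_derive vs (F t) x)) => l.
have := Ckp_cont (@Ckp_iter _ _ unit_itv 0 vs _ (cF _ le l)).
move=> jc t x eps t01 e0; have [d d0 Hd] := jc t x eps t01 e0; exists d => //.
move=> s y s01 ts xy; rewrite !(@iter_derive_coord _ _ unit_itv) //; last 2 first.
- exact: cF.
- exact: cF.
exact: Hd.
Qed.

Local Notation G := (@Diffc0 R n).

Lemma supported_comp (K : set V) f g : supported_in K f -> supported_in K g -> supported_in K (f \o g).
Proof. by move=> hf hg x nKx /=; rewrite hg // hf. Qed.

Lemma supported_sub (K K' : set V) f : K `<=` K' -> supported_in K f -> supported_in K' f.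
Proof. by move=> KK hf x nK'x; apply: hf => /KK. Qed.

Lemma Dc_comp r f g : G r f -> G r g -> G r (f \o g).
Proof.
move=> [K [F [cK /isotopyP[dF sF] F0 F1]]] [K' [F' [cK' /isotopyP[dF' sF'] F'0 F'1]]].
exists (K `|` K'), (fun t => F t \o F' t); split.
- exact: compactU.
- apply/isotopyP; split=> [t t01|k kr l].
  have [d s] := dF t t01; have [d' s'] := dF' t t01. split; first exact: diffeo_comp.
  by apply: supported_comp; [apply: supported_sub s => x; left| apply: supported_sub s' => x; right].
 by apply: (@Ckp_comp _ _ _ _ (fun t x => F t x 0 l)); [exact: sF|exact: sF'].
- by rewrite F0 F'0.
- by rewrite F1 F'1.
Qed.

Lemma Dc_id r : G r id.
Proof.
exists set0, (fun=> id); split=> //; first exact: compact0.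
apply/isotopyP; split=> [t _|k _ l]; last exact: Ckp_coord.
split=> //; apply/diffeoP; split; first exact: Crv_id.
by exists id; split=> //; exact: Crv_id.
Qed.

Lemma Dc_inv r f : G r f -> exists g, [/\ G r g, cancel f g & cancel g f].
Proof.
move=> [K [F [cK /isotopyP[dF sF] F0 F1]]].
have one01 : 0 <= (1 : R) <= 1 by lra.
have [/diffeoP[cf [g [fg gf cg]]] sf] := dF 1 one01; rewrite F1 in cf fg gf sf.
have sg : supported_in K g by move=> x nK; rewrite -{1}(sf x nK) fg.
exists g; split=> //; exists K, (fun t => F (1 - t) \o g); split=> //.
- have flip t : unit_itv t -> unit_itv (1 - t).
  by rewrite /unit_itv /= => /andP[t0 t1]; rewrite subr_ge0 t1 /= gerBl.
 apply/isotopyP; split=> [t t01|k kr l].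
  have [d s] := dF _ (flip t t01); split; last exact: supported_comp.
  apply: diffeo_comp => //; apply/diffeoP; split=> //; exists f; split=> //.
 apply: (@Ckp_comp _ _ _ _ (fun t x => F (1 - t) x 0 l)).
  apply: (@Ckp_reparam _ _ unit_itv _ k (fun t x => F t x 0 l) (fun t => 1 - t)) => //.
  + by move=> t; apply: continuousB; [exact: cst_continuous|exact: cvg_id].
  + exact: sF.
 move=> m; apply: (@Ckp_reparam _ _ [set 0] unit_itv k (fun t x => g x 0 m) (fun=> 0)) => //.
  exact: cst_continuous.
 exact: cg.
- by rewrite subr0 F1; apply/funext => x /=; rewrite gf.
- by rewrite subrr F0.
Qed.

Lemma Dc_supp r f : G r f -> exists2 M : R, 0 < M & forall x, M < `|x| -> f x = x.
Proof.
move=> [K [F [cK [dF _] F0 F1]]].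
have one01 : 0 <= (1 : R) <= 1 by lra.
have [_ sf] := dF 1 one01; rewrite F1 in sf.
have [M [_ HM]] := compact_bounded cK.
exists (`|M| + 1); first by rewrite ltr_wpDl.
move=> x xM; apply: sf => /(HM (`|M| + 1)).
by rewrite (le_lt_trans (ler_norm M)) ?ltrDl // => /(_ isT) /=; rewrite leNgt xM.
Qed.

Lemma Dc_diffeo r f : G r f -> diffeo r f.
Proof.
move=> [K [F [_ [dF _] _ F1]]].
by have [|] := dF 1; [rewrite ler01 lexx|rewrite F1].
Qed.

Lemma Dc_le r r' f : (forall k, le_reg k r' -> le_reg k r) -> G r f -> G r' f.
Proof.
move=> rr [K [F [cK /isotopyP[dF sF] F0 F1]]].
exists K, F; split=> //; apply/isotopyP; split=> [t t01|k /rr]; last exact: sF.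
have [/diffeoP[cf [g [a b c]]] s] := dF t t01; split=> //; apply/diffeoP.
split=> [k /rr|]; first exact: cf.
by exists g; split=> // k /rr; exact: c.
Qed.

Lemma Dc_near_id r L C om B (eta : V -> V) (M d rho : R) : le_reg 1 r -> calculus L C om B -> 0 <= d -> 0 < rho -> 0 <= C ->
 4 * (n%:R * C * (2 * d) * rho) <= 1 -> 4 * (n%:R * (2 * d * rho)) <= 1 ->
 disp r om B d rho eta -> (forall x, M < `|x| -> eta x = 0) -> G r (fun x => x + eta x).
Proof.
move=> r1 cal d0 rho0 C0 dC dn He sup.
have key t : 0 <= t <= 1 -> disp r om B d rho (fun x => t *: eta x).
 move=> /andP[t0 t1]; have := disp_scale t He; apply: (disp_mono cal) => //.
 - by nonneg.
 - by rewrite ger0_norm // ler_piMl.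
 - by nonneg.
have van := calc_van cal.
have Cdisp K rho' (eta' : V -> V) k l : 0 <= K -> disp r om B K rho' eta' -> le_reg k r ->
  forall A, Ckp A k (fun _ x => eta' x 0 l).
 move=> K0 H kr A; apply: (@Ckp_Nb _ _ A om k (fun j => K * B j * rho' ^+ j)) => //.
  by rewrite expr0 mulr1 mulr_ge0 // (calc_B0 cal).
 exact: H.
have Cid_add K rho' (eta' : V -> V) : 0 <= K -> disp r om B K rho' eta' -> Crv r (fun x => x + eta' x).
 move=> K0 H k kr l. apply: (Ckp_ext _ (Ckp_add (Ckp_coord _ _ l) (Cdisp _ _ _ k l K0 H kr _))).
 by move=> t _; apply/funext => x; rewrite mxE.
exists [set x | `|x| <= M], (fun t x => x + t *: eta x); split.
- apply: bounded_closed_compact.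
  by exists M; split; rewrite ?num_real // => M' MM' x /=; move/le_trans; apply; exact: ltW.
 have -> : [set x : V | `|x| <= M] = Num.norm @^-1` [set y : R | y <= M] by [].
 by apply: closed_comp; [move=> x _; exact: norm_continuous|exact: closed_le].
- apply/isotopyP; split=> [t t01|k kr l]; last first.
  apply: (Ckp_ext _ (Ckp_add (Ckp_coord _ _ l) (Ckp_mul (Ckp_param _ _) (Cdisp _ _ _ k l d0 He kr _)))).
  by move=> t _; apply/funext => x; rewrite !mxE.
 split; last by move=> x /= /negP; rewrite -ltNge => /sup ->; rewrite scaler0 addr0.
 apply/diffeoP; split; first exact: Cid_add (key t t01). have q1 : 1 <= (2 : R) by lra.
 have [||Ki Ei] := @disp_inv R n r L C om B r1 cal (fun x => t *: eta x) d 2 rho d0 rho0 q1 _ _ (key t t01).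
 + by lra.
 + by lra. exists (fun y => y + inv_disp (fun x => t *: eta x) y); split.
 + move=> x; have -> : inv_disp (fun x => t *: eta x) (x + t *: eta x) = - (t *: eta x).
   apply: (@inv_disp_unique R n r L C om B r1 cal (fun x => t *: eta x) d 2 rho d0 rho0 q1 _ (key t t01)).
   * by lra.
   * by rewrite addrK.
  by rewrite addrK.
 + by move=> y; rewrite -[t *: eta _]opprK -Ei addrK.
 + by apply: Cid_add Ki; rewrite mulr_ge0.
- by apply/funext => x; rewrite scale0r addr0.
- by apply/funext => x; rewrite scale1r.
Qed.

End diffeomorphism_group.

Section weights_and_moduli.
Context {R : realType}.

Lemma lconvS (w v : nat -> R) j : lconv w v j.+1 = lconv (w \o succn) v j + lconv w (v \o succn) j.
Proof. by []. Qed.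

Lemma lconv_split (w v : nat -> R) (j : nat) (M : R) : (forall i, 0 <= w i) -> (forall i, 0 <= v i) -> 0 <= M ->
 (forall i, (0 < i < j)%N -> w i * v (j - i)%N <= M) -> (0 < j)%N ->
 lconv w v j <= 2 * (w 0%N * v j) + 2 * (w j * v 0%N) + (4 * 2 ^+ j - 4) * M.
Proof.
case: j => // j; elim: j w v => [|j IH] w v w0 v0 M0 H _.
 rewrite /= expr1; have : 0 <= (4 * 2 - 4) * M by nonneg. lra.
rewrite lconvS.
have h1 : lconv w (v \o succn) j.+1 <= 2 * (w 0%N * v j.+2) + 2 * (w j.+1 * v 1%N) + (4 * 2 ^+ j.+1 - 4) * M.
 apply: (IH w (v \o succn)) => // [i|i ij]; first exact: v0. by rewrite /= -subSn; [apply: H; lia|lia].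
have h2 : lconv (w \o succn) v j.+1 <= 2 * (w 1%N * v j.+1) + 2 * (w j.+2 * v 0%N) + (4 * 2 ^+ j.+1 - 4) * M.
 apply: (IH (w \o succn) v) => // [i|i ij]; first exact: w0.
 by have := H i.+1; rewrite subSS; apply; lia.
have h3 := H 1%N isT; rewrite subSS subn0 in h3.
have h4 := H j.+1; rewrite subSnn ltnSn /= in h4; have := h4 isT.
move=> h5; rewrite (exprS 2 j.+1).
move: h1 h2; set T := 2 ^+ _; set a := lconv _ _ _; set b := lconv _ _ _; lra.
Qed.

Fixpoint weight_seq (r0 : nat) (ell : nat -> R) (j : nat) : R := if j is j'.+1 then if (j <= r0)%N then 1
  else Num.max 1 (ell j) * (4 ^+ j * weight_seq r0 ell j' ^+ 2) else 1.

Definition leib_const (r0 : nat) : R := 8 + 4 * 2 ^+ r0.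

Lemma weights_exist (r0 : nat) (ell : nat -> R) : (0 < r0)%N -> exists B : nat -> R,
 [/\ leib_weights (leib_const r0) B, forall j, (j <= r0)%N -> B j = 1 & forall j, (r0 < j)%N -> ell j <= B j].
Proof.
move=> r01; pose B := weight_seq r0 ell; exists B.
have Ble j : (j <= r0)%N -> B j = 1 by case: j => // j; rewrite /B /= => ->.
have Bgt j : (r0 < j.+1)%N -> B j.+1 = Num.max 1 (ell j.+1) * (4 ^+ j.+1 * B j ^+ 2).
 by rewrite /B /= ltnNge => /negbTE ->.
have B1 j : 1 <= B j.
 elim: j => [//|j IH]; case: (leqP j.+1 r0) => [/Ble ->//|/Bgt ->].
 by rewrite !(mulr_ege1, exprn_ege1) // ?le_max ?lexx // ler1n.
have B0 j : 0 <= B j by apply: le_trans (B1 j).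
have step j : (r0 < j.+1)%N -> 4 ^+ j.+1 * B j ^+ 2 <= B j.+1.
 move=> /Bgt ->; rewrite ler_peMl ?le_max ?lexx //. by nonneg.
have sq j : B j <= B j ^+ 2 by rewrite expr2 ler_peMl.
have mono i j : (i <= j)%N -> B i <= B j.
 elim: j => [|j IH]; first by rewrite leqn0 => /eqP ->.
 rewrite leq_eqVlt => /orP[/eqP -> //|]; rewrite ltnS => /IH h.
 case: (leqP j.+1 r0) => jr; first by rewrite (Ble j.+1) //; apply: le_trans h _; rewrite Ble // ltnW.
 apply: le_trans h _; apply: le_trans (step j jr); apply: le_trans (sq j) _.
 by rewrite ler_peMl ?exprn_ege1 ?exprn_ge0 // ler1n.
have prod i k p : (i < p)%N -> (k < p)%N -> (r0 < p)%N -> 4 ^+ p * (B i * B k) <= B p.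
 case: p => // p; rewrite !ltnS => ip kp rp; apply: le_trans (step p rp).
 by rewrite ler_wpM2l ?exprn_ge0 // expr2 ler_pM // mono.
have mid i k p j : (i < p)%N -> (k < p)%N -> (j <= p)%N -> 4 * 2 ^+ j * (B i * B k) <= (4 + 4 * 2 ^+ r0) * B p.
 move=> ip kp jp; case: (leqP p r0) => pr.
  rewrite !Ble ?mulr1; [|lia..]. have : 2 ^+ j <= 2 ^+ r0 :> R by rewrite ler_eXn2l ?ltr1n //; lia.
  lra.
 have h := prod _ _ _ ip kp pr; have BB : 0 <= B i * B k by nonneg.
 have : 2 ^+ j * (B i * B k) <= 4 ^+ p * (B i * B k).
  rewrite ler_wpM2r //; apply: (@le_trans _ _ (2 ^+ p)).
   by rewrite ler_eXn2l ?ltr1n.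
  by rewrite lerXn2r ?nnegrE // ler_nat.
 have : 0 <= 2 ^+ r0 * B p by nonneg. lra.
have mid' i k p j : (i < p)%N -> (k < p)%N -> (j <= p)%N -> B i * B k <= (4 + 4 * 2 ^+ r0) * B p / (4 * 2 ^+ j).
 move=> ip kp jp; rewrite ler_pdivlMr ?mulr_gt0 ?exprn_gt0 // mulrC. exact: mid.
have fin p j (h : (j <= p)%N) : (4 * 2 ^+ j - 4) * ((4 + 4 * 2 ^+ r0) * B p / (4 * 2 ^+ j)) <= (4 + 4 * 2 ^+ r0) * B p.
 rewrite mulrA ler_pdivrMr ?mulr_gt0 ?exprn_gt0 // mulrC.
 have X0 : 0 <= (4 + 4 * 2 ^+ r0) * B p by nonneg. by lra.
have pos p j : 0 <= (4 + 4 * 2 ^+ r0) * B p / (4 * 2 ^+ j) by nonneg.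
have two0 : 0 <= 2 ^+ r0 :> R by [].
split=> //; last first.
 case=> [//|j] jr; rewrite Bgt //; apply: (@le_trans _ _ (Num.max 1 (ell j.+1))).
  by rewrite le_max lexx orbT.
 by rewrite ler_peMr ?le_max ?ler01 // mulr_ege1 ?exprn_ege1 // ler1n.
split=> // [[|j]|m [|j]].
- by rewrite /= Ble // /leib_const; lra.
- apply: le_trans (@lconv_split B B j.+1 _ B0 B0 (pos j.+1 j.+1) _ isT) _.
  by move=> i ij; apply: mid'; lia.
 have := fin j.+1 j.+1 (leqnn _); rewrite (Ble 0%N) // /leib_const.
 move: ((4 * 2 ^+ j.+1 - 4) * (_ / _)) => X. have := B0 j.+1; have := mulr_ge0 two0 (B0 j.+1); lra.
- rewrite /= addn0 /leib_const Ble //; have := B0 m.+1. have := mulr_ge0 two0 (B0 m.+1); lra.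
pose p := (m + j.+1).+1; apply: le_trans (@lconv_split (B \o succn)
  (fun i => B (m + i).+1) j.+1 _ _ _ (pos p j.+1) _ isT) _ => //.
- by move=> i; exact: B0.
- by move=> i ij; apply: mid'; rewrite /p; lia.
rewrite /= addn0 Ble // mul1r.
have last_le : B j.+2 * B m.+1 <= B p.
 case: (posnP m) => [m0|m0]; first by rewrite /p m0 add0n (Ble 1%N) // mulr1.
 case: (leqP p r0) => pr; first by rewrite !Ble ?mulr1 //; rewrite /p in pr; lia.
 have h : 4 ^+ p * (B j.+2 * B m.+1) <= B p by apply: prod => //; rewrite /p; lia.
 by apply: le_trans h; rewrite ler_peMl ?mulr_ge0 // exprn_ege1 // ler1n.
have jp : (j.+1 <= p)%N by lia.
have := fin p j.+1 jp; rewrite /leib_const -/p.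
move: ((4 * 2 ^+ j.+1 - 4) * (_ / _)) => X.
have := B0 p; have := mulr_ge0 two0 (B0 p); lra.
Qed.

Lemma dilation_envelope (al : R -> R) (L M : R) : 1 <= L -> (forall t, 0 <= al t <= M) ->
 (forall s t, 0 <= s -> s <= t -> al s <= al t) -> vanishing al -> exists om : R -> R, [/\ forall t, 0 <= om t,
  forall s t, 0 <= s -> s <= t -> om s <= om t, forall t, 0 <= t -> om (L * t) <= 2 * om t,
  forall t, al t <= om t & vanishing om].
Proof.
move=> L1 al0 almono alvan.
have L0 : 0 < L by lra.
pose E t := [set 2^-1 ^+ k * al (L ^+ k * t) | k in [set: nat]].
have half k : 0 <= (2^-1 : R) ^+ k <= 1 by rewrite exprn_ge0 //= exprn_ile1 // invf_le1 // ler1n.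
have M0 : 0 <= M by have /andP[a b] := al0 0; exact: le_trans b.
have Eub t : ubound (E t) M.
 move=> _ [k _ <-]; have /andP[a b] := al0 (L ^+ k * t).
 by have /andP[c d] := half k; rewrite -[M]mul1r ler_pM.
have Ele t k : 2^-1 ^+ k * al (L ^+ k * t) <= sup (E t) by apply: ub_le_sup; [exists M; exact: Eub|exists k].
have En t : E t !=set0 by exists (2^-1 ^+ 0 * al (L ^+ 0 * t)), 0%N.
exists (fun t => sup (E t)); split.
- move=> t; apply: le_trans (Ele t 0%N); rewrite !expr0 !mul1r. by have /andP[] := al0 t.
- move=> s t s0 st; apply: ge_sup => // _ [k _ <-]; apply: le_trans (Ele t k).
 have /andP[c _] := half k; rewrite ler_wpM2l // almono //.
  by nonneg.
 by rewrite ler_wpM2l // exprn_ge0 // ltW.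
- move=> t t0; apply: ge_sup => // _ [k _ <-].
 rewrite mulrA -exprSr; have := Ele t k.+1; rewrite [2^-1 ^+ k.+1]exprS; lra.
- by move=> t; have := Ele t 0%N; rewrite !expr0 !mul1r.
- move=> eps e0. have [N HN] : exists N, forall k, (N <= k)%N -> 2^-1 ^+ k * M <= eps.
  have : (fun k => 2^-1 ^+ k * M : R) @ \oo --> (0 * M : R).
   apply: cvgMl; apply: cvg_expr; rewrite ger0_norm //. by lra.
  rewrite mul0r => /cvgr0Pnorm_le /(_ _ e0) [N _ HN]; exists N => k Nk.
  exact: le_trans (ler_norm _) (HN k Nk).
 have [d d0 Hd] := alvan eps e0; have LN : 0 < L ^+ N by nonneg.
 exists (d / L ^+ N); first by nonneg. move=> t /andP[t0 td]; apply: ge_sup => // _ [k _ <-].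
 have /andP[c1 c2] := half k; case: (leqP N k) => Nk.
  apply: le_trans (HN k Nk); rewrite ler_wpM2l //. by have /andP[] := al0 (L ^+ k * t).
 apply: (@le_trans _ _ (al (L ^+ k * t))).
  by rewrite ler_piMl //; have /andP[] := al0 (L ^+ k * t).
 have L0' := ltW L0; apply: Hd; rewrite mulr_ge0 ?exprn_ge0 //=.
 apply: le_lt_trans (_ : L ^+ N * t < d); last by rewrite mulrC -ltr_pdivlMr.
 by rewrite ler_wpM2r // ler_weXn2l // ltnW.
Qed.

End weights_and_moduli.

Section class_of_a_map.
Context {R : realType} {n : nat}.
Local Notation V := 'rV[R]_n.
Local Notation e := (@basis_vec R n).

Lemma ball_compact (M : R) : compact [set x : V | `|x| <= M].
Proof.
apply: bounded_closed_compact.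
 by exists M; split; rewrite ?num_real // => M1 MM x /= /le_trans; apply; exact: ltW.
have -> : [set x : V | `|x| <= M] = Num.norm @^-1` [set y : R | y <= M] by [].
by apply: closed_comp; [move=> x _; exact: norm_continuous|exact: closed_le].
Qed.

Lemma csupp_uniform (h : V -> R) (M : R) : continuous h -> (forall x, M < `|x| -> h x = 0) ->
 (exists2 b : R, 0 <= b & forall x, `|h x| <= b) /\ forall eps : R, 0 < eps -> exists2 d : R, 0 < d &
  forall x y, `|x - y| < d -> `|h x - h y| <= eps.
Proof.
move=> ch hM; split.
 have [M0|M0] := ltP M 0.
  by exists 0 => // x; rewrite hM ?normr0 // (lt_le_trans M0).
 have cK := @ball_compact M. have ca : continuous (fun x => `|h x|).
  by move=> x; apply: (@continuous_comp _ _ _ h); [exact: ch|exact: norm_continuous].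
 have [||c _ Hc] := @EVT_max_rV R n (fun x => `|h x|) [set x : V | `|x| <= M] _ cK.
 - by exists 0; rewrite /= normr0.
 - exact: continuous_subspaceT.
 exists `|h c| => // x; case: (leP `|x| M) => xM; first by apply: Hc; rewrite inE.
 by rewrite hM // normr0.
move=> eps e0; apply: contrapT => nH.
have /choice[p Hp] : forall m : nat, exists p : V * V, `|p.1 - p.2| < m.+1%:R^-1 /\ eps < `|h p.1 - h p.2|.
 move=> m; apply: contrapT => nE; apply: nH; exists m.+1%:R^-1 => // x y xy.
 by rewrite leNgt; apply/negP => lt; apply: nE; exists (x, y).
have bnd m : `|(p m).1| <= M + 1.
 rewrite leNgt; apply/negP => lt; have [h1 h2] := Hp m.
 have : `|(p m).1| <= `|(p m).1 - (p m).2| + `|(p m).2|.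
  by rewrite -[X in `|X| <= _](subrK (p m).2); exact: ler_normD.
 have m1 : m.+1%:R^-1 <= 1 :> R by rewrite invf_le1 // ler1n.
 have {h1 m1} h1 := lt_le_trans h1 m1; move=> h3; move: h2; rewrite !hM ?subrr ?normr0; first by rewrite ltNge (ltW e0).
  by lra.
 by lra.
have [U [UU Usub]] := @ultraFilterLemma nat \oo _.
have := @ball_compact (M + 1); rewrite compact_ultra.
move=> /(_ ((fun m => (p m).1) @ U)) [].
- exact: ultra_fmap.
- by apply: nearW => m; exact: bnd.
move=> q [_ pq].
have e3 : 0 < eps / 3 by nonneg.
have /(@cvgrPdist_lt _ _ _ _ (nbhs_filter q))/(_ _ e3)/nbhs_ballP[d /= d0 Hd] := ch q.
have d2 : 0 < d / 2 by nonneg.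
have n1 : \forall m \near U, `|q - (p m).1| < d / 2 by have /cvgrPdist_lt/(_ _ d2) := pq.
have n2 : \forall m \near U, m.+1%:R^-1 < d / 2.
 apply: Usub; have /cvgrPdist_lt/(_ _ d2) := @cvg_harmonic R.
 by apply: filterS => m; rewrite sub0r normrN (ger0_norm (harmonic_ge0 _)).
have [m [h1 h2]] := filter_ex (filterI n1 n2).
have [g1 g2] := Hp m.
have b1 : `|h q - h (p m).1| < eps / 3 by apply: Hd; rewrite -ball_normE /=; lra.
have b2 : `|h q - h (p m).2| < eps / 3.
 apply: Hd; rewrite -ball_normE /=. have := lt_trans g1 h2.
 have := ler_normD (q - (p m).1) ((p m).1 - (p m).2); rewrite addrA subrK. by move: h1; clear; lra.
have := ler_normB (h q - h (p m).2) (h q - h (p m).1).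
have -> : h q - h (p m).2 - (h q - h (p m).1) = h (p m).1 - h (p m).2 by ring.
lra.
Qed.

Definition pderiv (s : seq 'I_n) (f : V -> R) : V -> R := iter_derive (map e s) f.

Lemma Nb_of_pderiv om k w (f : V -> R) : (forall s x, (size s <= k)%N -> `|pderiv s f x| <= w (size s)) ->
 (forall s x y, (size s <= k)%N -> `|pderiv s f x - pderiv s f y| <= w (size s) * om `|x - y|) ->
 (forall s x, (size s < k)%N -> differentiable (pderiv s f) x) -> Nb setT om k w f.
Proof.
have rc s i (g : V -> R) : pderiv (rcons s i) g = pderiv s ('D_(e i) g).
 by rewrite /pderiv map_rcons /iter_derive foldr_rcons.
elim: k w f => [|k IH] w f h1 h2 h3.
 by split=> // *; [exact: (h1 [::])|exact: (h2 [::])].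
split=> [x _|x y _ _|]; [exact: (h1 [::])|exact: (h2 [::])|].
split=> [x _|i]; first exact: (h3 [::]).
apply: IH => [s x sk|s x y sk|s x sk].
- by have := h1 (rcons s i) x; rewrite size_rcons rc; apply.
- by have := h2 (rcons s i) x y; rewrite size_rcons rc; apply.
- by have := h3 (rcons s i) x; rewrite size_rcons rc; apply.
Qed.

Lemma derive_out (f : V -> R) (M : R) (v x : V) : (forall x, M < `|x| -> f x = 0) -> M < `|x| -> 'D_v f x = 0.
Proof.
move=> fM Mx; rewrite (@near_eq_derive _ _ _ f (fun=> 0)) ?derive_cst //.
have d0 : 0 < `|x| - M by lra.
apply/nbhs_ballP; exists (`|x| - M) => //= y; rewrite -ball_normE /= => xy.
apply: fM; have := ler_normD (x - y) y; rewrite subrK; lra.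
Qed.

Lemma iter_derive_out (f : V -> R) (M : R) (vs : seq V) :
 (forall x, M < `|x| -> f x = 0) -> forall x, M < `|x| -> iter_derive vs f x = 0.
Proof.
by move=> fM; elim: vs => [//|v vs IH] x Mx /=; exact: derive_out IH Mx.
Qed.

Lemma class_exists r (r0 : nat) (L eps M : R) (ell : nat -> R) (phi : V -> V) :
 (0 < r0)%N -> le_reg r0 r -> 2 <= L -> 0 < eps -> Crv r phi -> (forall x, M < `|x| -> phi x = 0) ->
 (forall s l x, (size s <= r0)%N -> `|pderiv s (fun y => phi y 0 l) x| <= eps) ->
 exists om B, [/\ calculus L (leib_const r0) om B, forall j, (j <= r0)%N -> B j = 1, forall j, (r0 < j)%N -> ell j <= B j &
  disp r om B eps 1 phi].
Proof.
move=> r01 r0r L2 e0 cphi phiM phie.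
pose ph s l := pderiv s (fun y => phi y 0 l).
have phM s l x : M < `|x| -> ph s l x = 0 by apply: iter_derive_out => y /phiM ->; rewrite mxE.
have phC k s l : le_reg (k + size s) r -> Ckp [set (0 : R)] k (fun=> ph s l).
 move=> le; apply: (@Ckp_iter _ _ [set 0] k _ (fun _ y => phi y 0 l)). by rewrite size_map; exact: cphi.
have phU s l : le_reg (size s) r -> (exists2 b : R, 0 <= b & forall x, `|ph s l x| <= b) /\
  forall eps : R, 0 < eps -> exists2 d : R, 0 < d & forall x y, `|x - y| < d -> `|ph s l x - ph s l y| <= eps.
 move=> le; apply: (@csupp_uniform _ M); last exact: phM.
 by apply/jcont_continuous; exact: Ckp_cont (phC 0%N s l le).
have /choice[b Hb] : forall j, exists b : R, 0 <= b /\ (le_reg j r -> forall s l x, size s = j -> `|ph s l x| <= b).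
 move=> j; case: (boolP (le_reg j r)) => [le|_]; last by exists 0.
 have /choice[bb Hbb] : forall sl : j.-tuple 'I_n * 'I_n, exists b : R, 0 <= b /\ forall x, `|ph sl.1 sl.2 x| <= b.
  move=> [s l]; have [|[b b0 hb] _] := phU s l; first by rewrite size_tuple. by exists b.
 exists (\sum_sl bb sl); split; first by apply: sumr_ge0 => sl _; have [] := Hbb sl.
 move=> _ s l x sj; have [_ h] := Hbb (tcast sj (in_tuple s), l).
 have := h x; rewrite /= (_ : tval (tcast sj _) = s); last by rewrite val_tcast.
 move/le_trans; apply; rewrite (bigD1 (tcast sj (in_tuple s), l)) //= lerDl.
 by apply: sumr_ge0 => sl _; have [] := Hbb sl.
have lipb s l x y : le_reg (size s).+1 r -> `|ph s l x - ph s l y| <=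
  (2 * b (size s) + n%:R * b (size s).+1) * Num.min 1 `|x - y|.
 move=> le; have le' : le_reg (size s) r by case: (r) le => //= m /ltnW.
 have [b0 Hbs] := Hb (size s); have [b1 Hbs1] := Hb (size s).+1. have [h|h] := leP 1 `|x - y|.
  rewrite mulr1; apply: le_trans (ler_normB _ _) _.
  have := Hbs le' s l x erefl; have := Hbs le' s l y erefl. have : 0 <= n%:R * b (size s).+1 by nonneg.
  lra.
 have [_ [df _]] := phC 1%N s l le.
 have [t _|t _ ->] := @mvt_row R n (ph s l) y x; first exact: (df 0).
 apply: (@le_trans _ _ (n%:R * b (size s).+1 * `|x - y|)).
  by apply: sum_coord_le => i; exact: (Hbs1 le (i :: s)).
 by rewrite mulrDl lerDr !mulr_ge0.
pose m := if r is Some m then m else 0%N.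
have mr : le_reg m r by rewrite /m; case: (r) => /=.
pose I := (m.-tuple 'I_n * 'I_n)%type.
pose h (i : I) x := ph i.1 i.2 x / eps.
have hU (i : I) : (exists2 b : R, 0 <= b & forall x, `|h i x| <= b) /\ forall eps : R, 0 < eps -> exists2 d : R, 0 < d &
  forall x y, `|x - y| < d -> `|h i x - h i y| <= eps.
 have [|[b' b'0 hb'] hu] := phU i.1 i.2; first by rewrite size_tuple. split.
  exists (b' / eps); first by nonneg.
  by move=> x; rewrite normrM normfV (gtr0_norm e0) ler_pM2r ?invr_gt0.
 move=> ep ep0; have [|d d0 Hd] := hu (ep * eps); first by nonneg.
 exists d => // x y /Hd; rewrite -mulrBl normrM normfV (gtr0_norm e0). by rewrite ler_pdivrMr.
pose a := 1 + (\sum_(j < r0.+1) (2 * b j + n%:R * b j.+1)) / eps.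
have sum0 : 0 <= \sum_(j < r0.+1) (2 * b j + n%:R * b j.+1).
 apply: sumr_ge0 => j _; have [b0 _] := Hb j; have [b1 _] := Hb j.+1. by nonneg.
have a1 : 1 <= a by rewrite lerDl divr_ge0 // ltW.
pose S t := [set z | exists i x y, `|x - y| <= t /\ z = `|h i x - h i y|].
have /choice[bh Hbh] : forall i, exists b : R, 0 <= b /\ forall x, `|h i x| <= b.
 by move=> i; have [[b' ? ?] _] := hU i; exists b'.
pose Mh := 2 * \sum_i bh i.
have bhM i : 2 * bh i <= Mh.
 rewrite /Mh ler_pM2l // (bigD1 i) //= lerDl. by apply: sumr_ge0 => j _; have [] := Hbh j.
have Sub t : ubound (S t) Mh.
 move=> _ [i [x [y [_ ->]]]]; apply: le_trans (bhM i).
 have [_ hb] := Hbh i; apply: le_trans (ler_normB _ _) _. by have := hb x; have := hb y; lra.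
have Mh0 : 0 <= Mh by rewrite mulr_ge0 // sumr_ge0 // => i _; have [] := Hbh i.
pose al t := if t < 0 then 0 else a * Num.min 1 t + Num.max 0 (sup (S t)).
have supS t : sup (S t) <= Mh.
 have [S0|/set0P/negP] := pselect (S t !=set0); first by apply: ge_sup => //; exact: Sub.
 by rewrite negbK => /eqP ->; rewrite sup0.
have supM t : 0 <= Num.max 0 (sup (S t)) <= Mh by rewrite le_max lexx /= ge_max Mh0 supS.
have al_bnd t : 0 <= al t <= a + Mh.
 have a0 : 0 <= a by lra. rewrite /al; case: ltP => t0; first by rewrite lexx addr_ge0.
 have /andP[s0 sM] := supM t. have mn : 0 <= Num.min 1 t by rewrite le_min ler01.
 have mn1 : Num.min 1 t <= 1 by rewrite ge_min lexx. by rewrite addr_ge0 ?mulr_ge0 //= lerD // ler_piMr.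
have al_mono s t : 0 <= s -> s <= t -> al s <= al t.
 move=> s0 st; have t0 := le_trans s0 st; rewrite /al !ltNge s0 t0 /=.
 apply: lerD; first by rewrite ler_wpM2l ?(le_trans ler01) // le_min2 //.
 rewrite ge_max le_max lexx /=; have [S0|/set0P/negP] := pselect (S s !=set0).
  rewrite le_max; apply/orP; right; apply: ge_sup => // z [i [x [y [xy ->]]]].
  apply: ub_le_sup; first by exists Mh; exact: Sub. by exists i, x, y; split=> //; exact: le_trans st.
 by rewrite negbK => /eqP ->; rewrite sup0 le_max lexx.
have al_van : vanishing al.
 move=> ep ep0; have ep2 : 0 < ep / 2 by nonneg.
 have /choice[dh Hdh] : forall i : I, exists d : R, 0 < d /\ forall x y, `|x - y| < d -> `|h i x - h i y| <= ep / 2.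
  by move=> i; have [_ /(_ _ ep2)[d ? ?]] := hU i; exists d.
 have a0 : 0 < a by lra. exists (Num.min (ep / 2 / a) (\big[Num.min/1]_i dh i)).
  rewrite lt_min divr_gt0 //=; apply: lt_bigmin => // i _. by have [] := Hdh i.
 move=> t /andP[t0]; rewrite lt_min => /andP[ta td]. rewrite /al ltNge t0 /= [leRHS]splitr; apply: lerD.
  rewrite mulrC -ler_pdivlMr //; apply: le_trans (ltW ta). by rewrite ge_min lexx orbT.
 rewrite ge_max (ltW ep2) /=; have [S0|/set0P/negP] := pselect (S t !=set0).
  apply: ge_sup => // z [i [x [y [xy ->]]]]; have [_ hh] := Hdh i; apply: hh.
  apply: le_lt_trans xy (lt_le_trans td _); exact: bigmin_le_cond.
 by rewrite negbK => /eqP ->; rewrite sup0 ltW.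
have [om [om0 omono omL omal omvan]] := dilation_envelope (le_trans (ler1n R 2) L2 : 1 <= L) al_bnd al_mono al_van.
have om_a t : 0 <= t -> a * Num.min 1 t <= om t.
 move=> t0; apply: le_trans (omal t); rewrite /al ltNge t0 /= lerDl. by have /andP[] := supM t.
have om_h i x y : `|h i x - h i y| <= om `|x - y|.
 apply: le_trans (omal _); rewrite /al ltNge normr_ge0 /=. have a0 : 0 <= a by lra.
 rewrite -[leLHS]add0r; apply: lerD.
  by nonneg.
 rewrite le_max; apply/orP; right; apply: ub_le_sup; first by exists Mh; exact: Sub. by exists i, x, y.
have mod_om : modulus om L.
 split=> // t t0; apply: le_trans (om_a t t0). by rewrite ler_peMl // le_min ler01.
pose ell' j := Num.max (ell j) ((2 * b j + n%:R * b j.+1) / eps).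
have [B [Bw B1 Bell]] := weights_exist ell' r01.
exists om, B; split=> //.
- by split=> //; [exact: B1|exact: B1].
- by move=> j /Bell; apply: le_trans; rewrite le_max lexx.
have two_b j : 0 <= 2 * b j + n%:R * b j.+1.
 by have [b0 _] := Hb j; have [b1 _] := Hb j.+1; rewrite addr_ge0 ?mulr_ge0.
have Bge j : (r0 < j)%N -> 2 * b j + n%:R * b j.+1 <= eps * B j.
 move=> /Bell h'; rewrite [leRHS]mulrC -ler_pdivrMr //; apply: le_trans h'. by rewrite le_max lexx orbT.
have Bj1 j : 1 <= B j by case: Bw.
move=> k l kr; apply: Nb_of_pderiv => [s x sk|s x y sk|s x sk]; rewrite ?expr1n ?mulr1.
- case: (leqP (size s) r0) => sr; first by rewrite B1 // mulr1; exact: phie.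
 have sr' : le_reg (size s) r by case: (r) kr => //= q; exact: leq_trans.
 apply: le_trans (Bge _ sr); have [_ hb] := Hb (size s).
 apply: le_trans (hb sr' s l x erefl) _; have [b0 _] := Hb (size s).
 by have [b1 _] := Hb (size s).+1; have := mulr_ge0 (ler0n R n) b1; lra.
- case: (boolP (le_reg (size s).+1 r)) => sr.
  apply: le_trans (lipb s l x y sr) _. have mn : 0 <= Num.min 1 `|x - y| by [].
  case: (leqP (size s) r0) => sr0.
   rewrite B1 // mulr1; apply: le_trans (ler_wpM2l (ltW e0) (om_a _ (normr_ge0 _))).
   rewrite mulrA ler_wpM2r // /a mulrDr mulr1 [eps * _]mulrC divfK ?gt_eqF //.
   apply: ler_wpDl (ltW e0) _.
   by rewrite (bigD1 (Ordinal (sr0 : size s < r0.+1)%N)) //= lerDl sumr_ge0.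
  apply: ler_pM => //; first exact: Bge. by apply: le_trans (om_a _ (normr_ge0 _)); rewrite ler_peMl.
 have sm : size s = m.
  move: sr kr sk; rewrite /m; case: (r) => //= q; rewrite -leqNgt => qs kq sk. by lia.
 have := om_h (tcast sm (in_tuple s), l) x y; rewrite /h /= val_tcast.
 rewrite -mulrBl normrM normfV (gtr0_norm e0) ler_pdivrMr // mulrC => h'.
 apply: le_trans h' _; apply: ler_wpM2r => //; exact: ler_peMr (ltW e0) (Bj1 _).
- have sr' : le_reg (1 + size s) r by case: (r) kr => //= q; exact: leq_trans.
 by have [_ [+ _]] := phC 1%N s l sr'; move=> /(_ 0); exact.
Qed.

End class_of_a_map.

Lemma leib_const0 (R : realType) r0 : 0 <= leib_const r0 :> R.
Proof. by rewrite /leib_const; have := exprn_ge0 r0 (ler0n R 2); lra. Qed.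

Section scarf.
Local Open Scope nat_scope.
Context {X I : finType} (rk : I -> X -> nat) (col : X -> I).
Hypotheses (rk_inj : forall i, injective (rk i)) (X0 : X).
Implicit Types (s t : {set X}) (C D : {set I}).

Definition dominant s C : bool := [forall x, [exists i in C, [forall y in s, rk i x <= rk i y]]].

Lemma dominantP s C : reflect (forall x, exists2 i, i \in C & forall y, y \in s -> rk i x <= rk i y) (dominant s C).
Proof.
apply: (iffP forallP) => H x; have := H x.
 by case/exists_inP => i iC /forall_inP h; exists i.
by case=> i iC h; apply/exists_inP; exists i => //; apply/forall_inP.
Qed.

Lemma dominant_sub s t C D : t \subset s -> C \subset D -> dominant s C -> dominant t D.
Proof.
move=> /fintype.subsetP ts /fintype.subsetP CD /dominantP H; apply/dominantP => x.
by have [i iC h] := H x; exists i; [exact: CD|move=> y /ts; exact: h].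
Qed.

Section door.
Context (s : {set X}) (C : {set I}) (x0 : X).
Hypothesis (xs : x0 \in s) (dom : dominant s C) (card : #|s|.+1 = #|C|).

Let f (i : I) : X := [arg min_(y < x0 in s) rk i y].

Let f_in i : f i \in s. Proof. by rewrite /f; case: arg_minnP. Qed.
Let f_min i y : y \in s -> rk i (f i) <= rk i y.
Proof. by rewrite /f; case: arg_minnP => // z _ h /h. Qed.

Let f_surj D : dominant s D -> f @: D = s.
Proof.
move=> /dominantP dD; apply/finset.setP => y; apply/imsetP/idP => [[i _ ->] //|ys].
have [i iD h] := dD y; exists i => //; apply: (@rk_inj i); apply/eqP.
by rewrite eqn_leq h ?f_min.
Qed.

Let cand a : {set X} := [set x | [forall k in C :\ a, rk k (f k) < rk k x]].

Let candP a x : reflect (forall k, k \in C -> k != a -> rk k (f k) < rk k x) (x \in cand a).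
Proof.
rewrite inE; apply: (iffP forall_inP) => h k.
 by move=> kC ka; apply: h; rewrite !inE ka.
by rewrite !inE => /andP[ka kC]; exact: h.
Qed.

Let cand0 a : dominant s (C :\ a) = (cand a == finset.set0).
Proof.
apply/dominantP/eqP => [H|H x].
 apply/finset.setP => x; rewrite finset.in_set0; apply/negP => /candP h.
 have [i] := H x; rewrite !inE => /andP[ia iC] h'. by have := h i iC ia; rewrite ltnNge h'.
have : x \notin cand a by rewrite H finset.in_set0.
rewrite inE negb_forall => /existsP[k]; rewrite negb_imply -leqNgt => /andP[kC h].
by exists k => // y ys; exact: leq_trans h (f_min _ ys).
Qed.

Let top a : X := [arg max_(y > odflt x0 [pick z in cand a] in cand a) rk a y].

Let room a : {set X} * {set I} := if cand a == finset.set0 then (s, C :\ a) else (top a |: s, C).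

Let adj (r : {set X} * {set I}) : bool := dominant r.1 r.2 && ([exists x, (x \notin s) && (r == (x |: s, C))] ||
  [exists i, (i \in C) && (r == (s, C :\ i))]).

Let top_spec a : cand a != finset.set0 -> top a \in cand a /\ forall y, y \in cand a -> rk a y <= rk a (top a).
Proof.
case/finset.set0Pn => z zc; rewrite /top; case: pickP => [z' zc'|/(_ z)] /=.
 by case: arg_maxnP => // m mc mh; split=> // y yc; exact: mh.
by rewrite zc.
Qed.

Let top_in a : cand a != finset.set0 -> top a \in cand a.
Proof. by case/top_spec. Qed.

Let top_max a y : cand a != finset.set0 -> y \in cand a -> rk a y <= rk a (top a).
Proof. by case/top_spec => _; exact. Qed.

Let dom_a x a : x \in cand a -> a \in C /\ forall y, y \in s -> rk a x <= rk a y.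
Proof.
move=> /candP h; have /dominantP/(_ x)[i iC h'] := dom.
have [<-|ia] := eqVneq i a; first by [].
by have := h i iC ia; rewrite ltnNge h'.
Qed.

Lemma door_rooms : #|[set r | adj r]%SET| = 2.
Proof.
have sur := f_surj dom.
have ninj : ~~ [forall i in C, [forall k in C, (f i == f k) ==> (i == k)]].
 apply/negP => H; have : #|f @: C| = #|C|.
  apply: card_in_imset => i k iC kC fik; apply/eqP.
  by have /forall_inP/(_ i iC)/forall_inP/(_ k kC) := H; rewrite fik eqxx.
 by rewrite sur -card => /eqP; rewrite -[X in X == _]addn0 -addn1 eqn_add2l.
have [a [b [aC bC ab fab]]] : exists a b, [/\ a \in C, b \in C, a != b & f a = f b].
 move: ninj; rewrite negb_forall => /existsP[a]; rewrite negb_imply => /andP[aC].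
 rewrite negb_forall => /existsP[b]; rewrite negb_imply => /andP[bC].
 by rewrite negb_imply => /andP[/eqP fab ab]; exists a, b.
have only i : i \in C -> f @: (C :\ i) = s -> (i == a) || (i == b).
 move=> iC si; apply/negPn/negP; rewrite negb_or => /andP[ia ib].
 have h : f @: (C :\ i) = f @: (C :\ i :\ a).
  apply/finset.setP => y; apply/imsetP/imsetP => -[k]; rewrite !inE => h ->.
   have [ka|ka] := eqVneq k a; last by exists k => //; rewrite !inE ka.
   by exists b; rewrite ?ka // !inE bC andbT eq_sym ab eq_sym ib.
  by exists k => //; rewrite !inE; case/and3P: h => _ -> ->.
 have := leq_imset_card f (C :\ i :\ a); rewrite -h si.
 have := cardsD1 i C; have := cardsD1 a (C :\ i); rewrite iC !inE aC eq_sym ia /=. rewrite -card; lia.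
have onto i : (i == a) || (i == b) -> f @: (C :\ i) = s.
 move=> iab; rewrite -sur; apply/finset.setP => y; apply/imsetP/imsetP => -[k].
  by rewrite !inE => /andP[_ kC] ->; exists k.
 move=> kC ->; have [ki|ki] := eqVneq k i; last by exists k; rewrite // !inE ki.
 case/orP: iab => /eqP ii; rewrite ki ii.
  by exists b; rewrite // !inE bC eq_sym ab.
 by exists a; rewrite // !inE aC ab.
have iC i : (i == a) || (i == b) -> i \in C by case/orP => /eqP ->.
have room_ok i : (i == a) || (i == b) -> room i \in [set r | adj r]%SET.
 move=> iab; rewrite inE /adj /room; case: ifPn => [c0|c0] /=.
  rewrite cand0 c0 /=; apply/orP; right; apply/existsP; exists i. by rewrite iC ?eqxx.
 have tc := top_in c0; have [_ tmin] := dom_a tc. have tns : top i \notin s.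
  apply/negP => ts; have : top i \in f @: (C :\ i) by rewrite onto.
  case/imsetP => k; rewrite !inE => /andP[ki kC] tk. by have /candP/(_ k kC ki) := tc; rewrite tk ltnn.
 apply/andP; split; last first.
  by apply/orP; left; apply/existsP; exists (top i); rewrite tns eqxx.
 apply/dominantP => y; case: (boolP (y \in cand i)) => yc.
  exists i; first exact: iC. move=> z; rewrite !inE => /orP[/eqP ->|zs]; first exact: top_max.
  by have [_] := dom_a yc; exact.
 move: yc; rewrite inE negb_forall => /existsP[k]; rewrite negb_imply -leqNgt.
 rewrite !inE => /andP[/andP[ki kC] h]; exists k => // z.
 rewrite !inE => /orP[/eqP ->|zs]; last exact: leq_trans h (f_min _ zs).
 by apply: leq_trans h _; apply: ltnW; have /candP := tc; exact.
have room_all r : r \in [set r | adj r]%SET -> r = room a \/ r = room b.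
 suff H : r \in [set r | adj r]%SET -> exists2 i, (i == a) || (i == b) & r = room i.
  by move=> /H[i /orP[]/eqP -> ->]; [left|right].
 rewrite inE => /andP[dr /orP[/existsP[x /andP[xns /eqP rE]]|/existsP[i /andP[ic /eqP rE]]]]; last first.
  move: dr; rewrite rE /= => dr; exists i; first by apply: only => //; exact: f_surj.
  by rewrite /room -cand0 dr.
 move: dr; rewrite rE /= => /dominantP dr. have [i ic ix] := dr x.
 have xlt y : y \in s -> rk i x < rk i y.
  move=> ys; rewrite ltn_neqAle ix ?inE ?ys ?orbT // andbT.
  by apply/eqP => /rk_inj xy; rewrite xy ys in xns.
 have surj_i : f @: (C :\ i) = s.
  apply/finset.setP => y; apply/imsetP/idP => [[k _ ->] //|ys]. have [k kC hk] := dr y; exists k.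
   rewrite !inE kC andbT; apply/eqP => ki; have := hk x; rewrite !inE eqxx => /(_ isT).
   by rewrite ki leqNgt xlt.
  apply: (@rk_inj k); apply/eqP; rewrite eqn_leq f_min // hk //. by rewrite !inE f_in orbT.
 have xc : x \in cand i.
  apply/candP => k kC ki; rewrite ltnNge; apply/negP => xk.
  have : f k \in f @: (C :\ i :\ k).
   have [k' k'C hk'] := dr (f k). have k'i : k' != i.
    apply/eqP => k'i; have := hk' x; rewrite !inE eqxx => /(_ isT). by rewrite k'i leqNgt xlt.
   have k'k : k' != k.
    apply/eqP => k'k; have := hk' x; rewrite !inE eqxx => /(_ isT).
    rewrite k'k => fx; have /rk_inj fE : rk k (f k) = rk k x by apply/eqP; rewrite eqn_leq fx.
    by move: (f_in k); rewrite fE (negbTE xns).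
   apply/imsetP; exists k'; first by rewrite !inE k'k k'i.
   apply: (@rk_inj k'); apply/eqP; rewrite eqn_leq f_min // hk' ?andbT //. by rewrite !inE f_in orbT.
  move=> fk; have h : f @: (C :\ i :\ k) = s.
   rewrite -surj_i; apply/finset.setP => y; apply/imsetP/imsetP => -[l].
    by rewrite !inE => /and3P[_ li lC] ->; exists l; rewrite // !inE li.
   move=> hl ->; have [lk|lk] := eqVneq l k; first by rewrite lk; exact/imsetP.
   by exists l; rewrite // !inE lk; move: hl; rewrite !inE.
  have := leq_imset_card f (C :\ i :\ k); rewrite h.
  have := cardsD1 i C; have := cardsD1 k (C :\ i); rewrite ic !inE kC ki /=. rewrite -card; lia.
 have c0 : cand i != finset.set0 by apply/finset.set0Pn; exists x. exists i; first exact: only.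
 rewrite /room (negbTE c0); congr (_ |: _, _); apply: (@rk_inj i); apply/eqP.
 rewrite eqn_leq top_max //=; have tc := top_in c0.
 have [k kC hk] := dr (top i); have [ki|ki] := eqVneq k i.
  by have := hk x; rewrite ki !inE eqxx; exact.
 have /candP/(_ k kC ki) := tc; rewrite ltnNge hk //. by rewrite !inE f_in orbT.
have nab : room a != room b.
 rewrite /room; case: ifPn => ca; case: ifPn => cb; rewrite xpair_eqE negb_and.
 - apply/orP; right; apply/eqP => /finset.setP/(_ a). by rewrite !inE eqxx aC ab.
 - apply/orP; right; apply/eqP => /finset.setP/(_ a); by rewrite !inE eqxx aC.
 - apply/orP; right; apply/eqP => /finset.setP/(_ b); by rewrite !inE eqxx bC.
 apply/orP; left; apply/eqP => E. have : top a \in top b |: s by rewrite -E !inE eqxx.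
 have ta := top_in ca; have tb := top_in cb; have [_ amin] := dom_a ta.
 rewrite !inE => /orP[/eqP tab|ts].
  move/candP: tb => /(_ a aC ab); rewrite -tab ltnNge. by rewrite amin.
 have : top a \in f @: (C :\ a) by rewrite onto ?eqxx.
 case/imsetP => k; rewrite !inE => /andP[ka kC] tk. by move/candP: ta => /(_ k kC ka); rewrite tk ltnn.
suff -> : [set r | adj r]%SET = [set room a; room b]%SET by rewrite cards2 nab.
apply/finset.setP => r; apply/idP/idP => [/room_all[] ->|]; rewrite ?inE ?eqxx ?orbT //.
case/orP => /eqP ->; first by have := room_ok a; rewrite eqxx inE => /(_ isT).
by have := room_ok b; rewrite eqxx orbT inE => /(_ isT).
Qed.

End door.

Variable j : I.

Let door (d : {set X} * {set I}) : bool := [&& dominant d.1 d.2, #|d.1|.+1 == #|d.2|, j \in d.2 & col @: d.1 == d.2 :\ j].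

Let is_room (r : {set X} * {set I}) : bool := dominant r.1 r.2 && (#|r.1| == #|r.2|).

Let adj (d r : {set X} * {set I}) : bool := dominant r.1 r.2 && ([exists x, (x \notin d.1) && (r == (x |: d.1, d.2))] ||
   [exists i, (i \in d.2) && (r == (d.1, d.2 :\ i))]).

Let adj_room d r : door d -> adj d r -> is_room r.
Proof.
move=> /and4P[dd /eqP cd jd _] /andP[dr H]; rewrite /is_room dr /=.
case/orP: H => /existsP[x /andP[h /eqP ->]] /=.
 by rewrite cardsU1 h -cd add1n.
by have := cardsD1 x d.2; rewrite h -cd add1n => -[->].
Qed.

Let start : {set X} * {set I} := (finset.set0, [set j]%SET).

Let start_door : door start.
Proof.
rewrite /door /= cards0 cards1 eqxx inE eqxx imset0 /= finset.setDv eqxx andbT.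
by apply/dominantP => x; exists j; rewrite ?inE // => y; rewrite inE.
Qed.

Let start_rooms : #|[set r | adj start r]%SET| = 1.
Proof.
pose m := [arg max_(y > X0 in [set: X]%SET) rk j y].
have mmax y : rk j y <= rk j m by rewrite /m; case: arg_maxnP => [|z _]; [rewrite inE|apply; rewrite inE].
suff -> : [set r | adj start r]%SET = [set ([set m]%SET, [set j]%SET)]%SET by rewrite cards1.
apply/finset.setP => r; rewrite !inE; apply/andP/eqP => [[dr]|->]; last first.
 split; first by apply/dominantP => y; exists j; rewrite ?inE // => z; rewrite inE => /eqP ->.
 by apply/orP; left; apply/existsP; exists m; rewrite inE /= finset.setU0.
case/orP => /existsP[x /andP[h /eqP rE]]; move: dr; rewrite rE /=.
 rewrite finset.setU0 => /dominantP/(_ m)[i]; rewrite inE => /eqP -> /(_ x).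
 rewrite inE eqxx => /(_ isT) h'; congr ([set _]%SET, _); apply: (@rk_inj j).
 by apply/eqP; rewrite eqn_leq mmax.
move: h; rewrite /= inE => /eqP ->; rewrite finset.setDv => /dominantP/(_ X0)[i].
by rewrite inE.
Qed.

Let door_two d : door d -> d != start -> #|[set r | adj d r]%SET| = 2.
Proof.
move=> dd; have /and4P[dom /eqP cd jd /eqP cold] := dd; move=> ds.
have [s0|[x xs]] := finset.set_0Vmem d.1; last exact: door_rooms xs dom cd.
case/eqP: ds; rewrite /start -s0; case: d {dd dom cold} cd jd s0 => s C /= cd jd s0.
suff -> : C = [set j]%SET by [].
apply/eqP; rewrite eq_sym eqEcard finset.sub1set jd /=.
by rewrite -cd s0 cards0 cards1.
Qed.

Let room_doors r : is_room r -> col @: r.1 != r.2 -> ~~ odd #|[set d | door d && adj d r]%SET|.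
Proof.
case: r => t D /andP[/= dt /eqP tD] nf.
have dE d : door d && adj d (t, D) -> [/\ j \in D & exists2 x, x \in t & d = (t :\ x, D) /\ col @: (t :\ x) = D :\ j] \/
  [/\ j \in D & exists2 i, i \notin D & d = (t, i |: D) /\ col @: t = i |: (D :\ j)].
 case: d => s C /andP[/and4P[/= _ _ jC /eqP cs] /andP[_]] /=.
 case/orP => /existsP[x /andP[h /eqP[tE DE]]]; [left|right].
  rewrite DE; split=> //; exists x; first by rewrite tE !inE eqxx.
  have -> : t :\ x = s by rewrite tE setU1K. by split.
 have CE : C = x |: D by rewrite DE finset.setD1K. have jD : j \in D.
  rewrite DE !inE jC andbT; apply/negP => /eqP jx; case/eqP: nf. by rewrite tE cs jx -DE.
 split=> //; exists x; first by rewrite DE !inE eqxx.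
 rewrite tE -CE; split=> //; rewrite cs CE; apply/finset.setP => k; rewrite !inE.
 have [->|//] := eqVneq k x; have [xj|//] := eqVneq x j. by move: jD; rewrite DE -xj !inE eqxx.
have d1 x : j \in D -> x \in t -> col @: (t :\ x) = D :\ j -> door (t :\ x, D) && adj (t :\ x, D) (t, D).
 move=> jD xt cx; rewrite /door /adj /= jD cx dt eqxx /= (dominant_sub _ _ dt) ?subD1set //=.
 rewrite -tD (cardsD1 x t) xt add1n eqxx /=; apply/orP; left; apply/existsP; exists x.
 by rewrite !inE eqxx /= finset.setD1K.
have d2 i : j \in D -> i \notin D -> col @: t = i |: (D :\ j) -> door (t, i |: D) && adj (t, i |: D) (t, D).
 move=> jD iD cx; rewrite /door /adj /= cx dt !inE jD orbT.
 rewrite (dominant_sub _ _ dt) ?finset.subsetUr //= cardsU1 iD tD add1n eqxx /=.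
 have ij : i != j by apply: contraNneq iD => ->. apply/andP; split.
  apply/eqP/finset.setP => k; rewrite !inE; have [->|//] := eqVneq k i; by rewrite ij.
 by apply/orP; right; apply/existsP; exists i; rewrite !inE eqxx /= setU1K.
have [->|/finset.set0Pn[d0]] := eqVneq [set d | door d && adj d (t, D)]%SET finset.set0.
 by rewrite cards0.
rewrite inE => /dE h0.
have [jD [x xt cx]] : j \in D /\ exists2 x, x \in t & col @: (t :\ x) = D :\ j.
 case: h0 => -[jD]; first by case=> x xt [_ cx]; split=> //; exists x. case=> i iD [_ ct]; split=> //.
 have ij : i != j by apply: contraNneq iD => ->. have inj : {in t &, injective col}.
  apply/imset_injP; rewrite ct cardsU1 !inE (negbTE iD) andbF /= tD. by rewrite (cardsD1 j D) jD.
 have : i \in col @: t by rewrite ct !inE eqxx.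
 case/imsetP => x xt ix; exists x => //; apply/finset.setP => k; apply/idP/idP.
  case/imsetP => y; rewrite !inE => /andP[yx yt] ->. have : col y \in col @: t by exact: imset_f.
  rewrite ct !inE => /orP[|//]; rewrite ix => /eqP /inj E. by rewrite E ?eqxx // in yx.
 move=> kD; have : k \in col @: t by rewrite ct !inE; move: kD; rewrite !inE => ->; rewrite orbT.
 case/imsetP => y yt ky; rewrite ky; apply: imset_f; rewrite !inE yt andbT.
 by apply: contraTneq kD => yx; rewrite ky yx -ix !inE (negbTE iD) andbF.
have injx : {in t :\ x &, injective col}.
 apply/imset_injP; rewrite cx; move: tD; rewrite (cardsD1 x t) (cardsD1 j D) xt jD.
 by rewrite !add1n => -[->].
have ctE : col @: t = col x |: (D :\ j) by rewrite -cx -imsetU1 finset.setD1K.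
have cxj : col x != j by apply: contraNneq nf => cj; rewrite ctE cj finset.setD1K.
have [cxD|cxD] := boolP (col x \in D).
 have : col x \in col @: (t :\ x) by rewrite cx !inE cxj.
 case/imsetP => y; rewrite !inE => /andP[yx yt] cxy. have cy : col @: (t :\ y) = D :\ j.
  rewrite -cx; apply/finset.setP => k; apply/imsetP/imsetP => -[z]; rewrite !inE => /andP[zn zt] ->.
   have [->|zx] := eqVneq z x; first by exists y; rewrite // !inE yx. by exists z; rewrite // !inE zx.
  have [->|zy] := eqVneq z y; first by exists x; rewrite // !inE eq_sym yx.
  by exists z; rewrite // !inE zy.
 have -> : [set d | door d && adj d (t, D)]%SET = [set (t :\ x, D); (t :\ y, D)]%SET.
  apply/finset.setP => d; rewrite inE in_set2; apply/idP/orP => [/dE[[_]|[_]]|[]/eqP ->].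
  - case=> z zt [-> cz]; have [->|zx] := eqVneq z x; first by left.
   have [->|zy] := eqVneq z y; first by right. exfalso; have injz : {in t :\ z &, injective col}.
    apply/imset_injP; rewrite cz; move: tD; rewrite (cardsD1 z t) (cardsD1 j D) zt jD.
    by rewrite !add1n => -[->].
   have := injz x y; rewrite !inE xt yt [x == z]eq_sym zx [y == z]eq_sym zy.
   by move=> /(_ isT isT cxy) E; rewrite E eqxx in yx.
  - case=> i iD [_ ci]; exfalso; have : i \in col @: t by rewrite ci !inE eqxx.
   rewrite ctE !inE (negbTE iD) andbF orbF => /eqP E. by rewrite E cxD in iD.
  - exact: d1.
  - exact: d1.
 rewrite cards2 (_ : (_ != _) = true) //; apply/eqP => -[/finset.setP/(_ x)].
 by rewrite !inE eqxx xt eq_sym yx.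
have -> : [set d | door d && adj d (t, D)]%SET = [set (t :\ x, D); (t, col x |: D)]%SET.
 apply/finset.setP => d; rewrite inE in_set2; apply/idP/orP => [/dE[[_]|[_]]|[]/eqP ->].
 - case=> z zt [-> cz]; have [->|zx] := eqVneq z x; first by left.
  exfalso; have : col x \in col @: (t :\ z) by apply: imset_f; rewrite !inE xt eq_sym zx.
  by rewrite cz !inE (negbTE cxD) andbF.
 - case=> i iD [-> ci]; right; have : i \in col @: t by rewrite ci !inE eqxx.
  by rewrite ctE !inE (negbTE iD) andbF orbF => /eqP ->.
 - exact: d1.
 - exact: d2.
rewrite cards2 (_ : (_ != _) = true) //; apply/eqP => -[/finset.setP/(_ x)].
by rewrite !inE eqxx xt.
Qed.

(* Scarf's lemma. Each door other than the initial one lies on two rooms, and a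
  room which is not fully coloured has an even number of doors. *)
Lemma scarf : exists s C, [/\ dominant s C, #|s| = #|C|, C != finset.set0 & col @: s = C].
Proof.
apply: contrapT => H.
have nf r : is_room r -> r.2 != finset.set0 -> col @: r.1 != r.2.
 move=> /andP[dr /eqP cr] r0; apply/eqP => cE; apply: H. by exists r.1, r.2.
have : \sum_(d | door d) #|[set r | adj d r]%SET| = \sum_r #|[set d | door d && adj d r]%SET|.
 under eq_bigr do rewrite -sum1dep_card. under [RHS]eq_bigr do rewrite -sum1dep_card.
 by rewrite (exchange_big_dep predT).
move=> /(congr1 odd); rewrite (bigD1 start start_door) /= start_rooms.
have -> : \sum_(i | door i && (i != start)) #|[set r | adj i r]%SET| = 2 * \sum_(i | door i && (i != start)) 1.
 by rewrite big_distrr; apply: eq_bigr => d /andP[dd ds]; rewrite door_two.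
rewrite oddD mul2n odd_double /= => E.
suff : odd (\sum_r #|[set d | door d && adj d r]%SET|) = false by rewrite -E.
apply: (big_ind (fun m => odd m = false)) => // [x y|r _].
 by rewrite oddD => -> ->.
have [->|/finset.set0Pn[d0]] := eqVneq [set d | door d && adj d r]%SET finset.set0.
 by rewrite cards0.
rewrite inE => /andP[dd0 ad0]; have rr := adj_room dd0 ad0.
apply/negbTE; apply: room_doors => //; apply: nf => //.
have /andP[dr _] := ad0; move/dominantP: dr => /(_ X0)[i ir _].
by apply/finset.set0Pn; exists i.
Qed.

End scarf.

Section schauder.
Context {R : realType}.

Definition in_simplex (I : finType) (a : I -> R) : Prop := (forall i, 0 <= a i) /\ \sum_i a i = 1.

Lemma simplex_colouring (I : finType) (i0 : I) (col : (I -> R) -> I) (K : nat) :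
 (0 < K)%N -> exists (a : I -> R) (b : I -> I -> R) (C : {set I}), [/\ in_simplex a, forall i, in_simplex (b i),
   forall i k, `|b i k - a k| <= #|I|%:R / K%:R, forall i, i \in C -> col (b i) = i &
   forall i, i \notin C -> a i <= #|I|%:R / K%:R].
Proof.
move=> K0; have KR0 : (0 : R) < K%:R by rewrite ltr0n.
pose X : finType := {l : {ffun I -> 'I_K.+1} | (\sum_i (l i : nat) == K)%N}.
have Xsum (x : X) : (\sum_i (val x i : nat) = K)%N by case: x => l /= /eqP.
have mk (f : I -> nat) : (\sum_i f i = K)%N -> exists x : X, forall i, val x i = f i :> nat.
 move=> sf; have fK i : (f i < K.+1)%N by rewrite ltnS -sf (bigD1 i) //= leq_addr.
 have h : (\sum_i ([ffun i => Ordinal (fK i)] i : nat) == K)%N.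
  by apply/eqP; rewrite -[RHS]sf; apply: eq_bigr => i _; rewrite ffunE.
 by exists (exist _ [ffun i => Ordinal (fK i)] h) => i; rewrite /= ffunE.
have [x0 _] : exists x : X, forall i, val x i = (if i == i0 then K else 0%N) :> nat.
 by apply: mk; rewrite -big_mkcond /= big_pred1_eq.
pose rk i (x : X) := (val x i * #|X| + enum_rank x)%N.
have rkE i x y : (rk i x <= rk i y)%N -> (val x i <= val y i)%N.
 rewrite /rk; apply: contraTT; rewrite -!ltnNge => h.
 apply: leq_trans (leq_addr _ _); apply: (@leq_trans ((val y i).+1 * #|X|)%N).
  by rewrite mulSn addnC ltn_add2r ltn_ord.
 by rewrite leq_mul2r h orbT.
have rki i : injective (rk i).
 move=> x y E; have : (val x i = val y i :> nat) by apply/eqP; rewrite eqn_leq !rkE // E.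
 move: E; rewrite /rk => + h; rewrite h => /addnI/ord_inj/enum_rank_inj. exact.
pose pt (x : X) (i : I) : R := (val x i : nat)%:R / K%:R.
have pts x : in_simplex (pt x).
 split=> [i|]; first by nonneg. by rewrite /pt -mulr_suml -natr_sum Xsum divff // gt_eqF.
have [s [C [dom _ C0 sC]]] := scarf (fun x => col (pt x)) rki x0 i0.
have sx : exists x, x \in s.
 case/finset.set0Pn: C0 => i; rewrite -sC => /imsetP[x xs _]; by exists x.
have [x1 x1s] := sx.
have [i1 i1C] : exists i, i \in C by apply/finset.set0Pn.
pose ym i : X := [arg min_(y < x1 in s) (val y i : nat)].
have ymP i : ym i \in s /\ forall y, y \in s -> (val (ym i) i <= val y i)%N.
 by rewrite /ym; case: arg_minnP => // y ys h; split.
pose mu i : nat := if i \in C then (val (ym i) i : nat) else 0%N.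
have mu_le y i : y \in s -> (mu i <= val y i)%N by rewrite /mu; case: ifP => // _; exact: (ymP i).2.
have mu_sum : (K <= \sum_i mu i + #|I|)%N.
 rewrite leqNgt; apply/negP => h. have h' : (\sum_(i in C) (mu i).+1 <= K)%N.
  apply: leq_trans (ltnW h). under eq_bigr do rewrite -addn1.
  rewrite big_split /= sum1_card leq_add ?max_card //.
  by rewrite [X in (_ <= X)%N](bigID (mem C)) /= leq_addr.
 pose f i : nat := ((if i \in C then (mu i).+1 else 0) + (if i == i1 then K - \sum_(i in C) (mu i).+1 else 0))%N.
 have [|x xf] := mk f.
  by rewrite big_split /= -!big_mkcond /= big_pred1_eq subnKC.
 have /dominantP/(_ x)[i iC /(_ _ (ymP i).1)/rkE] := dom.
 by rewrite xf /f iC leqNgt /mu iC addSn ltnS leq_addr.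
have mu_ge y i : y \in s -> (val y i <= mu i + #|I|)%N.
 move=> ys; have : (\sum_k (val y k - mu k) <= #|I|)%N.
  rewrite sumnB => [|k _]; last exact: mu_le. by rewrite Xsum leq_subLR.
 rewrite (bigD1 i) //= => /(leq_trans (leq_addr _ _)). by rewrite leq_subLR.
have mu0 i : i \notin C -> mu i = 0%N by rewrite /mu => /negbTE ->.
have bx i : exists x, x \in s /\ (i \in C -> col (pt x) = i).
 case: (boolP (i \in C)) => [|_]; last by exists x1. by rewrite -{1}sC => /imsetP[x xs ->]; exists x.
have [xb xbP] := choice bx.
exists (pt x1), (fun i => pt (xb i)), C; split=> // [i k|i|i iC].
- rewrite /pt -mulrBl normrM [`|_^-1|]gtr0_norm ?invr_gt0 //. rewrite ler_pM2r ?invr_gt0 //.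
 have := mu_le _ k x1s; have := mu_ge _ k x1s. have := mu_le _ k (xbP i).1; have := mu_ge _ k (xbP i).1.
 rewrite -!(ler_nat R) !natrD ler_norml; lra.
- by case: (xbP i).
- rewrite /pt ler_pM2r ?invr_gt0 // ler_nat. by have := mu_ge _ i x1s; rewrite mu0.
Qed.

Lemma finite_net (T : Type) (X : set (T -> R)) (M : R) (J : finType) (P : J -> T)
  (eps : R) : 0 < eps -> (exists x, X x) -> (forall x t, X x -> `|x t| <= M) ->
 exists (I : finType) (y : I -> T -> R) (col : (T -> R) -> I), (forall i, X (y i)) /\
  forall x k, X x -> `|y (col x) (P k) - x (P k)| <= eps.
Proof.
move=> eps0 [x0 Xx0] Xbounded.
pose N := (Num.truncn ((M + M) / eps)).+1.
pose cd (x : T -> R) (t : T) : 'I_N := inord (Num.truncn ((x t + M) / eps)).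
have cdE x z t : X x -> X z -> cd x t = cd z t -> `|x t - z t| <= eps.
 move=> Xx Xz /(congr1 val) /=. have ge0 w : X w -> 0 <= (w t + M) / eps.
  by move=> Xw; have := Xbounded w t Xw; rewrite ler_norml => ?; rewrite divr_ge0 ?(ltW eps0) //; lra.
 have bd w : X w -> (Num.truncn ((w t + M) / eps) < N)%N.
  move=> Xw; rewrite ltnS; apply: le_truncn; rewrite ler_pM2r ?invr_gt0 //.
  by have := Xbounded w t Xw; rewrite ler_norml => ?; lra.
 rewrite !inordK ?bd // => E.
 have /andP[a1 a2] := truncn_itv (ge0 _ Xx); have /andP[b1 b2] := truncn_itv (ge0 _ Xz).
 move: a1 a2 b1 b2; rewrite E; move: (Num.truncn _) => m.
 rewrite !ler_pdivlMr // !ltr_pdivrMr // -natr1 mulrDl mul1r ler_norml. move: (_ * eps) => w; lra.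
exists {ffun J -> 'I_N}.
pose code x : {ffun J -> 'I_N} := [ffun k => cd x (P k)].
pose y c := xget x0 [set x | X x /\ code x = c].
exists y, code; split=> [c|x k Xx]; first by rewrite /y; case: xgetP => // z _ [].
have [Xy yE] : X (y (code x)) /\ code (y (code x)) = code x.
 by rewrite /y; case: xgetP => [z _ //|/(_ x) h]; case: h.
apply: cdE => //; have := congr1 (fun f : {ffun J -> 'I_N} => f k) yE.
by rewrite !ffunE.
Qed.

Lemma ultra_nat : exists2 U : set_system nat, UltraFilter U & \oo `<=` U.
Proof. by have [U [UU sU]] := ultraFilterLemma eventually_filter; exists U. Qed.

Context {T : Type} (X : set (T -> R)) (theta : (T -> R) -> (T -> R)) (M : R).
Hypotheses (Xne : exists x, X x)
 (Xconvex : forall (I : finType) (a : I -> R) (y : I -> T -> R), in_simplex a -> (forall i, X (y i)) -> X (fun t => \sum_i a i * y i t))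
 (Xbounded : forall x t, X x -> `|x t| <= M)
 (Xclosed : forall (J : Type) (U : set_system J) (f : J -> T -> R) g, UltraFilter U -> (\forall j \near U, X (f j)) -> (forall t, f ^~ t @ U --> g t) -> X g)
 (thetaX : forall x, X x -> X (theta x))
 (theta_cont : forall (J : Type) (U : set_system J) (f : J -> T -> R) g, UltraFilter U -> (\forall j \near U, X (f j)) -> X g -> (forall t, f ^~ t @ U --> g t) -> forall t, (fun j => theta (f j) t) @ U --> theta g t).

Lemma almost_fixed_point (J : finType) (P : J -> T) (eps : R) : 0 < eps ->
 exists2 z, X z & forall k, `|theta z (P k) - z (P k)| <= eps.
Proof.
move=> eps0; have [I [y [col [Xy net]]]] := finite_net P eps0 Xne Xbounded.
have [x0 Xx0] := Xne.
pose ph (a : I -> R) (t : T) := \sum_i a i * y i t.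
have Xph a : in_simplex a -> X (ph a) by move=> sa; exact: Xconvex.
have H (K : nat) := @simplex_colouring I (col x0) (fun a => col (theta (ph a))) K.+1 isT.
have [a /choice[b /choice[C HK]]] := choice H.
have {}HK K := HK K.
have [U UU sU] := ultra_nat.
have m0 : (fun K : nat => #|I|%:R / K.+1%:R : R) @ U --> (0 : R).
 suff : (fun K : nat => #|I|%:R / K.+1%:R : R) @ \oo --> (0 : R).
  by move=> h A /h /sU.
 have := cvgM (cvg_cst (#|I|%:R : R)) (@cvg_harmonic R). by rewrite mulr0; apply.
have simp K : in_simplex (a K) by have [] := HK K.
have simb K i : in_simplex (b K i) by have [] := HK K.
have le1 (c : I -> R) i : in_simplex c -> `|c i| <= 1.
 case=> c0 c1; rewrite ger0_norm // -c1 (bigD1 i) //= lerDl. by apply: sumr_ge0 => k _; exact: c0.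
have /choice[l la] : forall i, exists l : R, (fun K => a K i) @ U --> l.
 move=> i; apply: (@ultra_cvg _ _ U UU _ 1). by apply: nearW => K; exact: le1.
have sl : in_simplex l.
 split=> [i|].
  apply: (cvgr_to_ge (la i)); apply: nearW => K; exact: (simp K).1.
 apply: (@cvg_unique _ (@Rhausdorff R) (fmap (fun K => \sum_i a K i) U)).
  exact: cvg_sum_fun.
 rewrite (_ : (fun K => \sum_i a K i) = cst 1); first exact: cvg_cst.
 by apply/funext => K; rewrite (simp K).2.
exists (ph l); first exact: Xph.
have key i : l i = 0 \/ forall k, `|y i (P k) - theta (ph l) (P k)| <= eps.
 have [Ui|Ui] := in_ultra_setVsetC [set K | i \in C K] UU; [right=> k|left].
  have bl k' : (fun K => b K i k') @ U --> l k'.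
   have -> : l k' = 0 + l k' by rewrite add0r.
   rewrite (_ : (fun K => b K i k') = (fun K => b K i k' - a K k') \+ (a ^~ k')).
    2: by apply/funext => K /=; rewrite subrK.
   apply: cvgD => //; apply: norm_cvg0; apply: (squeeze_cvgr _ (cvg_cst 0) m0).
   by apply: nearW => K; rewrite normr_ge0 /=; have [_ _ + _ _] := HK K; apply.
  apply: (cvg_norm_le (U := U) (h := fun K => y i (P k) - theta (ph (b K i)) (P k))).
   apply: cvgB; first exact: cvg_cst.
   apply: (theta_cont UU) => [||t]; [by apply: nearW => K; exact/Xph|exact: Xph|].
   by apply: cvg_sum_fun => k'; apply: cvgM => //; exact: cvg_cst.
  apply: filterS Ui => K /= iC; have [_ _ _ + _] := HK K.
  move=> /(_ i iC) {1}<-; apply: net; exact/thetaX/Xph.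
 apply/eqP; rewrite eq_le sl.1 andbT. apply: (ler_cvg_to (la i) m0); apply: filterS Ui => K /= /negP iC.
 by have [_ _ _ _] := HK K; apply.
move=> k; have -> : theta (ph l) (P k) - ph l (P k) = \sum_i l i * (theta (ph l) (P k) - y i (P k)).
 under eq_bigr do rewrite mulrBr. by rewrite sumrB -mulr_suml sl.2 mul1r.
apply: le_trans (ler_norm_sum _ _ _) _.
rewrite -[X in _ <= X]mul1r -sl.2 mulr_suml; apply: ler_sum => i _.
rewrite normrM ger0_norm; last exact: sl.1.
case: (key i) => [->|h]; first by rewrite !mul0r.
by apply: ler_wpM2l; [exact: sl.1|rewrite distrC].
Qed.

Theorem schauder_fp : exists2 z, X z & theta z = z.
Proof.
pose F := [set A : set (T -> R) | exists (J : finType) (P : J -> T) (eps : R), 0 < eps /\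
  forall z, X z -> (forall k, `|theta z (P k) - z (P k)| <= eps) -> A z].
have FF : ProperFilter F.
 apply: Build_ProperFilter_ex.
  move=> A [J [P [eps [e0 h]]]]; have [z Xz hz] := almost_fixed_point P e0. by exists z; exact: h.
 split.
 - by exists void, (fun x : void => match x with end), 1.
 - move=> A B [J [P [eps [e0 h]]]] [J' [P' [eps' [e0' h']]]].
  exists (J + J')%type, (fun x => match x with inl k => P k | inr k => P' k end), (Num.min eps eps').
  split=> [|z Xz hz]; first by rewrite lt_min e0. split; [apply: h => // k|apply: h' => // k].
   by have := hz (inl k); rewrite le_min => /andP[].
  by have := hz (inr k); rewrite le_min => /andP[].
 - move=> A B AB [J [P [eps [e0 h]]]]; exists J, P, eps; split=> // z Xz hz. by apply: AB; exact: h.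
have [U [UU sU]] := ultraFilterLemma FF.
have UX : \forall z \near U, X z by apply: sU; exists void, (fun x : void => match x with end), 1.
have /choice[g zg] : forall t, exists l : R, (fun z : T -> R => z t) @ U --> l.
 move=> t; apply: (@ultra_cvg _ _ U UU _ M). by apply: filterS UX => z; exact: Xbounded.
have Xg : X g by apply: (Xclosed (U := U) (f := id)).
exists g => //; apply/funext => t.
have tg : (fun z => theta z t) @ U --> theta g t by apply: (theta_cont UU UX Xg).
apply/eqP; rewrite -subr_eq0 -normr_le0; apply/ler_addgt0Pl => eps e0; rewrite addr0.
apply: (cvg_norm_le (U := U) (h := fun z => theta z t - z t)); first exact: cvgB.
apply: sU; exists unit, (fun=> t), eps; split=> // z _ /(_ tt); exact.
Qed.

End schauder.

Section composition_difference.
Context {R : realType} {n : nat}.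
Local Notation V := 'rV[R]_n.
Local Notation e := (@basis_vec R n).

Lemma pderiv_rcons s i (f : V -> R) : pderiv (rcons s i) f = pderiv s ('D_(e i) f).
Proof. by rewrite /pderiv map_rcons /iter_derive foldr_rcons. Qed.

Lemma Nb_pderiv D om k w (f : V -> R) s : Nb D om k w f -> (size s <= k)%N ->
 Nb D om (k - size s) (fun j => w (size s + j)%N) (pderiv s f).
Proof.
elim/last_ind: s k w f => [|s i IH] k w f Nf; first by rewrite subn0.
rewrite size_rcons; case: k Nf => // k Nf sk; rewrite subSS pderiv_rcons.
have := IH _ _ _ (Nb_derive i Nf) sk; congr (Nb _ _ _ _ _).
Qed.

Lemma Nb_pderiv_sup D om k w (f : V -> R) s x : Nb D om k w f -> (size s <= k)%N -> D x -> `|pderiv s f x| <= w (size s).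
Proof. by move=> Nf sk Dx; have := Nb0 (Nb_pderiv Nf sk) Dx; rewrite addn0. Qed.

Lemma Nb_diff D om k w (f : V -> R) x : Nb D om k.+1 w f -> D x -> differentiable f x.
Proof. by case=> _ _ [+ _]; apply. Qed.

Lemma Nb_comp_diff (L C d q rho1 K E : R) om B k (eta : V -> V) m g : modulus om L -> 2 <= L -> leib_weights C B ->
 0 <= d -> 0 < rho1 -> 1 + n%:R * C * d * (rho1 * q) <= q -> 1 <= q -> 0 <= K ->
 Nbv setT om k (fun j => d * B j * (rho1 * q) ^+ j) eta -> (forall x y, `|x + eta x - (y + eta y)| <= 2 * `|x - y|) ->
 Nb setT om k (fun j => K * B (m + j)%N * rho1 ^+ (m + j)) g -> (forall s, (size s <= k)%N ->
   Nb setT om 0 (fun=> E * B (m + size s)%N * (rho1 * q) ^+ (m + size s)) (fun x => pderiv s g (x + eta x) - pderiv s g x)) ->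
 Nb setT om k (fun j => (E + 2 * n%:R * K * C * d * (rho1 * q) * j%:R) * B (m + j)%N * (rho1 * q) ^+ (m + j))
   (fun x => g (x + eta x) - g x).
Proof.
move=> mo L2 wt d0 r0 qC q1 K0 Neta lip; have [B1 _ BC] := wt.
have om0 := modulus_ge0 mo.
have B0 j : 0 <= B j by apply: le_trans (B1 j).
have q0 : 0 < q by lra.
have rn i' : 0 < rho1 ^+ i' by nonneg.
elim: k m g Neta => [|k IH] m g Neta Ng base.
 by have := base nil isT; rewrite /= mulr0 addr0.
have Neta' : Nbv setT om k (fun j => d * B j * (rho1 * q) ^+ j) eta by move=> l; exact: Nb_le (Neta l).
have [pa pb _] := base nil isT; rewrite /= addn0 in pa pb.
have [_ _ [dg Ng']] := Ng.
have deta x l : differentiable (fun y => eta y 0 l : R) x by have [_ _ [H _]] := Neta l; exact: H.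
have dc x : differentiable (fun y => g (y + eta y)) x.
 apply: (@differentiable_comp _ _ _ _ (fun y => y + eta y) g); last exact: dg.
 by apply: diff_shift_id.
split; rewrite /= ?addn0 ?mulr0 ?addr0 //; split=> [x _|i].
 by apply: differentiableB; [exact: dc|exact: dg].
have NDg l : Nb setT om k (fun j => K * B (m.+1 + j)%N * rho1 ^+ (m.+1 + j)) ('D_(e l) g).
 by have := Ng' l; apply: Nb_eq => // j /=; rewrite addSnnS.
set s := rho1 * q in qC pa pb base Neta Neta' IH *.
have s0 : 0 < s by nonneg.
have NT l : Nb setT om k (fun j => 2 * K * s ^+ m.+1 * s ^+ j * B (m + j).+1) (fun x => 'D_(e l) g (x + eta x)).
 have HG j : 0 <= K * B (m.+1 + j)%N * rho1 ^+ (m.+1 + j) <= K * B (m.+1 + j)%N * rho1 ^+ (m.+1 + j).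
  by rewrite lexx andbT; have r0' := ltW r0; rewrite !(mulr_ge0, exprn_ge0).
 have := Nb_comp (G := fun j => K * B j * rho1 ^+ j) openT mo L2 wt d0 r0 qC q1 Neta' (fun x y _ _ => lip x y) HG (NDg l).
 apply: Nb_mono => // j _; rewrite [leLHS](_ : _ = 2 * K * B (m + j).+1 * (rho1 ^+ m.+1 * (rho1 ^+ j * q ^+ j))).
  rewrite -exprMn [leRHS](_ : _ = 2 * K * B (m + j).+1 * (s ^+ m.+1 * s ^+ j)); last by ring.
  apply: ler_wpM2l; first by nonneg. apply: ler_wpM2r; first by nonneg.
  by apply: lerXn2r; rewrite ?nnegrE; [exact: ltW|exact: ltW|rewrite ler_peMr // ltW].
 by rewrite exprD addSn; ring.
clearbody s.
apply: (@Nb_ext _ _ _ _ _ _ (fun x => ('D_(e i) g (x + eta x) - 'D_(e i) g x) +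
 \sum_l 'D_(e i) (fun y => eta y 0 l : R) x * 'D_(e l) g (x + eta x))).
- exact: openT.
- move=> x _; rewrite deriveB; last 2 first.
  by apply: diff_derivable; exact: dc. by apply: diff_derivable; exact: dg.
 rewrite derive_shift_id //; last by move=> y; exact: dg. by rewrite addrAC.
pose vS : nat -> R := (fun j => d * B j * s ^+ j) \o succn.
pose T j := 2 * K * s ^+ m.+1 * s ^+ j * B (m + j).+1.
apply: (@Nb_mono _ _ _ _ _ (fun j => (E + 2 * n%:R * K * C * d * s * j%:R) * B (m.+1 + j)%N * s ^+ (m.+1 + j) +
 \sum_(l <- index_enum 'I_n) lconv vS T j)) => //; last first. apply: Nb_add; first exact: openT.
  apply: (IH m.+1 ('D_(e i) g)) => // w wk.
  have := base (rcons w i); rewrite size_rcons pderiv_rcons addSnnS; exact.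
 apply: Nb_sum => //; first exact: openT. move=> l; apply: Nb_mul => //; first exact: openT.
 by have [_ _ [_ H]] := Neta l; exact: H.
move=> j _; rewrite sumr_const card_ord -[lconv _ _ _ *+ n]mulr_natl.
have le1 i' : 0 <= vS i' <= d * s * s ^+ i' * (B \o succn) i'.
 rewrite /vS /=; apply/andP; split.
  by nonneg.
 by rewrite exprS; apply: eq_ler; ring.
have le2 i' : 0 <= T i' <= 2 * K * s ^+ m.+1 * s ^+ i' * B (m + i').+1.
 by rewrite /T lexx andbT; have s0' := ltW s0; do ![apply: mulr_ge0 => //]; exact: exprn_ge0.
have /andP[_ le3] := lconv_mono j le1 le2.
rewrite lconv_geom in le3.
have BCj := BC m j.
have : d * s * (2 * K * s ^+ m.+1) * s ^+ j * lconv (B \o succn) (fun i0 => B (m + i0).+1) j <=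
  d * s * (2 * K * s ^+ m.+1) * s ^+ j * (C * B (m + j).+1).
 apply: ler_wpM2l BCj; have s0' := ltW s0. by nonneg.
move=> /(le_trans le3) le4.
apply: le_trans (lerD (lexx _) (ler_wpM2l (ler0n R n) le4)) _.
rewrite /= !addnS !addSn -[j.+1%:R]natr1 le_eqVlt; apply/orP; left; apply/eqP.
by rewrite -[(m + j).+1]addSn exprD; ring.
Qed.

Lemma comp_diff_sup (eta : V -> V) (g : V -> R) (b d : R) :
 0 <= b -> (forall y, differentiable g y) -> (forall l y, `|'D_(e l) g y| <= b) ->
 (forall y, `|eta y| <= d) -> forall x, `|g (x + eta x) - g x| <= n%:R * b * d.
Proof.
move=> b0 dg Dg He x.
have [|t _ ->] := @mvt_row R n g x (x + eta x); first by [].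
apply: le_trans (sum_coord_le _ _) (_ : n%:R * b * `|_| <= _) => [l|].
 by [].
by rewrite addrAC subrr add0r ler_wpM2l // mulr_ge0.
Qed.

Lemma comp_diff_modulus om L (eta : V -> V) (g : V -> R) (b d : R) : 
 modulus om L -> 0 <= b -> 0 <= d -> (forall s y, (size s <= 1)%N -> differentiable (pderiv s g) y) ->
 (forall s y, (0 < size s <= 2)%N -> `|pderiv s g y| <= b) ->
 (forall y, `|eta y| <= d) -> (forall l y, differentiable (fun y => eta y 0 l : R) y) ->
 (forall i l y, `|'D_(e i) (fun y => eta y 0 l : R) y| <= d) ->
 Nb setT om 0 (fun=> (2 * n%:R + 2 * n%:R ^+ 2) * b * d) (fun x => g (x + eta x) - g x).
Proof.
move=> mo b0 d0 dg Dg He de De.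
have dc x : differentiable (fun y => g (y + eta y)) x.
 apply: (@differentiable_comp _ _ _ _ (fun y => y + eta y) g); last exact: (dg nil).
 by apply: diff_shift_id.
have dg0 y : differentiable g y := dg nil y isT.
have sup0 := comp_diff_sup b0 dg0 (fun l y => Dg [:: l] y isT) He.
pose w j := if j is 0%N then n%:R * b * d else 2 * n%:R * b * d.
have N1 : Nb setT (fun=> 2) 1 w (fun x => g (x + eta x) - g x).
 apply: (@Nb_sup _ _ _ (fun t => 2)); first by rewrite /w /= => *; rewrite !mulr_ge0.
 split=> [x _|x y _ _|]; first exact: sup0.
  by apply: le_trans (ler_normB _ _) _; rewrite mulr_natr mulr2n lerD.
 have sup1 i x : `|'D_(e i) (fun x => g (x + eta x) - g x) x| <= 2 * n%:R * b * d.
  rewrite deriveB; last 2 first.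
   by apply: diff_derivable; exact: dc. by apply: diff_derivable; exact: dg0.
  rewrite derive_shift_id // addrAC; apply: le_trans (ler_normD _ _) _.
  have -> : 2 * n%:R * b * d = n%:R * b * d + n%:R * b * d by ring. apply: lerD.
   apply: (@comp_diff_sup eta ('D_(e i) g) b d b0 _ _ He) => [y|l y].
    exact: (dg [:: i]).
   exact: (Dg [:: l; i]).
  apply: le_trans (ler_norm_sum _ _ _) _.
  have -> : n%:R * b * d = \sum_(l < n) (d * b) by rewrite sumr_const card_ord -mulr_natl; ring.
  apply: ler_sum => l _; rewrite normrM. apply: ler_pM => //; exact: (Dg [:: l]).
 split=> [x _|i]; first by apply: differentiableB; [exact: dc|exact: dg0].
 split=> [x _|x y _ _|//]; first exact: sup1.
 by apply: le_trans (ler_normB _ _) _; rewrite mulr_natr mulr2n lerD //; exact: sup1.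
have := Nb_upgrade openT (fun _ _ _ _ _ _ => I) (modulus_min mo) N1.
apply: Nb_mono; first exact: modulus_ge0 mo.
by case=> // _; rewrite /w /= le_eqVlt; apply/orP; left; apply/eqP; ring.
Qed.

Lemma Nb_extend om k w (f : V -> R) (a : R) : (forall t, 0 <= om t) -> (forall t, 1 <= t -> 1 <= om t) -> (forall j, 0 <= w j) ->
 (forall x, a < `|x| -> f x = 0) -> Nb [set x | `|x| < a + 1] om k w f -> Nb setT om k w f.
Proof.
move=> om0 om1; have D x : `|x| <= a -> [set x : V | `|x| < a + 1] x by move=> /= xa; rewrite (le_lt_trans xa) // ltrDl.
have oD : open [set x : V | `|x| < a + 1].
 have -> : [set x : V | `|x| < a + 1] = ball (0 : V) (a + 1).
  by apply/seteqP; split=> x; rewrite -ball_normE /= sub0r normrN.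
 exact: ball_open.
have base w' f' : (forall j, 0 <= w' j) -> (forall x, a < `|x| -> f' x = 0) ->
  Nb [set x : V | `|x| < a + 1] om 0 w' f' -> Nb setT om 0 w' f'.
 move=> w0 f0 [p q _].
 have p' x : `|f' x| <= w' 0%N by have [xa|xa] := leP `|x| a; [apply/p/D|rewrite f0 // normr0].
 have half x y : `|x| <= a -> `|f' x - f' y| <= w' 0%N * om `|x - y|.
  move=> xa; have [ya|ya] := ltP `|y| (a + 1); first by apply: q => //; exact: D.
  rewrite (f0 y) ?subr0; last by apply: lt_le_trans ya; rewrite ltrDl.
  apply: le_trans (p' x) _; rewrite ler_peMr // om1 //.
  have := ler_normD (y - x) x; rewrite subrK distrC => h; lra.
 split=> // x y _ _; have [xa|xa] := leP `|x| a; first exact: half.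
 have [ya|ya] := leP `|y| a; first by rewrite distrC (distrC x); exact: half.
 by rewrite !f0 // subrr normr0 mulr_ge0.
elim: k w f => [|k IH] w f w0 f0 Nf; first exact: base.
have [p q _] := base _ _ w0 f0 (Nb_le (leq0n _) Nf); split=> //.
have [_ _ [df Df]] := Nf; split=> [x _|i].
 have [xa|xa] := leP `|x| a; first exact/df/D.
 apply: (@near_diffble _ _ (fun=> 0)); last exact: differentiable_cst. have : \near x, a < `|x|.
  have : (fun y : V => `|y|) @ x --> `|x| by exact: norm_continuous. by move/cvgr_gt => /(_ _ xa).
 by apply: filterS => y ya; rewrite f0.
apply: IH => [j|x xa|]; [exact: w0|exact: derive_out xa|exact: Df].
Qed.

Lemma Nb_disjoint (N : nat) om k w (f : 'I_N -> V -> R) (c : 'I_N -> V) (a : R) :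
 (forall t, 0 <= om t) -> (forall t, 1 <= t -> 1 <= om t) -> (forall j, 0 <= w j) ->
 (forall i j, i != j -> 2 * a + 1 <= `|c i - c j|) -> (forall i x, a < `|x - c i| -> f i x = 0) ->
 (forall i, Nb setT om k w (f i)) -> Nb setT om k (fun j => 2 * w j) (fun x => \sum_i f i x).
Proof.
move=> om0 om1; elim: k w f => [|k IH] w f w0 cc f0 Nf.
 have single x : exists i0 : option 'I_N, forall i, Some i != i0 -> f i x = 0.
  have [[i xi]|h] := pselect (exists i, `|x - c i| <= a).
   exists (Some i) => j ji; apply: f0; rewrite ltNge; apply/negP => xj.
   have /cc : i != j by apply: contraNneq ji => ->.
   have := ler_normD (c i - x) (x - c j); rewrite addrA subrK (distrC (c i) x); lra.
  exists None => i _; apply: f0; rewrite ltNge; apply/negP => xi; apply: h. by exists i.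
 have sumE x i0 : (forall i, Some i != i0 -> f i x = 0) -> \sum_i f i x = if i0 is Some i then f i x else 0.
  case: i0 => [i|] h; last by apply: big1 => i _; exact: h.
  rewrite (bigD1 i) //= big1 ?addr0 // => j ji; apply: h.
 have p x : `|\sum_i f i x| <= w 0%N.
  have [i0 /sumE ->] := single x; case: i0 => [i|]; last by rewrite normr0.
  exact: (Nb0 (Nf i) (I : setT x)).
 split=> [x _|x y _ _|//]; first by apply: le_trans (p x) _; have := w0 0%N; lra.
 have [i0 hx] := single x; have [i1 hy] := single y.
 have dl (g1 g2 : R) : `|g1| <= w 0%N * om `|x - y| -> `|g2| <= w 0%N * om `|x - y| -> `|g1 - g2| <= 2 * w 0%N * om `|x - y|.
  by move=> h1 h2; apply: le_trans (ler_normB _ _) _; lra.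
 have one i : f i y = 0 -> `|f i x| <= w 0%N * om `|x - y|.
  by move=> fy; have := Nb_mod (Nf i) (I : setT x) (I : setT y); rewrite fy subr0.
 have one' i : f i x = 0 -> `|f i y| <= w 0%N * om `|x - y|.
  by move=> fy; have := Nb_mod (Nf i) (I : setT x) (I : setT y); rewrite fy sub0r normrN.
 have w00 : 0 <= w 0%N * om `|x - y| by nonneg. rewrite (sumE x i0 hx) (sumE y i1 hy).
 case: i0 hx => [i|] hx; case: i1 hy => [j|] hy.
 - have [ij|ij] := eqVneq i j.
   rewrite -ij; apply: le_trans (Nb_mod (Nf i) (I : setT x) (I : setT y)) _; lra.
  apply: dl; [apply/one/hy|apply/one'/hx].
   by [].
  by apply: contraNneq ij => -[->].
 - by apply: dl; [apply/one/hy|rewrite normr0].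
 - by apply: dl; [rewrite normr0|apply/one'/hx].
 - by apply: dl; rewrite normr0.
have [p q _] : Nb setT om 0 (fun j => 2 * w j) (fun x => \sum_i f i x).
 apply: Nb_le (leq0n k) _; apply: IH => // i; exact: Nb_le (leqnSn k) (Nf i).
split=> //; have df i x : differentiable (f i) x by apply: (Nb_diff (Nf i)).
have sE : (fun x => \sum_i f i x) = \sum_i f i by apply/funext => x; rewrite fct_sumE.
split=> [x _|l]; first by rewrite sE; exact: differentiable_sum.
rewrite sE (_ : 'D_(e l) _ = (fun x => \sum_i 'D_(e l) (f i) x)).
 apply: (IH (w \o succn)) => // [j|i x xi|i]; [exact: w0| |exact: (Nb_derive _ (Nf i))].
 have fi0 : \near x, f i x = 0.
  have : (fun y : V => `|y - c i|) @ x --> `|x - c i|.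
   apply: (continuous_comp (f := fun y : V => y - c i) (g := fun y : V => `|y|)).
    by apply: continuousB => //; exact: cst_continuous.
   exact: norm_continuous.
  by move/cvgr_gt => /(_ _ xi); apply: filterS => y /f0.
 by rewrite (near_eq_derive _ fi0) derive_cst.
apply/funext => x; rewrite derive_sum // => i; exact/diff_derivable/df.
Qed.

End composition_difference.

Section tame_operators.
Context {R : realType} {n : nat}.
Local Notation V := 'rV[R]_n.
Local Notation e := (@basis_vec R n).
Context (r : regularity) (r0 : nat) (L C : R) (ell : nat -> R).
Hypotheses (r1 : le_reg 1 r) (C0 : 0 <= C).

Definition good om B := [/\ @calculus R L C om B, forall j, (j <= r0)%N -> B j = 1 & forall j, (r0 < j)%N -> ell j <= B j].

Definition unit_field om B (eps : R) (phi : V -> V) := disp r om B eps 1 phi /\ forall x, 1 < `|x| -> phi x = 0.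

(* "for all sufficiently small fields, uniformly over all good moduli and weights" *)
Definition ev (P : (R -> R) -> (nat -> R) -> R -> (V -> V) -> Prop) :=
 exists2 e0 : R, 0 < e0 & forall om B eps phi, good om B -> 0 <= eps <= e0 -> unit_field om B eps phi -> P om B eps phi.

Lemma ev_imp (P Q : (R -> R) -> (nat -> R) -> R -> (V -> V) -> Prop) :
 (forall om B eps phi, good om B -> 0 <= eps -> unit_field om B eps phi -> P om B eps phi -> Q om B eps phi) -> ev P -> ev Q.
Proof.
move=> H [e0 e00 h]; exists e0 => // om B eps phi g /[dup] ee /andP[eps0 _] f.
by apply: H => //; exact: h.
Qed.

Lemma ev_and P Q : ev P -> ev Q -> ev (fun om B eps phi => P om B eps phi /\ Q om B eps phi).
Proof.
move=> [e0 e00 h] [e1 e10 h']; exists (Num.min e0 e1); first by rewrite lt_min e00.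
move=> om B eps phi g /andP[eps0]; rewrite le_min => /andP[a b] f.
by split; [apply: h|apply: h'] => //; apply/andP.
Qed.

Lemma ev_small (c : R) : 0 < c -> ev (fun _ _ eps _ => eps <= c).
Proof. by move=> c0; exists c => // om B eps phi _ /andP[]. Qed.

Lemma ev_true (P : (R -> R) -> (nat -> R) -> R -> (V -> V) -> Prop) :
 (forall om B eps phi, good om B -> 0 <= eps -> unit_field om B eps phi -> P om B eps phi) -> ev P.
Proof. by move=> H; apply: ev_imp (ev_small ltr01) => *; exact: H. Qed.

Lemma ev_fin (m : nat) (P : 'I_m -> (R -> R) -> (nat -> R) -> R -> (V -> V) -> Prop) :
 (forall i, ev (P i)) -> ev (fun om B eps phi => forall i, P i om B eps phi).
Proof.
elim: m P => [|m IH] P H; first by apply: ev_true => om B eps phi _ _ _ [].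
have := ev_and (H ord0) (IH (fun i => P (lift ord0 i)) (fun i => H _)).
apply: ev_imp => om B eps phi _ _ _ [h0 hS] i.
by case: (unliftP ord0 i) => [j|] ->.
Qed.

Lemma ev_scale (a c : R) : 0 <= a -> 0 < c -> ev (fun _ _ eps _ => a * eps <= c).
Proof.
move=> a0 c0; have a1 : 0 < a + 1 by lra.
apply: ev_imp (ev_small (divr_gt0 c0 a1)) => om B eps phi _ eps0 _.
rewrite ler_pdivlMr // => h; apply: le_trans h.
by lra.
Qed.

Definition sc om B K rho (f : V -> R) := forall k, le_reg k r -> Nb setT om k (fun j => K * B j * rho ^+ j) f.

Definition tm p rho (H : (V -> V) -> V -> R) := forall rho', rho < rho' ->
 exists2 K, 0 <= K & ev (fun om B eps phi => sc om B (K * eps ^+ p) rho' (H phi)).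

Definition conv_field om B eps (J : Type) (U : set_system J) (f : J -> V -> V) g :=
 [/\ UltraFilter U, good om B, \forall j \near U, unit_field om B eps (f j),
   unit_field om B eps g & forall x l, (fun j => f j x 0 l : R) @ U --> (g x 0 l : R)].

Definition ct (H : (V -> V) -> V -> R) := exists2 e0 : R, 0 < e0 & forall om B eps (J : Type) (U : set_system J) f g,
 conv_field om B eps U f g -> 0 <= eps <= e0 -> forall x, (fun j => H (f j) x) @ U --> H g x.

Definition tame p rho H := tm p rho H /\ ct H.
Definition tamev p rho (H : (V -> V) -> V -> V) := forall l, tame p rho (fun phi x => H phi x 0 l).

Let lt1 (rho : R) : rho < rho + 1. Proof. by rewrite ltrDl. Qed.
Let goodB1 om B : good om B -> forall j, 1 <= B j.
Proof. by case=> /calc_wt[+ _ _] _ _ j; apply. Qed.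
Let goodB0 om B : good om B -> forall j, 0 <= B j.
Proof. by move=> g j; apply: le_trans (goodB1 g j). Qed.
Let goodom om B : good om B -> forall t, 0 <= om t.
Proof. by case=> /calc_mod/modulus_ge0. Qed.

Lemma sc_mono om B K K' rho rho' f : good om B -> 0 <= rho -> rho <= rho' -> K <= K' ->
 0 <= K -> sc om B K rho f -> sc om B K' rho' f.
Proof.
move=> g a b c d h k kr; apply: Nb_mono (h k kr); first exact: goodom g.
move=> j _; apply: ler_pM; rewrite ?exprn_ge0 ?mulr_ge0 ?(goodB0 g) //.
 by rewrite ler_wpM2r ?(goodB0 g).
by rewrite lerXn2r ?nnegrE // (le_trans a).
Qed.

Lemma sc0 om B K rho f x : good om B -> sc om B K rho f -> `|f x| <= K.
Proof.
move=> [cal _ _] h; have r00 : le_reg 0 r by case: (r) => [[]|].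
by have := Nb0 (h 0%N r00) (I : setT x); rewrite (calc_B0 cal) expr0 !mulr1.
Qed.

Lemma sc_lip om B K rho f x y : good om B -> sc om B K rho f -> `|f x - f y| <= n%:R * (K * rho) * `|x - y|.
Proof.
move=> [cal _ _] h.
have := Nb_lipschitz (fun _ _ _ _ _ _ => I) (h 1%N r1) (I : setT x) (I : setT y).
by rewrite (calc_B1 cal) expr1 mulr1.
Qed.

Lemma tm_le p p' rho rho' H : (p' <= p)%N -> 0 <= rho -> rho <= rho' -> tm p rho H -> tm p' rho' H.
Proof.
move=> pp rho0 rr h t /(le_lt_trans rr) /[dup] rt /h[K K0 {}h]; exists K => //.
apply: ev_imp (ev_and h (ev_small ltr01)) => om B eps phi g eps0 _ [+ eps1].
apply: sc_mono => //; first exact: le_trans rho0 (ltW rt).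
 by rewrite ler_wpM2l // ler_wiXn2l.
by nonneg.
Qed.

Lemma tame_le p p' rho rho' H : (p' <= p)%N -> 0 <= rho -> rho <= rho' -> tame p rho H -> tame p' rho' H.
Proof. by move=> a b c [h h']; split=> //; exact: tm_le h. Qed.

Lemma ct_and (H1 H2 H : (V -> V) -> V -> R) : (forall (J : Type) (U : set_system J) (f : J -> V -> V) g x, UltraFilter U ->
   (fun j => H1 (f j) x) @ U --> H1 g x -> (fun j => H2 (f j) x) @ U --> H2 g x -> (fun j => H (f j) x) @ U --> H g x) ->
 ct H1 -> ct H2 -> ct H.
Proof.
move=> HH [e1 e10 h1] [e2 e20 h2]; exists (Num.min e1 e2); first by rewrite lt_min e10.
move=> om B eps J U f g cv /andP[eps0]; rewrite le_min => /andP[a b] x; have [UU _ _ _ _] := cv.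
by apply: HH; [apply: h1 cv _ x|apply: h2 cv _ x]; apply/andP.
Qed.

Lemma tame_add p rho f g : 0 <= rho -> tame p rho f -> tame p rho g -> tame p rho (fun phi x => f phi x + g phi x).
Proof.
move=> rho0 [tf cf] [tg cg]; split; last by apply: ct_and cf cg => *; exact: cvgD.
move=> rho' rr; have [K K0 hf] := tf _ rr; have [K' K'0 hg] := tg _ rr.
exists (K + K'); first exact: addr_ge0.
apply: ev_imp (ev_and hf hg) => om B eps phi gd eps0 _ [h h'] k kr.
have := Nb_add openT (h k kr) (h' k kr); apply: Nb_eq => // j.
by rewrite -mulrDl -mulrDl -mulrDl.
Qed.

Lemma tame_scale p rho a f : tame p rho f -> tame p rho (fun phi x => a * f phi x).
Proof.
move=> [tf cf]; split; last by apply: ct_and cf (cf) => *; apply: cvgM => //; exact: cvg_cst.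
move=> rho' rr; have [K K0 hf] := tf _ rr.
exists (`|a| * K); first exact: mulr_ge0.
apply: ev_imp hf => om B eps phi gd eps0 _ h k kr.
by have := Nb_scale a openT (h k kr); apply: Nb_eq => // j; rewrite !mulrA.
Qed.

Lemma tame_cst p rho (c : (V -> V) -> R) : 0 <= rho -> (exists2 K, 0 <= K & ev (fun om B eps phi => `|c phi| <= K * eps ^+ p)) ->
 ct (fun phi _ => c phi) -> tame p rho (fun phi _ => c phi).
Proof.
move=> rho0 [K K0 h] cc; split=> // rho' rr; exists K => //.
apply: ev_imp h => om B eps phi gd eps0 _ h k _.
have w0 j : 0 <= K * eps ^+ p * B j * rho' ^+ j.
 by rewrite !mulr_ge0 ?exprn_ge0 ?(goodB0 gd) // (le_trans rho0) // ltW.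
have B01 : B 0%N = 1 by case: gd => /calc_B0.
case: k => [|k]; split=> //= *; rewrite ?B01 ?expr0 ?mulr1 ?subrr ?normr0 //.
- by rewrite mulr_ge0 ?(goodom gd) // mulr_ge0 ?exprn_ge0.
- by rewrite mulr_ge0 ?(goodom gd) // mulr_ge0 ?exprn_ge0.
split=> [x _|i]; first exact: differentiable_cst.
have -> : 'D_(e i) (fun=> c phi) = (fun=> 0) :> (V -> R) by apply/funext => x; exact: derive_cst.
by apply: Nb_zero => [|j]; [exact: goodom gd|exact: w0].
Qed.

Lemma tame_at p rho rho' f x0 : 0 <= rho' -> tame p rho f -> tame p rho' (fun phi _ => f phi x0).
Proof.
move=> rho0 [tf [e0 e00 cf]]; apply: tame_cst => //; last first.
 by exists e0 => // om B eps J U f' g cv ee x; exact: (cf om B eps).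
have [K K0 h] := tf (rho + 1) (lt1 _); exists K => //.
by apply: ev_imp h => om B eps phi gd eps0 _ h; exact: sc0 gd h.
Qed.

Lemma tame_0 p rho : 0 <= rho -> tame p rho (fun _ _ => 0).
Proof.
move=> rho0; apply: tame_cst => //.
 by exists 0 => //; apply: ev_true => *; rewrite normr0 mul0r.
by exists 1 => // om B eps J U ? ? [UU _ _ _ _] _ x; exact: cvg_cst.
Qed.

Lemma tame_mul p p' rho f g : 0 <= rho -> tame p rho f -> tame p' rho g -> tame (p + p') rho (fun phi x => f phi x * g phi x).
Proof.
move=> rho0 [tf cf] [tg cg]; split; last by apply: ct_and cf cg => *; exact: cvgM.
move=> rho' rr; have [K K0 hf] := tf _ rr; have [K' K'0 hg] := tg _ rr.
exists (K * K' * C); first by nonneg.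
apply: ev_imp (ev_and hf hg) => om B eps phi gd eps0 _ [h h'] k kr.
have r'0 : 0 <= rho' by lra.
have := Nb_mul openT (goodom gd) (h k kr) (h' k kr); apply: Nb_mono; first exact: goodom gd.
move=> j _.
have a1 p0 K0' i : 0 <= K0' -> 0 <= K0' * eps ^+ p0 * B i * rho' ^+ i <= K0' * eps ^+ p0 * rho' ^+ i * B i.
 move=> ?; rewrite mulrAC lexx andbT !mulr_ge0 ?exprn_ge0 ?(goodB0 gd) //.
have /andP[_ le3] := lconv_mono j (fun i => a1 p K i K0) (fun i => a1 p' K' i K'0).
apply: le_trans le3 _; rewrite lconv_geom.
have [/calc_wt[_ + _] _ _] := gd => /(_ j) BB.
apply: le_trans (ler_wpM2l _ BB) _; first by nonneg.
by apply: eq_ler; rewrite exprD; ring.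
Qed.

Lemma tamevP p rho H : tamev p rho H -> forall rho', rho < rho' -> 0 <= rho ->
 exists2 K, 0 <= K & ev (fun om B eps phi => disp r om B (K * eps ^+ p) rho' (H phi)).
Proof.
move=> tH rho' rr rho0.
have /choice[K hK] : forall l, exists K, 0 <= K /\ ev (fun om B eps phi => sc om B (K * eps ^+ p) rho' (fun x => H phi x 0 l)).
 by move=> l; have [K ? ?] := (tH l).1 _ rr; exists K.
have S0 : 0 <= \sum_l K l by apply: sumr_ge0 => l _; case: (hK l).
exists (\sum_l K l) => //; have := ev_fin (fun l => (hK l).2).
apply: ev_imp => om B eps phi gd eps0 _ h k l kr.
apply: (@sc_mono _ _ (K l * eps ^+ p) _ rho' _ _ gd _ _ _ _ (h l) k kr) => //.
- by lra.
- rewrite ler_wpM2r ?exprn_ge0 // (bigD1 l) //= lerDl. by apply: sumr_ge0 => i _; case: (hK i).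
- by rewrite mulr_ge0 ?exprn_ge0 //; case: (hK l).
Qed.

Lemma sc_comp om B K d q rho1 eta f : good om B -> 0 <= K -> 0 <= d -> 0 < rho1 -> 1 <= q ->
 1 + n%:R * C * d * (rho1 * q) <= q -> n%:R * (d * (rho1 * q)) <= 1 -> sc om B K rho1 f -> disp r om B d (rho1 * q) eta ->
 sc om B (2 * K) (rho1 * q) (fun x => f (x + eta x)).
Proof.
move=> gd K0 d0 rho0 q1 qC dn hf he k kr; have [cal _ _] := gd.
have := @Nb_comp_disp _ _ r L C om B r1 cal k 0 (fun j => K * B j * rho1 ^+ j) K d q rho1 eta f kr d0 rho0 q1 qC dn he.
move=> H; apply: Nb_mono (H _ (hf k kr)); first exact: goodom gd.
 by move=> j _; rewrite !add0n exprMn -subr_ge0 (_ : _ - _ = 0) //; ring.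
by move=> j; rewrite lexx andbT !mulr_ge0 ?(goodB0 gd) ?exprn_ge0 // ltW.
Qed.

Lemma ultra_lip_cvg (J : Type) (U : set_system J) (h : J -> V -> R) (y : J -> V) (z : V) (l M : R) : UltraFilter U ->
 (\forall j \near U, forall x x', `|h j x - h j x'| <= M * `|x - x'|) -> (fun j => h j z) @ U --> l ->
 (forall i, (fun j => y j 0 i : R) @ U --> (z 0 i : R)) -> (fun j => h j (y j)) @ U --> l.
Proof.
move=> UU lip hz yz; apply/cvgrPdist_le => eps eps0.
have e2 : 0 < eps / 2 by lra.
have M1 : 0 < `|M| + 1 by [].
have e3 : 0 < eps / 2 / (`|M| + 1) by nonneg.
have /cvgrPdist_le/(_ _ e2) h1 := hz.
have h2 : \forall j \near U, `|z - y j| <= eps / 2 / (`|M| + 1).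
 have : \forall j \near U, forall i, `|z 0 i - y j 0 i| <= eps / 2 / (`|M| + 1).
  by apply: filter_forall => i; have /cvgrPdist_le/(_ _ e3) := yz i.
 by apply: filterS => j H; apply: le_coord (ltW e3) _ => i; rewrite !mxE.
apply: filterS (filterI lip (filterI h1 h2)) => j [lj [a b]].
have -> : l - h j (y j) = (l - h j z) + (h j z - h j (y j)) by rewrite addrA subrK.
apply: le_trans (ler_normD _ _) _.
have : `|h j z - h j (y j)| <= eps / 2; last by lra.
apply: le_trans (lj _ _) _; apply: le_trans (ler_wpM2r (normr_ge0 _) (ler_norm M)) _.
apply: (@le_trans _ _ ((`|M| + 1) * `|z - y j|)); first by rewrite ler_wpM2r //; lra.
by rewrite mulrC -ler_pdivlMr.
Qed.

Lemma tm_lip p rho f : 0 <= rho -> tm p rho f -> exists2 M, 0 <= M &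
 ev (fun om B eps phi => forall x y, `|f phi x - f phi y| <= M * `|x - y|).
Proof.
move=> rho0 tf; have [K K0 h] := tf (rho + 1) (lt1 _).
exists (n%:R * (K * (rho + 1))); first by nonneg.
apply: ev_imp (ev_and h (ev_small ltr01)) => om B eps phi gd eps0 _ [{}h eps1] x y.
apply: le_trans (sc_lip _ _ gd h) _; rewrite ler_wpM2r // ler_wpM2l //.
rewrite ler_wpM2r ?addr_ge0 // -[leRHS]mulr1 ler_wpM2l //.
by rewrite exprn_ile1.
Qed.

Lemma ctvP (H : (V -> V) -> V -> V) : (forall l, ct (fun phi x => H phi x 0 l)) ->
 exists2 e0 : R, 0 < e0 & forall om B eps (J : Type) (U : set_system J) f g, conv_field om B eps U f g -> 0 <= eps <= e0 ->
 forall x l, (fun j => H (f j) x 0 l : R) @ U --> (H g x 0 l : R).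
Proof.
move=> cH; have /choice[d hd] : forall l, exists d : R, 0 < d /\ forall om B eps (J : Type) (U : set_system J) f g,
  conv_field om B eps U f g -> 0 <= eps <= d -> forall x, (fun j => H (f j) x 0 l : R) @ U --> (H g x 0 l : R).
 by move=> l; have [d d0 h] := cH l; exists d.
exists (\big[Num.min/1]_l d l).
 by elim/big_ind : _ => // [x y x0 y0|l _]; [rewrite lt_min x0|case: (hd l)].
move=> om B eps J U f g cv /andP[eps0 epsd] x l.
apply: (hd l).2 cv _ x; rewrite eps0 (le_trans epsd) //.
exact: bigmin_le_cond.
Qed.

Lemma ct_comp p rho (f : (V -> V) -> V -> R) (tau : (V -> V) -> V -> V) : 0 <= rho ->
 tame p rho f -> (forall l, ct (fun phi x => tau phi x 0 l)) -> ct (fun phi x => f phi (x + tau phi x)).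
Proof.
move=> rho0 [tf [e0 e00 cf]] ctau; have [M M0 [e1 e10 lip]] := tm_lip rho0 tf.
have [e2 e20 ctau'] := ctvP ctau.
exists (Num.min e0 (Num.min e1 e2)); first by rewrite !lt_min e00 e10.
move=> om B eps J U f' g cv /andP[eps0]; rewrite !le_min => /and3P[a b c] x.
have [UU gd fU fg _] := cv.
apply: (@ultra_lip_cvg _ _ (fun j => f (f' j)) (fun j => x + tau (f' j) x) (x + tau g x) _ M) => //.
- by apply: filterS fU => j fj; apply: (lip om B eps) => //; rewrite eps0.
- by apply: cf cv _ _; rewrite eps0.
- move=> i; under eq_fun do rewrite mxE; rewrite mxE; apply: cvgD; first exact: cvg_cst.
 by apply: ctau' cv _ _ _; rewrite eps0.
Qed.

Lemma mid_ratio (rho rho' : R) : 0 <= rho -> rho < rho' -> exists rho1 q, [/\ 0 < rho1, rho < rho1, 1 < q & rho1 * q = rho'].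
Proof.
move=> rho0 rr; exists ((rho + rho') / 2), (rho' / ((rho + rho') / 2)).
have m0 : 0 < (rho + rho') / 2 by lra.
by split=> //; [lra|rewrite ltr_pdivlMr //; lra|rewrite mulrC divfK // gt_eqF].
Qed.

Lemma tame_comp p rho f tau : 0 <= rho -> tame p rho f -> tamev 1 rho tau -> tame p rho (fun phi x => f phi (x + tau phi x)).
Proof.
move=> rho0 tf ttau; split; last by apply: ct_comp tf _ => // l; case: (ttau l).
move=> rho' rr; have [rho1 [q [rho10 rr1 q1 E]]] := mid_ratio rho0 rr.
have [K K0 hf] := tf.1 _ rr1; have [K' K'0 ht] := tamevP ttau rr rho0.
have r'0 : 0 <= rho' by lra.
exists (2 * K); first by nonneg.
have s1 : ev (fun _ _ eps _ => n%:R * C * K' * rho' * eps <= q - 1).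
 by apply: ev_scale; rewrite ?subr_gt0 // !mulr_ge0.
have s2 : ev (fun _ _ eps _ => n%:R * K' * rho' * eps <= 1) by apply: ev_scale; rewrite // !mulr_ge0.
apply: ev_imp (ev_and (ev_and hf ht) (ev_and s1 s2)) => om B eps phi gd eps0 _ [[h h'] [a b]].
rewrite -E -mulrA; apply: (@sc_comp _ _ _ (K' * eps)) => //; rewrite ?E.
- by nonneg.
- by nonneg.
- by nonneg.
- by lra.
- by lra.
- by [].
Qed.

Lemma tame_inv rho H : 0 <= rho -> tamev 1 rho H -> tamev 1 rho (fun phi => inv_disp (H phi)) /\ ev (fun om B eps phi =>
  (forall y, inv_disp (H phi) y = - H phi (y + inv_disp (H phi) y)) /\
  forall y h, h = - H phi (y + h) -> inv_disp (H phi) y = h).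
Proof.
move=> rho0 tH.
have key rho' : rho < rho' -> exists2 K, 0 <= K & ev (fun om B eps phi => [/\ disp r om B (K * eps) rho' (inv_disp (H phi)),
   forall y, inv_disp (H phi) y = - H phi (y + inv_disp (H phi) y), forall y h, h = - H phi (y + h) -> inv_disp (H phi) y = h &
   forall x y l, `|H phi x 0 l - H phi y 0 l| <= 1 * `|x - y|]).
 move=> rr; have [rho1 [q [rho10 rr1 q1 E]]] := mid_ratio rho0 rr. have [K K0 hH] := tamevP tH rr1 rho0.
 have r'0 : 0 <= rho' by lra. exists (2 * K); first by nonneg.
 have s1 : ev (fun _ _ eps _ => n%:R * C * (2 * K) * rho' * eps <= q - 1).
  by apply: ev_scale; rewrite ?subr_gt0 // !mulr_ge0.
 have s2 : ev (fun _ _ eps _ => n%:R * (2 * K) * rho' * eps <= 2^-1) by apply: ev_scale; rewrite // !mulr_ge0.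
 have s3 : ev (fun _ _ eps _ => n%:R * K * rho1 * eps <= 1) by apply: ev_scale; rewrite // !mulr_ge0 // ltW.
 apply: ev_imp (ev_and hH (ev_and (ev_and s1 s3) s2)) => om B eps phi gd eps0 _ [h [[a a'] b]].
 have [cal _ _] := gd; rewrite expr1 in h. have d0 : 0 <= K * eps by nonneg.
 have c1 : 1 + n%:R * C * (2 * (K * eps)) * (rho1 * q) <= q.
  rewrite E; have -> : n%:R * C * (2 * (K * eps)) * rho' = n%:R * C * (2 * K) * rho' * eps by ring.
  lra.
 have c2 : n%:R * (2 * (K * eps) * (rho1 * q)) <= 2^-1.
  by rewrite E; have -> : n%:R * (2 * (K * eps) * rho') = n%:R * (2 * K) * rho' * eps by ring.
 have [di eq_i] := disp_inv r1 cal d0 rho10 (ltW q1) c1 c2 h. split=> //; first by rewrite -E -mulrA.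
  by move=> y h' hE; exact: (inv_disp_unique r1 cal d0 rho10 (ltW q1) c2 h hE).
 move=> x y l; have h1 := h 1%N l r1.
 have := Nb_lipschitz (fun _ _ _ _ _ _ => I) h1 (I : setT x) (I : setT y).
 move=> /le_trans; apply; rewrite ler_wpM2r // (calc_B1 cal) expr1 mulr1. by lra.
split; last first.
 have [K K0 h] := key (rho + 1) (lt1 _). by apply: ev_imp h => om B eps phi _ _ _ [].
move=> l; split=> [rho' rr|].
 have [K K0 h] := key _ rr; exists K => //.
 by apply: ev_imp h => om B eps phi gd eps0 _ [h _ _ _] k kr; rewrite expr1; exact: h.
have [K K0 [e1 e10 h]] := key (rho + 1) (lt1 _).
have [e2 e20 cH] := ctvP (fun l => (tH l).2).
exists (Num.min e1 (Num.min e2 1)); first by rewrite !lt_min e10 e20 ltr01.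
move=> om B eps J U f' g cv /andP[eps0]; rewrite !le_min => /and3P[a b eps1] x.
have [UU gd fU fg _] := cv.
have inv_le phi : unit_field om B eps phi -> `|inv_disp (H phi) x| <= K.
 move=> uf; have [|di _ _ _] := h om B eps phi gd _ uf; first by lra.
 have [cal _ _] := gd; apply: le_trans (disp_norm cal x _ di) _; first by nonneg.
 by rewrite -[leRHS]mulr1 ler_wpM2l.
have /choice[z hz] : forall i, exists a : R, (fun j => inv_disp (H (f' j)) x 0 i : R) @ U --> a.
 move=> i; apply: (@ultra_cvg _ _ U UU _ K).
 apply: filterS fU => j /inv_le; apply: le_trans; exact: coord_le.
have -> : inv_disp (H g) x = \row_i z i; last by rewrite mxE; exact: hz.
have [|_ _ uniq _] := h om B eps g gd _ fg; first by lra.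
apply: uniq; apply/rowP => i; rewrite !mxE.
apply: (@cvg_unique _ (@Rhausdorff R) ((fun j => inv_disp (H (f' j)) x 0 i : R) @ U)).
 exact: hz.
apply: (@cvg_trans _ ((fun j => - H (f' j) (x + inv_disp (H (f' j)) x) 0 i : R) @ U)).
 apply: near_eq_cvg; apply: filterS fU => j uf.
 have [|_ e_j _ _] := h om B eps (f' j) gd _ uf; first by lra. by rewrite [in RHS]e_j mxE.
apply: cvgN; apply: (@ultra_lip_cvg _ _ (fun j y => H (f' j) y 0 i) _ (x + \row_i z i) _ 1) => //.
- apply: filterS fU => j uf y y'.
 by have [|_ _ _ lip] := h om B eps (f' j) gd _ uf; [rewrite eps0|exact: lip].
- by apply: cH cv _ _ _; rewrite eps0.
- move=> l'; under eq_fun do rewrite mxE; rewrite !mxE; apply: cvgD; first exact: cvg_cst. by [].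
Qed.

Lemma tame_id : tamev 1 1 id.
Proof.
move=> l; split; last by exists 1 => // om B eps J U f g [_ _ _ _ cv] _ x; exact: cv.
move=> rho rr; exists 1 => //; apply: ev_true => om B eps phi gd eps0 [h _].
by rewrite mul1r expr1; apply: (sc_mono gd _ (ltW rr) (lexx _)) => // k kr; exact: h.
Qed.

Lemma tame_dilate p rho f (a : R) (b : V) : 0 < a <= 1 -> 0 <= rho -> tame p rho f ->
 tame p (a * rho) (fun phi x => f phi (a *: x + b)).
Proof.
move=> /andP[a0 a1] rho0 [tf [e0 e00 cf]]; split; last first.
 by exists e0 => // om B eps J U f' g cv ee x; exact: cf cv ee _.
move=> rho' rr; have [|K K0 h] := tf (rho' / a); first by rewrite ltr_pdivlMr // mulrC.
exists K => //; apply: ev_imp h => om B eps phi gd eps0 _ h k kr.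
have om0 := goodom gd; have r'0 : 0 <= rho' by apply: le_trans (ltW rr); rewrite mulr_ge0 // ltW.
have := @Nb_affine _ _ om k (fun j => K * eps ^+ p * B j * (rho' / a) ^+ j) (f phi) a 1 b om0.
rewrite (gtr0_norm a0) => H; have {H} := H (lexx _); move=> H.
have [cal _ _] := gd.
have {H} := H _ _ (h k kr); move=> H.
have : Nb setT om k (fun j => 1 * a ^+ j * (K * eps ^+ p * B j * (rho' / a) ^+ j)) (fun x => f phi (a *: x + b)).
 apply: H => [t t0|j]; last first.
  by rewrite !mulr_ge0 ?exprn_ge0 ?(goodB0 gd) // divr_ge0 // ltW.
 rewrite mul1r; apply: (modulus_mono (calc_mod cal)); first by nonneg.
 by rewrite ler_piMl.
apply: Nb_eq => // j; rewrite mul1r mulrCA -exprMn.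
by congr (_ * _ ^+ _); rewrite mulrC divfK // gt_eqF.
Qed.

(* Smooth functions whose derivatives are dominated by every good weight, with
  two derivatives to spare. *)
Definition bump rho (g : V -> R) := exists2 K : R, 0 <= K & forall s, (size s <= 2)%N -> forall om B, good om B ->
 forall k, Nb setT om k (fun j => K * B j * rho ^+ j) (pderiv s g).

Lemma tame_bump rho g : 0 <= rho -> bump rho g -> tame 0 rho (fun _ => g).
Proof.
move=> rho0 [K K0 h]; split; last by exists 1 => // om B eps J U ? ? [UU _ _ _ _] _ x; exact: cvg_cst.
move=> rho' rr; exists K => //.
apply: ev_true => om B eps phi gd eps0 _; rewrite expr0 mulr1.
by apply: (sc_mono gd rho0 (ltW rr) (lexx _) K0) => k _; exact: (h nil).
Qed.

Lemma tame_diff rho g tau : 0 <= rho -> bump rho g -> tamev 1 rho tau -> tame 1 (2 * rho) (fun phi x => g (x + tau phi x) - g x).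
Proof.
move=> rho0 bg tt; split; last first.
 apply: ct_and; last 2 first.
 - by apply: (ct_comp rho0 (tame_bump rho0 bg)) => l; exact: (tt l).2.
 - exact: (tame_bump rho0 bg).2.
 by move=> *; exact: cvgB.
move=> rho'' rr; have [rho' rE] : exists rho', rho'' = 2 * rho' by exists (rho'' / 2); field.
have rr' : rho < rho' by lra.
have [rho1 [q [rho10 rr1 q1 E]]] := mid_ratio rho0 rr'.
have [G G0 bG] := bg; have [K K0 ht] := tamevP tt rr' rho0.
have r'0 : 0 <= rho' by lra.
pose c : R := 2 * n%:R + 2 * n%:R ^+ 2; have c0 : 0 <= c by nonneg.
pose K1 := K * (1 + rho').
have K10 : 0 <= K1 by nonneg.
exists (c * G * K1 + 2 * n%:R * G * C * K * rho').
 by nonneg.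
have s1 : ev (fun _ _ eps _ => n%:R * C * K * rho' * eps <= q - 1).
 by apply: ev_scale; rewrite ?subr_gt0 // !mulr_ge0.
have s2 : ev (fun _ _ eps _ => n%:R * K * rho' * eps <= 1) by apply: ev_scale; rewrite // !mulr_ge0.
apply: ev_imp (ev_and ht (ev_and s1 s2)) => om B eps phi gd eps0 _ [h [a b]] k kr.
have [cal _ _] := gd; rewrite expr1 in h.
have d0 : 0 <= K * eps by nonneg.
have c1 : 1 + n%:R * C * (K * eps) * (rho1 * q) <= q.
 rewrite E; have -> : n%:R * C * (K * eps) * rho' = n%:R * C * K * rho' * eps by ring. lra.
have c2 : n%:R * (K * eps * (rho1 * q)) <= 1.
 by rewrite E; have -> : n%:R * (K * eps * rho') = n%:R * K * rho' * eps by ring.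
have h1 l : Nb setT om 1 (fun j => K * eps * B j * rho' ^+ j) (fun x => tau phi x 0 l) by exact: h.
have bB := goodB0 gd.
have bG' s k' : (size s <= 2)%N -> Nb setT om k' (fun j => G * B j * rho1 ^+ j) (pderiv s g).
 move=> s2'; apply: Nb_mono (bG s s2' om B gd k'); first exact: goodom gd.
 move=> j _; rewrite ler_wpM2l ?mulr_ge0 ?bB // lerXn2r ?nnegrE //; exact: ltW.
have catE s t : pderiv s (pderiv t g) = pderiv (s ++ t) g by rewrite /pderiv map_cat /iter_derive foldr_cat.
have bnd s t x : (size t <= 2)%N -> `|pderiv (t ++ s) g x| <= G * B (size s) * rho1 ^+ size s.
 move=> t2; have -> : t ++ s = take (size s) (t ++ s) ++ drop (size s) (t ++ s) by rewrite cat_take_drop.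
 rewrite -catE. have h' : size (drop (size s) (t ++ s)) = size t by rewrite size_drop size_cat addnK.
 have := Nb_pderiv_sup (s := take (size s) (t ++ s)) (bG' _ (size s) _) _ (I : setT x).
 rewrite size_take size_cat; have -> : (if (size s < size t + size s)%N then size s else (size t + size s)%N) = size s.
  by case: ltnP => //; rewrite -{2}[size s]add0n leq_add2r leqn0 => /eqP ->.
 by apply; rewrite // h'.
have lip x y : `|x + tau phi x - (y + tau phi y)| <= 2 * `|x - y|.
 apply: (disp_shift_lip r1 cal x y d0 r'0 _ h). by lra.
have Ng : Nb setT om k (fun j => G * B (0 + j)%N * rho1 ^+ (0 + j)) g by exact: (bG' nil).
have base s : (size s <= k)%N -> Nb setT om 0 (fun=> (c * G * K1 * eps) * B (0 + size s)%N * (rho1 * q) ^+ (0 + size s))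
    (fun x => pderiv s g (x + tau phi x) - pderiv s g x).
 move=> sk; pose b' := G * B (size s) * rho1 ^+ size s.
 have := @comp_diff_modulus R n om L (tau phi) (pderiv s g) b' (K1 * eps) (calc_mod cal).
 move=> H; have {H} : Nb setT om 0 (fun=> c * b' * (K1 * eps)) (fun x => pderiv s g (x + tau phi x) - pderiv s g x).
  apply: H.
  - by nonneg.
  - by nonneg.
  - move=> t y t1; rewrite catE.
   have := Nb_pderiv (s := t ++ s) (bG' nil (size (t ++ s)).+1 isT) (leqnSn _).
   by rewrite subSn // subnn => /Nb_diff; apply.
  - by move=> t y /andP[_ t2]; rewrite catE; exact: bnd.
  - move=> y; apply: le_trans (disp_norm cal y d0 h) _; rewrite /K1 mulrAC ler_peMr //; lra.
  - by move=> l y; apply: (Nb_diff (h1 l)).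
  - move=> i l y; have := Nb0 (Nb_derive i (h1 l)) (I : setT y); rewrite /= (calc_B1 cal) expr1 mulr1.
   move/le_trans; apply; rewrite /K1 [leRHS]mulrAC ler_wpM2l //; lra.
 apply: Nb_mono; first exact: goodom gd.
 move=> j _; rewrite !add0n; have -> : c * b' * (K1 * eps) = c * G * K1 * eps * B (size s) * rho1 ^+ size s.
  by rewrite /b'; ring.
 apply: ler_wpM2l; first by nonneg.
 by rewrite lerXn2r ?nnegrE ?E //; [exact: ltW|rewrite -E ler_peMr ?ltW].
have := Nb_comp_diff (calc_mod cal) (calc_L cal) (calc_wt cal) d0 rho10 c1 (ltW q1) G0 _ lip Ng base.
rewrite E; move=> /(_ (fun l => h k l kr)); apply: Nb_mono; first exact: goodom gd.
move=> j _; rewrite !add0n expr1.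
rewrite rE.
rewrite exprMn [leRHS](_ : _ = (c * G * K1 * eps * 2 ^+ j +
 2 * n%:R * G * C * (K * eps) * rho' * 2 ^+ j) * B j * rho' ^+ j); last by ring.
apply: ler_wpM2r; first by nonneg.
apply: ler_wpM2r; first exact: bB.
apply: lerD.
 by rewrite ler_peMr ?exprn_ege1 ?ler1n //; do ![apply: mulr_ge0 => //].
apply: ler_wpM2l; first by nonneg.
by rewrite -natrX ler_nat ltnW // ltn_expl.
Qed.

End tame_operators.

Lemma tame_ext (R : realType) (n : nat) (r : regularity) r0 (L C : R) ell p rho (f g : ('rV[R]_n -> 'rV[R]_n) -> 'rV[R]_n -> R) :
 (forall phi x, f phi x = g phi x) -> tame r r0 L C ell p rho f -> tame r r0 L C ell p rho g.
Proof. by move=> fg; have -> : f = g by apply/funext => phi; apply/funext => x. Qed.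

Section smooth_functions.
Context {R : realType}.
Implicit Types (f g h : R -> R).

Fixpoint smooth_on (D : set R) k h : Prop := (forall x, D x -> {for x, continuous h}) /\ if k is k'.+1 then
  exists2 h' : R -> R, (forall x, D x -> is_derive x (1 : R) h (h' x)) & smooth_on D k' h' else True.

Lemma is_derive_cont h h' : (forall x, is_derive x (1 : R) h (h' x)) -> continuous h.
Proof. by move=> H x; apply/differentiable_continuous/derivable1_diffP; case: (H x). Qed.

Lemma smooth_le D k k' h : (k' <= k)%N -> smooth_on D k h -> smooth_on D k' h.
Proof.
elim: k k' h => [|k IH] [|k'] h //= le; first by case.
by case=> a [h' d c]; split=> //; exists h' => //; exact: IH c.
Qed.

Lemma smooth_cst D k (c : R) : smooth_on D k (fun=> c).
Proof.
elim: k c => [|k IH] c; split=> //; try by move=> x _; exact: cst_continuous.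
by exists (fun=> 0) => [x _|]; [exact: is_derive_cst|exact: IH].
Qed.

Lemma smooth_id D k : smooth_on D k id.
Proof.
case: k => [|k]; split=> //; try by move=> x _; exact: cvg_id.
by exists (fun=> 1) => [x _|]; [exact: is_derive_id|exact: smooth_cst].
Qed.

Lemma smooth_add D k f g : smooth_on D k f -> smooth_on D k g -> smooth_on D k (f \+ g).
Proof.
elim: k f g => [|k IH] f g [cf df] [cg dg]; split=> //; try by move=> x Dx; apply: continuousD; [exact: cf|exact: cg].
have [f' hf sf] := df; have [g' hg sg] := dg; exists (f' \+ g') => [x Dx|]; last exact: IH.
exact: is_deriveD (hf x Dx) (hg x Dx).
Qed.

Lemma smooth_mul D k f g : smooth_on D k f -> smooth_on D k g -> smooth_on D k (f \* g).
Proof.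
elim: k f g => [|k IH] f g sf sg; have [cf df] := sf; have [cg dg] := sg; split=> //;
 try by move=> x Dx; apply: continuousM; [exact: cf|exact: cg].
have [f' hf sf'] := df; have [g' hg sg'] := dg.
exists ((f \* g') \+ (g \* f')) => [x Dx|]; first exact: (is_deriveM (hf x Dx) (hg x Dx)).
by apply: smooth_add; apply: IH => //; exact: smooth_le (leqnSn k) _.
Qed.

Lemma smooth_inv D k f : (forall x, D x -> 0 < f x) -> smooth_on D k f -> smooth_on D k (fun x => (f x)^-1).
Proof.
move=> f0; elim: k => [|k IH] sf; have [cf df] := sf; split=> //;
 try by move=> x Dx; apply: continuousV; [rewrite gt_eqF ?f0|exact: cf].
have [f' hf sf'] := df; have sV := IH (smooth_le (leqnSn k) sf).
exists ((fun x => (f x)^-1) \* (fun x => (f x)^-1) \* ((fun=> -1) \* f')) => [x Dx|].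
 apply: is_derive_eq; first by apply: (is_deriveV _ (hf x Dx)); rewrite gt_eqF ?f0.
 by rewrite /= /GRing.scale /= -exprVn; ring.
by apply: smooth_mul; [exact: smooth_mul|apply: smooth_mul => //; exact: smooth_cst].
Qed.

Lemma smooth_affine k h (a b : R) : smooth_on setT k h -> smooth_on setT k (fun x => h (a * x + b)).
Proof.
have da x : is_derive x (1 : R) (fun x : R => a * x + b) a.
 apply: (is_derive_eq (is_deriveD (is_deriveZ a (is_derive_id x (1 : R))) (is_derive_cst b x (1 : R)))).
 by rewrite addr0 /GRing.scale /= mulr1.
have ca := is_derive_cont da.
elim: k h => [|k IH] h [ch dh]; split=> //; try by move=> x _; apply: (continuous_comp (ca x)); exact: ch.
have [h' hh sh] := dh; exists ((fun=> a) \* (fun x => h' (a * x + b))) => [x _|].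
 by have := is_derive1_comp (f := h) (g := fun x => a * x + b) (hh _ I) (da x); rewrite mulrC.
by apply: smooth_mul; [exact: smooth_cst|exact: IH].
Qed.

Definition expneg k (x : R) : R := if 0 < x then x^-1 ^+ k * expR (- x^-1) else 0.

Lemma expneg_pos k x : 0 < x -> 0 < expneg k x.
Proof. by move=> x0; rewrite /expneg x0 mulr_gt0 ?expR_gt0 // exprn_gt0 // invr_gt0. Qed.

Lemma expneg0 k x : x <= 0 -> expneg k x = 0.
Proof. by rewrite /expneg ltNge => ->. Qed.

Lemma expneg_ge0 k x : 0 <= expneg k x.
Proof. by have [/(expneg_pos k)/ltW|/(expneg0 k) ->] := ltP 0 x. Qed.

Lemma expneg_quad k x : expneg k x <= (k.+2)%:R ^+ k.+2 * x ^+ 2.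
Proof.
have [x0|/(expneg0 k) ->] := ltP 0 x; last first.
 by apply: mulr_ge0; [exact: exprn_ge0|exact: sqr_ge0].
rewrite /expneg x0; set N := k.+2.
have N0 : (0 : R) < N%:R by [].
have h : (x^-1 / N%:R) ^+ N <= expR x^-1.
 have -> : expR x^-1 = expR (x^-1 / N%:R) ^+ N by rewrite -expRM_natl mulrCA divff ?mulr1 // gt_eqF.
 apply: lerXn2r; rewrite ?nnegrE ?expR_ge0 //.
  by nonneg.
 by apply: le_trans (expR_ge1Dx _); rewrite lerDr.
have xN0 : 0 < (x^-1 / N%:R) ^+ N by rewrite exprn_gt0 // divr_gt0 // invr_gt0.
rewrite expRN; apply: (@le_trans _ _ (x^-1 ^+ k * ((x^-1 / N%:R) ^+ N)^-1)).
 by rewrite ler_wpM2l ?exprn_ge0 ?invr_ge0 ?(ltW x0) // lef_pV2 ?posrE ?expR_gt0.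
rewrite -exprVn invf_div invrK exprMn.
rewrite mulrCA [x ^+ N](_ : _ = x ^+ 2 * x ^+ k); last by rewrite -exprD.
by rewrite [x^-1 ^+ k * _]mulrCA -exprMn mulVf ?gt_eqF // expr1n mulr1.
Qed.

Lemma expneg_derive k x : is_derive x (1 : R) (expneg k) (expneg k.+2 x - k%:R * expneg k.+1 x).
Proof.
have [x0|x0|x0] := ltgtP x 0.
- apply: (@near_eq_is_derive _ _ _ (fun=> 0)); rewrite ?oner_eq0 //.
  by near=> y; rewrite expneg0 // ltW //; near: y; exact: lt_nbhsl.
 rewrite !expneg0 ?ltW // mulr0 subr0; exact: is_derive_cst.
- apply: (@near_eq_is_derive _ _ _ (fun y : R => (y^-1) ^+ k * expR (- y^-1))); rewrite ?oner_eq0 //.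
  by near=> y; rewrite /expneg ifT //; near: y; exact: lt_nbhsr.
 have xn0 : x != 0 by rewrite gt_eqF. have dV : is_derive x (1 : R) (fun y : R => y^-1) (- x ^- 2).
  apply: (is_derive_eq (is_deriveV xn0 (is_derive_id x (1 : R)))). by rewrite /GRing.scale /= mulr1.
 have dE : is_derive x (1 : R) (fun y : R => expR (- y^-1)) (x ^- 2 * expR (- x^-1)).
  have := is_derive1_comp (f := expR) (g := fun y : R => - y^-1) (is_derive_expR _) (is_deriveN dV).
  by rewrite opprK mulrC.
 have dX : is_derive x (1 : R) (fun y : R => (y^-1) ^+ k) (- (k%:R * x^-1 ^+ k.+1)).
  elim: k => [|k IH]; first by rewrite mul0r oppr0; exact: is_derive_cst.
  rewrite (_ : (fun y : R => (y^-1) ^+ k.+1) = (fun y => y^-1) \* (fun y => (y^-1) ^+ k)).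
   apply: (is_derive_eq (is_deriveM dV IH)).
   by rewrite /GRing.scale /= -exprVn !exprS expr0 mulr1 -natr1; ring.
  by apply/funext => y; rewrite exprS.
 apply: (is_derive_eq (is_deriveM dX dE)). rewrite /GRing.scale /= /expneg x0 -exprVn !exprS; ring.
rewrite x0 !(expneg0 _ (lexx 0)) mulr0 subr0.
have lim0 : (fun h : R => h^-1 *: ((expneg k \o shift 0) (h *: 1) - expneg k 0)) @ 0^' --> (0 : R).
 apply/cvgrPdist_le => eps eps0. have c0 : 0 < (k.+2)%:R ^+ k.+2 :> R by [].
 near=> h; rewrite sub0r normrN (expneg0 k (lexx 0)) subr0 /= addr0 /GRing.scale /= mulr1.
 have h0 : h != 0 by near: h; exact: nbhs_dnbhs_neq. rewrite normrM normfV ler_pdivrMl ?normr_gt0 //.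
 rewrite ger0_norm ?expneg_ge0 //; apply: le_trans (expneg_quad _ _) _.
 rewrite -(real_normK (num_real h)) expr2 mulrCA; apply: ler_wpM2l => //. rewrite mulrC -ler_pdivlMr //.
 near: h; apply: dnbhs0_le; exact: divr_gt0.
have D : derivable (expneg k) 0 1 by apply/cvg_ex; exists 0.
by apply: DeriveDef => //; apply: cvg_lim lim0.
Unshelve. all: by end_near. Qed.

Lemma smooth_expneg m k : smooth_on setT m (expneg k).
Proof.
have c k' : continuous (expneg k') by exact: is_derive_cont (expneg_derive k').
elim: m k => [|m IH] k; split=> //; try by move=> x _; exact: c.
exists (fun x => expneg k.+2 x - k%:R * expneg k.+1 x); first by move=> x _; exact: expneg_derive.
apply: smooth_add => //; have := smooth_mul (smooth_cst _ m (- k%:R)) (IH k.+1).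
by congr (smooth_on _ _ _); apply/funext => x /=; rewrite mulNr.
Qed.

Definition sstep (x : R) : R := expneg 0 (x - 4^-1) / (expneg 0 (x - 4^-1) + expneg 0 (3 / 4 - x)).

Lemma sstep_smooth k : smooth_on setT k sstep.
Proof.
have d0 x : 0 < expneg 0 (x - 4^-1) + expneg 0 (3 / 4 - x).
 have [h|h] := ltP (4^-1) x.
  by rewrite ltr_pwDl ?expneg_ge0 // expneg_pos // subr_gt0.
 rewrite ltr_wpDl ?expneg_ge0 // expneg_pos //; lra.
have s1 : smooth_on setT k (fun x => expneg 0 (x - 4^-1)).
 have := smooth_affine 1 (- 4^-1) (smooth_expneg k 0).
 by congr (smooth_on _ _ _); apply/funext => x; rewrite mul1r.
have s2 : smooth_on setT k (fun x => expneg 0 (3 / 4 - x)).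
 have := smooth_affine (-1) (3 / 4) (smooth_expneg k 0).
 by congr (smooth_on _ _ _); apply/funext => x; rewrite mulN1r addrC.
by apply: smooth_mul => //; apply: smooth_inv => //; exact: smooth_add.
Qed.

Lemma sstep0 x : x <= 4^-1 -> sstep x = 0.
Proof. by move=> h; rewrite /sstep expneg0 ?mul0r // subr_le0. Qed.

Lemma sstep1 x : 3 / 4 <= x -> sstep x = 1.
Proof.
move=> h; rewrite /sstep [expneg 0 (3 / 4 - x)]expneg0 ?addr0 ?subr_le0 // divff //.
by rewrite gt_eqF // expneg_pos //; lra.
Qed.

Definition bump1 (x : R) : R := sstep (x + 1) - sstep x.

Lemma bump1_smooth k : smooth_on setT k bump1.
Proof.
apply: smooth_add.
 have := smooth_affine 1 1 (sstep_smooth k).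
 by congr (smooth_on _ _ _); apply/funext => x; rewrite mul1r.
have := smooth_mul (smooth_cst _ k (-1)) (sstep_smooth k).
by congr (smooth_on _ _ _); apply/funext => x /=; rewrite mulN1r.
Qed.

Lemma bump1_supp x : 3 / 4 <= `|x| -> bump1 x = 0.
Proof.
rewrite /bump1; have [x0|x0] := leP 0 x; [rewrite ger0_norm // => h|rewrite ltr0_norm // => h].
 by rewrite !sstep1 ?subrr //; lra.
by rewrite !sstep0 ?subrr //; lra.
Qed.

Lemma bump1_sum (N : nat) (y : R) : `|y| <= N%:R -> \sum_(k < N.*2.+1) bump1 (y - (k%:R - N%:R)) = 1.
Proof.
rewrite ler_norml => /andP[a b].
have -> : \sum_(k < N.*2.+1) bump1 (y - (k%:R - N%:R)) = sstep (y + N%:R + 1) - sstep (y - N%:R).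
 have tel m : \sum_(k < m) bump1 (y - (k%:R - N%:R)) = sstep (y + N%:R + 1) - sstep (y + N%:R + 1 - m%:R).
  elim: m => [|m IH]; first by rewrite big_ord0 subr0 subrr. rewrite big_ord_recr /= IH /bump1 -natr1.
  rewrite (_ : y - (m%:R - N%:R) + 1 = y + N%:R + 1 - m%:R); last by ring.
  rewrite (_ : y + N%:R + 1 - (m%:R + 1) = y - (m%:R - N%:R)); last by ring. by rewrite addrA subrK.
 rewrite tel -natr1 -muln2 natrM; congr (_ - sstep _); ring.
by rewrite sstep1 ?sstep0 ?subr0 //; lra.
Qed.

Lemma bump1_sum2 (N : nat) (y : R) : (1 < N)%N -> `|y| <= 1 -> \sum_(k < N.*2.+1) bump1 ((y + (k%:R - N%:R)) / 2) = 2.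
Proof.
move=> N0; rewrite ler_norml => /andP[a b]; have N1 : 2 <= N%:R :> R by rewrite (ler_nat _ 2).
have tel m : \sum_(k < m) bump1 ((y + (k%:R - N%:R)) / 2) = sstep ((y - N%:R + m%:R) / 2) + sstep ((y - N%:R + m%:R + 1) / 2)
  - sstep ((y - N%:R) / 2) - sstep ((y - N%:R + 1) / 2).
 elim: m => [|m IH]; first by rewrite big_ord0 addr0; ring.
 rewrite big_ord_recr /= IH /bump1 -[m.+1%:R]natr1.
 rewrite (_ : (y + (m%:R - N%:R)) / 2 + 1 = (y - N%:R + (m%:R + 1) + 1) / 2); last by field.
 rewrite (_ : (y + (m%:R - N%:R)) / 2 = (y - N%:R + m%:R) / 2); last by field.
 rewrite (_ : (y - N%:R + (m%:R + 1)) / 2 = (y - N%:R + m%:R + 1) / 2); last by field. ring.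
rewrite tel -natr1 -muln2 natrM.
rewrite (sstep0 (x := (y - N%:R) / 2)); last by lra.
rewrite (sstep0 (x := (y - N%:R + 1) / 2)); last by lra.
rewrite !sstep1; last 2 first.
- by lra.
- by lra.
by rewrite !subr0.
Qed.

End smooth_functions.

Section smooth_fields.
Context {R : realType} {n : nat}.
Local Notation V := 'rV[R]_n.
Local Notation e := (@basis_vec R n).

Lemma Ckp_fun (A D : set R) k (F : R -> V -> R) (h : R -> R) : (forall t x, A t -> D (F t x)) ->
 Ckp A k F -> smooth_on D k h -> Ckp A k (fun t x => h (F t x)).
Proof.
have jc F' h' : (forall t x, A t -> D (F' t x)) -> jcont A F' ->
  (forall y : R, D y -> {for y, continuous h'}) -> jcont A (fun t x => h' (F' t x)).
 move=> FD jf ch t x eps At e0. have /cvgrPdist_le/(_ _ e0)/nbhs_ballP[d /= d0 Hd] := ch _ (FD t x At).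
 have d2 : 0 < d / 2 by nonneg. have [d' d'0 Hd'] := jf t x _ At d2; exists d' => // s y As ts xy.
 by apply: Hd; apply: le_lt_trans (Hd' s y As ts xy) _; lra.
move=> FD; elim: k F h FD => [|k IH] F h FD CF sh.
 by split=> //; apply: jc => //; [exact: Ckp_cont CF|case: sh].
have [jf [c d]] := CF; have [ch [h' hh sh']] := sh; split; first exact: jc.
have dh (y : R) : D y -> differentiable h y by move=> Dy; apply/derivable1_diffP; case: (hh y Dy).
split=> [t x At|i].
 by apply: (@differentiable_comp _ _ _ _ (F t) h); [exact: c|apply: dh; exact: FD].
have CF' := Ckp_le (leqnSn k) CF.
apply: Ckp_ext (Ckp_mul (IH _ _ FD CF' sh') (d i)) => t At; apply/funext => x /=.
have Dx := FD t x At.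
rewrite [RHS]deriveE; last by apply: (@differentiable_comp _ _ _ _ (F t) h); [exact: c|exact: dh].
rewrite (@diff_comp _ _ _ _ (F t) h) //; [|exact: c|exact: dh].
rewrite /= deriv1E; last by case: (hh (F t x) Dx).
rewrite /GRing.scale /= -deriveE; last exact: c.
by rewrite derive1E; have [_ ->] := hh (F t x) Dx; rewrite mulrC.
Qed.

Lemma Ckp_prod A k (I : Type) (s : seq I) (F : I -> R -> V -> R) :
 (forall i, Ckp A k (F i)) -> Ckp A k (fun t x => \prod_(i <- s) F i t x).
Proof.
move=> H; elim: s => [|i s IH].
 apply: (Ckp_ext _ (Ckp_cst A k 1)) => t _. by apply/funext => x; rewrite big_nil.
apply: (Ckp_ext _ (Ckp_mul (H i) IH)) => t _.
by apply/funext => x; rewrite big_cons.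
Qed.

Definition smoothV (g : V -> R) := forall k, Ckp [set (0 : R)] k (fun=> g).

Lemma smoothV_pderiv g s : smoothV g -> smoothV (pderiv s g).
Proof.
by move=> sg k; apply: (@Ckp_iter _ _ [set 0] k (map e s) (fun=> g)); exact: sg.
Qed.

Lemma smoothV_cont g : smoothV g -> continuous g.
Proof. by move=> sg; apply/jcont_continuous; exact: Ckp_cont (sg 0%N). Qed.

Lemma smoothV_diff g x : smoothV g -> differentiable g x.
Proof. by move=> sg; have [_ [+ _]] := sg 1%N; move/(_ 0 x erefl). Qed.

Lemma smoothV_mul f g : smoothV f -> smoothV g -> smoothV (fun x => f x * g x).
Proof. by move=> sf sg k; exact: (Ckp_mul (sf k) (sg k)). Qed.

Lemma smoothV_affine f (a : R) (b : V) : smoothV f -> smoothV (fun x => f (a *: x + b)).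
Proof.
move=> sf k; apply: (Ckp_comp (G := fun _ x => a *: x + b) (sf k)) => l.
apply: (Ckp_ext _ (Ckp_add (Ckp_scale a (Ckp_coord _ _ l)) (Ckp_cst _ k (b 0 l)))).
by move=> t _; apply/funext => x; rewrite /= !mxE.
Qed.

Lemma bump_exists (J : finType) (gs : J -> V -> R) (M rho : R) (r0 : nat) : 0 < rho ->
 (forall i, smoothV (gs i) /\ forall x, M < `|x| -> gs i x = 0) ->
 exists ell : nat -> R, forall L C i, bump r0 L C ell rho (gs i).
Proof.
move=> rho0 Hg.
have /choice[b hb] : forall p : J * seq 'I_n, exists b, 0 <= b /\ forall x, `|pderiv p.2 (gs p.1) x| <= b.
 move=> [i s] /=; have [sg sup] := Hg i.
 have [[b b0 hb] _] := csupp_uniform (smoothV_cont (smoothV_pderiv s sg)) (iter_derive_out (map e s) sup).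
 by exists b.
pose bb (m : nat) : R := \sum_(i : J) \sum_(m' < m.+1) \sum_(t : m'.-tuple 'I_n) b (i, val t).
have b0 p : 0 <= b p by case: (hb p).
have bb_ge i s m : (size s <= m)%N -> b (i, s) <= bb m.
 move=> sm; rewrite /bb (bigD1 i) //=; apply: ler_wpDr.
  by apply: sumr_ge0 => i' _; apply: sumr_ge0 => m' _; exact: sumr_ge0.
 rewrite (bigD1 (Ordinal (sm : (size s < m.+1)%N))) //=; apply: ler_wpDr.
  by apply: sumr_ge0 => m' _; exact: sumr_ge0.
 by rewrite (bigD1 (in_tuple s)) //=; apply: ler_wpDr => //; exact: sumr_ge0.
have bb0 m : 0 <= bb m by apply: sumr_ge0 => i' _; apply: sumr_ge0 => m' _; exact: sumr_ge0.
pose ell j := (2 + n%:R) * bb (j + 3)%N / rho ^+ j.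
have rj j : 0 < rho ^+ j by nonneg.
have ell0 j : 0 <= ell j by nonneg.
exists ell => L C i; exists (1 + \sum_(j < r0.+1) ell j).
 by rewrite addr_ge0 // sumr_ge0.
move=> s s2 om B [cal B1 Bell] k; have [sg sup] := Hg i.
have catE t : pderiv t (pderiv s (gs i)) = pderiv (t ++ s) (gs i).
 by rewrite /pderiv map_cat /iter_derive foldr_cat.
have bnd t x : `|pderiv t (pderiv s (gs i)) x| <= bb (size t + 2)%N.
 rewrite catE; apply: le_trans ((hb (i, t ++ s)).2 x) _; apply: bb_ge. by rewrite size_cat leq_add2l.
have N1 : Nb setT (fun=> 2) k.+1 (fun j => bb (j + 2)%N) (pderiv s (gs i)).
 apply: Nb_of_pderiv => [t x _|t x y _|t x _]; first exact: bnd.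
  by apply: le_trans (ler_normB _ _) _; rewrite mulr_natr mulr2n lerD.
 by apply: smoothV_diff; do 2 apply: smoothV_pderiv.
have := Nb_upgrade openT (fun _ _ _ _ _ _ => I) (modulus_min (calc_mod cal)) N1.
apply: Nb_mono; first exact: modulus_ge0 (calc_mod cal).
move=> j _; apply: (@le_trans _ _ (ell j * rho ^+ j)).
 rewrite /ell divfK; last by rewrite gt_eqF.
 rewrite [leRHS]mulrDl addSn -addnS; apply: lerD => //; apply: ler_wpM2l => //.
 rewrite (addnS j 2) /bb; apply: ler_sum => l _. by rewrite [leRHS]big_ord_recr /= ler_wpDr // sumr_ge0.
apply: ler_wpM2r; first exact: ltW.
have S0 : 0 <= \sum_(j < r0.+1) ell j by rewrite sumr_ge0.
have [jr|jr] := leqP j r0.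
 rewrite B1 // mulr1 (bigD1 (Ordinal (jr : (j < r0.+1)%N))) //= addrCA lerDl addr_ge0 //.
 by rewrite sumr_ge0.
apply: le_trans (Bell _ jr) _; rewrite ler_peMl; [by []|exact: le_trans (Bell _ jr)|by rewrite lerDl].
Qed.

Definition beta (x : V) : R := \prod_i bump1 (x 0 i).

Lemma beta_smooth : smoothV beta.
Proof.
move=> k; apply: (@Ckp_prod _ _ _ (index_enum 'I_n) (fun i _ x => bump1 (x 0 i))) => i.
by apply: (Ckp_fun (D := setT) _ (Ckp_coord _ _ i)) => //; exact: bump1_smooth.
Qed.

Lemma beta_supp x : 3 / 4 < `|x| -> beta x = 0.
Proof.
move=> xs; have [i xi] : exists i, 3 / 4 < `|x 0 i|.
 apply: contrapT => h; move: xs; rewrite ltNge; apply/negP/negPn.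
 apply: le_coord => // i; rewrite leNgt; apply/negP => xi; apply: h; by exists i.
by rewrite /beta (bigD1 i) //= bump1_supp ?mul0r // ltW.
Qed.

Definition latpt N (k : {ffun 'I_n -> 'I_N.*2.+1}) : V := \row_i ((k i : nat)%:R - N%:R).
Definition lattice N : seq V := [seq latpt k | k <- index_enum {ffun 'I_n -> 'I_N.*2.+1}].

Lemma lattice_uniq N : uniq (lattice N).
Proof.
rewrite map_inj_uniq ?index_enum_uniq // => k k' /rowP E; apply/ffunP => i.
have := E i; rewrite !mxE => /addIr/eqP; rewrite eqr_nat => /eqP; exact: val_inj.
Qed.

Lemma lattice_partition N x : `|x| <= N%:R -> \sum_(c <- lattice N) beta (x - c) = 1.
Proof.
move=> xN; rewrite big_map.
have -> : \sum_(k <- index_enum {ffun 'I_n -> 'I_N.*2.+1}) beta (x - latpt k) =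
  \sum_(k : {ffun 'I_n -> 'I_N.*2.+1}) \prod_i bump1 (x 0 i - ((k i : nat)%:R - N%:R)).
 by apply: eq_bigr => k _; apply: eq_bigr => i _; rewrite !mxE.
rewrite -(bigA_distr_bigA (fun i (j : 'I_N.*2.+1) => bump1 (x 0 i - ((j : nat)%:R - N%:R)))) /=.
by rewrite big1 // => i _; apply: bump1_sum; apply: le_trans xN; exact: coord_le.
Qed.

Lemma lattice_half N x : (1 < N)%N -> `|x| <= 1 -> \sum_(c <- lattice N) beta (2^-1 *: (x + c)) = 2 ^+ n.
Proof.
move=> N1 x1; rewrite big_map.
have -> : \sum_(k <- index_enum {ffun 'I_n -> 'I_N.*2.+1}) beta (2^-1 *: (x + latpt k)) =
  \sum_(k : {ffun 'I_n -> 'I_N.*2.+1}) \prod_i bump1 ((x 0 i + ((k i : nat)%:R - N%:R)) / 2).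
 by apply: eq_bigr => k _; apply: eq_bigr => i _; rewrite !mxE mulrC.
rewrite -(bigA_distr_bigA (fun i (j : 'I_N.*2.+1) => bump1 ((x 0 i + ((j : nat)%:R - N%:R)) / 2))) /=.
rewrite (eq_bigr (fun=> 2)) ?prodr_const ?card_ord // => i _; apply: bump1_sum2 => //.
by apply: le_trans x1; exact: coord_le.
Qed.

Lemma lattice_periodic N (f : V -> R) (M : R) x i : (forall y, M < `|y| -> f y = 0) -> M + `|x| < N%:R ->
 \sum_(c <- lattice N) f (x + e i + c) = \sum_(c <- lattice N) f (x + c).
Proof.
move=> f0 xN; rewrite !big_map.
pose h (k : {ffun 'I_n -> 'I_N.*2.+1}) : {ffun 'I_n -> 'I_N.*2.+1} := [ffun j => if j == i then ordS (k j) else k j].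
have hinj : injective h.
 move=> k k' /ffunP E; apply/ffunP => j; have := E j; rewrite !ffunE.
 by case: ifP => // _; apply: (can_inj (@ordSK _)).
rewrite [RHS](reindex_inj hinj) /=; apply: eq_bigr => k _.
have far y : N%:R <= `|x 0 i + y| + `|x 0 i| -> M < `|x 0 i + y|.
 move=> hy; have := coord_le x i; lra.
have [ki|ki] := eqVneq (k i : nat) N.*2; last first.
 congr f; apply/rowP => j; rewrite !mxE ffunE. have [->|ji] := eqVneq j i; last first.
  by rewrite eqxx /= addr0.
 rewrite /= modn_small; last by rewrite ltnS ltn_neqAle ki /= -ltnS ltn_ord. by rewrite -natr1; ring.
rewrite !f0 //.
 apply: lt_le_trans (coord_le _ i); rewrite !mxE ffunE eqxx /= ki modnn.
 apply: far; rewrite sub0r; have := ler_normD (x 0 i - N%:R) (- x 0 i).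
 by rewrite addrAC subrr add0r !normrN (ger0_norm (ler0n _ N)).
apply: lt_le_trans (coord_le _ i); rewrite !mxE ki !eqxx /= -muln2 natrM.
have -> : x 0 i + true%:R + (N%:R * 2 - N%:R) = x 0 i + (N%:R + 1) by rewrite /=; ring.
apply: far; have := ler_normD (x 0 i + (N%:R + 1)) (- x 0 i).
rewrite addrAC subrr add0r !normrN (ger0_norm (addr_ge0 (ler0n _ N) ler01)); lra.
Qed.

End smooth_fields.

Section cutoff_elements.
Context {R : realType} {n : nat}.
Local Notation V := 'rV[R]_n.
Local Notation e := (@basis_vec R n).
Local Notation G r := (@Diffc0 R n r).

Definition cutoff (M : R) (x : V) : R := \prod_i (sstep (M + 1 + x 0 i) * sstep (M + 1 - x 0 i)).

Lemma cutoff_smooth M : smoothV (cutoff M).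
Proof.
move=> k; apply: (@Ckp_prod _ _ _ _ _ (index_enum 'I_n) (fun i _ x => sstep (M + 1 + x 0 i) * sstep (M + 1 - x 0 i))) => i.
apply: (Ckp_fun (D := setT) (h := fun t => sstep (M + 1 + t) * sstep (M + 1 - t)) _ (Ckp_coord _ _ i)) => //.
apply: smooth_mul.
 have := smooth_affine 1 (M + 1) (@sstep_smooth R k).
 by congr (smooth_on _ _ _); apply/funext => x; rewrite mul1r addrC.
have := smooth_affine (-1) (M + 1) (@sstep_smooth R k).
by congr (smooth_on _ _ _); apply/funext => x; rewrite mulN1r addrC.
Qed.

Lemma cutoff1 M x : `|x| <= M -> cutoff M x = 1.
Proof.
move=> xM; rewrite /cutoff big1 // => i _.
have := le_trans (coord_le x i) xM; rewrite ler_norml => /andP[a b].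
by rewrite !sstep1 ?mulr1 //; lra.
Qed.

Lemma cutoff0 M x : M + 1 < `|x| -> 0 <= M -> cutoff M x = 0.
Proof.
move=> xs M0; have [i xi] : exists i, M + 1 < `|x 0 i|.
 apply: contrapT => h; move: xs; rewrite ltNge; apply/negP/negPn.
 apply: le_coord => [|i]; first by nonneg.
 by rewrite leNgt; apply/negP => xi; apply: h; exists i.
rewrite /cutoff (bigD1 i) //=; move: xi; have [h|h] := leP 0 (x 0 i).
 by rewrite ger0_norm // => xi; rewrite (sstep0 (x := M + 1 - _)) ?mulr0 ?mul0r //; lra.
by rewrite ltr0_norm // => xi; rewrite (sstep0 (x := M + 1 + _)) ?mul0r //; lra.
Qed.

Lemma small_Dc r (eta : V -> V) (M : R) : (forall l, smoothV (fun x => eta x 0 l)) -> (forall x, M < `|x| -> eta x = 0) ->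
 exists2 d0 : R, 0 < d0 & forall d, `|d| <= d0 -> G r (fun x => x + d *: eta x).
Proof.
move=> se sup.
have supl l x : M < `|x| -> eta x 0 l = 0 by move=> /sup ->; rewrite mxE.
have /choice[b hb] : forall p : 'I_n * option 'I_n, exists b : R, 0 <= b /\
  forall x, `|pderiv (if p.2 is Some i then [:: i] else [::]) (fun x => eta x 0 p.1) x| <= b.
 move=> [l s] /=; set s' := (if _ is Some _ then _ else _).
 have [[b b0 hb] _] := csupp_uniform (smoothV_cont (smoothV_pderiv s' (se l))) (iter_derive_out (map e s') (supl l)).
 by exists b.
pose bb : R := \sum_p b p; have bb_ge p : b p <= bb.
 by rewrite /bb (bigD1 p) //= lerDl sumr_ge0 // => q _; case: (hb q).
have bb0 : 0 <= bb by apply: sumr_ge0 => q _; case: (hb q).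
pose C : R := leib_const 1.
have C0 : 0 <= C by nonneg.
pose eps : R := (4 * (n%:R * C * 2 + n%:R * 2 + 1))^-1.
have D0 : 0 < 4 * (n%:R * C * 2 + n%:R * 2 + 1).
 have := mulr_ge0 (ler0n R n) C0; have := ler0n R n; lra.
have eps0 : 0 < eps by nonneg.
exists (eps / (bb + 1)) => [|d dd]; first by rewrite divr_gt0 // ltr_wpDl.
have dbb : `|d| * (bb + 1) <= eps by rewrite -ler_pdivlMr // ltr_wpDl.
have CF : Crv None (fun x => d *: eta x).
 move=> k _ l; apply: (Ckp_ext _ (Ckp_scale d (se l k))) => t _. by apply/funext => x; rewrite mxE.
have sup' x : M < `|x| -> d *: eta x = 0 by move=> /sup ->; rewrite scaler0.
have [s l x s1|om [B [cal B1 _ dis]]] := @class_exists R n None 1 2 eps M (fun=> 0)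
  (fun x => d *: eta x) isT isT (lexx _) eps0 CF sup'.
- have -> : (fun y => (d *: eta y) 0 l) = (fun y => d * eta y 0 l) by apply/funext => y; rewrite mxE.
 have bs : `|pderiv s (fun y => eta y 0 l) x| <= bb.
  apply: le_trans (bb_ge (l, if s is i :: _ then Some i else None)).
  by case: s s1 => [|i [|//]] _; [exact: (hb (l, None)).2|exact: (hb (l, Some i)).2].
 have -> : pderiv s (fun y => d * eta y 0 l) x = d * pderiv s (fun y => eta y 0 l) x.
  case: s s1 {bs} => [//|i [|//]] _; rewrite /pderiv /=.
  by rewrite (@deriveZ _ _ _ (fun y => eta y 0 l) d) //; apply/diff_derivable/smoothV_diff/se.
 rewrite normrM; apply: le_trans dbb; rewrite ler_wpM2l //. by lra.
apply: (@Dc_le _ _ None) => [k _ //|].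
apply: (@Dc_near_id _ _ None 2 C om B _ M eps 1) => //; first exact: ltW.
- rewrite mulr1; have -> : 4 * (n%:R * C * (2 * eps)) = (4 * (n%:R * C * 2)) * eps by ring.
 rewrite /eps ler_pdivrMr // mul1r; have := ler0n R n; lra.
- rewrite mulr1; have -> : 4 * (n%:R * (2 * eps)) = (4 * (n%:R * 2)) * eps by ring.
 by rewrite /eps ler_pdivrMr // mul1r; have := mulr_ge0 (ler0n R n) C0; lra.
Qed.

Lemma Dc_iter r f k : G r f -> G r (iter k f).
Proof.
by move=> Gf; elim: k => [|k IH]; [exact: Dc_id|exact: (@Dc_comp _ _ r f (iter k f))].
Qed.

Lemma transl_Dc r (c : V) (M : R) : exists2 g, G r g & forall x, `|x| <= M -> g x = x + c.
Proof.
have [M0|M0] := ltP M 0.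
 by exists id; [exact: Dc_id|move=> x xM; have := le_lt_trans xM M0; rewrite normr_lt0].
pose M' := M + `|c|; have M'0 : 0 <= M' by nonneg.
have [||d0 d00 Hd] := @small_Dc r (fun x => cutoff M' x *: c) (M' + 1).
- move=> l k; apply: (Ckp_ext _ (Ckp_scale (c 0 l) (cutoff_smooth M' k))) => t _.
 by apply/funext => x; rewrite mxE mulrC.
- by move=> x xM; rewrite cutoff0 // scale0r.
have [N N0 Nd] : exists2 N : nat, (0 < N)%N & (N%:R^-1 : R) <= d0.
 exists (Num.truncn d0^-1).+1 => //; rewrite invf_ple ?posrE ?ltr0n //.
 by have := truncn_itv (ltW (_ : 0 < d0^-1)); rewrite invr_gt0 => /(_ d00)/andP[_ /ltW].
exists (iter N (fun x => x + N%:R^-1 *: (cutoff M' x *: c))).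
 by apply/Dc_iter/Hd; rewrite ger0_norm // invr_ge0.
move=> x xM; have key k : (k <= N)%N -> iter k (fun x => x + N%:R^-1 *: (cutoff M' x *: c)) x = x + (k%:R / N%:R) *: c.
 elim: k => [|k IH] kN; first by rewrite mul0r scale0r addr0.
 rewrite iterS IH ?(ltnW kN) // cutoff1 ?scale1r.
  by rewrite -addrA -scalerDl -natr1 mulrDl mul1r.
 apply: le_trans (ler_normD _ _) _; rewrite lerD // normrZ.
 rewrite ger0_norm ?divr_ge0 // ler_piMl // ler_pdivrMr ?ltr0n // mul1r ler_nat. by lia.
by rewrite key // divff ?scale1r // pnatr_eq0 -lt0n.
Qed.

Lemma dilation_Dc r (a M : R) : 1 <= a -> exists2 g, G r g & forall x, `|x| <= M -> g x = a *: x.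
Proof.
move=> a1; have a0 : 0 < a by lra.
have [M0|M0] := ltP M 0.
 by exists id; [exact: Dc_id|move=> x xM; have := le_lt_trans xM M0; rewrite normr_lt0].
pose M' := a * M; have M'0 : 0 <= M' by nonneg.
have [||d0 d00 Hd] := @small_Dc r (fun x => cutoff M' x *: x) (M' + 1).
- move=> l k; apply: (Ckp_ext _ (Ckp_mul (cutoff_smooth M' k) (Ckp_coord _ _ l))) => t _.
 by apply/funext => x; rewrite mxE.
- by move=> x xM; rewrite cutoff0 // scale0r.
pose N := (Num.truncn (a / d0)).+1; pose q := a `^ (N%:R^-1).
have qN : q ^+ N = a.
 rewrite -powR_mulrn ?powR_ge0 // -powRrM mulVf ?pnatr_eq0 // powRr1 //; exact: ltW.
have q1 : 1 <= q by rewrite -(powRr0 a) /q; apply: ler_powR => //; rewrite invr_ge0.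
have qd : `|q - 1| <= d0.
 rewrite ger0_norm ?subr_ge0 // lerBlDl leNgt; apply/negP => h. have : a < q ^+ N.
  apply: (@lt_le_trans _ _ ((1 + d0) ^+ N)); last first.
   apply: lerXn2r; rewrite ?nnegrE; [by nonneg|exact: le_trans q1|exact: ltW].
  apply: (@lt_le_trans _ _ (1 + N%:R * d0)).
   have /andP[_] := truncn_itv (divr_ge0 (ltW a0) (ltW d00)).
   by rewrite -/N ltr_pdivrMr // => /lt_trans; apply; rewrite ltrDr.
  have H0 : 0 <= d0 := ltW d00; elim: (N) => [|m IH]; first by lra.
  rewrite exprS; apply: le_trans (ler_wpM2l _ IH); last by nonneg.
  rewrite -natr1; have := mulr_ge0 (mulr_ge0 (ler0n R m) H0) H0; lra.
 by rewrite qN ltxx.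
exists (iter N (fun x => x + (q - 1) *: (cutoff M' x *: x))); first exact/Dc_iter/Hd.
move=> x xM; have key k : (k <= N)%N -> iter k (fun x => x + (q - 1) *: (cutoff M' x *: x)) x = q ^+ k *: x.
 elim: k => [|k IH] kN; first by rewrite scale1r. rewrite iterS IH ?(ltnW kN) // cutoff1 ?scale1r.
  by rewrite -{1}[q ^+ k *: x]scale1r -scalerDl scalerA addrC subrK exprS.
 have q0 : 0 <= q by lra. rewrite normrZ ger0_norm ?exprn_ge0 // /M' -qN ler_pM ?exprn_ge0 //.
 by apply: ler_weXn2l => //; exact: ltnW.
by rewrite key // qN.
Qed.

End cutoff_elements.

Section gather.
Context {R : realType} {n : nat}.
Local Notation V := 'rV[R]_n.
Local Notation G r := (@Diffc0 R n r).

(* Fragments of id + psi, cut out by the functions lamf c, are conjugated by the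
  translations by - c and composed with id + w. *)
Fixpoint gat (psi : V -> V) (lamf : V -> V -> R) (cs : seq V) (lam : V -> R) (w : V -> V) {struct cs} : V -> V :=
 if cs is c :: cs' then let P x := w x + inv_disp (fun y => lam y *: psi y) (x + w x + c) in
  gat psi lamf cs' (fun y => lam y + lamf c y) (fun x => w x + lamf c (x + c + P x) *: psi (x + c + P x)) else w.

Context (r : regularity) (r0 : nat) (L C : R) (ell : nat -> R).
Hypotheses (r1 : le_reg 1 r) (C0 : 0 <= C).
Local Notation tame := (@tame R n r r0 L C ell).
Local Notation tamev := (@tamev R n r r0 L C ell).
Local Notation ev := (@ev R n r r0 L C ell).

Definition csupp (H : (V -> V) -> V -> V) := exists M : R, ev (fun _ _ _ phi => forall x, M < `|x| -> H phi x = 0).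

Lemma tame_small p rho H (c : R) : (0 < p)%N -> 0 <= rho -> 0 < c -> tamev p rho H ->
 ev (fun _ _ _ phi => forall x, `|H phi x| <= c).
Proof.
move=> p0 rho0 c0 tH; have [|K K0 h] := tamevP tH (rho' := rho + 1) _ rho0.
 by lra.
apply: ev_imp (ev_and h (ev_and (ev_small _ _ _ _ _ ltr01) (ev_scale _ _ _ _ _ K0 c0))).
move=> om B eps phi [cal _ _] eps0 _ [{}h [e1 Kc]] x.
apply: le_trans (disp_norm cal x _ h) _; first by nonneg.
apply: le_trans Kc; rewrite ler_wpM2l // -[leRHS]expr1; exact: ler_wiXn2l.
Qed.

Lemma tame_Dc rho H : 0 <= rho -> tamev 1 rho H -> csupp H -> ev (fun _ _ _ phi => G r (fun x => x + H phi x)).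
Proof.
move=> rho0 tH [M sH]; have [|K K0 h] := tamevP tH (rho' := rho + 1) _ rho0.
 by lra.
have rho10 : 0 < rho + 1 by lra.
have s1 := @ev_scale R n r r0 L C ell (4 * (n%:R * C * 2 * (rho + 1)) * K) 1.
have s2 := @ev_scale R n r r0 L C ell (4 * (n%:R * 2 * (rho + 1)) * K) 1.
apply: ev_imp (ev_and (ev_and h sH) (ev_and (s1 _ ltr01) (s2 _ ltr01))).
- move=> om B eps phi [cal _ _] eps0 _ [[{}h {}sH] [e1 e2]]. rewrite expr1 in h.
 apply: (@Dc_near_id _ _ r L C om B _ M (K * eps) (rho + 1)) => //.
 + by nonneg.
 + by lra.
 + by lra.
- by nonneg.
- by nonneg.
Qed.

Lemma tame_translate p rho f (c : V) : 0 <= rho -> tame p rho f -> tame p rho (fun phi x => f phi (x + c)).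
Proof.
move=> rho0 tf; have := @tame_dilate R n r r0 L C ell p rho f 1 c; rewrite ltr01 lexx mul1r.
move=> /(_ isT rho0 tf); apply: tame_ext => phi x.
by rewrite scale1r.
Qed.

Lemma tamev_add p rho H H' : 0 <= rho -> tamev p rho H -> tamev p rho H' -> tamev p rho (fun phi x => H phi x + H' phi x).
Proof.
move=> rho0 tH tH' l; have := tame_add rho0 (tH l) (tH' l).
by apply: tame_ext => phi x; rewrite mxE.
Qed.

Lemma tamev_smul p p' rho f H : 0 <= rho -> tame p rho f -> tamev p' rho H ->
 tamev (p + p') rho (fun phi x => f phi x *: H phi x).
Proof.
move=> rho0 tf tH l; have := tame_mul C0 rho0 tf (tH l).
by apply: tame_ext => phi x; rewrite mxE.
Qed.

Lemma tamev_comp p rho H tau : 0 <= rho -> tamev p rho H -> tamev 1 rho tau -> tamev p rho (fun phi x => H phi (x + tau phi x)).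
Proof. by move=> rho0 tH tt l; exact: (tame_comp r1 C0 rho0 (tH l) tt). Qed.

Context (rho : R) (Psi : (V -> V) -> V -> V) (lamf : V -> V -> R).
Hypotheses (rho0 : 0 <= rho) (tPsi : tamev 1 rho Psi) (tlamf : forall c, tame 0 rho (fun _ => lamf c)).

Let step (lam : V -> R) (W : (V -> V) -> V -> V) c phi x := W phi x + inv_disp (fun y => lam y *: Psi phi y) (x + W phi x + c).

Let tstep lam W c : tame 0 rho (fun _ => lam) -> tamev 1 rho W -> tamev 1 rho (step lam W c).
Proof.
move=> tl tW; apply: tamev_add => //.
have [ti _] := tame_inv r1 C0 rho0 (tamev_smul rho0 tl tPsi).
have ti' : tamev 1 rho (fun phi x => inv_disp (fun y => lam y *: Psi phi y) (x + c)).
 by move=> l; exact: (tame_translate c rho0 (ti l)).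
move=> l; have := tamev_comp rho0 ti' tW l.
by apply: tame_ext => phi x.
Qed.

Let term c (T : (V -> V) -> V -> V) phi x := lamf c (x + c + T phi x) *: Psi phi (x + c + T phi x).

Let tterm c T : tamev 1 rho T -> tamev 1 rho (term c T).
Proof.
move=> tT; have t0 : tamev 1 rho (fun phi x => lamf c x *: Psi phi x).
 exact: (tamev_smul rho0 (tlamf c) tPsi).
have t1 : tamev 1 rho (fun phi x => lamf c (x + c) *: Psi phi (x + c)).
 by move=> l; exact: (tame_translate c rho0 (t0 l)).
move=> l; have := tamev_comp rho0 t1 tT l.
by apply: tame_ext => phi x; rewrite /term addrAC.
Qed.

Lemma gat_expansion cs lam W : uniq cs -> tame 0 rho (fun _ => lam) -> tamev 1 rho W ->
 exists2 T : V -> (V -> V) -> V -> V, (forall c, tamev 1 rho (T c)) & forall phi x, gat (Psi phi) lamf cs lam (W phi) x =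
  W phi x + \sum_(c <- cs) lamf c (x + c + T c phi x) *: Psi phi (x + c + T c phi x).
Proof.
elim: cs lam W => [|c cs IH] lam W /= => [_ _ _|/andP[ccs ucs] tl tW].
 exists (fun _ _ _ => 0) => [c l|phi x]; last by rewrite big_nil addr0.
 rewrite (_ : (fun _ => _) = (fun _ _ => 0)); first exact: tame_0.
 by apply/funext => phi; apply/funext => x; rewrite mxE.
have tS := tstep c tl tW.
have [||T tT E] := IH (fun y => lam y + lamf c y) (fun phi x => W phi x + term c (step lam W c) phi x) ucs.
- exact: (tame_add rho0 tl (tlamf c)).
- exact: (tamev_add rho0 tW (tterm c tS)).
exists (fun c' => if c' == c then step lam W c else T c').
 by move=> c'; case: ifP.
move=> phi x; rewrite E big_cons eqxx -addrA; congr (_ + (_ + _)).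
rewrite big_seq [RHS]big_seq; apply: eq_bigr => c' c'cs.
by case: eqVneq => // cc; rewrite -cc c'cs in ccs.
Qed.

Context {Z : zmodType} (chi : (V -> V) -> Z).
Hypothesis chiM : forall f g, G r f -> G r g -> chi (f \o g) = chi f + chi g.

Lemma chi_conj f f' tau : G r f -> G r f' -> G r tau -> (forall x, f' x <> x -> tau (f' x) = f (tau x)) ->
 (forall y, f y <> y -> exists2 x, f' x <> x & tau x = y) -> chi f = chi f'.
Proof.
move=> Gf Gf' Gt H1 H2; have [tau' [_ tK _]] := Dc_inv Gt.
have E : tau \o f' = f \o tau.
 apply/funext => x /=; have [fx|fx] := pselect (f' x = x); last exact: H1.
 rewrite fx; have [fy|fy] := pselect (f (tau x) = tau x); first by [].
 have [x' fx' tx] := H2 _ fy; have xx : x' = x by rewrite -(tK x') tx tK. by rewrite xx in fx'.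
have := chiM Gt Gf'; rewrite E chiM // => /eqP; rewrite addrC => /eqP/addrI.
by [].
Qed.

Hypothesis sPsi : csupp Psi.

Lemma gat_chi cs lam W : tame 0 rho (fun _ => lam) -> tamev 1 rho W -> csupp W ->
 [/\ ev (fun _ _ _ phi => chi (fun x => x + gat (Psi phi) lamf cs lam (W phi) x) = chi (fun x => x + W phi x) +
  (chi (fun x => x + (lam x + \sum_(c <- cs) lamf c x) *: Psi phi x) - chi (fun x => x + lam x *: Psi phi x))),
  tamev 1 rho (fun phi => gat (Psi phi) lamf cs lam (W phi)) & csupp (fun phi => gat (Psi phi) lamf cs lam (W phi))].
Proof.
have [M sM] := sPsi; have smul_supp lam' : csupp (fun phi x => lam' x *: Psi phi x).
 by exists M; apply: ev_imp sM => om B eps phi _ _ _ h x xM; rewrite h // scaler0.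
elim: cs lam W => [|c cs IH] lam W tl tW sW /=.
 split=> //; apply: ev_true => om B eps phi _ _ _.
 rewrite (_ : (fun x => x + (lam x + _) *: _) = (fun x => x + lam x *: Psi phi x)) ?subrr ?addr0 //.
 by apply/funext => x; rewrite big_nil addr0.
have tlP : tamev 1 rho (fun phi y => lam y *: Psi phi y) := tamev_smul rho0 tl tPsi.
pose lam' y := lam y + lamf c y.
have tl' : tame 0 rho (fun _ => lam') := tame_add rho0 tl (tlamf c).
have tlP' : tamev 1 rho (fun phi y => lam' y *: Psi phi y) := tamev_smul rho0 tl' tPsi.
have tcP : tamev 1 rho (fun phi y => lamf c y *: Psi phi y) := tamev_smul rho0 (tlamf c) tPsi.
have tS := tstep c tl tW.
pose W' phi x := W phi x + term c (step lam W c) phi x.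
have tW' : tamev 1 rho W' := tamev_add rho0 tW (tterm c tS).
have [tinv einv] := tame_inv r1 C0 rho0 tlP.
pose v phi x := lamf c (x + inv_disp (fun y => lam y *: Psi phi y) x) *: Psi phi (x + inv_disp (fun y => lam y *: Psi phi y) x).
have tv : tamev 1 rho v := tamev_comp rho0 tcP tinv.
pose u phi x := v phi (x + c).
have tu : tamev 1 rho u by move=> l; exact: (tame_translate c rho0 (tv l)).
have small_i := tame_small (p := 1) isT rho0 ltr01 tinv.
have sv' : ev (fun _ _ _ phi => forall x, M + 1 < `|x| -> v phi x = 0).
 apply: ev_imp (ev_and sM small_i) => om B eps phi _ _ _ [h si] x xM.
 rewrite /v h ?scaler0 //; have := ler_normB (x + inv_disp (fun y => lam y *: Psi phi y) x) (inv_disp (fun y => lam y *: Psi phi y) x).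
 by rewrite addrK; have := si x; lra.
have su' : ev (fun _ _ _ phi => forall x, M + 1 + `|c| < `|x| -> u phi x = 0).
 apply: ev_imp sv' => om B eps phi _ _ _ h x xM; rewrite /u h //.
 have := ler_normB (x + c) c; rewrite addrK; lra.
have sv : csupp v by exists (M + 1).
have su : csupp u by exists (M + 1 + `|c|).
have sW' : csupp W'.
 have [MW hW] := sW; have smallS := tame_small (p := 1) isT rho0 ltr01 tS.
 exists (Num.max MW (M + `|c| + 1)).
 apply: ev_imp (ev_and sM (ev_and hW smallS)) => om B eps phi _ _ _ [h [h' si]] x.
 rewrite gt_max => /andP[x1 x2]; rewrite /W' h' // /term h ?scaler0 ?addr0 //.
 have := ler_normB (x + c + step lam W c phi x) (c + step lam W c phi x).
 rewrite -(addrA x) addrK; have := ler_normD c (step lam W c phi x); have := si x; lra.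
have [E tg sg] := IH lam' W' tl' tW' sW'; split=> //.
have Gv := tame_Dc rho0 tv sv; have Gu := tame_Dc rho0 tu su.
have Gp := tame_Dc rho0 tlP (smul_supp lam).
have GW := tame_Dc rho0 tW sW.
have small_u := tame_small (p := 1) isT rho0 ltr01 tu.
apply: ev_imp (ev_and E (ev_and (ev_and Gv Gu) (ev_and (ev_and Gp GW) (ev_and einv (ev_and su' small_u))))).
move=> om B eps phi gd eps0 _ [{}E [[{}Gv {}Gu] [[{}Gp {}GW] [[_ uniq] [{}su' {}small_u]]]]].
rewrite -/(W' phi) -/lam' E.
have -> : (fun x => x + W' phi x) = (fun x => x + u phi x) \o (fun x => x + W phi x).
 apply/funext => x; rewrite /= /W' /term /step /u /v -!addrA; congr (_ + (_ + _)).
 by rewrite (addrCA c) !addrA.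
have pE : (fun x => x + lam' x *: Psi phi x) = (fun x => x + v phi x) \o (fun x => x + lam x *: Psi phi x).
 apply/funext => x; rewrite /= /v; set y := x + lam x *: Psi phi x.
 have -> : inv_disp (fun y => lam y *: Psi phi y) y = - (lam x *: Psi phi x) by apply: uniq; rewrite /y addrK.
 by rewrite /y addrK -addrA -scalerDl.
have uv : chi (fun x => x + v phi x) = chi (fun x => x + u phi x).
 have [tau Gtau htau] := transl_Dc r c (M + 1 + `|c| + 1).
 have usmall x : x + u phi x <> x -> `|x| <= M + 1 + `|c|.
  by move=> ux; rewrite leNgt; apply/negP => /su' u0; apply: ux; rewrite u0 addr0.
 apply: (chi_conj Gv Gu Gtau) => [x ux|y vy].
  have xM := usmall x ux; rewrite !htau; last 2 first.
  - by lra.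
  - by apply: le_trans (ler_normD _ _) _; exact: lerD.
  by rewrite addrAC.
 have ux : y - c + u phi (y - c) <> y - c.
  by rewrite /u subrK => h; apply: vy; move/(congr1 (fun z => z + c)): h; rewrite subrK addrAC subrK.
 exists (y - c) => //; rewrite htau ?subrK //. by apply: le_trans (usmall _ ux) _; rewrite lerDl.
rewrite chiM // -uv.
have -> : (fun x => x + (lam' x + \sum_(c0 <- cs) lamf c0 x) *: Psi phi x) =
  (fun x => x + (lam x + \sum_(c0 <- c :: cs) lamf c0 x) *: Psi phi x).
 by apply/funext => x; rewrite big_cons addrA.
have -> : chi (fun x => x + v phi x) = chi (fun x => x + lam' x *: Psi phi x) - chi (fun x => x + lam x *: Psi phi x).
 by rewrite pE chiM // addrK.
rewrite [_ + chi (fun x => x + W phi x)]addrC -addrA; congr (_ + _).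
by rewrite addrC addrA subrK.
Qed.

End gather.

Section periodic_estimates.
Context {R : realType} {n : nat}.
Local Notation V := 'rV[R]_n.
Local Notation e := (@basis_vec R n).

Lemma Nb_cst D om k w (c : R) : (forall t, 0 <= om t) -> (forall j, 0 <= w j) -> `|c| <= w 0%N -> Nb D om k w (fun _ : V => c).
Proof.
move=> om0 w0 cw; case: k => [|k]; split=> // *; rewrite ?subrr ?normr0 ?mulr_ge0 //.
split=> [x _|i]; first exact: differentiable_cst.
have -> : 'D_(e i) (fun=> c) = (fun=> 0) :> (V -> R) by apply/funext => x; exact: derive_cst.
by apply: Nb_zero => // j; exact: w0.
Qed.

Lemma Nb_sup_pderiv (D : set V) k w (f : V -> R) : (forall s x, D x -> (size s <= k)%N -> `|pderiv s f x| <= w (size s)) ->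
 (forall s x, D x -> (size s < k)%N -> differentiable (pderiv s f) x) -> Nb D (fun=> 2) k w f.
Proof.
elim: k w f => [|k IH] w f h1 h3.
 split=> // [x Dx|x y Dx Dy]; first exact: (h1 [::]).
 by apply: le_trans (ler_normB _ _) _; rewrite mulr_natr mulr2n lerD // (h1 [::]).
split=> [x Dx|x y Dx Dy|]; first exact: (h1 [::]).
 by apply: le_trans (ler_normB _ _) _; rewrite mulr_natr mulr2n lerD // (h1 [::]).
split=> [x Dx|i]; first exact: (h3 [::]).
apply: IH => [s x Dx sk|s x Dx sk].
- by have := h1 (rcons s i) x Dx; rewrite size_rcons pderiv_rcons; apply.
- by have := h3 (rcons s i) x Dx; rewrite size_rcons pderiv_rcons; apply.
Qed.

Lemma pderiv_shift s (f : V -> R) a x : pderiv s (fun y => f (y + a)) x = pderiv s f (x + a).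
Proof.
elim: s x => [//|i s IH] x; rewrite /pderiv /= -/(pderiv s _) -/(pderiv s _).
have -> : pderiv s (fun y => f (y + a)) = (fun y => pderiv s f (y + a)) by exact/funext.
rewrite /derive; suff -> : (fun h : R => h^-1 *: (((fun y => pderiv s f (y + a)) \o shift x) (h *: e i) -
  pderiv s f (x + a))) = (fun h => h^-1 *: ((pderiv s f \o shift (x + a)) (h *: e i) - pderiv s f (x + a))) by [].
by apply/funext => h /=; rewrite addrA.
Qed.

Lemma pderiv_open_eq (D : set V) s f g x : open D -> D x -> (forall y, D y -> f y = g y) -> pderiv s f x = pderiv s g x.
Proof.
move=> oD + fg; elim: s x => [|i s IH] x Dx; first exact: fg.
by apply: near_eq_derive; apply: near_open_eq Dx _ => // y Dy; exact: IH.
Qed.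

Lemma open_ball0 (a : R) : open [set x : V | `|x| < a].
Proof.
have -> : [set x : V | `|x| < a] = ball (0 : V) a by apply/seteqP; split=> x; rewrite -ball_normE /= sub0r normrN.
exact: ball_open.
Qed.

Lemma segment_closed_ball0 (a : R) : segment_closed [set x : V | `|x| < a].
Proof.
move=> x y t /= xa ya /andP[t0 t1].
have -> : y + t *: (x - y) = t *: x + (1 - t) *: y by apply/rowP => l; rewrite !mxE; ring.
apply: le_lt_trans (ler_normD _ _) _; rewrite !normrZ ger0_norm // ger0_norm ?subr_ge0 //.
have [t1'|t1'] := eqVneq t 1.
 by rewrite t1' mul1r subrr mul0r addr0.
have h1 : t * `|x| <= t * a by rewrite ler_wpM2l // ltW.
have h2 : (1 - t) * `|y| < (1 - t) * a by rewrite ltr_pM2l // subr_gt0 lt_neqAle t1'.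
lra.
Qed.

(* Rolle's theorem: in a periodic function a derivative of positive order is
  controlled by the derivatives of the next order. *)
Lemma periodic_low_order om w (f : V -> R) (r0 : nat) (p rad : R) : Nb setT om r0 w f -> 0 <= p -> w r0 <= p -> 2 + r0%:R < rad ->
 (forall i x, `|x| < rad -> f (x + e i) = f x) ->
 forall s x, (0 < size s <= r0)%N -> `|x| <= 2 + (size s)%:R -> `|pderiv s f x| <= p.
Proof.
move=> Nf p0 wp rr per s; move: {2}(r0 - size s)%N (erefl (r0 - size s)%N) => m.
elim: m s => [|m IH] s sm x /andP[s0 sr] xs.
 have sE : size s = r0 by lia. by apply: le_trans (Nb_pderiv_sup Nf sr I) _; rewrite sE.
case: s s0 sr xs sm => // i s _ sr xs sm.
have sr' : ((size s).+1 < r0)%N by rewrite -subn_gt0 -[(size s).+1]/(size (i :: s)) sm.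
have dif t y : (size t < r0)%N -> differentiable (pderiv t f) y.
 move=> tr; have := Nb_pderiv Nf (ltnW tr). by rewrite -(subnSK tr) => /Nb_diff; apply.
have gper y : `|y| < rad -> pderiv s f (y + e i) = pderiv s f y.
 move=> yr; rewrite -pderiv_shift; apply: (pderiv_open_eq (D := [set x : V | `|x| < rad])) => //.
  exact: open_ball0.
 by move=> z; exact: per.
have sum_e (a : 'I_n -> R) t : \sum_l (t *: e i) 0 l * a l = t * a i.
 rewrite (bigD1 i) //= !mxE !eqxx mulr1 big1 ?addr0 // => l /negbTE li.
 by rewrite !mxE li andbF mulr0 mul0r.
have xrad : `|x| < rad.
 apply: le_lt_trans xs (le_lt_trans _ rr); rewrite lerD2l ler_nat //.
have [|t /andP[t0 t1]] := @mvt_row R n (pderiv s f) x (x + e i).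
 by move=> *; apply: dif; exact: leq_trans sr' .
rewrite gper // subrr addrAC subrr add0r -[e i]scale1r sum_e mul1r scale1r => Di0.
have [|t' /andP[t'0 t'1]] := @mvt_row R n (pderiv (i :: s) f) x (x + t *: e i).
 by move=> *; apply: dif.
rewrite [x + t *: e i - x]addrAC subrr add0r sum_e -[pderiv (i :: s) f (x + t *: e i)]Di0 sub0r.
move/(congr1 Num.norm); rewrite normrN => ->.
rewrite normrM (ger0_norm (ltW t0)); apply: (@le_trans _ _ (1 * p)); last by rewrite mul1r.
apply: ler_pM => //; [exact: ltW|exact: ltW|].
apply: (IH (i :: i :: s)).
- by rewrite -[size (i :: i :: s)]/(size (i :: s)).+1 subnS sm.
- by [].
rewrite (_ : (size (i :: i :: s))%:R = (size (i :: s))%:R + 1); last by rewrite natr1.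
rewrite addrA.
apply: le_trans (ler_normD _ _) _; apply: lerD; first exact: xs.
rewrite !normrZ (ger0_norm (ltW t0)) (ger0_norm (ltW t'0)).
apply: mulr_ile1; rewrite ?(ltW t'0) ?(ltW t'1) //; first by nonneg.
by apply: mulr_ile1; rewrite ?(ltW t0) ?(ltW t1) // norm_basis_vec.
Qed.

End periodic_estimates.

Section periodic_sum.
Context {R : realType} {n : nat}.
Local Notation V := 'rV[R]_n.
Context (r : regularity) (L C : R) (om : R -> R) (B : nat -> R) (r0 A : nat).
Hypotheses (r1 : le_reg 1 r) (r0r : le_reg r0 r) (r00 : (0 < r0)%N)
 (C0 : 0 <= C) (cal : calculus L C om B) (B1 : forall j, (j <= r0)%N -> B j = 1) (A4 : (4 <= A)%N).
Let N := (A + r0 + 3)%N.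
Let cs : seq V := lattice N.
Let S0 : R := (size cs)%:R.
Let Ar : R := A%:R.
Let P : R := S0 * Ar * Ar^-1 ^+ r0.

Context (psi : V -> R) (T : V -> V -> V) (eps d : R).
Hypotheses (eps0 : 0 <= eps) (d0 : 0 <= d) (supp : forall x, Ar < `|x| -> psi x = 0)
 (Npsi : forall k, le_reg k r -> Nb setT om k (fun j => eps * Ar * B j * Ar^-1 ^+ j) psi)
 (dT : forall c, c \in cs -> disp r om B d (3 / 8) (T c))
 (d1 : n%:R * C * d * (3 / 8) <= Ar^-1 ^+ r0) (d2 : n%:R * (d * (3 / 8)) <= 1)
 (d3 : S0 * ((n%:R * Ar * (8 / 3) ^+ r0 + 2 * n%:R * C * Ar * r0%:R) * d) <= P).

Let Bp j : 0 <= B j.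
Proof. by have [h _ _] := calc_wt cal; apply: le_trans (h j). Qed.
Let om0 : forall t, 0 <= om t := modulus_ge0 (calc_mod cal).
Let A0 : 0 < Ar. Proof. by rewrite ltr0n (leq_trans _ A4). Qed.
Let Ai0 : 0 <= Ar^-1. Proof. by nonneg. Qed.
Let Ai4 : Ar^-1 <= 1 / 4.
Proof. by rewrite div1r lef_pV2 ?posrE // /Ar ler_nat. Qed.

Let q : R := 1 + Ar^-1 ^+ r0.
Let rho1 : R := 3 / 8 / q.
Let q1 : 1 <= q. Proof. by rewrite lerDl exprn_ge0. Qed.
Let q54 : q <= 5 / 4.
Proof.
have this : Ar^-1 ^+ r0 <= Ar^-1 by rewrite -[leRHS]expr1 ler_wiXn2l // (le_trans Ai4) //; lra.
by rewrite /q; move: Ai4 this; move: (Ar^-1 ^+ r0) (Ar^-1) => u v; lra.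
Qed.
Let q0 : 0 < q. Proof. exact: lt_le_trans q1. Qed.
Let rho1q : rho1 * q = 3 / 8. Proof. by rewrite divfK // gt_eqF. Qed.
Let rho10 : 0 < rho1. Proof. by nonneg. Qed.
Let Arho : Ar^-1 <= rho1.
Proof. by apply: le_trans Ai4 _; rewrite ler_pdivlMr //; move: q54; move: q => u; lra. Qed.

Let S (x : V) : R := \sum_(c <- cs) psi (x + c + T c x).
Let Pi (x : V) : R := \sum_(c <- cs) psi (x + c).

Let Npsi_c k c : le_reg k r -> Nb setT om k (fun j => eps * Ar * B j * Ar^-1 ^+ j) (fun x => psi (x + c)).
Proof.
move=> kr; have := @Nb_affine R n om k (fun j => eps * Ar * B j * Ar^-1 ^+ j) psi 1 1 c om0 (lexx _).
rewrite normr1 => H; have {H} := H _ _ (Npsi kr); move=> H.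
have : Nb setT om k (fun j => 1 * 1 ^+ j * (eps * Ar * B j * Ar^-1 ^+ j)) (fun x => psi (1 *: x + c)).
 by apply: H => [t _|j]; rewrite ?mul1r // !mulr_ge0 ?exprn_ge0 // ltW.
apply: Nb_eq => [j|x]; first by rewrite expr1n !mul1r.
by rewrite scale1r.
Qed.

Let whigh j := 2 * (eps * Ar * B j * Ar^-1 ^+ j) + 2 * (eps * Ar) * (q ^+ j - 1) * B j * rho1 ^+ j.

Let wpos j : 0 <= eps * Ar * B j * Ar^-1 ^+ j.
Proof. by nonneg. Qed.

Let whigh0 j : 0 <= whigh j.
Proof.
apply: addr_ge0; first by nonneg.
by rewrite !mulr_ge0 ?exprn_ge0 ?subr_ge0 ?exprn_ege1 // ltW.
Qed.

Lemma Nb_sum_seq (I : eqType) (s : seq I) (D : set V) om' k (w : nat -> R) (f : I -> V -> R) :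
 (forall t, 0 <= om' t) -> open D -> (forall j, 0 <= w j) -> (forall i, i \in s -> Nb D om' k w (f i)) ->
 Nb D om' k (fun j => (size s)%:R * w j) (fun x => \sum_(i <- s) f i x).
Proof.
move=> om0' oD w0 H.
have := @Nb_sum R n 'I_(size s) (index_enum _) D om' k (fun _ => w) (fun i => f (tnth (in_tuple s) i)) om0' oD.
move=> /(_ (fun i => H _ (mem_tnth i (in_tuple s)))); apply: Nb_eq => [j|x].
 by rewrite sumr_const card_ord mulr_natl.
rewrite [RHS]big_tnth; apply: eq_bigr => i _; by [].
Qed.

Let NS k : le_reg k r -> Nb setT om k (fun j => S0 * whigh j) S.
Proof.
move=> kr; apply: (Nb_sum_seq (f := fun c x => psi (x + c + T c x))) => //; first exact: openT.
move=> c ccs; have := @Nb_comp_disp R n r L C om B r1 cal k 0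
 (fun j => eps * Ar * B j * Ar^-1 ^+ j) (eps * Ar) d q rho1 (T c) (fun x => psi (x + c)) kr d0 rho10 q1.
rewrite rho1q => H; have {H} : Nb setT om k whigh (fun x => psi (x + T c x + c)).
 apply: H => //; [by rewrite /q lerD2l|exact: dT| |exact: Npsi_c].
 move=> j; rewrite wpos /= ler_wpM2l ?mulr_ge0 // ?(ltW A0) // lerXn2r ?nnegrE //; exact: ltW.
by apply: Nb_eq => // x; rewrite addrAC.
Qed.

Let NPi k : le_reg k r -> Nb setT om k (fun j => S0 * (eps * Ar * B j * Ar^-1 ^+ j)) Pi.
Proof.
move=> kr; apply: (Nb_sum_seq (f := fun c x => psi (x + c))) => //; first exact: openT.
by move=> c _; exact: Npsi_c.
Qed.

Let P0 : 0 <= P. Proof. by nonneg. Qed.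
Let Pe0 : 0 <= P * eps. Proof. by nonneg. Qed.

Let low_Pi : Nb [set x : V | `|x| < 2] (fun=> 2) r0 (fun=> (2 * n%:R + 1) * P * eps) (fun x => Pi x - Pi 0).
Proof.
have low : forall s x, (0 < size s <= r0)%N -> `|x| <= 2 + (size s)%:R -> `|pderiv s Pi x| <= P * eps.
 apply: (@periodic_low_order R n om _ Pi r0 (P * eps) (r0%:R + 3) (NPi r0r)) => //.
 - by rewrite (B1 (leqnn _)) mulr1 /P; apply: eq_ler; ring.
 - lra.
 - move=> i x xr; apply: (@lattice_periodic R n N psi Ar) => //. by rewrite /N !natrD; rewrite /Ar; lra.
have dPi s x : (size s < r0)%N -> differentiable (pderiv s Pi) x.
 move=> sr; have := Nb_pderiv (NPi r0r) (ltnW sr). by rewrite -(subnSK sr) => /Nb_diff; apply.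
have pE s x : (0 < size s)%N -> pderiv s (fun y => Pi y - Pi 0) x = pderiv s Pi x.
 case/lastP: s => // s i _; rewrite !pderiv_rcons; congr (pderiv s _ x); apply/funext => y.
 by rewrite deriveB ?derive_cst ?subr0 //; exact/diff_derivable/(dPi [::]).
have nP : 0 <= n%:R * (P * eps) by nonneg.
apply: Nb_sup_pderiv => [s x /= x2 sr|s x _ sr].
 have [/size0nil s0|s0] := posnP (size s); last first.
  rewrite pE //; apply: le_trans (low s x _ _) _; first by rewrite s0.
   by rewrite ltW // (lt_le_trans x2) // lerDl.
  have -> : (2 * n%:R + 1) * P * eps = 2 * (n%:R * (P * eps)) + P * eps by ring. by lra.
 rewrite s0 /= /pderiv /=; have [|t /andP[t0 t1] ->] := @mvt_row R n Pi 0 x.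
  by move=> *; exact: (dPi [::]).
 rewrite add0r subr0; apply: (@le_trans _ _ (n%:R * (P * eps) * `|x|)).
  apply: sum_coord_le => l; apply: (low [:: l]) => //.
  rewrite normrZ ger0_norm ?(ltW t0) //; apply: (@le_trans _ _ (1 * `|x|)).
   by rewrite ler_wpM2r // ltW.
  by rewrite mul1r /=; lra.
 apply: (@le_trans _ _ (n%:R * (P * eps) * 2)); first by rewrite ler_wpM2l // ltW.
 have -> : (2 * n%:R + 1) * P * eps = n%:R * (P * eps) * 2 + P * eps by ring. by rewrite lerDl.
have NF0 : Nb setT om r0 (fun j => S0 * (eps * Ar * B j * Ar^-1 ^+ j) + `|Pi 0|) (fun x => Pi x - Pi 0).
 apply: (@Nb_add _ _ _ _ _ _ (fun=> `|Pi 0|) Pi (fun=> - Pi 0) openT (NPi r0r)).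
 by apply: Nb_cst; rewrite ?normrN.
have := Nb_pderiv NF0 (ltnW sr).
by rewrite -(subnSK sr) => /Nb_diff; apply.
Qed.

Let low_diff : Nb setT (fun=> 2) r0.-1 (fun=> P * eps) (fun x => S x - Pi x).
Proof.
have mo2 : modulus (fun=> 2 : R) 2.
 split=> // [t _|t _]; [lra|by rewrite ge_min; apply/orP; left; lra].
have r0' : (r0.-1 <= r0)%N by rewrite leq_pred.
have kr : le_reg r0.-1 r by case: (r) r0r => //= m; exact: leq_trans.
pose E := n%:R * Ar * (8 / 3) ^+ r0 * (eps * d).
have key c : c \in cs -> Nb setT (fun=> 2) r0.-1 (fun=> (n%:R * Ar * (8 / 3) ^+ r0 + 2 * n%:R * C * Ar * r0%:R) * d * eps)
  (fun x => psi (x + T c x + c) - psi (x + c)).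
 move=> ccs; have Ng : Nb setT om r0 (fun j => eps * Ar * B j * Ar^-1 ^+ j) (fun x => psi (x + c)) by exact: Npsi_c.
 have Ai1 : Ar^-1 <= 1 by apply: le_trans Ai4 _; lra.
 have Ng' : Nb setT (fun=> 2) r0.-1 (fun j => eps * Ar * B (0 + j)%N * rho1 ^+ (0 + j)) (fun x => psi (x + c)).
  apply: Nb_sup => [x _|]; first by nonneg.
  apply: Nb_mono (Nb_le r0' Ng) => // j _; rewrite ler_wpM2l ?mulr_ge0 ?(ltW A0) //.
  by apply: lerXn2r; rewrite ?nnegrE //; exact: ltW.
 have NT : Nbv setT (fun=> 2) r0.-1 (fun j => d * B j * (rho1 * q) ^+ j) (T c).
  move=> l; rewrite rho1q; apply: Nb_sup (dT ccs l kr) => x _. by nonneg.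
 have lip x y : `|x + T c x - (y + T c y)| <= 2 * `|x - y|.
  by apply: (disp_shift_lip r1 cal x y d0 _ _ (dT ccs)) => //; lra.
 have qC : 1 + n%:R * C * d * (rho1 * q) <= q by rewrite rho1q /q lerD2l.
 have base s : (size s <= r0.-1)%N -> Nb setT (fun=> 2) 0 (fun=> E * B (0 + size s)%N * (rho1 * q) ^+ (0 + size s))
   (fun x => pderiv s (fun x => psi (x + c)) (x + T c x) - pderiv s (fun x => psi (x + c)) x).
  move=> sr; have sr' : (size s < r0)%N by rewrite (leq_ltn_trans sr) // prednK.
  have sup x : `|pderiv s (fun x => psi (x + c)) (x + T c x) - pderiv s (fun x => psi (x + c)) x| <=
    E * B (size s) * (3 / 8) ^+ size s.
   apply: (@le_trans _ _ (n%:R * (eps * Ar) * d)).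
    apply: comp_diff_sup => [|y|l y|y].
    - by nonneg.
    - have := Nb_pderiv Ng (ltnW sr'). by rewrite -(subnSK sr') => /Nb_diff; apply.
    - have := Nb_pderiv_sup (s := l :: s) Ng sr' (I : setT y); rewrite /= B1 // mulr1.
     by move/le_trans; apply; rewrite ler_piMr ?mulr_ge0 ?(ltW A0) // exprn_ile1.
    - exact: (disp_norm cal y d0 (dT ccs)).
   rewrite /E B1 ?mulr1; last exact: ltnW.
   have -> : n%:R * Ar * (8 / 3) ^+ r0 * (eps * d) * (3 / 8) ^+ size s =
    n%:R * (eps * Ar) * d * ((8 / 3) ^+ (r0 - size s)). rewrite -[r0 in LHS](subnK (ltnW sr')) exprD.
    have : (8 / 3) ^+ size s * (3 / 8) ^+ size s = 1 :> R.
     by rewrite -exprMn (_ : 8 / 3 * (3 / 8) = 1) ?expr1n //; field.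
    move: ((8 / 3) ^+ size s) ((3 / 8) ^+ size s) => u v uv. by rewrite -[RHS]mulr1 -uv; ring.
   rewrite ler_peMr ?mulr_ge0 ?(ltW A0) // exprn_ege1 //; lra.
  rewrite rho1q add0n; split=> [x _|x y _ _|//]; first exact: sup.
  by apply: le_trans (ler_normB _ _) _; rewrite mulr_natr mulr2n lerD //; exact: sup.
 have eA : 0 <= eps * Ar by nonneg.
 have := Nb_comp_diff mo2 (lexx _) (calc_wt cal) d0 rho10 qC q1 eA NT lip Ng' base.
 rewrite rho1q; apply: Nb_mono => // j jr. rewrite add0n B1 ?mulr1; last exact: leq_trans r0'.
 have jr0 : j%:R <= r0%:R :> R by rewrite ler_nat (leq_trans jr). have E0 : 0 <= E by nonneg.
 have X0 : 0 <= 2 * n%:R * (eps * Ar) * C * d by nonneg.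
 have X1 : 2 * n%:R * (eps * Ar) * C * d * (3 / 8) * j%:R <= 2 * n%:R * (eps * Ar) * C * d * r0%:R.
  rewrite -mulrA; apply: ler_wpM2l => //; have := ler0n R j; lra.
 have X2 : 0 <= 2 * n%:R * (eps * Ar) * C * d * (3 / 8) * j%:R by nonneg.
 apply: (@le_trans _ _ (E + 2 * n%:R * (eps * Ar) * C * d * r0%:R)).
  apply: (@le_trans _ _ (E + 2 * n%:R * (eps * Ar) * C * d * (3 / 8) * j%:R)); last by rewrite lerD2l.
  by rewrite ler_piMr ?addr_ge0 // exprn_ile1 //; lra.
 by rewrite /E; apply: eq_ler; ring.
have := @Nb_sum_seq _ cs setT (fun=> 2) r0.-1 (fun=> (n%:R * Ar * (8 / 3) ^+ r0 + 2 * n%:R * C * Ar * r0%:R) * d * eps)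
 (fun c x => psi (x + T c x + c) - psi (x + c)) (fun _ => ler0n _ 2) openT.
move=> H; apply: (@Nb_ext _ _ setT _ _ _ _ _ openT) (_ : Nb _ _ _ _ (fun x => \sum_(c <- cs) (psi (x + T c x + c) - psi (x + c)))).
 move=> x _; rewrite sumrB /S /Pi; congr (_ - _); apply: eq_bigr => c _; by rewrite addrAC.
apply: Nb_mono (H _ key) => // [j _|j].
 by rewrite mulrA ler_wpM2r.
by nonneg; lra.
Qed.

Let kap2 : R := (4 * 2 ^+ r0 + 2 * n%:R + 2) * P.

Let Ppow : S0 * (Ar * Ar^-1 ^+ r0) = P. Proof. by rewrite /P mulrA. Qed.

Let high_bound j : (r0 <= j)%N -> S0 * whigh j <= 4 * 2 ^+ r0 * P * eps * B j * (3 / 4) ^+ j.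
Proof.
move=> rj.
have h1 : Ar * Ar^-1 ^+ j <= Ar * Ar^-1 ^+ r0 * 2 ^+ r0 * (3 / 4) ^+ j.
 rewrite -{1}(subnK rj) exprD [_ ^+ (j - r0) * _]mulrC mulrA -!mulrA.
 apply: ler_wpM2l; first exact: ltW. apply: ler_wpM2l; first exact: exprn_ge0.
 rewrite -[j in (3 / 4) ^+ j](subnK rj) exprD mulrCA -exprMn.
 apply: (@le_trans _ _ ((3 / 4) ^+ (j - r0))).
  by apply: lerXn2r; rewrite ?nnegrE //; have := Ai4; lra.
 by rewrite ler_peMr ?exprn_ge0 // exprn_ege1 //; lra.
have h2 : (q ^+ j - 1) * rho1 ^+ j <= Ar^-1 ^+ r0 * (3 / 4) ^+ j.
 have qj : q ^+ j - 1 <= (q - 1) * 2 ^+ j * q ^+ j.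
  elim: j {rj h1} => [|j IH]; first by rewrite !expr0 subrr !mulr1 subr_ge0.
  have qj1 : 1 <= q ^+ j by exact: exprn_ege1.
  have j1 : (1 : R) <= 2 ^+ j by apply: exprn_ege1; rewrite ler1n. rewrite (exprS q) (exprS 2).
  have a1 : 0 <= q - 1 by rewrite subr_ge0.
  have a2 := mulr_ge0 (mulr_ge0 a1 (le_trans ler01 j1)) (le_trans ler01 qj1).
  have a3 : q ^+ j <= 2 ^+ j * q ^+ j by rewrite ler_peMl // (le_trans ler01).
  have a4 := ler_wpM2l a1 a3; have a5 := mulr_ge0 a1 a2.
  move: IH a2 a4 a5; move: (2 ^+ j) (q ^+ j) => u v; nra.
 apply: (@le_trans _ _ ((q - 1) * 2 ^+ j * q ^+ j * rho1 ^+ j)).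
  by rewrite ler_wpM2r // exprn_ge0 // ltW.
 rewrite -!mulrA -!exprMn (mulrC q rho1) rho1q /q addrAC subrr add0r.
 by rewrite (_ : 2 * (3 / 8) = 3 / 4 :> R); last by field.
have b0 : 0 <= S0 * eps * B j by nonneg.
have h1' := ler_wpM2l b0 h1.
have h2' := ler_wpM2l (mulr_ge0 b0 (ltW A0)) h2.
rewrite /whigh [leLHS](_ : _ = 2 * (S0 * eps * B j * (Ar * Ar^-1 ^+ j)) +
 2 * (S0 * eps * B j * Ar * ((q ^+ j - 1) * rho1 ^+ j))); last by ring.
have two : (1 : R) <= 2 ^+ r0 by apply: exprn_ege1; rewrite ler1n.
have Z0 : 0 <= S0 * eps * B j * Ar * Ar^-1 ^+ r0 * (3 / 4) ^+ j by nonneg.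
have Z1 := ler_wpM2l Z0 two.
rewrite /P; move: h1' h2' Z1.
have -> : S0 * eps * B j * (Ar * Ar^-1 ^+ r0 * 2 ^+ r0 * (3 / 4) ^+ j) =
 S0 * eps * B j * Ar * Ar^-1 ^+ r0 * (3 / 4) ^+ j * 2 ^+ r0 by ring.
have -> : S0 * eps * B j * Ar * (Ar^-1 ^+ r0 * (3 / 4) ^+ j) = S0 * eps * B j * Ar * Ar^-1 ^+ r0 * (3 / 4) ^+ j * 1 by ring.
have -> : 4 * 2 ^+ r0 * (S0 * Ar * Ar^-1 ^+ r0) * eps * B j * (3 / 4) ^+ j =
 4 * (S0 * eps * B j * Ar * Ar^-1 ^+ r0 * (3 / 4) ^+ j * 2 ^+ r0) by ring.
move=> a1 a2 a3; apply: le_trans (lerD (ler_wpM2l _ a1) (ler_wpM2l _ (le_trans a2 a3))) _ => //.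
by rewrite -mulrDl (_ : 2 + 2 = 4 :> R) //; ring.
Qed.

Let kap2_0 : 0 <= kap2.
Proof. by nonneg. Qed.

Let F x := S x - Pi 0.

Let low_F : Nb [set x : V | `|x| < 2] om r0.-1 (fun=> (2 + n%:R) * kap2 * eps) F.
Proof.
have oD := @open_ball0 R n 2.
have two0 : (0 : R) < 2 ^+ r0 by exact: exprn_gt0.
have l1 : Nb [set x : V | `|x| < 2] (fun=> 2) r0.-1 (fun=> (2 * n%:R + 2) * P * eps) F.
 have := Nb_add oD (Nb_subset (@subsetT _ _) low_diff) (Nb_le (leq_pred r0) low_Pi).
 apply: Nb_eq => [j|x]; first by ring. by rewrite /F /= addrA subrK.
have l2 : Nb [set x : V | `|x| < 2] (fun=> 2) r0 (fun j => S0 * whigh j + `|Pi 0| * (j == 0)%:R) F.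
 apply: (@Nb_add _ _ _ _ _ _ (fun j => `|Pi 0| * (j == 0)%:R) S (fun=> - Pi 0)) => //.
  apply: (Nb_sup (om := om)); last exact: Nb_subset (@subsetT _ _) (NS r0r).
  by move=> x _; rewrite mulr_ge0.
 by apply: Nb_cst => *; rewrite ?normrN ?mulr1 ?mulr_ge0.
have l3 := Nb_merge l2 l1 (leq_pred r0).
have l4 : Nb [set x : V | `|x| < 2] (fun=> 2) r0.-1.+1 (fun=> kap2 * eps) F.
 rewrite prednK //; apply: Nb_mono l3 => // j jr /=; case: ifP => jr1.
  rewrite ler_wpM2r // /kap2 ler_wpM2r // -addrA lerDr mulr_ge0 // ltW //.
 have rj : (r0 <= j)%N by move/negbT: jr1; rewrite -ltnNge prednK.
 have -> : j = r0 by apply/eqP; rewrite eqn_leq jr.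
 rewrite (gtn_eqF r00) mulr0 addr0; apply: le_trans (high_bound (leqnn _)) _.
 rewrite B1 // mulr1 -/(kap2) /kap2; apply: (@le_trans _ _ (4 * 2 ^+ r0 * P * eps)).
  apply: ler_piMr; last by apply: exprn_ile1; lra. by nonneg.
 by rewrite ler_wpM2r // ler_wpM2r // -addrA lerDl addr_ge0 // mulr_ge0.
have := Nb_upgrade oD (@segment_closed_ball0 R n 2) (modulus_min (calc_mod cal)) l4.
by apply: Nb_eq => // j; ring.
Qed.

Lemma periodic_sum_le (Kb : R) (b : V -> R) : 0 <= Kb -> (forall k, Nb setT om k (fun j => Kb * B j * (1 / 4) ^+ j) b) ->
 (forall x, 1 < `|x| -> b x = 0) -> forall k, le_reg k r -> Nb setT om k
  (fun j => C * Kb * ((2 + n%:R) * kap2 * 2 ^+ r0) * eps * B j * (3 / 4) ^+ j) (fun x => b x * (S x - Pi 0)).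
Proof.
move=> Kb0 Nb_b sb k kr; have oD := @open_ball0 R n 2.
have two0 : (0 : R) < 2 ^+ r0 by exact: exprn_gt0.
pose W j := (2 + n%:R) * kap2 * 2 ^+ r0 * eps * B j * (3 / 4) ^+ j.
have W0 j : 0 <= W j by nonneg.
have low_le j : (j <= r0.-1)%N -> (2 + n%:R) * kap2 * eps <= W j.
 move=> jr; rewrite /W B1 ?mulr1; last by exact: leq_trans jr (leq_pred _).
 have -> : (2 + n%:R) * kap2 * 2 ^+ r0 * eps * (3 / 4) ^+ j = (2 + n%:R) * kap2 * eps * (2 ^+ r0 * (3 / 4) ^+ j) by ring.
 apply: ler_peMr; first by do 2 (apply: mulr_ge0 => //); exact: addr_ge0.
 apply: (@le_trans _ _ (2 ^+ j * (3 / 4) ^+ j)).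
  by rewrite -exprMn exprn_ege1 //; lra.
 apply: ler_wpM2r; first exact: exprn_ge0.
 by apply: ler_weXn2l; [rewrite ler1n|exact: leq_trans jr (leq_pred _)].
have NF : Nb [set x : V | `|x| < 2] om k W F.
 have [kr0|kr0] := leqP k r0.-1.
  apply: Nb_mono (Nb_le kr0 low_F) => // j jk; apply: low_le; exact: leq_trans kr0.
 have l2 : Nb [set x : V | `|x| < 2] om k (fun j => S0 * whigh j + `|Pi 0| * (j == 0)%:R) F.
  apply: (@Nb_add _ _ _ _ _ _ (fun j => `|Pi 0| * (j == 0)%:R) S (fun=> - Pi 0)) => //.
   exact: Nb_subset (@subsetT _ _) (NS kr).
  by apply: Nb_cst => *; rewrite ?normrN ?mulr1 ?mulr_ge0.
 apply: Nb_mono (Nb_merge l2 low_F (ltnW kr0)) => // j _ /=; case: ifP => [/low_le //|].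
 move/negbT; rewrite -ltnNge prednK // => rj.
 rewrite (gtn_eqF (leq_trans r00 rj)) mulr0 addr0; apply: le_trans (high_bound rj) _.
 rewrite /W; apply: ler_wpM2r; first by apply: exprn_ge0.
 apply: ler_wpM2r => //; apply: ler_wpM2r => //. apply: (@le_trans _ _ kap2).
  by rewrite /kap2 ler_wpM2r // -addrA lerDl addr_ge0 // mulr_ge0.
 have t1 : (1 : R) <= 2 ^+ r0 by apply: exprn_ege1; rewrite ler1n.
 rewrite -mulrA mulrCA ler_peMr // mulr_ege1 //; have := ler0n R n; lra.
have oml t : 1 <= t -> 1 <= om t.
 by move=> t1; apply: le_trans (modulus_min (calc_mod cal) (le_trans ler01 t1)); rewrite le_min lexx.
have := Nb_mul oD om0 (Nb_subset (@subsetT _ _) (Nb_b k)) NF.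
move=> NbF; apply: (@Nb_extend _ _ _ _ _ _ 1) => //.
- by move=> j; rewrite !mulr_ge0 ?addr_ge0 ?exprn_ge0 // ltW.
- by move=> x x1; rewrite sb // mul0r.
rewrite (_ : 1 + 1 = 2) //; apply: Nb_mono NbF => // j _.
have le1 i : 0 <= Kb * B i * (1 / 4) ^+ i <= Kb * (3 / 4) ^+ i * B i.
 rewrite !mulr_ge0 ?exprn_ge0 //= mulrAC ler_wpM2r // ler_wpM2l //.
 by apply: lerXn2r; rewrite ?nnegrE; lra.
have le2 i : 0 <= W i <= (2 + n%:R) * kap2 * 2 ^+ r0 * eps * (3 / 4) ^+ i * B i by rewrite W0 /= /W mulrAC.
have /andP[_ le3] := lconv_mono j le1 le2; rewrite lconv_geom in le3.
apply: le_trans le3 _; have [_ BB _] := calc_wt cal.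
have X0 : 0 <= Kb * ((2 + n%:R) * kap2 * 2 ^+ r0 * eps) by nonneg.
apply: le_trans (ler_wpM2l _ (BB j)) _; first by nonneg.
by apply: eq_ler; ring.
Qed.

End periodic_sum.

Lemma lattice_width_le A r0 : (0 < A)%N -> ((A + r0 + 3).*2.+1 <= A * (2 * r0 + 9))%N.
Proof. by case: A => // a _; rewrite -muln2; nia. Qed.

Section contractions.
Context {R : realType} {n : nat}.
Local Notation V := 'rV[R]_n.
Local Notation G r := (@Diffc0 R n r).

Definition additive_on r (Z : zmodType) (chi : (V -> V) -> Z) := forall f g, G r f -> G r g -> chi (f \o g) = chi f + chi g.

Definition contracts r r0 L C ell (Th : (V -> V) -> V -> V) := [/\ forall l, @ct R n r r0 L C ell (fun phi x => Th phi x 0 l),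
  @ev R n r r0 L C ell (fun om B eps phi => disp r om B (eps / 4) (7 / 8) (Th phi)),
  @ev R n r r0 L C ell (fun _ _ _ phi => forall x, 1 < `|x| -> Th phi x = 0) &
  forall (Z : zmodType) (chi : (V -> V) -> Z), additive_on r chi -> @ev R n r r0 L C ell (fun _ _ _ phi =>
    G r (fun x => x + Th phi x) /\ chi (fun x => x + Th phi x) = chi (fun x => x + phi x))].

Lemma chi_id r (Z : zmodType) (chi : (V -> V) -> Z) : additive_on r chi -> chi id = 0.
Proof.
move=> h; have := h id id (Dc_id r) (Dc_id r).
by rewrite -{1}[chi _]addr0 => /addrI <-.
Qed.

Lemma chi_dilate r (Z : zmodType) (chi : (V -> V) -> Z) (phi : V -> V) (a M : R) : additive_on r chi -> 1 <= a ->
 G r (fun x => x + a *: phi (a^-1 *: x)) -> G r (fun x => x + phi x) ->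
 (forall x, M < `|x| -> phi x = 0) -> (forall x, `|phi x| <= 1) ->
 chi (fun x => x + a *: phi (a^-1 *: x)) = chi (fun x => x + phi x).
Proof.
move=> hchi a1 Gf Gf' sup small; have an0 : a != 0 by rewrite gt_eqF // (lt_le_trans _ a1).
have [tau Gtau htau] := @dilation_Dc R n r a (M + 1) a1.
have ns x : x + phi x <> x -> `|x| <= M.
 by move=> h; rewrite leNgt; apply/negP => /sup p0; apply: h; rewrite p0 addr0.
apply: (chi_conj hchi Gf Gf' Gtau) => [x hx|y hy].
 have xM := ns x hx; rewrite !htau; last 2 first.
 - by lra.
 - by apply: le_trans (ler_normD _ _) _; exact: lerD.
 by rewrite scalerK // scalerDr.
have hx : a^-1 *: y + phi (a^-1 *: y) <> a^-1 *: y.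
 by rewrite -[X in _ <> X]addr0 => /addrI h; apply: hy; rewrite h scaler0 addr0.
exists (a^-1 *: y) => //; rewrite htau ?scalerKV //.
by apply: le_trans (ns _ hx) _; rewrite lerDl.
Qed.

Section high.
Context (r : regularity).
Hypothesis hr : le_reg n.+2 r.
Let r0 := n.+2.
Let C : R := leib_const r0.
Let L : R := 2.
Let r1 : le_reg 1 r. Proof. by case: (r) hr => //= m; exact: leq_ltn_trans. Qed.
Let C0 : 0 <= C. Proof. exact: leib_const0. Qed.

Lemma ev_seq (ell : nat -> R) (s : seq V) P : (forall c, c \in s -> @ev R n r r0 L C ell (P c)) ->
 @ev R n r r0 L C ell (fun om B eps phi => forall c, c \in s -> P c om B eps phi).
Proof.
elim: s => [|c s IH] H; first by apply: ev_true.
have h1 : @ev R n r r0 L C ell (P c) by apply: H; rewrite inE eqxx.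
have h2 := IH (fun c' c's => H c' (mem_behead (s := c :: s) c's)).
apply: ev_imp (ev_and h1 h2) => om B eps phi _ _ _ [a b] c'; rewrite inE => /orP[/eqP ->//|].
exact: b.
Qed.

Lemma tamev_sum ell p rho (s : seq V) (H : V -> (V -> V) -> V -> V) : 0 <= rho ->
 (forall c, c \in s -> @tamev R n r r0 L C ell p rho (H c)) ->
 @tamev R n r r0 L C ell p rho (fun phi x => \sum_(c <- s) H c phi x).
Proof.
move=> rho0; elim: s => [|c s IH] tH.
 move=> l; have := @tame_0 R n r r0 L C ell p rho rho0.
 by apply: tame_ext => phi x; rewrite big_nil mxE.
have h1 : @tamev R n r r0 L C ell p rho (H c) by apply: tH; rewrite inE eqxx.
have h2 := IH (fun c' c's => tH c' (mem_behead (s := c :: s) c's)).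
move=> l; have := tamev_add rho0 h1 h2 l.
by apply: tame_ext => phi x; rewrite big_cons.
Qed.

Lemma contraction_high : exists (ell : nat -> R) Th, contracts r r0 L C ell Th.
Proof.
have q4 : (0 : R) < 1 / 4 by [].
have [ell0 hell0] := @bump_exists R n unit (fun=> @beta R n) (3 / 4) (1 / 4) r0 q4
  (fun _ => conj (@beta_smooth R n) (@beta_supp R n)).
have [Kb Kb0 hKb] := hell0 L C tt.
pose X : R := C * Kb * ((2 + n%:R) * (4 * 2 ^+ r0 + 2 * n%:R + 2) * 2 ^+ r0) * (2 * r0%:R + 9) ^+ n.
have two0 : (0 : R) <= 2 ^+ r0 by [].
have c10 : (0 : R) <= 2 + n%:R by [].
have c20 : (0 : R) <= 4 * 2 ^+ r0 + 2 * n%:R + 2 by [].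
have c30 : (0 : R) <= 2 * r0%:R + 9 by [].
have X0 : 0 <= X by nonneg.
pose A := maxn 4 (Num.truncn (8 * X)).+1.
have A4 : (4 <= A)%N by rewrite leq_maxl.
have A0 : (0 : R) < A%:R by rewrite ltr0n (leq_trans _ A4).
have XA : X * A%:R^-1 <= 1 / 8.
 rewrite ler_pdivrMr //; have : 8 * X <= A%:R; last by lra.
 have /andP[_ /ltW h] := truncn_itv (mulr_ge0 (ler0n R 8) X0).
 by apply: le_trans h _; rewrite ler_nat leq_maxr.
move: A A4 A0 XA => A A4 A0 XA.
pose N := (A + r0 + 3)%N; pose cs : seq V := lattice N.
have N1 : (1 < N)%N by rewrite /N addn3.
pose gg (c x : V) : R := 2 * beta x * beta (2^-1 *: (x + c)).
have gg_smooth c : smoothV (gg c).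
 have h : smoothV (fun x : V => beta (2^-1 *: x + 2^-1 *: c)) := smoothV_affine _ _ (@beta_smooth R n).
 have := smoothV_mul (@beta_smooth R n) h => h' k.
 apply: (Ckp_ext _ (Ckp_scale 2 (h' k))) => t _; apply/funext => x. by rewrite /gg scalerDr mulrA.
have gg_supp c x : 3 / 4 < `|x| -> gg c x = 0 by move=> /beta_supp h; rewrite /gg h mulr0 mul0r.
have [ell1 hell1] := @bump_exists R n _ (fun k => gg (@latpt R n N k)) (3 / 4) (1 / 4) r0 q4
  (fun k => conj (gg_smooth _) (@gg_supp _)).
pose ell j := Num.max (ell0 j) (ell1 j).
have bmono ell' g : (forall j, ell' j <= ell j) -> bump r0 L C ell' (1 / 4) g -> bump r0 L C ell (1 / 4) g.
 move=> le [K K0 h]; exists K => // s s2 om B [a b c]; apply: h => //; split=> // j /c. exact: le_trans.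
have bbeta : bump r0 L C ell (1 / 4) (@beta R n) by apply: bmono (hell0 L C tt) => j; rewrite le_max lexx.
have bgg c : c \in cs -> bump r0 L C ell (1 / 4) (gg c).
 by case/mapP => k _ ->; apply: bmono (hell1 L C k) => j; rewrite le_max lexx orbT.
have q40 : (0 : R) <= 1 / 4 by [].
pose tamev' := @tamev R n r r0 L C ell.
pose tame' := @tame R n r r0 L C ell.
have Ai1 : (A%:R : R)^-1 <= 1 / 4 by rewrite div1r lef_pV2 ?posrE // ler_nat.
have Ai0 : (0 : R) < A%:R^-1 by nonneg.
pose Psi (phi : V -> V) (x : V) : V := A%:R *: phi (A%:R^-1 *: x).
have tPsi1 : tamev' 1%N A%:R^-1 Psi.
 move=> l; have h := @tame_id R n r r0 L C ell l.
 have := @tame_dilate R n r r0 L C ell 1 1 _ (A%:R^-1) 0 _ ler01 h.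
 rewrite Ai0 mulr1 (le_trans Ai1) //; last by lra. move=> /(_ isT) h'; have := tame_scale A%:R h'.
 by apply: tame_ext => phi x; rewrite !mxE addr0.
have tPsi : tamev' 1%N (1 / 4) Psi by move=> l; exact: tame_le (leqnn _) (ltW Ai0) Ai1 (tPsi1 l).
pose lamf (c x : V) : R := beta (x - c).
have tbeta : tame' 0%N (1 / 4) (fun _ => @beta R n) := tame_bump r q40 bbeta.
have tlamf c : tame' 0%N (1 / 4) (fun _ => lamf c) := tame_translate (- c) q40 tbeta.
have t0 : tame' 0%N (1 / 4) (fun _ _ => 0) := tame_0 r r0 L C ell 0 q40.
pose a : R := (2 ^+ n.+1 - 1)^-1.
have a1 : 0 < (2 : R) ^+ n.+1 - 1.
 rewrite subr_gt0 exprS; apply: (@lt_le_trans _ _ (2 * 1)); first by rewrite mulr1 ltr1n.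
 by rewrite ler_pM2l // exprn_ege1 // ler1n.
pose m phi : V := - a *: \sum_(c <- cs) Psi phi c.
have tm : tamev' 1%N (1 / 4) (fun phi _ => m phi).
 have ts : tamev' 1%N (1 / 4) (fun phi x => \sum_(c <- cs) Psi phi c).
  apply: tamev_sum => // c _ l; exact: tame_at c q40 (tPsi l).
 move=> l; have := tame_scale (- a) (ts l). by apply: tame_ext => phi x; rewrite /m mxE.
pose bm (phi : V -> V) (x : V) : V := beta x *: m phi.
have tbm : tamev' 1%N (1 / 4) bm := tamev_smul C0 q40 tbeta tm.
pose iota phi := inv_disp (bm phi).
have [tiota eiota] := tame_inv r1 C0 q40 tbm.
pose W1 phi := gat (Psi phi) lamf cs (fun=> 0) (iota phi).
pose Psi2 (phi : V -> V) (x : V) : V := 2 *: bm phi (2^-1 *: x).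
have tPsi2 : tamev' 1%N (1 / 4) Psi2.
 move=> l; have := @tame_dilate R n r r0 L C ell 1 (1 / 4) _ (2^-1) 0 _ q40 (tbm l).
 move=> h; have {h} := tame_scale 2 (h _); rewrite invr_gt0 ltr0n invf_le1 ?ler1n // => /(_ isT) h.
 have := tame_le (leqnn _) _ _ h => h'.
 have : tame' 1%N (1 / 4) (fun phi x => 2 * bm phi (2^-1 *: x + 0) 0 l) by apply: h'; lra.
 by apply: tame_ext => phi x; rewrite !mxE addr0.
pose W2 phi := gat (Psi2 phi) lamf cs (fun=> 0) (W1 phi).
have csN : 0 <= (N%:R : R) by [].
have sPsi : @csupp R n r r0 L C ell Psi.
 exists A%:R; apply: ev_true => om B eps phi _ _ [_ h] x xA; rewrite /Psi h ?scaler0 //.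
 by rewrite normrZ gtr0_norm // ltr_pdivlMl // mulr1.
have sbm : @csupp R n r r0 L C ell bm.
 by exists (3 / 4); apply: ev_true => om B eps phi _ _ _ x /beta_supp h; rewrite /bm h scale0r.
have small_iota := tame_small (p := 1) isT q40 q4 tiota.
have siota' : @ev R n r r0 L C ell (fun _ _ _ phi => forall x, 1 < `|x| -> iota phi x = 0).
 apply: ev_imp (ev_and small_iota eiota) => om B eps phi _ _ _ [h [h' _]] x x1.
 rewrite /iota h' /bm beta_supp ?scale0r ?oppr0 //.
 have := ler_normB (x + iota phi x) (iota phi x); rewrite addrK; have := h x; rewrite -/(iota phi x); lra.
have siota : @csupp R n r r0 L C ell iota by exists 1.
have sPsi2 : @csupp R n r r0 L C ell Psi2.
 exists (3 / 2); apply: ev_true => om B eps phi _ _ _ x x1; rewrite /Psi2 /bm beta_supp ?scale0r ?scaler0 //.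
 rewrite normrZ ger0_norm //; lra.
have [T tT ET] := gat_expansion r1 C0 q40 tPsi tlamf (@lattice_uniq R n N) t0 tiota.
have tW1 : tamev' 1%N (1 / 4) W1 by have [] := gat_chi r1 C0 q40 tPsi tlamf (chi := fun _ => 0 : int)
  (fun _ _ _ _ => esym (addr0 _)) sPsi cs t0 tiota siota.
have sW1 : @csupp R n r r0 L C ell W1 by have [] := gat_chi r1 C0 q40 tPsi tlamf (chi := fun _ => 0 : int)
  (fun _ _ _ _ => esym (addr0 _)) sPsi cs t0 tiota siota.
have [T' tT' ET'] := gat_expansion r1 C0 q40 tPsi2 tlamf (@lattice_uniq R n N) t0 tW1.
have [_ tW2 sW2] := gat_chi r1 C0 q40 tPsi2 tlamf (chi := fun _ => 0 : int) (fun _ _ _ _ => esym (addr0 _)) sPsi2 cs t0 tW1 sW1.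
exists ell, W2; split.
- by move=> l; have [] := tW2 l.
- pose psum phi (x : V) : V := \sum_(c <- cs) Psi phi (x + c + T c phi x).
 pose err (phi : V -> V) (x : V) : V := - ((beta (x + iota phi x) - beta x) *: m phi) +
  (\sum_(c <- cs) (beta (x + T c phi x) - beta x) *: Psi phi (x + c + T c phi x) +
   \sum_(c <- cs) (gg c (x + T' c phi x) - gg c x) *: m phi).
 have q2 : (0 : R) <= 1 / 2 by [].
 have half p H : tamev' p (1 / 4) H -> tamev' p (1 / 2) H by move=> tH l; apply: tame_le (tH l) => //; lra.
 have dbl p f : tame' p (2 * (1 / 4)) f -> tame' p (1 / 2) f by rewrite (_ : 2 * (1 / 4) = 1 / 2 :> R) //; field.
 have terr : tamev' 2%N (1 / 2) err.
  apply: tamev_add => //.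
   have h := tamev_smul C0 q2 (dbl _ _ (tame_diff r1 C0 q40 bbeta tiota)) (half _ _ tm).
   move=> l; have := tame_scale (-1) (h l). by apply: tame_ext => phi x; rewrite !mxE mulN1r.
  apply: tamev_add => //; apply: tamev_sum => // c ccs.
   have h1 : tamev' 1%N (1 / 4) (fun phi x => Psi phi (x + c)).
    by move=> l; exact: (tame_translate c q40 (tPsi l)).
   have h2 := half _ _ (tamev_comp r1 C0 q40 h1 (tT c)).
   have h := tamev_smul C0 q2 (dbl _ _ (tame_diff r1 C0 q40 bbeta (tT c))) h2. move=> l; have := h l.
   by apply: tame_ext => phi x; rewrite (addrAC x c).
  have h := tamev_smul C0 q2 (dbl _ _ (tame_diff r1 C0 q40 (bgg c ccs) (tT' c))) (half _ _ tm). by [].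
 have sum_gg x : \sum_(c <- cs) gg c x = 2 ^+ n.+1 * beta x.
  have [x1|x1] := leP `|x| 1; last first.
   rewrite beta_supp ?mulr0; last by lra. by apply: big1 => c _; rewrite gg_supp //; lra.
  by rewrite /gg -mulr_sumr lattice_half // exprS; ring.
 have sum_m phi : \sum_(c <- cs) Psi phi c = - (2 ^+ n.+1 - 1) *: m phi.
  by rewrite /m scalerA mulrNN divff ?scale1r // gt_eqF.
 have dec : @ev R n r r0 L C ell (fun _ _ _ phi => forall x,
   W2 phi x = err phi x + beta x *: (psum phi x - \sum_(c <- cs) Psi phi c)).
  apply: ev_imp eiota => om B eps phi _ _ _ [h _] x. rewrite /W2 ET' /W1 ET -/cs -/(iota phi).
  have -> : iota phi x = - (beta (x + iota phi x) *: m phi) by rewrite {1}/iota h.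
  have -> : \sum_(c <- cs) lamf c (x + c + T c phi x) *: Psi phi (x + c + T c phi x) =
    \sum_(c <- cs) beta (x + T c phi x) *: Psi phi (x + c + T c phi x).
   by apply: eq_bigr => c _; rewrite /lamf (addrAC x c) addrK.
  have -> : \sum_(c <- cs) lamf c (x + c + T' c phi x) *: Psi2 phi (x + c + T' c phi x) =
    (\sum_(c <- cs) gg c (x + T' c phi x)) *: m phi.
   rewrite scaler_suml; apply: eq_bigr => c _.
   rewrite /lamf /Psi2 /bm (addrAC x c) addrK !scalerA /gg; congr (_ *: _); ring.
  rewrite /err /psum.
  have -> : \sum_(c <- cs) (beta (x + T c phi x) - beta x) *: Psi phi (x + c + T c phi x) =
    \sum_(c <- cs) beta (x + T c phi x) *: Psi phi (x + c + T c phi x) - beta x *: \sum_(c <- cs) Psi phi (x + c + T c phi x).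
   by rewrite scaler_sumr -sumrB; apply: eq_bigr => c _; rewrite scalerBl.
  have -> : \sum_(c <- cs) (gg c (x + T' c phi x) - gg c x) *: m phi =
    (\sum_(c <- cs) gg c (x + T' c phi x)) *: m phi - (2 ^+ n.+1 * beta x) *: m phi.
   rewrite -sum_gg !scaler_suml -sumrB; apply: eq_bigr => c _; exact: scalerBl.
  rewrite sum_m; move: (\sum_(c <- cs) _) (\sum_(c <- cs) _) (\sum_(c <- cs) _) => u v w.
  by apply/rowP => l; rewrite !mxE; ring.
 have lt12 : (1 / 2 : R) < 7 / 8 by lra. have [Ke Ke0 herr] := tamevP terr lt12 q2.
 have lt38 : (1 / 4 : R) < 3 / 8 by lra. have /choice[KT hKT] : forall c, exists K, 0 <= K /\
   @ev R n r r0 L C ell (fun om B eps phi => disp r om B (K * eps) (3 / 8) (T c phi)).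
  move=> c; have [K K0 h] := tamevP (tT c) lt38 q40; by exists K.
 pose KS : R := \sum_(c <- cs) KT c. have KS0 : 0 <= KS by apply: sumr_ge0 => c _; case: (hKT c).
 have KT_le c : c \in cs -> KT c <= KS.
  move=> ccs; rewrite /KS (bigD1_seq c) ?lattice_uniq //= lerDl.
  by apply: sumr_ge0 => c' _; case: (hKT c').
 have allT := ev_seq (fun c (_ : c \in cs) => (hKT c).2). pose S0 : R := (size cs)%:R.
 have szE : size cs = (N.*2.+1 ^ n)%N.
  by rewrite size_map -[X in size X]/(index_enum _) /index_enum -enumT -cardE card_ffun !card_ord.
 have S00 : 0 < S0 by rewrite ltr0n szE expn_gt0. pose P : R := S0 * A%:R * A%:R^-1 ^+ r0.
 have P0 : 0 < P by apply: mulr_gt0; [exact: mulr_gt0|exact: exprn_gt0].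
 have P_le : P <= (2 * r0%:R + 9) ^+ n * A%:R^-1.
  have h : S0 <= (A%:R * (2 * r0%:R + 9)) ^+ n.
   rewrite /S0 szE natrX; apply: lerXn2r; rewrite ?nnegrE //.
   rewrite -(natrM R 2) -natrD -natrM ler_nat; apply: lattice_width_le; exact: leq_trans A4.
  apply: (@le_trans _ _ ((A%:R * (2 * r0%:R + 9)) ^+ n * A%:R * A%:R^-1 ^+ r0)).
   by rewrite !ler_wpM2r ?exprn_ge0 // ltW.
  have e1 : A%:R ^+ n * A%:R^-1 ^+ n = 1 :> R by rewrite -exprMn divff ?expr1n // gt_eqF.
  have e2 : A%:R * A%:R^-1 = 1 :> R by rewrite divff // gt_eqF.
  rewrite exprMn /r0 !exprS; move: e1 e2; move: (A%:R) (A%:R^-1) (A%:R^-1 ^+ n) (A%:R ^+ n) ((_ + 9) ^+ n) => z w v u y e1 e2.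
  have -> : u * y * z * (w * (w * v)) = (u * v) * (z * w) * (y * w) by ring. by rewrite e1 e2 !mul1r.
 have s1 := @ev_scale R n r r0 L C ell (n%:R * C * KS * (3 / 8)) (A%:R^-1 ^+ r0).
 have s2 := @ev_scale R n r r0 L C ell (n%:R * KS * (3 / 8)) 1.
 have X30 : 0 <= S0 * ((n%:R * A%:R * (8 / 3) ^+ r0 + 2 * n%:R * C * A%:R * r0%:R) * KS) by nonneg.
 have s3 := @ev_scale R n r r0 L C ell _ P X30 P0.
 have s4 := @ev_scale R n r r0 L C ell Ke (1 / 8) Ke0. have lt8 : (0 : R) < 1 / 8 by [].
 have {}s4 := s4 lt8. have p1 : 0 <= n%:R * C * KS * (3 / 8) by nonneg.
 have p2 : 0 <= n%:R * KS * (3 / 8) by nonneg.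
 have {p1}s1 := s1 p1 (exprn_gt0 r0 Ai0); have {p2}s2 := s2 p2 ltr01.
 apply: ev_imp (ev_and (ev_and dec herr) (ev_and allT (ev_and (ev_and s1 s2) (ev_and s3 s4)))).
 move=> om B eps phi gd eps0 [dphi sphi] [[{}dec {}herr] [{}allT [[{}s1 {}s2] [{}s3 {}s4]]]].
 have [cal B1 Bell] := gd; have om0 := modulus_ge0 (calc_mod cal).
 have B0 j : 0 <= B j by have [h _ _] := calc_wt cal; apply: le_trans (h j). move=> k l kr.
 have Npsi k' : le_reg k' r -> Nb setT om k' (fun j => eps * A%:R * B j * A%:R^-1 ^+ j) (fun x => Psi phi x 0 l).
  move=> kr'; have := @Nb_affine R n om k' (fun j => eps * B j * 1 ^+ j) (fun x => phi x 0 l) (A%:R^-1) 1 0 om0 (lexx _).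
  rewrite (gtr0_norm Ai0) => H; have {H} := H _ _ (dphi k' l kr') => H.
  have : Nb setT om k' (fun j => 1 * A%:R^-1 ^+ j * (eps * B j * 1 ^+ j)) (fun x => phi (A%:R^-1 *: x + 0) 0 l).
   apply: H => [t t0'|j]; last by nonneg.
   rewrite mul1r; apply: (modulus_mono (calc_mod cal)); first by nonneg.
   by rewrite ler_piMl //; lra.
  move=> /(Nb_scale A%:R openT); rewrite gtr0_norm //; apply: Nb_eq => [j|x].
   by rewrite expr1n; ring.
  by rewrite /Psi mxE addr0.
 have sPsil x : A%:R < `|x| -> Psi phi x 0 l = 0.
  move=> xA; rewrite /Psi sphi ?scaler0 ?mxE //. by rewrite normrZ gtr0_norm // ltr_pdivlMl // mulr1.
 have dT c : c \in cs -> disp r om B (KS * eps) (3 / 8) (T c phi).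
  move=> ccs; apply: (disp_mono cal _ (lexx _) _ _ (allT c ccs)) => //.
   by rewrite ler_wpM2r // KT_le.
  by rewrite mulr_ge0 //; case: (hKT c).
 have ss1 : n%:R * C * (KS * eps) * (3 / 8) <= A%:R^-1 ^+ r0.
  by have -> : n%:R * C * (KS * eps) * (3 / 8) = n%:R * C * KS * (3 / 8) * eps by ring.
 have ss2 : n%:R * (KS * eps * (3 / 8)) <= 1.
  by have -> : n%:R * (KS * eps * (3 / 8)) = n%:R * KS * (3 / 8) * eps by ring.
 have ss3 : S0 * ((n%:R * A%:R * (8 / 3) ^+ r0 + 2 * n%:R * C * A%:R * r0%:R) * (KS * eps)) <= P.
  by move: s3; congr (_ <= _); ring.
 have Nbeta k' : Nb setT om k' (fun j => Kb * B j * (1 / 4) ^+ j) (@beta R n).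
  apply: (hKb [::]) => //; split=> // j /Bell; apply: le_trans; by rewrite le_max lexx.
 have sbeta x : 1 < `|x| -> @beta R n x = 0 by move=> x1; rewrite beta_supp //; lra.
 have KSe : 0 <= KS * eps by nonneg.
 have main := periodic_sum_le r1 hr isT C0 cal B1 A4 (T := fun c => T c phi) eps0 KSe sPsil Npsi dT ss1 ss2 ss3 Kb0 Nbeta sbeta kr.
 have := Nb_add openT (herr k l kr) main; move=> H.
 apply: (@Nb_ext _ _ setT _ _ _ _ _ openT _ (Nb_mono om0 _ H)) => [x _|j _] /=.
  rewrite dec !mxE; congr (_ + _ * _); rewrite /psum !summxE.
  by congr (_ - _); apply: eq_bigr => c _; rewrite add0r.
 have e34 : (3 / 4 : R) ^+ j <= (7 / 8) ^+ j by apply: lerXn2r; rewrite ?nnegrE; lra.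
 have X340 : 0 <= C * Kb * ((2 + n%:R) * ((4 * 2 ^+ r0 + 2 * n%:R + 2) * P) * 2 ^+ r0) * eps * B j.
  by have P0' := ltW P0; do ![apply: mulr_ge0 => //].
 apply: le_trans (lerD (lexx _) (ler_wpM2l X340 e34)) _.
 rewrite -mulrDl; apply: ler_wpM2r; first by apply: exprn_ge0; lra.
 rewrite -mulrDl; apply: ler_wpM2r => //.
 have e1 : Ke * eps ^+ 2 <= 1 / 8 * eps by rewrite expr2 mulrA ler_wpM2r.
 have e2 : C * Kb * ((2 + n%:R) * ((4 * 2 ^+ r0 + 2 * n%:R + 2) * P) * 2 ^+ r0) <= 1 / 8.
  apply: le_trans XA; rewrite /X.
  have h0 : 0 <= C * Kb * ((2 + n%:R) * (4 * 2 ^+ r0 + 2 * n%:R + 2) * 2 ^+ r0) by nonneg.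
  have := ler_wpM2l h0 P_le; congr (_ <= _); ring.
 have -> : eps / 4 = 1 / 8 * eps + 1 / 8 * eps by field.
 by apply: lerD e1 _; exact: (ler_wpM2r eps0 e2).
- have smallT := ev_seq (fun c (_ : c \in cs) => tame_small (p := 1) isT q40 q4 (tT c)).
 have smallT' := ev_seq (fun c (_ : c \in cs) => tame_small (p := 1) isT q40 q4 (tT' c)).
 apply: ev_imp (ev_and siota' (ev_and smallT smallT')) => om B eps phi _ _ _ [h1 [h2 h3]] x x1.
 have far (y : V) : `|y| <= 1 / 4 -> beta (x + y) = 0.
  by move=> y4; rewrite beta_supp //; have := ler_normB (x + y) y; rewrite addrK; lra.
 rewrite /W2 ET' /W1 ET -/cs -/(iota phi) h1 // add0r big_seq big1 ?add0r => [|c ccs].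
  rewrite big_seq big1 // => c ccs; rewrite /lamf addrAC addrK far ?scale0r //; exact: h3.
 by rewrite /lamf addrAC addrK far ?scale0r //; exact: h2.
move=> Z chi hchi.
have [E1 _ _] := gat_chi r1 C0 q40 tPsi tlamf hchi sPsi cs t0 tiota siota.
have [E2 _ _] := gat_chi r1 C0 q40 tPsi2 tlamf hchi sPsi2 cs t0 tW1 sW1.
have GW2 := tame_Dc r1 C0 q40 tW2 sW2.
have Gbm := tame_Dc r1 C0 q40 tbm sbm.
have Giota := tame_Dc r1 C0 q40 tiota siota.
have GPsi := tame_Dc r1 C0 q40 tPsi sPsi.
have GPsi2 := tame_Dc r1 C0 q40 tPsi2 sPsi2.
have tid : tamev' 1%N 1 id := @tame_id R n r r0 L C ell.
have sid : @csupp R n r r0 L C ell id by exists 1; apply: ev_true => om B eps phi _ _ [].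
have Gid := tame_Dc r1 C0 ler01 tid sid.
have small_id := tame_small (p := 1) isT ler01 ltr01 tid.
have small_bm := tame_small (p := 1) isT q40 ltr01 tbm.
apply: ev_imp (ev_and (ev_and E1 E2) (ev_and (ev_and GW2 Gbm) (ev_and (ev_and Giota (ev_and GPsi GPsi2)) (ev_and (ev_and Gid eiota) (ev_and small_id small_bm))))).
move=> om B eps phi gd eps0 [_ sphi] [[{}E1 {}E2] [[{}GW2 {}Gbm] [[{}Giota [{}GPsi {}GPsi2]] [[{}Gid [{}eiota _]] [{}small_id {}small_bm]]]]].
split; first exact: GW2.
have tot (H : V -> V) (M : R) : M <= N%:R -> (forall x, M < `|x| -> H x = 0) ->
  (fun x => x + (0 + \sum_(c <- cs) lamf c x) *: H x) = (fun x => x + H x).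
 move=> MN sH; apply/funext => x; have [xN|xN] := leP `|x| M.
  by rewrite add0r lattice_partition ?scale1r // (le_trans xN).
 by rewrite sH // scaler0.
have zero (H : V -> V) : chi (fun x => x + 0 *: H x) = 0.
 rewrite (_ : (fun x => _) = id) ?(chi_id hchi) //. by apply/funext => x; rewrite scale0r addr0.
have AN : A%:R <= N%:R :> R by rewrite ler_nat /N -addnA leq_addr.
rewrite E2 E1 !zero !subr0.
rewrite (tot (Psi phi) A%:R) //; last first.
 move=> x xA; rewrite /Psi sphi ?scaler0 //. by rewrite normrZ gtr0_norm // ltr_pdivlMl // mulr1.
rewrite (tot (Psi2 phi) 2); last 2 first.
- by rewrite (ler_nat R 2).
- move=> x x1; rewrite /Psi2 /bm beta_supp ?scale0r ?scaler0 //. rewrite normrZ ger0_norm //; lra.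
have -> : chi (fun x => x + Psi phi x) = chi (fun x => x + phi x).
 have A1 : 1 <= A%:R :> R by rewrite ler1n (leq_trans _ A4).
 exact: (chi_dilate hchi A1 GPsi Gid sphi small_id).
have -> : chi (fun x => x + Psi2 phi x) = chi (fun x => x + bm phi x).
 have two1 : (1 : R) <= 2 by lra. apply: (chi_dilate (M := 3 / 4) hchi two1 GPsi2 Gbm _ small_bm).
 by move=> x /beta_supp h; rewrite /bm h scale0r.
have -> : chi (fun x => x + iota phi x) = - chi (fun x => x + bm phi x).
 apply/eqP; rewrite -addr_eq0 addrC -(hchi _ _ Gbm Giota); apply/eqP; rewrite -(chi_id hchi).
 congr chi; apply/funext => x /=; rewrite -addrA.
 suff -> : iota phi x + bm phi (x + iota phi x) = 0 by rewrite addr0.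
 by apply/eqP; rewrite addr_eq0; apply/eqP; exact: eiota.
by rewrite addrAC addNr add0r.
Qed.

End high.

End contractions.

Section contraction_low.
Context {R : realType} {n m : nat}.
Local Notation V := 'rV[R]_n.
Local Notation G r := (@Diffc0 R n r).
Hypotheses (m1 : (0 < m)%N) (mn : (m <= n)%N).
Let r : regularity := Some m.
Let C : R := leib_const m.
Let r1 : le_reg 1 r. Proof. exact: m1. Qed.
Let C0 : 0 <= C. Proof. exact: leib_const0. Qed.

Let A : nat := (32 * 16 ^ m).*2.+1.
Let A1 : (1 : R) <= A%:R. Proof. by rewrite ler1n. Qed.
Let A32 : 32 * 16 ^+ m <= A%:R :> R.
Proof.
rewrite /A; have -> : 32 * 16 ^+ m = (32 * 16 ^ m)%N%:R :> R by rewrite natrM natrX.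
by rewrite ler_nat -addnn -addSn leq_addl.
Qed.
Let cs : seq V := [seq 4 *: c | c <- lattice (32 * 16 ^ m)].
Let N := size cs.
Let NE : N%:R = A%:R ^+ n :> R.
Proof.
rewrite /N /cs size_map size_map -[X in size X]/(index_enum _) /index_enum -enumT -cardE card_ffun !card_ord.
by rewrite natrX.
Qed.
Let N0 : 0 < N%:R :> R. Proof. by rewrite NE exprn_gt0 // (lt_le_trans ltr01). Qed.
Let ucs : uniq cs.
Proof.
by rewrite map_inj_uniq ?lattice_uniq // => c c'; apply: scalerI; rewrite pnatr_eq0.
Qed.
Let cs_far c c' : c \in cs -> c' \in cs -> c != c' -> 4 <= `|c - c'|.
Proof.
move=> /mapP[d /mapP[k _ ->] ->] /mapP[d' /mapP[k' _ ->] ->] ne.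
have kk : k != k' by apply: contraNneq ne => ->.
have [i ki] : exists i, k i != k' i.
 apply/existsP; apply: contraNT kk => /existsPn h; apply/eqP/ffunP => i.
 by have := h i; rewrite negbK => /eqP.
rewrite -scalerBr normrZ ger0_norm // ler_peMr //.
apply: le_trans (coord_le _ i); rewrite !mxE (_ : (k i)%:R - _ - _ = (k i)%:R - (k' i)%:R); last by ring.
have : (k i : nat) != k' i by [].
rewrite neq_ltn => /orP[] h.
 rewrite distrC -natrB ?(ltnW h) // normr_nat ler1n subn_gt0 //.
by rewrite -natrB ?(ltnW h) // normr_nat ler1n subn_gt0.
Qed.
Let cs_bound c : c \in cs -> `|c| <= 2 * (A%:R - 1).
Proof.
move=> /mapP[d /mapP[k _ ->] ->]; rewrite normrZ ger0_norm //.
have -> : 2 * (A%:R - 1) = 4 * (32 * 16 ^ m)%N%:R :> R by rewrite /A -addn1 -addnn !natrD; ring.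
rewrite ler_wpM2l //; apply: le_coord => // i; rewrite mxE.
have := ltn_ord (k i); move: (nat_of_ord (k i)) => q; rewrite ltnS -addnn -(ler_nat R) natrD => h.
rewrite ler_norml; have := ler0n R q; move: h; lra.
Qed.

Let low_factor (j : nat) (eps b : R) : (j <= m)%N -> 0 <= eps -> 0 <= b ->
 (4 * A%:R)^-1 * (2 * (4 * A%:R) ^+ j * (2 * (N%:R^-1 * (2 * eps) * b * 2 ^+ j))) <= eps / 4 * b * (7 / 8) ^+ j.
Proof.
move=> jm eps0 b0; have A00 : (0 : R) < A%:R by [].
suff H : (4 * A%:R)^-1 * (2 * (4 * A%:R) ^+ j * (2 * (N%:R^-1 * 2 * 2 ^+ j))) <= (7 / 8) ^+ j / 4 :> R.
 by have := ler_wpM2r (mulr_ge0 eps0 b0) H; congr (_ <= _); ring.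
have -> : (4 * A%:R)^-1 * (2 * (4 * A%:R) ^+ j * (2 * (N%:R^-1 * 2 * 2 ^+ j))) =
  2 * 8 ^+ j * (A%:R ^+ j * A%:R^-1 * N%:R^-1) :> R.
 have -> : (8 : R) = 4 * 2 by ring.
 rewrite invfM !exprMn; move: (A%:R ^+ j) (4 ^+ j) (2 ^+ j) (A%:R^-1) (N%:R^-1) => x y z u v. by field.
have le1 : A%:R ^+ j * N%:R^-1 <= 1 :> R.
 rewrite ler_pdivrMr // mul1r NE; apply: ler_weXn2l => //; exact: leq_trans jm mn.
have le2 : A%:R^-1 <= (32 * 16 ^+ m)^-1 :> R by rewrite lef_pV2 ?posrE // mulr_gt0 // exprn_gt0.
have le3 : 2 * 8 ^+ j * (A%:R ^+ j * A%:R^-1 * N%:R^-1) <= 2 * 8 ^+ j * (32 * 16 ^+ m)^-1 :> R.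
 rewrite ler_wpM2l ?mulr_ge0 ?exprn_ge0 // mulrAC; apply: le_trans le2.
 by rewrite ler_piMl // invr_ge0 ltW.
apply: le_trans le3 _; rewrite ler_pdivrMr ?mulr_gt0 ?exprn_gt0 //.
have e16 : (16 : R) ^+ j <= 16 ^+ m by apply: ler_weXn2l; rewrite ?ler1n.
have e78 : 8 ^+ j <= (7 / 8) ^+ j * 16 ^+ j :> R by rewrite -exprMn; apply: lerXn2r; rewrite ?nnegrE; lra.
have e8 : 0 <= (7 / 8 : R) ^+ j by [].
have := ler_wpM2l e8 e16; have := exprn_ge0 j (ler0n R 8).
move: e78; move: (8 ^+ j) (16 ^+ j) (16 ^+ m) ((7/8) ^+ j) => x y z u e78 x0 h; lra.
Qed.

Lemma contraction_low : exists L (ell : nat -> R) Th, 2 <= L /\ @contracts R n r m L C ell Th.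
Proof.
pose L : R := 4 * A%:R; pose ell (j : nat) : R := 0.
have A00 : (0 : R) < A%:R by [].
have L0 : 0 < L by nonneg.
have L2 : 2 <= L by rewrite /L; move: A1; lra.
have L1 : 1 <= L by lra.
pose tamev' := @tamev R n r m L C ell.
pose tame' := @tame R n r m L C ell.
have tid : tamev' 1%N 1 id := @tame_id R n r m L C ell.
have sid : @csupp R n r m L C ell id by exists 1; apply: ev_true => om B eps phi _ _ [].
pose lamf (c x : V) : R := N%:R^-1.
have ct0 (a : R) : @ct R n r m L C ell (fun _ _ => a).
 by exists 1 => // om B eps J U f g [UU _ _ _ _] _ x; exact: cvg_cst.
have tlamf c : tame' 0%N 1 (fun _ => lamf c).
 apply: (tame_cst ler01 _ (ct0 _)); exists N%:R^-1; first by nonneg.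
 by apply: ev_true => om B eps phi _ _ _; rewrite expr0 mulr1 ger0_norm // invr_ge0 ltW.
have t0 : tame' 0%N 1 (fun _ _ => 0) := tame_0 r m L C ell 0 ler01.
have tw : tamev' 1%N 1 (fun _ _ => 0).
 move=> l; rewrite (_ : (fun _ => _) = (fun _ _ => 0)); first exact: tame_0.
 by apply/funext => phi; apply/funext => x; rewrite mxE.
have sw : @csupp R n r m L C ell (fun _ _ => 0) by exists 1; apply: ev_true.
pose W phi := gat phi lamf cs (fun=> 0) (fun=> 0).
have [T tT ET] := gat_expansion r1 C0 ler01 tid tlamf ucs t0 tw.
have [_ tW sW] := gat_chi r1 C0 ler01 tid tlamf (chi := fun _ => 0 : int) (fun _ _ _ _ => esym (addr0 _)) sid cs t0 tw sw.
pose Th (phi : V -> V) (x : V) : V := L^-1 *: W phi (L *: x).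
have lt12 : (1 : R) < 2 by lra.
have /choice[KT hKT] : forall i : 'I_N, exists K, 0 <= K /\
  @ev R n r m L C ell (fun om B eps phi => disp r om B (K * eps) 2 (T (nth 0 cs i) phi)).
 by move=> i; have [K K0 h] := tamevP (tT (nth 0 cs i)) lt12 ler01; exists K.
have half0 : (0 : R) < 1 / 2 by [].
have smallT := ev_fin (fun i : 'I_N => tame_small (p := 1) isT ler01 half0 (tT (nth 0 cs i))).
have WE phi x : W phi x = \sum_(i < N) N%:R^-1 *: phi (x + nth 0 cs i + T (nth 0 cs i) phi x).
 by rewrite /W ET add0r (big_nth 0) big_mkord.
have supp_piece : @ev R n r m L C ell (fun _ _ _ phi => forall (i : 'I_N) x, 3 / 2 < `|x + nth 0 cs i| ->
  phi (x + nth 0 cs i + T (nth 0 cs i) phi x) = 0).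
 apply: ev_imp smallT => om B eps phi _ _ [_ h] sm i x xi; apply: h.
 have := ler_normB (x + nth 0 cs i + T (nth 0 cs i) phi x) (T (nth 0 cs i) phi x).
 by rewrite addrK; have := sm i x; move: xi; lra.
have disp_Th : @ev R n r m L C ell (fun om B eps phi => disp r om B (eps / 4) (7 / 8) (Th phi)).
 have allT := ev_fin (fun i => (hKT i).2).
 have s1 := ev_fin (fun i : 'I_N => @ev_scale R n r m L C ell (n%:R * C * KT i * 2) 1
  (mulr_ge0 (mulr_ge0 (mulr_ge0 (ler0n R n) C0) (hKT i).1) (ler0n R 2)) ltr01).
 have s2 := ev_fin (fun i : 'I_N => @ev_scale R n r m L C ell (n%:R * KT i * 2) 1
  (mulr_ge0 (mulr_ge0 (ler0n R n) (hKT i).1) (ler0n R 2)) ltr01).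
 apply: ev_imp (ev_and (ev_and allT supp_piece) (ev_and s1 s2)).
 move=> om B eps phi gd eps0 [dphi sphi] [[{}allT {}supp_piece] [{}s1 {}s2]].
 have [cal B1 _] := gd; have om0 := modulus_ge0 (calc_mod cal).
 have B0 j : 0 <= B j by have [h _ _] := calc_wt cal; apply: le_trans (h j).
 have piece (i : 'I_N) l : sc r om B (N%:R^-1 * (2 * eps)) 2 (fun x => (N%:R^-1 *: phi (x + nth 0 cs i + T (nth 0 cs i) phi x)) 0 l).
  have h0 : sc r om B eps 1 (fun x => phi (x + nth 0 cs i) 0 l).
   move=> k kr; have := @Nb_affine R n om k (fun j => eps * B j * 1 ^+ j) (fun x => phi x 0 l) 1 1 (nth 0 cs i) om0 (lexx _).
   rewrite normr1 => H; have {H} := H _ _ (dphi k l kr) => H.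
   have := H _ _; rewrite (_ : (fun j => 1 * 1 ^+ j * (eps * B j * 1 ^+ j)) = (fun j => eps * B j * 1 ^+ j)); last first.
    by apply/funext => j; rewrite expr1n; ring.
   rewrite (_ : (fun x => phi (1 *: x + _) 0 l) = (fun x => phi (x + nth 0 cs i) 0 l)); last first.
    by apply/funext => x; rewrite scale1r.
   apply => [t tt|j]; first by rewrite !mul1r. by nonneg.
  have KTi := (hKT i).1. have c1 : 1 + n%:R * C * (KT i * eps) * (1 * 2) <= 2.
   have := s1 i; have -> : n%:R * C * (KT i * eps) * (1 * 2) = n%:R * C * KT i * 2 * eps by ring. lra.
  have c2 : n%:R * (KT i * eps * (1 * 2)) <= 1.
   by have -> : n%:R * (KT i * eps * (1 * 2)) = n%:R * KT i * 2 * eps by ring.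
  have d2 : disp r om B (KT i * eps) (1 * 2) (T (nth 0 cs i) phi) by rewrite mul1r; exact: allT.
  have := sc_comp r1 gd eps0 (mulr_ge0 KTi eps0) ltr01 (ltW lt12) c1 c2 h0 d2.
  move=> H k kr; have := Nb_scale N%:R^-1 openT (H k kr).
  rewrite ger0_norm ?invr_ge0 ?(ltW N0) // mul1r; apply: Nb_eq => [j|x].
   by rewrite !mulrA.
  by rewrite mxE (addrAC x).
 move=> k l kr. have far (i j : 'I_N) : i != j -> 2 * (3 / 2) + 1 <= `|- nth 0 cs i - - nth 0 cs j|.
  move=> ij; rewrite (_ : 2 * (3 / 2) + 1 = 4 :> R); last by field.
  rewrite opprK addrC; apply: cs_far; rewrite ?mem_nth //. by rewrite nth_uniq // eq_sym.
 have wp j : 0 <= N%:R^-1 * (2 * eps) * B j * 2 ^+ j by nonneg. have om1 t : 1 <= t -> 1 <= om t.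
  move=> t1; have t00 : 0 <= t by lra. by have := modulus_min (calc_mod cal) t00; rewrite min_l.
 have NW : Nb setT om k (fun j => 2 * (N%:R^-1 * (2 * eps) * B j * 2 ^+ j)) (fun x => W phi x 0 l).
  have := @Nb_disjoint R n N om k _ (fun i x => (N%:R^-1 *: phi (x + nth 0 cs i + T (nth 0 cs i) phi x)) 0 l) (fun i => - nth 0 cs i) (3 / 2) om0 om1 wp far.
  move=> H; have {H} := H _ (fun i => piece i l k kr); move=> H.
  have : Nb setT om k (fun j => 2 * (N%:R^-1 * (2 * eps) * B j * 2 ^+ j)) (fun x => \sum_(i < N) (N%:R^-1 *: phi (x + nth 0 cs i + T (nth 0 cs i) phi x)) 0 l).
   by apply: H => i x; rewrite opprK => xi; rewrite supp_piece // scaler0 mxE.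
  by apply: Nb_eq => // x; rewrite WE summxE.
 have := @Nb_affine R n om k _ _ L 2 0 om0 (ltW lt12) _ _ NW. rewrite gtr0_norm // => H.
 have {H} := Nb_scale L^-1 openT (H (modulus_scale (calc_mod cal)) (fun j => mulr_ge0 (ler0n R 2) (wp j))).
 rewrite ger0_norm ?invr_ge0 ?(ltW L0) //; move=> H.
 apply: (@Nb_ext _ _ setT _ _ _ _ _ openT _ (Nb_mono om0 _ H)) => [x _|j jk] /=.
  by rewrite /Th mxE addr0.
 by apply: low_factor => //; exact: leq_trans jk kr.
have supp_Th : @ev R n r m L C ell (fun _ _ _ phi => forall x, 1 < `|x| -> Th phi x = 0).
 apply: ev_imp supp_piece => om B eps phi _ _ _ h x x1; rewrite /Th WE big1 ?scaler0 // => i _.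
 rewrite h ?scaler0 //; have := @cs_bound (nth 0 cs i) (mem_nth _ (ltn_ord i)).
 have := ler_normB (L *: x + nth 0 cs i) (nth 0 cs i); rewrite addrK normrZ gtr0_norm //.
 have : L < L * `|x| by rewrite ltr_pMr. rewrite {1}/L; move: A1; lra.
exists L, ell, Th; split=> //; split=> //.
- move=> l; have [_ [e0 e00 cf]] := tW l; exists e0 => // om B eps J U f g cv ee x.
 have := cf om B eps J U f g cv ee (L *: x). have UU : UltraFilter U by case: cv.
 move=> h; rewrite /Th; under eq_fun do rewrite mxE; rewrite mxE. by apply: cvgM => //; exact: cvg_cst.
move=> Z chi hchi.
have [E1 _ _] := gat_chi r1 C0 ler01 tid tlamf hchi sid cs t0 tw sw.
have GW := tame_Dc r1 C0 ler01 tW sW.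
have z1 : 0 <= 4 * (n%:R * C * 2 * (7 / 8)) * (1 / 4) by nonneg.
have z2 : 0 <= 4 * (n%:R * 2 * (7 / 8)) * (1 / 4) :> R by [].
have s1 := @ev_scale R n r m L C ell _ 1 z1 ltr01.
have s2 := @ev_scale R n r m L C ell _ 1 z2 ltr01.
apply: ev_imp (ev_and (ev_and E1 GW) (ev_and (ev_and disp_Th supp_Th) (ev_and (ev_and s1 s2) (ev_small _ _ _ _ _ ltr01)))).
move=> om B eps phi gd eps0 _ [[{}E1 {}GW] [[{}disp_Th {}supp_Th] [[{}s1 {}s2] eps1]]].
have [cal _ _] := gd.
have e4 : 0 <= eps / 4 by nonneg.
have GTh : G r (fun x => x + Th phi x).
 apply: (@Dc_near_id R n r L C om B _ 1 (eps / 4) (7 / 8)) => //.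
 - by lra.
 - by lra.
split=> //.
have ThW : (fun x => x + L *: Th phi (L^-1 *: x)) = (fun x => x + W phi x).
 by apply/funext => x; rewrite /Th !scalerKV ?gt_eqF.
have smTh x : `|Th phi x| <= 1 by apply: le_trans (disp_norm cal _ _ disp_Th) _ => //; move: eps1; lra.
have := @chi_dilate R n r Z chi (Th phi) L 1 hchi L1.
rewrite ThW => H; rewrite -(H GW GTh supp_Th smTh) E1 addrA.
have zE (f : V -> V) : (forall x, f x = x) -> chi f = 0.
 by move=> fE; rewrite (_ : f = id) ?(chi_id hchi) //; apply/funext.
rewrite (zE (fun x => x + 0)) ?add0r; last by move=> x; rewrite addr0.
rewrite (zE (fun x => x + 0 *: _)) ?subr0; last by move=> x; rewrite scale0r addr0.
congr chi; apply/funext => x; rewrite add0r /lamf big_const_seq count_predT iter_addr_0 -/N -[_ *+ _]mulr_natr.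
by rewrite mulVf ?scale1r // gt_eqF.
Qed.

End contraction_low.

Section fixed_point_argument.
Context {R : realType} {n : nat}.
Local Notation V := 'rV[R]_n.
Local Notation G r := (@Diffc0 R n r).

Lemma Nb_dilate_sup r r0 (phi : V -> V) (a b e0 : R) s l x : 0 < a -> 0 <= e0 -> le_reg r0 r -> Crv r phi ->
 (forall s l x, (size s <= r0)%N -> `|pderiv s (fun y => phi y 0 l) x| <= e0) ->
 (size s <= r0)%N -> `|pderiv s (fun y => b * phi (a *: y) 0 l) x| <= `|b| * (a ^+ size s * e0).
Proof.
move=> a0 e00 r0r cphi He sr.
have N0 : Nb setT (fun=> 2) r0 (fun=> e0) (fun y => phi y 0 l).
 apply: Nb_sup_pderiv => [s' y _ s'r|s' y _ s'r]; first exact: He.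
 have := @Ckp_iter R n [set 0] 1 (map (@basis_vec R n) s') (fun _ y => phi y 0 l).
 rewrite size_map => H; have [|_ [df _]] := H; last exact: (df 0).
 apply: cphi; rewrite /= add1n; case: (r) r0r => //= m; exact: leq_trans.
have := @Nb_affine R n (fun=> 2) r0 (fun=> e0) (fun y => phi y 0 l) a 1 0 (fun _ => ler0n R 2) (lexx _).
move=> H; have {H} := H (fun t _ => _) (fun _ => e00) N0; move=> H.
have h2 : 2 <= 1 * 2 :> R by lra.
have := Nb_pderiv_sup (s := s) (x := x) (Nb_scale b openT (H h2)) sr I.
rewrite (gtr0_norm a0); congr (`|pderiv s _ x| <= _); last by rewrite mul1r.
by apply/funext => y; rewrite addr0.
Qed.

Section small.
Context (r : regularity) (r0 : nat) (L : R) (ell : nat -> R) (Th : (V -> V) -> V -> V).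
Hypotheses (r0_gt0 : (0 < r0)%N) (r0r : le_reg r0 r) (L2 : 2 <= L).
Let C : R := leib_const r0.
Hypothesis cTh : @contracts R n r r0 L C ell Th.
Let r1 : le_reg 1 r. Proof. by case: (r) r0r => //= m; exact: leq_trans. Qed.
Let C0 : 0 <= C. Proof. exact: leib_const0. Qed.

Lemma chi_small (Z : zmodType) (chi : (V -> V) -> Z) : additive_on r chi ->
 exists2 e0 : R, 0 < e0 & forall phi : V -> V, Crv r phi -> (forall x, 1 < `|x| -> phi x = 0) ->
  (forall s l x, (size s <= r0)%N -> `|pderiv s (fun y => phi y 0 l) x| <= e0) ->
  G r (fun x => x + phi x) /\ chi (fun x => x + phi x) = 0.
Proof.
move=> hchi; have [cT dT sT chT] := cTh.
have [ec ec0 hc] := ctvP cT.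
have tid := @tame_id R n r r0 L C ell.
have sid : @csupp R n r r0 L C ell id by exists 1; apply: ev_true => om B eps phi _ _ [].
have Gid := tame_Dc r1 C0 ler01 tid sid.
have z1 : 0 <= n%:R * C * 8 by nonneg.
have z2 : 0 <= n%:R :> R by [].
have s1 := @ev_scale R n r r0 L C ell _ (1 / 7) z1 ltac:(lra).
have s2 := @ev_scale R n r r0 L C ell _ 1 z2 ltr01.
have [e1 e10 he] := ev_and (ev_and dT (ev_and sT (chT Z chi hchi))) (ev_and Gid (ev_and s1 s2)).
pose eps : R := Num.min e1 ec / 4.
have m0 : 0 < Num.min e1 ec by rewrite lt_min e10.
have eps0 : 0 < eps by nonneg.
have E4 : 4 * eps = Num.min e1 ec by rewrite /eps; field.
have Ee1 : 0 <= 4 * eps <= e1 by rewrite E4 ge_min lexx ltW.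
have Eec : 0 <= 4 * eps <= ec by rewrite E4 ge_min lexx orbT ltW.
clearbody eps.
have q87 : (0 : R) < 8 / 7 by [].
have p87 : (0 : R) < (8 / 7) ^+ r0 by [].
exists (eps / (8 / 7) ^+ r0); first exact: divr_gt0.
move=> phi cphi sphi dphi.
pose phi' x := phi ((8 / 7) *: x).
have cphi' : Crv r phi'.
 move=> k kr l; apply: (Ckp_comp (G := fun _ x => (8 / 7) *: x) (cphi k kr l)) => l'.
 apply: (Ckp_ext _ (Ckp_scale (8 / 7) (Ckp_coord _ _ l'))) => t _. by apply/funext => x; rewrite mxE.
have sphi' x : 1 < `|x| -> phi' x = 0.
 move=> x1; apply: sphi; rewrite normrZ gtr0_norm //. by lra.
have dphi' s l x : (size s <= r0)%N -> `|pderiv s (fun y => phi' y 0 l) x| <= eps.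
 move=> sr; have e'0 : 0 <= eps / (8 / 7) ^+ r0 by nonneg.
 rewrite (_ : (fun y => phi' y 0 l) = (fun y => 1 * phi ((8 / 7) *: y) 0 l)); last first.
  by apply/funext => y; rewrite mul1r.
 apply: le_trans (Nb_dilate_sup 1 _ _ q87 e'0 r0r cphi dphi sr) _.
 rewrite normr1 mul1r mulrA ler_pdivrMr // mulrC ler_pM2l //. by apply: ler_weXn2l => //; lra.
have [om [B [cal B1 Bell]]] := @class_exists R n r r0 L eps 1 ell phi' r0_gt0 r0r L2 eps0 cphi' sphi' dphi'.
move=> dis'; have gd : good r0 L C ell om B by [].
have om0 := modulus_ge0 (calc_mod cal).
have B0 j : 0 <= B j by have [h _ _] := calc_wt cal; apply: le_trans (h j).
have q78 : (0 : R) < 7 / 8 by [].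
have q780 : (0 : R) <= 7 / 8 by [].
have q781 : (7 / 8 : R) <= 1 by lra.
have eps00 := ltW eps0.
have dis : disp r om B eps (7 / 8) phi.
 move=> k l kr; have := @Nb_affine R n om k (fun j => eps * B j * 1 ^+ j) (fun x => phi' x 0 l) (7 / 8) 1 0 om0 (lexx _).
 rewrite (gtr0_norm q78) => H; have {H} := H _ _ (dis' k l kr) => H.
 have {H} : Nb setT om k (fun j => 1 * (7 / 8) ^+ j * (eps * B j * 1 ^+ j)) (fun x => phi' ((7 / 8) *: x + 0) 0 l).
  apply: H => [t t0'|j]; last by nonneg.
  rewrite mul1r; apply: (modulus_mono (calc_mod cal)); first by nonneg. by lra.
 apply: Nb_eq => [j|x]; first by rewrite expr1n; ring.
 rewrite /phi' addr0 scalerA (_ : 8 / 7 * (7 / 8) = 1) ?scale1r //; by field.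
have dis1 : disp r om B (4 * eps) 1 phi by apply: (disp_mono cal) dis => //; lra.
pose fld (z : V * 'I_n -> R) (x : V) : V := \row_l z (x, l).
pose X : set (V * 'I_n -> R) := [set z | disp r om B eps (7 / 8) (fld z) /\ forall x, 1 < `|x| -> fld z x = 0].
pose Gam (u : V -> V) (x : V) : V := u x + phi (x + u x).
have [_ [_ [small1 small2]]] := he om B (4 * eps) phi gd Ee1 (conj dis1 sphi).
have uGam z : X z -> unit_field r om B (4 * eps) (Gam (fld z)).
 move=> [dz sz]; have dz1 : disp r om B eps 1 (fld z) by apply: (disp_mono cal) dz.
 split; last by move=> x x1; rewrite /Gam sz // addr0 sphi // addr0. have q1 : 1 <= 8 / 7 :> R by lra.
 have c1 : 1 + n%:R * C * eps * (7 / 8 * (8 / 7)) <= 8 / 7 by lra.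
 have c2 : n%:R * (eps * (7 / 8 * (8 / 7))) <= 1 by lra.
 have dz' : disp r om B eps (7 / 8 * (8 / 7)) (fld z) by rewrite (_ : 7 / 8 * (8 / 7) = 1) //; field.
 have := disp_comp r1 cal eps00 eps00 q78 q1 c1 c2 dis dz'.
 rewrite (_ : 7 / 8 * (8 / 7) = 1); last by field.
 move=> h; have := disp_add dz1 h; apply: (disp_mono cal) => //; lra.
pose theta (z : V * 'I_n -> R) : V * 'I_n -> R := fun p => Th (Gam (fld z)) p.1 0 p.2.
have fldth z : fld (theta z) = Th (Gam (fld z)) by apply/funext => x; apply/rowP => l; rewrite mxE.
have sumfld (I : finType) (a : I -> R) (y : I -> V * 'I_n -> R) x :
  fld (fun t => \sum_i a i * y i t) x = \sum_i a i *: fld (y i) x.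
 by apply/rowP => l; rewrite summxE mxE; apply: eq_bigr => i _; rewrite !mxE.
have [u [du su] uE] : exists2 z, X z & theta z = z.
 apply: (@schauder_fp R (V * 'I_n) X theta eps).
 - exists (fun=> 0); rewrite /X /=; have -> : fld (fun=> 0) = (fun=> 0).
   by apply/funext => x; apply/rowP => l; rewrite !mxE.
  by split=> //; apply: (disp0 cal).
 - move=> I a y [a0 a1] Xy; split; last first.
   by move=> x x1; rewrite sumfld big1 // => i _; rewrite (Xy i).2 // scaler0.
  move=> k l kr; have := @Nb_sum R n I (index_enum I) setT om k (fun i j => a i * (eps * B j * (7 / 8) ^+ j)) (fun i x => a i * fld (y i) x 0 l) om0 openT.
  move=> H; have {H} : Nb setT om k (fun j => \sum_i a i * (eps * B j * (7 / 8) ^+ j)) (fun x => \sum_i a i * fld (y i) x 0 l).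
   by apply: H => i; have := Nb_scale (a i) openT ((Xy i).1 k l kr); rewrite ger0_norm.
  apply: Nb_eq => [j|x]; first by rewrite -mulr_suml a1 mul1r.
  by rewrite sumfld summxE; apply: eq_bigr => i _; rewrite !mxE.
 - move=> z [x l] [dz _]; have := disp_norm cal x eps00 dz; apply: le_trans.
  by have := coord_le (fld z x) l; rewrite mxE.
 - move=> J U f g UU Xf fg; split=> [k l kr|x x1].
   apply: (@Nb_ultra R n J U UU om k _ (fun j x => fld (f j) x 0 l)).
   + exact: modulus_mono (calc_mod cal).
   + exact: calc_van cal.
   + by apply: filterS Xf => j [h _]; exact: h.
   + move=> x; rewrite mxE; have := fg (x, l); apply: cvg_trans; apply: near_eq_cvg.
    by apply: nearW => j; rewrite mxE.
  apply/rowP => l; rewrite !mxE. have := cvg_norm_le (U := U) (M := 0) (fg (x, l)) => H.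
  apply/eqP; rewrite -normr_le0; apply: H; apply: filterS Xf => j [_ /(_ x x1)/rowP/(_ l)].
  by rewrite !mxE => ->; rewrite normr0.
 - move=> z Xz; have [[h1 [h2 _]] _] := he om B (4 * eps) _ gd Ee1 (uGam z Xz). split; rewrite fldth //.
  by move: h1; rewrite (_ : 4 * eps / 4 = eps) //; field.
 - move=> J U f g UU Xf Xg fg [x l] /=.
  apply: (hc om B (4 * eps) J U (fun j => Gam (fld (f j))) (Gam (fld g))) => //. split=> //.
  + by apply: filterS Xf => j; exact: uGam.
  + exact: uGam.
  + have fg' y i : (fun j => fld (f j) y 0 i) @ U --> fld g y 0 i.
    rewrite mxE; have := fg (y, i); apply: cvg_trans; apply: near_eq_cvg.
    by apply: nearW => j; rewrite mxE.
   move=> y i; rewrite /Gam mxE; under eq_fun do rewrite mxE. apply: cvgD; first exact: fg'.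
   have sc1 : sc r om B eps (7 / 8) (fun x => phi x 0 i) by move=> k; exact: dis.
   apply: (@ultra_lip_cvg R n J U (fun _ x => phi x 0 i) (fun j => y + fld (f j) y) (y + fld g y) _ (n%:R * (eps * (7 / 8)))) => //.
   * by apply: nearW => j a b; apply: (sc_lip r1 a b gd sc1).
   * exact: cvg_cst.
   * move=> i'; rewrite mxE; under eq_fun do rewrite mxE.
    by apply: cvgD; [exact: cvg_cst|exact: fg'].
have [_ [Gphi _]] := he om B (4 * eps) phi gd Ee1 (conj dis1 sphi).
split=> //.
have [[_ [_ [GTh chiTh]]] _] := he om B (4 * eps) _ gd Ee1 (uGam u (conj du su)).
have uT : Th (Gam (fld u)) = fld u by rewrite -fldth uE.
move: chiTh GTh; rewrite uT => E Gu.
have := hchi _ _ Gphi Gu; rewrite (_ : _ \o _ = (fun x => x + Gam (fld u) x)); last first.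
 by apply/funext => x; rewrite /= /Gam addrA.
by rewrite -E => /eqP; rewrite -subr_eq subrr eq_sym => /eqP.
Qed.

End small.

End fixed_point_argument.

Section perfectness.
Context {R : realType} {n : nat}.
Local Notation V := 'rV[R]_n.
Local Notation e := (@basis_vec R n).
Local Notation G r := (@Diffc0 R n r).

Lemma locally_constant_unit (T : Type) (h : R -> T) :
 (forall t, 0 <= t <= 1 -> exists2 d : R, 0 < d & forall s, 0 <= s <= 1 -> `|t - s| < d -> h s = h t) -> h 1 = h 0.
Proof.
move=> H; pose S := [set t : R | 0 <= t <= 1 /\ forall s, 0 <= s <= t -> h s = h 0].
have S0 : S 0 by split=> [|s /andP[s0 s0']]; [rewrite lexx ler01|congr h; apply/eqP; rewrite eq_le s0 s0'].
have Sub t : S t -> t <= 1 by case=> /andP[].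
have hS : has_sup S by split; [exists 0|exists 1 => t /Sub].
pose c := sup S.
have c01 : 0 <= c <= 1.
 by apply/andP; split; [apply: sup_upper_bound => //|apply: ge_sup; [exists 0|move=> t /Sub]].
have [d d0 Hd] := H c c01.
have [t [t01 St] ct] := sup_adherent d0 hS; rewrite -/c in ct.
have tc : t <= c by apply: sup_upper_bound.
have hc : h c = h 0.
 rewrite -(Hd t) // ?ger0_norm ?subr_ge0 //; last by rewrite ltrBlDr -ltrBlDl.
 by apply: St; rewrite lexx andbT; case/andP: t01.
have all s : 0 <= s <= 1 -> s <= c + d / 2 -> h s = h 0.
 move=> s01 sc; have [st|ts] := leP s t; first by apply: St; rewrite st andbT; case/andP: s01.
 rewrite Hd // ltr_norml; move: ct ts sc d0; lra.
have [c1|c1] := leP 1 (c + d / 2).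
 by apply: all => //; rewrite lexx ler01.
have Sc : S (c + d / 2).
 split=> [|s /andP[s0 sc]]; first by move: c01 c1 d0; lra.
 by apply: all => //; rewrite s0 (le_trans sc) // ltW.
exfalso; have := sup_upper_bound hS Sc; rewrite -/c; move: d0; lra.
Qed.

Lemma jcont_uniform A (h : R -> V -> R) (t0 M eps : R) : A t0 -> jcont A h ->
 (forall x, h t0 x = 0) -> (forall t x, A t -> M < `|x| -> h t x = 0) -> 0 < eps ->
 exists2 d : R, 0 < d & forall t x, A t -> `|t0 - t| < d -> `|h t x| <= eps.
Proof.
move=> At0 jc h0 hM eps0; apply/not_exists2P => H.
have /choice[s Hs] : forall N : nat, exists tx : R * V, [/\ A tx.1, `|t0 - tx.1| < N.+1%:R^-1 & eps < `|h tx.1 tx.2|].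
 move=> N; apply: contrapT => H'; case: (H N.+1%:R^-1) => [|[]]; first by nonneg.
 move=> t x At td. by rewrite leNgt; apply/negP => lt; apply: H'; exists (t, x).
have [U UU sU] := ultra_nat.
have bd N : `|(s N).2| <= M.
 have [At _ lt] := Hs N; rewrite leNgt; apply/negP => /(hM _ _ At) E.
 by move: lt; rewrite E normr0 ltNge ltW.
have /choice[l Hl] : forall i, exists l : R, (fun N => (s N).2 0 i : R) @ U --> l.
 move=> i; apply: (@ultra_cvg _ _ U UU _ M); apply: nearW => N.
 exact: le_trans (coord_le _ _) (bd N).
pose x : V := \row_i l i.
have [d d0 Hd] := jc t0 x eps At0 eps0.
have nx : \forall N \near U, forall i, `|l i - (s N).2 0 i| <= d / 2.
 apply: filter_forall => i; have /cvgrPdist_le/(_ (d / 2)) := Hl i; apply; exact: divr_gt0.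
have nt : \forall N \near U, N.+1%:R^-1 < d.
 by apply: sU; have /cvgrPdist_lt/(_ _ d0) := @cvg_harmonic R; apply: filterS => N; rewrite /harmonic sub0r normrN ger0_norm ?invr_ge0.
have [N [h1 h2]] := filter_ex (filterI nx nt).
have [At td lt] := Hs N; have := Hd _ (s N).2 At (lt_trans td h2).
rewrite h0 sub0r normrN leNgt lt => H'; apply: notF; apply: H'.
apply: (@le_lt_trans _ _ (d / 2)); last by move: d0; lra.
by apply: le_coord => [|i]; [rewrite divr_ge0 // ltW|rewrite !mxE].
Qed.

Lemma Ckp_uniform A k (F : R -> V -> R) (t0 M eps : R) : A t0 -> Ckp A k F ->
 (forall x, F t0 x = 0) -> (forall t x, A t -> M < `|x| -> F t x = 0) -> 0 < eps ->
 exists2 d : R, 0 < d & forall t s x, A t -> `|t0 - t| < d -> (size s <= k)%N -> `|pderiv s (F t) x| <= eps.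
Proof.
move=> At0 + + + eps0; elim: k F => [|k IH] F CF F0 FM.
 have [d d0 Hd] := jcont_uniform At0 (Ckp_cont CF) F0 FM eps0.
 by exists d => // t [|//] x At td _; exact: Hd.
have [d d0 Hd] := jcont_uniform At0 (Ckp_cont CF) F0 FM eps0.
have [_ [_ DF]] := CF.
have /choice[di Hdi] : forall i, exists d' : R, 0 < d' /\ forall t s x, A t -> `|t0 - t| < d' ->
  (size s <= k)%N -> `|pderiv s ('D_(e i) (F t)) x| <= eps.
 move=> i; have [] := IH _ (DF i) => [x|t x At Mx|d' d'0 h]; last by exists d'.
  have -> : F t0 = fun=> 0 by apply/funext. by rewrite derive_cst.
 by apply: (derive_out (M := M)) => // y; exact: FM.
exists (\big[Num.min/d]_i di i); first by apply: lt_bigmin => // i _; case: (Hdi i).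
move=> t s x At td; case: (lastP s) => [_|{}s i].
 by apply: Hd => //; apply: lt_le_trans td _; exact: bigmin_le_id.
rewrite size_rcons pderiv_rcons ltnS => sk; apply: (Hdi i).2 => //.
by apply: lt_le_trans td _; exact: bigmin_le_cond.
Qed.

Lemma Dc_isotopy r (K : set V) F t : compact K -> isotopy_in r K F -> F 0 = id -> 0 <= t <= 1 -> G r (F t).
Proof.
move=> cK /isotopyP[dF sF] F0 t01; exists K, (fun s => F (s * t)); split=> //; last first.
- by rewrite mul1r.
- by rewrite mul0r.
have st s : 0 <= s <= 1 -> 0 <= s * t <= 1 by case/andP: t01 => t0 t1 /andP[s0 s1]; rewrite mulr_ge0 //= mulr_ile1.
apply/isotopyP; split=> [s /st|k kr l]; first exact: dF.
apply: (@Ckp_reparam _ _ unit_itv _ k (fun t x => F t x 0 l) (fun s => s * t)) => //.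
- move=> s; apply: cvgM; [exact: cvg_id|exact: cvg_cst].
- exact: sF.
Qed.

Section smooth_case.
Context (r : regularity) (r0 : nat) (L : R) (ell : nat -> R) (Th : (V -> V) -> V -> V).
Hypotheses (r0_gt0 : (0 < r0)%N) (r0r : le_reg r0 r) (L2 : 2 <= L) (cTh : @contracts R n r r0 L (leib_const r0) ell Th).

Lemma chi_small_ball (Z : zmodType) (chi : (V -> V) -> Z) (M : R) : additive_on r chi -> 1 <= M ->
 exists2 e0 : R, 0 < e0 & forall phi : V -> V, Crv r phi -> (forall x, M < `|x| -> phi x = 0) ->
  (forall s l x, (size s <= r0)%N -> `|pderiv s (fun y => phi y 0 l) x| <= e0) ->
  G r (fun x => x + phi x) -> chi (fun x => x + phi x) = 0.
Proof.
move=> hchi M1; have [e1 e10 He1] := chi_small r0_gt0 r0r L2 cTh hchi.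
have M0 : 0 < M by lra.
have m0 : 0 < Num.min e1 1 by rewrite lt_min e10 ltr01.
have p0 : 0 < M ^+ r0 by nonneg.
exists (Num.min e1 1 / M ^+ r0); first exact: divr_gt0.
move=> phi cphi sphi dphi Gphi.
pose phi' x := M^-1 *: phi (M *: x).
have Mi0 : 0 < M^-1 by nonneg.
have cphi' : Crv r phi'.
 move=> k kr l; have h : Ckp [set 0] k (fun _ x => phi (M *: x) 0 l).
  apply: (Ckp_comp (G := fun _ x => M *: x) (cphi k kr l)) => l'.
  apply: (Ckp_ext _ (Ckp_scale M (Ckp_coord _ _ l'))) => t _. by apply/funext => x; rewrite mxE.
 apply: (Ckp_ext _ (Ckp_scale M^-1 h)) => t _. by apply/funext => x; rewrite mxE.
have sphi' x : 1 < `|x| -> phi' x = 0 by move=> x1; rewrite /phi' sphi ?scaler0 // normrZ gtr0_norm // ltr_pMr.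
have dphi' s l x : (size s <= r0)%N -> `|pderiv s (fun y => phi' y 0 l) x| <= Num.min e1 1.
 move=> sr; have e'0 : 0 <= Num.min e1 1 / M ^+ r0 by nonneg.
 rewrite (_ : (fun y => phi' y 0 l) = (fun y => M^-1 * phi (M *: y) 0 l)); last first.
  by apply/funext => y; rewrite mxE.
 apply: le_trans (Nb_dilate_sup M^-1 _ _ M0 e'0 r0r cphi dphi sr) _; rewrite (gtr0_norm Mi0).
 apply: (@le_trans _ _ (M ^+ size s * (Num.min e1 1 / M ^+ r0))).
  by rewrite ler_piMl ?invf_le1 // mulr_ge0 // exprn_ge0 // ltW.
 by rewrite mulrA ler_pdivrMr // mulrC ler_pM2l //; apply: ler_weXn2l.
have small x : `|phi' x| <= 1.
 apply: le_coord => // l; have := dphi' [::] l x isT; rewrite le_min => /andP[_]; exact.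
have [s l x sr|Gphi' chi'] := He1 phi' cphi' sphi'.
 by have := dphi' s l x sr; rewrite le_min => /andP[].
have := @chi_dilate R n r Z chi phi' M 1 hchi M1.
rewrite (_ : (fun x => x + M *: phi' (M^-1 *: x)) = (fun x => x + phi x)); last first.
 by apply/funext => x; rewrite /phi' !scalerKV ?gt_eqF.
by move=> -> //.
Qed.

Lemma perfect_smooth (Z : zmodType) (chi : (V -> V) -> Z) : additive_on r chi -> forall f, G r f -> chi f = 0.
Proof.
move=> hchi f [K [F [cK iF F0 F1]]]; have [dF sF] := (isotopyP _ _ _).1 iF.
have GF t := @Dc_isotopy r K F t cK iF F0.
have [M0 [_ HM]] := compact_bounded cK.
pose M := Num.max 1 (M0 + 1).
have M1 : 1 <= M by rewrite le_max lexx.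
have supF t x : 0 <= t <= 1 -> M < `|x| -> F t x = x.
 move=> t01 xM; have [_ s] := dF t t01; apply: s => Kx.
 have : M0 < M by rewrite lt_max ltrDl ltr01 orbT.
 by move=> MM; have /= := HM M MM x Kx; rewrite leNgt xM.
rewrite -F1 -(chi_id hchi) -F0; apply: (@locally_constant_unit _ (chi \o F)) => t t01 /=.
have [e0 e00 He0] := chi_small_ball hchi M1.
have [g [Gg Fg gF]] := Dc_inv (GF t t01).
have cg : Crv r g by have [] := (diffeoP _ _).1 (Dc_diffeo Gg).
have supg x : M < `|x| -> g x = x by move=> xM; rewrite -[in LHS](supF t x t01 xM) Fg.
pose phi s x : V := F s (g x) - x.
have Cphi k l : le_reg k r -> Ckp unit_itv k (fun s x => phi s x 0 l).
 move=> kr; have cg' : Ckpv unit_itv k (fun=> g).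
  move=> m; apply: (@Ckp_reparam _ _ [set 0] unit_itv k (fun t x => g x 0 m) (fun=> 0)) => //.
   exact: cst_continuous.
  exact: cg.
 have h1 := Ckp_comp (sF k kr l) cg'.
 apply: (Ckp_ext _ (Ckp_add h1 (Ckp_scale (-1) (Ckp_coord _ _ l)))) => s _.
 by apply/funext => x; rewrite /phi /= !mxE mulN1r.
have /choice[d Hd] : forall l, exists d' : R, 0 < d' /\ forall s u x, unit_itv s -> `|t - s| < d' -> (size u <= r0)%N ->
  `|pderiv u (fun x => phi s x 0 l) x| <= e0.
 move=> l; have [] := @Ckp_uniform unit_itv r0 (fun s x => phi s x 0 l) t M e0 t01 (Cphi r0 l r0r) _ _ e00.
 - by move=> x; rewrite /phi gF subrr mxE.
 - by move=> s x s01 xM; rewrite /phi supg // supF // subrr mxE.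
 - by move=> d' d'0 h; exists d'.
exists (\big[Num.min/1]_l d l); first by apply: lt_bigmin => // l _; case: (Hd l).
move=> s s01 ts.
have E : (fun x => x + phi s x) = F s \o g by apply/funext => x; rewrite /phi addrC subrK.
have GE : G r (F s \o g) by apply: Dc_comp => //; exact: GF.
have : chi (F s \o g) = 0.
 rewrite -E; apply: He0; rewrite ?E //.
 - move=> k kr l; apply: (@Ckp_reparam _ _ unit_itv [set 0] k (fun s x => phi s x 0 l) (fun=> s)) => //.
   exact: cst_continuous.
  exact: Cphi.
 - by move=> x xM; rewrite /phi supg // supF // subrr.
 - move=> u l x ur; apply: (Hd l).2 => //; apply: lt_le_trans ts _; exact: bigmin_le_cond.
have E2 : F s = (F s \o g) \o F t by apply/funext => x /=; rewrite Fg.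
by move=> chi0; rewrite [in LHS]E2 hchi ?chi0 ?add0r //; exact: GF.
Qed.

End smooth_case.

End perfectness.

Section homeomorphisms.
Context {R : realType} {n : nat}.
Local Notation V := 'rV[R]_n.
Local Notation G r := (@Diffc0 R n r).

Lemma Crv0 (f : V -> V) : continuous f -> Crv (Some 0%N) f.
Proof. by move=> cf [|//] _ l; split=> //; apply/jcont_continuous; exact: coord_cont. Qed.

Lemma Dc_cont r (f : V -> V) : G r f -> continuous f.
Proof.
move=> Gf; have r0 : le_reg 0 r by case: (r) => [[]|].
have [cf _] := (diffeoP _ _).1 (Dc_diffeo Gf).
by apply: continuous_coords => l; apply/jcont_continuous; exact: Ckp_cont (cf 0%N r0 l).
Qed.

(* The Alexander trick: the isotopy is F_t x = t f (x / t). *)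
Lemma alexander (f g : V -> V) (M : R) : continuous f -> continuous g ->
 cancel f g -> cancel g f -> (forall x, M < `|x| -> f x = x) -> G (Some 0%N) f.
Proof.
move=> cf cg fg gf sf.
have sg x : M < `|x| -> g x = x by move=> xM; rewrite -[in LHS](sf x xM) fg.
pose F t x : V := t *: f (t^-1 *: x) + (t == 0)%:R *: x.
have F0 : F 0 = id by apply/funext => x; rewrite /F scale0r eqxx scale1r add0r.
have Fn t : t != 0 -> F t = (fun x => t *: f (t^-1 *: x)).
 by move=> /negbTE t0; apply/funext => x; rewrite /F t0 scale0r addr0.
have cont t (h : V -> V) : continuous h -> continuous (fun x : V => t *: h (t^-1 *: x)).
 move=> ch x; apply: (@cvgZr _ _ _ _ (nbhs_filter x)).
 apply: (@continuous_comp _ _ _ (fun x : V => t^-1 *: x) h); last exact: ch. exact: scaler_continuous.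
have [C C0 HC] : exists2 C : R, 0 <= C & forall x, `|f x - x| <= C.
 have /choice[b Hb] : forall l, exists b : R, 0 <= b /\ forall x, `|(f x - x) 0 l| <= b.
  move=> l; have [] := @csupp_uniform R n (fun x => (f x - x) 0 l) M.
  - apply: (@coord_cont R n (fun x => f x - x)) => x.
   by apply: (@cvgB _ _ _ _ (nbhs_filter x)); [exact: cf|exact: cvg_id].
  - by move=> x xM; rewrite sf // subrr mxE.
  - by move=> [b b0 hb] _; exists b.
 have S0 : 0 <= \sum_l b l by apply: sumr_ge0 => l _; case: (Hb l).
 exists (\sum_l b l) => // x; apply: le_coord => // l.
 apply: le_trans ((Hb l).2 x) _; rewrite (bigD1 l) //= lerDl. by apply: sumr_ge0 => i _; case: (Hb i).
pose K := [set x : V | `|x| <= M].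
exists K, F; split=> //; last by rewrite Fn ?oner_eq0 //; apply/funext => x; rewrite invr1 !scale1r.
 exact: ball_compact.
apply/isotopyP; split=> [t /andP[t0 t1]|[|//] _ l].
 case: (eqVneq t 0) => [->|tn0].
  by rewrite F0; split=> //; apply: Dc_diffeo; exact: Dc_id.
 have tp : 0 < t by lra. split; last first.
  move=> x /negP; rewrite -ltNge => xM; rewrite Fn // sf ?scalerKV //.
  have [M0|M0] := ltP M 0; first by apply: lt_le_trans M0 _.
  rewrite normrZ gtr0_norm ?invr_gt0 //; apply: lt_le_trans xM _. by rewrite ler_peMl // invf_ge1.
 apply/diffeoP; rewrite Fn //; split; first by apply: Crv0; exact: cont.
 exists (fun x => t *: g (t^-1 *: x)); split.
 - by move=> x; rewrite scalerK // fg scalerKV.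
 - by move=> x; rewrite scalerK // gf scalerKV.
 - by apply: Crv0; exact: cont.
split=> // t x eps /andP[t0 t1] eps0; rewrite /=.
case: (eqVneq t 0) => [->|tn0].
 pose d := eps / (C + 2). have C2 : 0 < C + 2 by lra. have d0 : 0 < d by nonneg.
 exists d => // s y /andP[s0 s1]; rewrite sub0r normrN ger0_norm // => sd xy.
 have -> : F 0 x 0 l - F s y 0 l = (x - y - (F s y - y)) 0 l by rewrite F0 !mxE; ring.
 apply: le_trans (coord_le _ l) _; apply: le_trans (ler_normB _ _) _.
 have h : `|F s y - y| <= C * d.
  case: (eqVneq s 0) => [->|sn0].
   by rewrite F0 subrr normr0 mulr_ge0 // ltW.
  have -> : F s y - y = s *: (f (s^-1 *: y) - s^-1 *: y) by rewrite Fn // scalerBr scalerKV.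
  rewrite normrZ ger0_norm // mulrC; apply: ler_pM => //; exact: ltW.
 have : eps = C * d + 2 * d by rewrite -mulrDl /d mulrC divfK // gt_eqF. move: xy h d0; lra.
have tp : 0 < t by lra.
pose A := [set s : R | t / 2 < s].
pose ph s : R := (Num.max s (t / 2))^-1.
have t2 : 0 < t / 2 by nonneg.
have cph : continuous ph.
 move=> s; apply: cvgV; first by rewrite gt_eqF // lt_max t2 orbT.
 apply: (@continuous_max _ _ (fun s : R => s) (fun=> t / 2)); first exact: cvg_id. exact: cvg_cst.
have Cph : Ckp A 0 (fun s (_ : V) => ph s).
 exact: (@Ckp_reparam _ _ setT A 0 (fun s _ => s) ph cph (fun _ _ => I) (Ckp_param _ _)).
have Cf : Ckp A 0 (fun _ y => f y 0 l).
 apply: (@Ckp_reparam _ _ [set 0] A 0 (fun _ y => f y 0 l) (fun=> 0)) => //.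
  exact: cst_continuous.
 exact: (Crv0 cf).
have [jcG _] : Ckp A 0 (fun s y => s * f (ph s *: y) 0 l).
 apply: Ckp_mul; first exact: Ckp_param. apply: (Ckp_comp (G := fun s y => ph s *: y) Cf) => l'.
 apply: (Ckp_ext _ (Ckp_mul Cph (Ckp_coord _ _ l'))) => s _. by apply/funext => y; rewrite mxE.
have At : A t by rewrite /A /=; move: tp; lra.
have [d d0 Hd] := jcG t x eps At eps0.
exists (Num.min d (t / 2)); first by rewrite lt_min d0.
move=> s y /andP[s0 s1]; rewrite !lt_min => /andP[ts ts2] /andP[xy _].
have As : A s by rewrite /A /=; move: ts2; rewrite ltr_norml; lra.
have FE s' z : A s' -> F s' z 0 l = s' * f (ph s' *: z) 0 l.
 move=> As'; have sp : 0 < s' by exact: lt_trans As'. by rewrite Fn ?gt_eqF // mxE /ph max_l // ltW.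
by rewrite !FE //; exact: Hd.
Qed.

End homeomorphisms.

Section shells.
Context {R : realType} {n : nat}.
Local Notation V := 'rV[R]_n.
Variable M : R.
Hypothesis M0 : 0 < M.

Definition in_shell (k : nat) (x : V) : Prop := M < 4 ^+ k * `|x| < 4 * M.
Definition shell (x : V) : nat := xget 0%N [set k | in_shell k x].

Let p4 k : 0 < (4 : R) ^+ k. Proof. exact: exprn_gt0. Qed.

Lemma shell_uniq j k x : in_shell j x -> in_shell k x -> j = k.
Proof.
wlog jk : j k / (j <= k)%N.
 by move=> H hj hk; have [jk|/ltnW kj] := leqP j k; [exact: H|apply/esym; exact: H].
rewrite /in_shell => /andP[a _] /andP[_ b]; apply/eqP; rewrite eqn_leq jk leqNgt; apply/negP => lt.
have : (4 : R) ^+ j.+1 <= 4 ^+ k by apply: ler_weXn2l => //; rewrite ler1n.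
move=> /(ler_wpM2r (normr_ge0 x)); rewrite exprS; move: a b; move: (4 ^+ j) (4 ^+ k) `|x| => u v w.
by rewrite -mulrA; move: (u * w) (v * w) => a b; lra.
Qed.

Lemma shellE k x : in_shell k x -> shell x = k.
Proof.
by move=> h; rewrite /shell; case: xgetP => [j _ hj|/(_ k)//]; exact: shell_uniq hj h.
Qed.

(* The infinite product of the conjugates of f by the powers of x |-> x / 4. *)
Definition tele_map (f : V -> V) (x : V) : V := 4 ^- shell x *: f (4 ^+ shell x *: x).

Section one_map.
Variable f g : V -> V.
Hypotheses (fg : cancel f g) (sf : forall x, f x <> x -> M < `|x| < 4 * M).

Lemma tele_out x : (forall k, ~ in_shell k x) -> tele_map f x = x.
Proof.
move=> h; have -> : tele_map f x = f x.
 rewrite /tele_map /shell; case: xgetP => [k _ /h//|_]. by rewrite expr0 invr1 !scale1r.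
by apply: contrapT => /sf fx; apply: (h 0%N); rewrite /in_shell expr0 mul1r.
Qed.

Lemma shell_pres y : M < `|y| < 4 * M -> M < `|f y| < 4 * M.
Proof.
move=> yM; have [->//|fy] := pselect (f y = y); apply: sf => ffy.
by apply: fy; rewrite -[RHS]fg -ffy fg.
Qed.

Lemma tele_in k x : in_shell k x -> tele_map f x = 4 ^- k *: f (4 ^+ k *: x) /\ in_shell k (tele_map f x).
Proof.
move=> kx; have E : tele_map f x = 4 ^- k *: f (4 ^+ k *: x) by rewrite /tele_map (shellE kx).
split=> //; rewrite /in_shell E normrZ gtr0_norm ?invr_gt0 // mulrA mulfV ?mul1r ?gt_eqF //.
by apply: shell_pres; rewrite normrZ gtr0_norm.
Qed.

Lemma tele_norm x : `|tele_map f x| <= 4 * `|x|.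
Proof.
have [[k kx]|nk] := pselect (exists k, in_shell k x); last first.
 rewrite tele_out ?ler_peMl ?ler1n // => k kx; apply: nk; by exists k.
have [_] := tele_in kx; move: kx; rewrite /in_shell => /andP[a _] /andP[_ b].
rewrite -(ler_pM2l (p4 k)) mulrCA; move: a b; move: (4 ^+ k * `|x|) (4 ^+ k * `|tele_map f x|) => u v; lra.
Qed.

Lemma tele_sum N x : 4 * M <= 4 ^+ N * `|x| -> tele_map f x - x = \sum_(k < N) 4 ^- k *: (f (4 ^+ k *: x) - 4 ^+ k *: x).
Proof.
move=> hN; have [[k kx]|nk] := pselect (exists k, in_shell k x).
 have kN : (k < N)%N.
  rewrite ltnNge; apply/negP => Nk; move: kx; rewrite /in_shell => /andP[_].
  have : (4 : R) ^+ N <= 4 ^+ k by apply: ler_weXn2l => //; rewrite ler1n.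
  by move=> /(ler_wpM2r (normr_ge0 x)); move: hN; lra.
 rewrite (bigD1 (Ordinal kN)) //= big1 ?addr0.
  by rewrite (tele_in kx).1 scalerBr scalerK // gt_eqF.
 move=> i ik; suff -> : f (4 ^+ i *: x) = 4 ^+ i *: x by rewrite subrr scaler0.
 apply: contrapT => /sf h; move: ik; rewrite -val_eqE /= => /eqP; apply.
 by apply: shell_uniq kx; move: h; rewrite normrZ gtr0_norm.
rewrite tele_out ?subrr; last by move=> k kx; apply: nk; exists k.
rewrite big1 // => i _; suff -> : f (4 ^+ i *: x) = 4 ^+ i *: x by rewrite subrr scaler0.
apply: contrapT => /sf h; apply: nk; exists i; by move: h; rewrite normrZ gtr0_norm.
Qed.

Lemma tele_cont : continuous f -> continuous (tele_map f).
Proof.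
move=> cf x; case: (eqVneq x 0) => [->|x0].
 have E0 : tele_map f 0 = 0 by apply/eqP; rewrite -normr_le0; have := tele_norm 0; rewrite normr0 mulr0.
 apply/(@cvgrPdist_le _ _ _ _ (nbhs_filter _)) => eps eps0; rewrite E0. have e4 : 0 < eps / 4 by nonneg.
 apply/nbhs_ballP; exists (eps / 4) => //= y; rewrite -ball_normE /= sub0r normrN => y4.
 rewrite sub0r normrN; apply: le_trans (tele_norm y) _; move: y4; lra.
have nx : 0 < `|x| by rewrite normr_gt0.
have x20 : 0 < `|x| / 2 by nonneg.
pose N := (Num.truncn (4 * M / (`|x| / 2))).+1.
have hN : 4 * M <= 4 ^+ N * (`|x| / 2).
 have /andP[_ /ltW h] := truncn_itv (divr_ge0 (mulr_ge0 (ler0n R 4) (ltW M0)) (ltW x20)).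
 rewrite -ler_pdivrMr //; apply: le_trans h _; rewrite -/N -natrX ler_nat.
 by apply: ltnW; exact: ltn_expl.
clearbody N.
pose S (y : V) : V := y + \sum_(k < N) 4 ^- k *: (f (4 ^+ k *: y) - 4 ^+ k *: y).
have near_S : \forall y \near x, tele_map f y = S y.
 apply/nbhs_ballP; exists (`|x| / 2) => //= y; rewrite -ball_normE /= => xy.
 have : `|x| / 2 <= `|y| by have := ler_normD (x - y) y; rewrite subrK; move: xy; lra.
 move=> /(ler_wpM2l (ltW (p4 N))) h; have E := tele_sum (le_trans hN h).
 by rewrite /S -E addrC subrK.
have cS : continuous S.
 move=> y; apply: (@cvgD _ _ _ _ (nbhs_filter _)); first exact: cvg_id. elim: (N) => [|j IH].
  by under eq_fun do rewrite big_ord0; rewrite big_ord0; exact: cvg_cst.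
 under eq_fun do rewrite big_ord_recr /=; rewrite big_ord_recr /=.
 apply: (@cvgD _ _ _ _ (nbhs_filter _)) => //; apply: (@cvgZl_tmp _ _ _ _ (nbhs_filter _)).
 apply: (@cvgB _ _ _ _ (nbhs_filter _)); last exact: scaler_continuous.
 apply: (@continuous_comp _ _ _ (fun x : V => 4 ^+ j *: x) f); last exact: cf. exact: scaler_continuous.
apply/(@cvgrPdist_le _ _ _ _ (nbhs_filter _)) => eps eps0; rewrite (nbhs_singleton near_S).
have /(@cvgrPdist_le _ _ _ _ (nbhs_filter _))/(_ _ eps0) := cS x.
by apply: (@filterS2 _ _ (nbhs_filter _) _ _ _ _ near_S) => y ->.
Qed.

End one_map.

Lemma tele_cancel (f g : V -> V) : cancel f g -> cancel g f ->
 (forall x, f x <> x -> M < `|x| < 4 * M) -> cancel (tele_map f) (tele_map g).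
Proof.
move=> fg gf sf.
have sg x : g x <> x -> M < `|x| < 4 * M by move=> h; apply: sf => fx; apply: h; rewrite -[in LHS]fx fg.
move=> x; have [[k kx]|nk] := pselect (exists k, in_shell k x).
 have [E kE] := tele_in fg sf kx; rewrite (tele_in gf sg kE).1 E.
 by rewrite scalerKV ?gt_eqF // fg scalerK // gt_eqF.
by rewrite (tele_out sf) ?(tele_out sg) // => k kx; apply: nk; exists k.
Qed.

End shells.

Section perfect.
Context {R : realType} {n : nat}.
Local Notation V := 'rV[R]_n.
Local Notation G r := (@Diffc0 R n r).

Lemma perfect_homeo (Z : zmodType) (chi : (V -> V) -> Z) : (0 < n)%N ->
 additive_on (Some 0%N) chi -> forall f, G (Some 0%N) f -> chi f = 0.
Proof.
move=> n0 hchi f0 Gf0; have [M M0 sf0] := Dc_supp Gf0.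
have [g0 [Gg0 fg0 gf0]] := Dc_inv Gf0.
pose p : V := const_mx (5 / 2 * M).
have pn : `|p| = 5 / 2 * M.
 apply/eqP; rewrite eq_le; apply/andP; split.
  apply: le_coord => [|l]; first by nonneg; lra.
  by rewrite mxE ger0_norm // mulr_ge0 ?(ltW M0) //; lra.
 have := coord_le p (Ordinal n0); rewrite mxE ger0_norm //. by nonneg.
pose f x := p + f0 (x - p); pose g x := p + g0 (x - p).
have fg : cancel f g by move=> x; rewrite /f /g addrAC subrr add0r fg0 addrC subrK.
have gf : cancel g f by move=> x; rewrite /f /g addrAC subrr add0r gf0 addrC subrK.
have cshift (h : V -> V) : continuous h -> continuous (fun x : V => p + h (x - p) : V).
 move=> ch x; apply: (@cvgD _ _ _ _ (nbhs_filter _)); first exact: cvg_cst.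
 apply: (@continuous_comp _ _ _ (fun x : V => x - p) h); last exact: ch.
 by apply: (@cvgB _ _ _ _ (nbhs_filter _)); [exact: cvg_id|exact: cvg_cst].
have cf : continuous f by apply: cshift; exact: Dc_cont Gf0.
have cg : continuous g by apply: cshift; exact: Dc_cont Gg0.
have sf x : f x <> x -> M < `|x| < 4 * M.
 move=> fx; have xp : `|x - p| <= M.
  rewrite leNgt; apply/negP => /sf0 h; apply: fx; by rewrite /f h addrC subrK.
 have := ler_normD (x - p) p; rewrite subrK; have := ler_normB x (x - p); rewrite opprB addrC subrK.
 rewrite pn; move: xp M0; lra.
have sg x : g x <> x -> M < `|x| < 4 * M by move=> h; apply: sf => fx; apply: h; rewrite -[in LHS]fx fg.
have far x : 4 * M < `|x| -> f x = x by move=> xM; apply: contrapT => /sf; move: xM; lra.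
have Gf : G (Some 0%N) f := alexander cf cg fg gf far.
have -> : chi f0 = chi f.
 have [tau Gtau htau] := @transl_Dc R n (Some 0%N) p (M + M).
 have n0' x : f0 x <> x -> `|x| <= M by move=> h; rewrite leNgt; apply/negP => /sf0.
 have fn x : f0 x <> x -> f0 (f0 x) <> f0 x by move=> h h'; apply: h; rewrite -[RHS]fg0 -h' fg0.
 apply/esym; apply: (chi_conj hchi Gf Gf0 Gtau) => [x hx|y hy].
  rewrite !htau; last 2 first.
  - by apply: le_trans (n0' x hx) _; rewrite lerDl ltW.
  - by apply: le_trans (n0' _ (fn _ hx)) _; rewrite lerDl ltW.
  by rewrite /f addrK addrC.
 have hx : f0 (y - p) <> y - p by move=> h; apply: hy; rewrite /f h addrC subrK.
 exists (y - p) => //; rewrite htau ?subrK //. by apply: le_trans (n0' _ hx) _; rewrite lerDl ltW.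
pose F := tele_map M f; pose F' := tele_map M g.
have FF' : cancel F F' := tele_cancel fg gf sf.
have F'F : cancel F' F := tele_cancel gf fg sg.
have cF : continuous F := tele_cont M0 fg sf cf.
have cF' : continuous F' := tele_cont M0 gf sg cg.
have p1 k : 1 <= (4 : R) ^+ k by apply: exprn_ege1; rewrite ler1n.
have sF x : 4 * M <= `|x| -> F x = x.
 move=> xM; apply: (tele_out sf) => k; rewrite /in_shell => /andP[_].
 have := ler_wpM2r (normr_ge0 x) (p1 k); rewrite mul1r; move: (_ ^+ k * _) => u; move: xM; lra.
have GF : G (Some 0%N) F by apply: (alexander cF cF' FF' F'F (M := 4 * M)) => x /ltW; exact: sF.
pose F1 x := 4^-1 *: F (4 *: x); pose F1' x := 4^-1 *: F' (4 *: x).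
have four : (4 : R) != 0 by [].
have cdil (h : V -> V) : continuous h -> continuous (fun x : V => 4^-1 *: h (4 *: x) : V).
 move=> ch x; apply: (@cvgZl_tmp _ _ _ _ (nbhs_filter _)).
 apply: (@continuous_comp _ _ _ (fun x : V => 4 *: x) h); last exact: ch. exact: scaler_continuous.
have sF1 x : M <= `|x| -> F1 x = x by move=> xM; rewrite /F1 sF ?scalerK // normrZ ger0_norm // ler_pM2l.
have GF1 : G (Some 0%N) F1.
 apply: (alexander (g := F1') (M := M) (cdil _ cF) (cdil _ cF')) => x.
 - by rewrite /F1 /F1' scalerKV // FF' scalerK.
 - by rewrite /F1 /F1' scalerKV // F'F scalerK.
 - by move=> /ltW; exact: sF1.
have E : F = f \o F1.
 apply/funext => x /=; have [[k kx]|nk] := pselect (exists k, in_shell M k x).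
  rewrite /F (tele_in fg sf kx).1; case: k kx => [|k] kx.
   rewrite expr0 invr1 !scale1r sF1 //; move: kx; rewrite /in_shell expr0 mul1r => /andP[/ltW]. by [].
  have kx4 : in_shell M k (4 *: x) by move: kx; rewrite /in_shell exprSr normrZ (ger0_norm (ler0n R 4)) mulrA.
  have [Ek kE] := tele_in fg sf kx4.
  have F1E : F1 x = 4 ^- k.+1 *: f (4 ^+ k.+1 *: x) by rewrite /F1 /F Ek !scalerA exprSr invfM mulrC.
  rewrite F1E; apply/esym; apply: contrapT => /sf /andP[h _]; move: h; rewrite -F1E /F1 normrZ.
  rewrite gtr0_norm ?invr_gt0 // ltr_pdivlMl //; move: kE; rewrite /in_shell -/(F (4 *: x)) => /andP[_].
  have := ler_wpM2r (normr_ge0 (F (4 *: x))) (p1 k); rewrite mul1r; move: (_ ^+ k * _) => u; lra.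
 rewrite /F (tele_out sf) => [|k kx]; last by apply: nk; exists k. have F1x : F1 x = x.
  rewrite /F1 /F (tele_out sf) ?scalerK // => k kx; apply: nk; exists k.+1.
  by move: kx; rewrite /in_shell exprSr normrZ (ger0_norm (ler0n R 4)) mulrA.
 rewrite F1x; apply/esym; apply: contrapT => /sf h; apply: nk; exists 0%N.
 by rewrite /in_shell expr0 mul1r.
have chiF1 : chi F = chi F1.
 have four1 : (1 : R) <= 4 by lra. have [tau Gtau htau] := @dilation_Dc R n (Some 0%N) 4 M four1.
 have n1 x : F1 x <> x -> `|x| <= M by move=> h; rewrite leNgt; apply/negP => /ltW/sF1.
 have F1F1' : cancel F1 F1' by move=> x; rewrite /F1 /F1' scalerKV // FF' scalerK.
 have fn x : F1 x <> x -> F1 (F1 x) <> F1 x by move=> h h'; apply: h; rewrite -[RHS]F1F1' -h' F1F1'.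
 apply: (chi_conj hchi GF GF1 Gtau) => [x hx|y hy].
  by rewrite !htau ?n1 //; [rewrite /F1 scalerKV|exact: fn].
 have hx : F1 (4^-1 *: y) <> 4^-1 *: y by rewrite /F1 scalerKV // => /(scalerI (invr_neq0 four)).
 by exists (4^-1 *: y) => //; rewrite htau ?scalerKV // n1.
have := hchi f F1 Gf GF1; rewrite -E chiF1 => /eqP; rewrite -subr_eq subrr eq_sym => /eqP.
by [].
Qed.

Theorem Dc_perfect r (Z : zmodType) (chi : (V -> V) -> Z) : (0 < n)%N -> r <> Some n.+1 ->
 additive_on r chi -> forall f, G r f -> chi f = 0.
Proof.
move=> n0 rn hchi.
have high : le_reg n.+2 r -> forall f, G r f -> chi f = 0.
 by move=> hr; have [ell [Th H]] := @contraction_high R n r hr; exact: (perfect_smooth _ hr (lexx _) H).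
case: r rn hchi high => [[|m] rn hchi high|rn hchi high]; [exact: perfect_homeo| |exact: high].
have [mn|nm] := leqP m.+1 n.
 have [L [ell [Th [L2 H]]]] := @contraction_low R n m.+1 isT mn.
 exact: (@perfect_smooth R n (Some m.+1) m.+1 L ell Th isT (leqnn _) L2 H Z chi hchi).
apply: high => /=; rewrite ltn_neqAle nm andbT; apply/eqP => E; apply: rn; by rewrite E.
Qed.

End perfect.

Section increasing_bijections.
Context {R : realType}.
Implicit Types (f g h : R -> R).

Definition inc_bij f fi := [/\ cancel f fi, cancel fi f & {mono f : x y / x <= y}].

Lemma inc_bij_sym f fi : inc_bij f fi -> inc_bij fi f.
Proof. by move=> [a b c]; split=> // x y; rewrite -c !b. Qed.

Lemma inc_bij_comp f fi g gi : inc_bij f fi -> inc_bij g gi -> inc_bij (f \o g) (gi \o fi).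
Proof.
move=> [a b c] [a' b' c']; split=> [x|x|x y] /=; by rewrite ?a ?a' ?b' ?b ?c ?c'.
Qed.

Lemma inc_lt f fi : inc_bij f fi -> {mono f : x y / x < y}.
Proof. by move=> [_ _ c]; exact: leW_mono. Qed.

Lemma inc_inj f fi : inc_bij f fi -> injective f.
Proof. by move=> [a _ _]; exact: can_inj a. Qed.

Lemma fix_inv f fi x : inc_bij f fi -> f x = x -> fi x = x.
Proof. by move=> [a _ _] fx; rewrite -{1}fx a. Qed.

Lemma iter_fix f x n : f x = x -> iter n f x = x.
Proof. by move=> fx; elim: n => //= n ->. Qed.

Lemma fix_of_iter f fi x n : (0 < n)%N -> inc_bij f fi -> iter n f x = x -> f x = x.
Proof.
move=> n0 F; have lt := inc_lt F; case: (ltgtP (f x) x) => // h.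
 suff H m : iter m.+1 f x < x by case: n n0 => // m _ E; have := H m; rewrite E ltxx.
 by elim: m => //= m IH; apply: lt_trans h; rewrite lt.
suff H m : x < iter m.+1 f x by case: n n0 => // m _ E; have := H m; rewrite E ltxx.
by elim: m => //= m IH; apply: lt_trans h _; rewrite lt.
Qed.

Lemma iter_mono f fi x : inc_bij f fi -> x <= f x -> forall m n, (m <= n)%N -> iter m f x <= iter n f x.
Proof.
move=> [_ _ fle] xf m n mn; rewrite -(subnK mn); elim: (n - m)%N => [|k IH]; first by rewrite add0n.
apply: le_trans IH _; rewrite addSn; elim: (k + m)%N => //= j; by rewrite fle.
Qed.

Lemma iter_lim f fi x p : inc_bij f fi -> x <= f x -> (forall n, iter n f x <= p) ->
 exists e, [/\ f e = e, x <= e <= p & forall eps, 0 < eps -> exists N, forall n, (N <= n)%N -> e - eps < iter n f x <= e].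
Proof.
move=> F xf bd; have [fK fiK fle] := F; have lt := inc_lt F.
pose S := [set iter n f x | n in [set: nat]].
have hS : has_sup S by split; [exists x, 0%N|exists p => _ [n _ <-]].
have ub n : iter n f x <= sup S by apply: sup_upper_bound => //; exists n.
exists (sup S); split.
- apply/eqP; rewrite eq_le; apply/andP; split.
  rewrite leNgt; apply/negP => h; have h' : fi (sup S) < sup S by rewrite -lt fiK.
  have [_ [n _ <-]] := sup_adherent (eps := sup S - fi (sup S)) ltac:(by rewrite subr_gt0) hS.
  by rewrite opprB addrC subrK -lt fiK ltNge => /negP; apply; exact: (ub n.+1).
 apply: ge_sup; first by case: hS.
 move=> _ [n _ <-]; apply: le_trans (_ : iter n.+1 f x <= _); last by rewrite /= fle.
 exact: (iter_mono F xf).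
- by rewrite (ub 0%N) /=; apply: ge_sup => [|_ [n _ <-]]; [case: hS|].
- move=> eps eps0; have [_ [N _ <-] h] := sup_adherent eps0 hS.
 exists N => n Nn; rewrite ub andbT; apply: lt_le_trans h _; exact: (iter_mono F xf).
Qed.

Definition refl_fun f (x : R) : R := - f (- x).

Lemma inc_bij_reflect f fi : inc_bij f fi -> inc_bij (refl_fun f) (refl_fun fi).
Proof.
move=> [a b c]; split=> [x|x|x y]; rewrite /refl_fun ?opprK ?a ?b ?opprK //.
by rewrite lerN2 c lerN2.
Qed.

Lemma iter_reflect f n x : iter n (refl_fun f) x = - iter n f (- x).
Proof. by elim: n => [|n IH] /=; rewrite ?opprK // IH /refl_fun opprK. Qed.

(* In the next lemmas f o k o f = k expresses that k conjugates f to its inverse. *)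
Lemma conj_inv_fix f fi k ki x : inc_bij f fi -> inc_bij k ki -> continuous f ->
 (forall y, f (k (f y)) = k y) -> exists2 p, x <= p & f p = p.
Proof.
move=> F K cf fkf; have [fK fiK fle] := F; have [kK kiK kle] := K.
have flt := inc_lt F; have klt := inc_lt K.
apply/not_exists2P => H; have nofix y : x <= y -> f y != y by move=> xy; apply/eqP => fy; case: (H y).
have ivt y z : x <= y -> x <= z -> f y < y -> z < f z -> False.
 move=> xy xz fy fz; pose u := Num.min y z; pose v := Num.max y z.
 have uv : u <= v by rewrite ge_min le_max lexx.
 have hc : {within `[u, v], continuous (fun t => f t - t)}.
  by apply: continuous_subspaceT => t; apply: cvgB; [exact: cf|exact: cvg_id].
 have hm : Num.min (f u - u) (f v - v) <= 0 <= Num.max (f u - u) (f v - v).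
  have fy' : f y - y <= 0 by lra. have fz' : 0 <= f z - z by lra.
  by rewrite /u /v; case: (leP y z) => _; rewrite ge_min le_max fy' fz' ?orbT.
 have [c] := IVT uv hc hm; rewrite in_itv /= => /andP[uc _] /eqP.
 rewrite subr_eq0; apply/negP; apply: nofix. by apply: le_trans uc; rewrite le_min xy.
pose m := Num.max x (ki x).
have xm : x <= m by rewrite le_max lexx.
have xkm y : m <= y -> x <= k y by move=> my; rewrite -[x]kiK kle (le_trans _ my) // le_max lexx orbT.
case: (ltgtP (f m) m) => h; last by have := nofix m xm; rewrite h eqxx.
 have down y : x <= y -> f y < y.
  move=> xy; case: (ltgtP (f y) y) => // h'; first by case: (ivt m y).
  by have := nofix y xy; rewrite h' eqxx.
 pose z := fi m. have fz : f z = m by rewrite /z fiK. have xz : x <= z.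
  rewrite leNgt; apply/negP => zx; have := down x (lexx x).
  by rewrite ltNge => /negP; apply; apply: ltW; apply: le_lt_trans xm _; rewrite -fz flt.
 have := down _ (xkm _ (lexx m)); rewrite -fz fkf => h1.
 have : k (f z) < k z by rewrite klt; exact: down. by rewrite ltNge ltW.
have up y : x <= y -> y < f y.
 move=> xy; case: (ltgtP (f y) y) => // h'; first by case: (ivt y m).
 by have := nofix y xy; rewrite h' eqxx.
have := up _ (xkm _ (ltW h)); rewrite fkf => h1.
have h2 : k m < k (f m) by rewrite klt.
by have := lt_trans h1 h2; rewrite ltxx.
Qed.

Lemma conj_inv_fix_below f fi k ki x : inc_bij f fi -> inc_bij k ki -> continuous f ->
 (forall y, f (k (f y)) = k y) -> exists2 p, p <= x & f p = p.
Proof.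
move=> F K cf fkf.
have [||p xp fp] := conj_inv_fix (- x) (inc_bij_reflect F) (inc_bij_reflect K).
- move=> y; apply: (@continuousN R _ _ (fun y => f (- y))).
 by apply: (@continuous_comp _ _ _ (fun y : R => - y) f); [exact: opp_continuous|exact: cf].
- by move=> y; rewrite /refl_fun !opprK fkf.
exists (- p); first by rewrite lerNl.
by rewrite -[RHS]/(- p) -[in RHS]fp /refl_fun opprK.
Qed.

End increasing_bijections.

Section line_lemma.
Context {R : realType}.
Variables a ai b bi : R -> R.
Hypotheses (A : inc_bij a ai) (B : inc_bij b bi).
Variables da db : R -> R.
Hypotheses (a_der : forall x : R, is_derive x 1 a (da x))
 (b_der : forall x : R, is_derive x 1 b (db x)) (da_cont : continuous da) (db_cont : continuous db)
 (da_pos : forall x, 0 < da x) (db_pos : forall x, 0 < db x) (ab : forall x, a (b x) = iter 4 b (a x)).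

Lemma mvt_ball (f df : R -> R) (e r x y : R) : (forall x : R, is_derive x 1 f (df x)) ->
 `|x - e| < r -> `|y - e| < r -> exists2 c, `|c - e| < r & f x - f y = df c * (x - y).
Proof.
move=> fd; wlog xy : x y / y <= x.
 move=> H xe ye; have [yx|/ltW yx] := leP y x; first exact: H.
 by have [c ce E] := H _ _ yx ye xe; exists c => //; rewrite -opprB E -mulrN opprB.
move=> xe ye; have [E|yx] := eqVneq y x.
 by exists x => //; rewrite E !subrr mulr0.
have lt : y < x by lra.
have fc : {within `[y, x], continuous f} by apply: derivable_within_continuous => z _; have [] := fd z.
have [c] := @MVT R f df y x lt (fun z _ => fd z) fc; rewrite in_itv /= => /andP[yc cx] ->; exists c => //.
by move: xe ye; rewrite !ltr_norml; move: yc cx; lra.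
Qed.

Lemma cont_near (f : R -> R) (e eps : R) : continuous f -> 0 < eps ->
 exists2 r : R, 0 < r & forall x, `|x - e| < r -> `|f x - f e| < eps.
Proof.
move=> cf eps0; have /cvgrPdist_lt/(_ _ eps0)/nbhs_ballP[r /= r0 H] := cf e.
exists r => // x xe; rewrite distrC; apply: H.
by rewrite -ball_normE /= distrC.
Qed.

Lemma b_derive_at_fixed e : a e = e -> b e = e -> db e = 1.
Proof.
move=> ae be.
have c (f g : R -> R) u v : is_derive e 1 f u -> is_derive e 1 g v -> f e = e -> is_derive e 1 (g \o f) (v * u).
 move=> fd gd fe; have gd' : is_derive (f e) 1 g v by rewrite fe.
 by have := is_derive1_comp gd' fd; rewrite mulrC.
have d1 := c _ _ _ _ (b_der e) (a_der e) be.
have d2 := c _ _ _ _ (b_der e) (b_der e) be.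
have d3 := c _ _ _ _ d2 (b_der e) ltac:(by rewrite /= !be).
have d4 := c _ _ _ _ d3 (b_der e) ltac:(by rewrite /= !be).
have d5 := c _ _ _ _ (a_der e) d4 ae.
have E : a \o b = (b \o (b \o (b \o b))) \o a by apply/funext => x /=; rewrite ab.
have : da e * db e = db e * (db e * (db e * db e)) * da e.
 by rewrite -(derive_val (is_derive := d1)) E (derive_val (is_derive := d5)).
rewrite mulrC => /(mulIf (lt0r_neq0 (da_pos e))).
rewrite -{1}[db e]mulr1 => /(mulfI (lt0r_neq0 (db_pos e))) => h.
have p := db_pos e; move: h p; move: (db e) => z h p.
have : (z - 1) * (z ^+ 2 + z + 1) = 0 by rewrite (_ : _ * _ = z * (z * z) - 1); [rewrite -h subrr|ring].
move/eqP; rewrite mulf_eq0 => /orP[/eqP|]; first by lra.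
by rewrite gt_eqF // !addr_gt0 // exprn_gt0.
Qed.

(* Near a common fixed point, b ^ 4 moves points almost four times as far as b. *)
Lemma b4_spread e : a e = e -> b e = e -> exists2 r : R, 0 < r & forall y, `|y - e| < r -> `|b y - e| <= 2 * `|y - e| /\
 exists2 q : R, 15 / 8 <= q & iter 4 b y - y = q * (b y - y).
Proof.
move=> ae be; have d1 := b_derive_at_fixed ae be.
have h2 : (0 : R) < 1 / 2 by [].
have [r r0 Hr] := cont_near e db_cont h2.
have lip y : `|y - e| < r -> `|b y - e| <= 2 * `|y - e|.
 move=> ye; have e0 : `|e - e| < r by rewrite subrr normr0.
 have [c ce] := mvt_ball b_der ye e0; rewrite be => ->; rewrite normrM ler_wpM2r //.
 by have := Hr _ ce; rewrite d1 gtr0_norm // ltr_norml; lra.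
exists (r / 8); first by nonneg.
move=> y ye; have r8 : r / 8 < r by lra.
split; first by apply: lip; exact: lt_trans r8.
have y0 : `|y - e| < r by lra.
have y1' := lip y y0; have y1 : `|b y - e| < r by lra.
have y2' := lip _ y1; have y2 : `|b (b y) - e| < r by lra.
have y3' := lip _ y2; have y3 : `|b (b (b y)) - e| < r by lra.
have [c1 /Hr h1 e1] := mvt_ball b_der y1 y0; have [c2 /Hr h3 e2] := mvt_ball b_der y2 y1.
have [c3 /Hr h4 e3] := mvt_ball b_der y3 y2.
exists (1 + db c1 + db c2 * db c1 + db c3 * (db c2 * db c1)).
 move: h1 h3 h4; rewrite d1 !ltr_norml => /andP[h1 _] /andP[h3 _] /andP[h4 _].
 have p1 : 1 / 2 <= db c1 by lra. have p2 : 1 / 2 <= db c2 by lra. have p3 : 1 / 2 <= db c3 by lra.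
 have h20 := ltW h2; have q1 : 1 / 2 * (1 / 2) <= db c2 * db c1 by apply: ler_pM.
 have q2 : 1 / 2 * (1 / 2 * (1 / 2)) <= db c3 * (db c2 * db c1) by apply: ler_pM => //; rewrite mulr_ge0.
 by lra.
rewrite /=; move: e1 e2 e3; move: (b y) (b (b y)) (b (b (b y))) (b (b (b (b y)))) => z1 z2 z3 z4 e1 e2 e3.
have -> : z4 - y = (z4 - z3) + (z3 - z2) + (z2 - z1) + (z1 - y) by ring.
rewrite e3 e2 e1; ring.
Qed.

Lemma b_fixed_limit e x : a e = e -> b e = e ->
 (forall eps, 0 < eps -> exists N, forall n, (N <= n)%N -> `|iter n ai x - e| < eps) -> b x = x.
Proof.
move=> ae be lim; apply: contrapT => bx.
have [aK aiK ale] := A; have [r1 r10 H1] := b4_spread ae be.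
have d9 : 0 < da e / 10 by nonneg.
have [r2 r20 H2] := cont_near e da_cont d9.
pose r := Num.min r1 r2 / 2; have m0 : 0 < Num.min r1 r2 by rewrite lt_min r10.
have r0 : 0 < r by nonneg.
have rr1 : r < r1 by apply: lt_le_trans (_ : Num.min r1 r2 <= _); rewrite ?ge_min ?lexx // /r; move: m0; lra.
have rr2 : 2 * r <= r2 by apply: le_trans (_ : Num.min r1 r2 <= _); rewrite ?ge_min ?lexx ?orbT // /r; lra.
clearbody r.
have grow y : `|y - e| < r -> `|ai y - e| < r -> 3 / 2 * `|b y - y| * `|ai y - e| <= `|b (ai y) - ai y| * `|y - e|.
 move=> ye; set z := ai y => ze; have yE : y = a z by rewrite /z aiK.
 have [_ [q q15 hq]] := H1 y (lt_trans ye rr1). have [bz _] := H1 z (lt_trans ze rr1).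
 have bz2 : `|b z - e| < r2 by lra. have z2 : `|z - e| < r2 by lra.
 have e2 : `|e - e| < r2 by rewrite subrr normr0.
 have [c1 /H2 h1 E1] := mvt_ball a_der bz2 z2; have [c2 /H2 h2 E2] := mvt_ball a_der z2 e2.
 rewrite ab -yE hq in E1; rewrite -yE ae in E2. have E1n : q * `|b y - y| = da c1 * `|b z - z|.
  have q0 : 0 <= q by lra.
  by have := congr1 Num.norm E1; rewrite !normrM (ger0_norm q0) (gtr0_norm (da_pos c1)).
 have E2n : `|y - e| = da c2 * `|z - e| by rewrite E2 normrM gtr0_norm.
 rewrite E2n; have d1 := da_pos c1. have key : 3 / 2 * da c1 <= q * da c2.
  move: h1 h2; rewrite !ltr_norml => h1 h2.
  have : 15 / 8 * da c2 <= q * da c2 by rewrite ler_wpM2r // ltW.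
  have p := da_pos e; move: h1 h2 p; move: (da e) (da c1) (da c2) (q * da c2) => z' v w u; lra.
 rewrite -(ler_pM2l d1).
 have -> : da c1 * (3 / 2 * `|b y - y| * `|z - e|) = 3 / 2 * da c1 * (`|b y - y| * `|z - e|) by ring.
 have -> : da c1 * (`|b z - z| * (da c2 * `|z - e|)) = q * da c2 * (`|b y - y| * `|z - e|).
  by rewrite mulrA -E1n; ring.
 by rewrite ler_wpM2r // mulr_ge0.
have [N HN] := lim r r0.
pose y n := iter (N + n) ai x.
have yr n : `|y n - e| < r by apply: HN; rewrite leq_addr.
have yS n : y n.+1 = ai (y n) by rewrite /y addnS.
have bai z : b z <> z -> b (ai z) <> ai z.
 move=> h h'; apply: h; have := ab (ai z); rewrite h' aiK => h4. exact: (@fix_of_iter _ b bi z 4).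
have by_ n : b (y n) <> y n by rewrite /y; elim: (N + n)%N => //= m IH; exact: bai.
have yn0 n : 0 < `|y n - e|.
 rewrite normr_gt0 subr_eq0; apply/eqP => E; apply: (by_ n); by rewrite E be.
pose c := `|b (y 0%N) - y 0%N| / `|y 0%N - e|.
have c0 : 0 < c by rewrite divr_gt0 // normr_gt0 subr_eq0; apply/eqP; exact: by_.
have low n : c * (3 / 2) ^+ n * `|y n - e| <= `|b (y n) - y n|.
 elim: n => [|n IH]; first by rewrite expr0 mulr1 /c divfK // gt_eqF.
 rewrite -(ler_pM2r (yn0 n)); have := grow (y n) (yr n); rewrite -yS => /(_ (yr n.+1)).
 apply: le_trans; rewrite exprS. have -> : c * (3 / 2 * (3 / 2) ^+ n) * `|y n.+1 - e| * `|y n - e| =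
   3 / 2 * (c * (3 / 2) ^+ n * `|y n - e|) * `|y n.+1 - e| by ring.
 by rewrite ler_wpM2r // ler_wpM2l //; lra.
have up n : c * (3 / 2) ^+ n <= 3.
 rewrite -(ler_pM2r (yn0 n)); apply: le_trans (low n) _. have [h _] := H1 (y n) (lt_trans (yr n) rr1).
 have -> : b (y n) - y n = (b (y n) - e) - (y n - e) by ring.
 by apply: le_trans (ler_normB _ _) _; move: h; lra.
have grow_lin n : 1 + n%:R / 2 <= (3 / 2 : R) ^+ n.
 elim: n => [|n IH]; first by rewrite expr0 mul0r addr0.
 by rewrite exprS -natr1; have := ler0n R n; move: IH; move: (_ ^+ n) (n%:R) => u v; lra.
pose n := (Num.truncn (6 / c)).+1.
have hn : 6 / c < n%:R by have /andP[] := truncn_itv (divr_ge0 (ler0n R 6) (ltW c0)).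
clearbody n; rewrite ltr_pdivrMr // in hn.
have := up n; have := ler_wpM2l (ltW c0) (grow_lin n).
by move: hn c0; move: ((3 / 2) ^+ n) (n%:R) => u v; lra.
Qed.

Lemma b_fixed_map y : b y = y -> b (a y) = a y /\ b (ai y) = ai y.
Proof.
have [aK aiK _] := A => byy; have h1 : iter 4 b (a y) = a y by rewrite -ab byy.
split; first exact: (@fix_of_iter _ b bi (a y) 4).
by apply: (inc_inj A); rewrite ab aiK iter_fix.
Qed.

Lemma b_cont : continuous b.
Proof. exact: is_derive_cont b_der. Qed.

Lemma a_cont : continuous a.
Proof. exact: is_derive_cont a_der. Qed.

Lemma closed_fix (f : R -> R) (S : set R) e : continuous f -> (forall x, S x -> f x = x) ->
 (forall eps, 0 < eps -> exists2 x, S x & `|x - e| < eps) -> f e = e.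
Proof.
move=> cf Sf lim; apply/eqP; rewrite -subr_eq0 -normr_le0; apply/ler_addgt0Pr => eps eps0.
have e2 : 0 < eps / 2 by nonneg.
have [r r0 Hr] := cont_near e cf e2; have m0 : 0 < Num.min r (eps / 2) by rewrite lt_min r0.
have [x Sx] := lim _ m0; rewrite lt_min => /andP[/Hr h1 h2].
have -> : f e - e = (x - e) - (f x - f e) by rewrite (Sf x Sx); ring.
rewrite add0r; apply: le_trans (ler_normB _ _) _; move: h1 h2; lra.
Qed.

(* Otherwise the next b-fixed point gam above q is fixed by a, and q and gam
  converge under h to a point e fixed by a and b. The a-fixed points h ^ N q
  and h ^ N gam give a'(e) = 1, while a (b q) = b ^ 4 q gives a'(e) >= 15 / 8. *)
Lemma no_b_fixed h hi q c : inc_bij h hi -> (forall x, h (a x) = a (h x)) ->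
 (forall x, h (b x) = b (h x)) -> (exists2 p, q <= p & h p = p) -> a q = q -> b q <> q -> q <= c <= h q -> b c <> c.
Proof.
move=> H ha hb [p qp hp] aq bq /andP[qc chq] bc; have [hK hiK hle] := H; have hlt := inc_lt H.
have qhq : q <= h q by lra.
pose S := [set y | q <= y /\ b y = y].
have Sc : S c by [].
have hS : has_inf S by split; [exists c|exists q => y []].
pose gam := inf S.
have bgam : b gam = gam.
 apply: (closed_fix (S := S) b_cont) => [x []//|eps eps0].
 have [x Sx h1] := inf_adherent eps0 hS; exists x => //.
 rewrite ger0_norm ?subr_ge0 ?ltrBlDl //; apply: inf_lbound => //; exact: hS.2.
have qgam : q <= gam by apply: lb_le_inf; [exact: hS.1|move=> y []].
have gamc : gam <= c by apply: inf_lbound => //; exact: hS.2.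
have glb y : S y -> gam <= y by move=> Sy; apply: inf_lbound => //; exact: hS.2.
have [aK aiK ale] := A.
have aiq : ai q = q by exact: fix_inv A aq.
have agam : a gam = gam.
 have [g1 g2] := b_fixed_map bgam; apply/eqP; rewrite eq_le; apply/andP; split.
  rewrite -[leRHS]aiK ale; apply: glb; split=> //; rewrite -[q]aiq. by have [_ _ ->] := inc_bij_sym A.
 by apply: glb; split=> //; rewrite -[q]aq ale.
have qb n : iter n h q <= p by elim: n => //= n IH; rewrite -hp hle.
have [e [he _ lim]] := iter_lim H qhq qb.
have it_comm f m x : (forall y, h (f y) = f (h y)) -> iter m h (f x) = f (iter m h x).
 by move=> hf; elim: m => //= m ->.
have gN n : iter n h q <= iter n h gam <= iter n.+1 h q.
 rewrite iterSr; have le m x y : x <= y -> iter m h x <= iter m h y by move=> xy; elim: m => //= m; rewrite hle.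
 by rewrite !le // (le_trans gamc).
have lim2 eps : 0 < eps -> exists n, `|iter n h q - e| < eps /\ `|iter n h gam - e| < eps.
 move=> eps0; have [N HN] := lim eps eps0; exists N.
 have := HN N (leqnn _); have := HN N.+1 (leqnSn _); have := gN N.
 move: (iter N h q) (iter N h gam) (iter N.+1 h q) => u v w. rewrite !ltr_norml; lra.
have ae : a e = e.
 apply: (closed_fix (S := [set y | a y = y]) a_cont) => // eps /lim2[n [h1 _]].
 by exists (iter n h q) => //=; rewrite -it_comm // aq.
have be : b e = e.
 apply: (closed_fix (S := [set y | b y = y]) b_cont) => // eps /lim2[n [_ h1]].
 by exists (iter n h gam) => //=; rewrite -it_comm // bgam.
have [r r0 Hr] := b4_spread ae be.
have e4 : (0 : R) < 1 / 4 by [].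
have [r' r'0 Hr'] := cont_near e da_cont e4.
have m0 : 0 < Num.min r (r' / 2) by rewrite lt_min r0 divr_gt0.
have [n []] := lim2 _ m0; set u := iter n h q; set v := iter n h gam.
rewrite !lt_min => /andP[u1 u2] /andP[_ v2].
have au : a u = u by rewrite /u -it_comm // aq.
have av : a v = v by rewrite /v -it_comm // agam.
have bv : b v = v by rewrite /v -it_comm // bgam.
have bu : b u <> u.
 move=> E; apply: bq; move: E; rewrite /u -it_comm //. by elim: (n) => //= m IH /(inc_inj H).
have uv : v - u != 0 by rewrite subr_eq0; apply/eqP => E; apply: bu; rewrite -E.
have [bu2 [s s15 Hs]] := Hr u u1.
have u3 : `|u - e| < r' by lra.
have v3 : `|v - e| < r' by lra.
have bu3 : `|b u - e| < r' by lra.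
have [c1 /Hr' h1 E1] := mvt_ball a_der bu3 u3.
have [c2 /Hr' h2 E2] := mvt_ball a_der v3 u3.
have d2 : da c2 = 1 by move: E2; rewrite au av -{1}[v - u]mul1r => /(mulIf uv).
have d1 : da c1 = s.
 move: E1; rewrite ab au Hs => /esym/mulIf -> //. by rewrite subr_eq0; apply/eqP.
by move: h1 h2; rewrite d1 d2 !ltr_norml; move: s15; lra.
Qed.

Variables g gi k ki k' ki' : R -> R.
Hypotheses (G : inc_bij g gi) (K : inc_bij k ki) (K' : inc_bij k' ki') (g_cont : continuous g)
 (aka : forall x, a (k (a x)) = k x) (gkg : forall x, g (k' (g x)) = k' x)
 (gga : forall x, g (g (a x)) = a (g (g x))) (ggb : forall x, g (g (b x)) = b (g (g x)))
 (gbga : forall x, g (b (gi (a x))) = a (g (b (gi x)))).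

Definition same_comp y z := forall c, Num.min y z <= c <= Num.max y z -> b c <> c.

Lemma same_comp_sym y z : same_comp y z -> same_comp z y.
Proof. by move=> h c; rewrite minC maxC; exact: h. Qed.

Lemma same_comp_trans x y z : same_comp x y -> same_comp y z -> same_comp x z.
Proof.
move=> h1 h2 c; rewrite ge_min le_max => /andP[c1 c2].
have [cy|yc] := leP c y; [case/orP: c1 => c1; [apply: h1|apply: h2]|case/orP: c2 => c2; [apply: h1|apply: h2]];
 by rewrite ge_min le_max ?c1 ?c2 ?cy ?(ltW yc) ?orbT.
Qed.

Lemma same_comp_sub x y z : same_comp x y -> x <= z <= y -> same_comp x z /\ same_comp z y.
Proof.
move=> h /andP[xz zy]; have xy := le_trans xz zy.
split=> c; rewrite ?(min_idPl _) ?(max_idPr _) // => /andP[c1 c2]; apply: h;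
 by rewrite (min_idPl xy) (max_idPr xy) ?c1 ?c2 ?(le_trans xz) ?(le_trans c2).
Qed.

Lemma same_comp_map f fi y z : inc_bij f fi -> (forall x, f (b x) = b (f x)) -> same_comp y z -> same_comp (f y) (f z).
Proof.
move=> F fb h c; have [fK fiK fle] := F; have [_ _ file] := inc_bij_sym F.
move=> cyz bc; apply: (h (fi c)).
 have e1 t : (t <= fi c) = (f t <= c) by rewrite -fle fiK.
 have e2 t : (fi c <= t) = (c <= f t) by rewrite -fle fiK.
 by move: cyz; rewrite !ge_min !le_max !e1 !e2.
by apply: (inc_inj F); rewrite fb fiK.
Qed.

Lemma same_comp_sqrt f fi y : inc_bij f fi -> same_comp y (f (f y)) -> same_comp y (f y).
Proof.
move=> [_ _ fle] h c; case: (leP y (f y)) => yf /andP[c1 c2]; apply: h; rewrite ge_min le_max.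
 have h2 : f y <= f (f y) by rewrite fle. by lra.
have h2 : f (f y) <= f y by rewrite fle ltW.
by lra.
Qed.

Lemma same_comp_b y : b y <> y -> same_comp y (b y).
Proof.
have blt := inc_lt B; have [bK _ ble] := B.
move=> by_ c; case: (leP y (b y)) => yb /andP[c1 c2] bc.
 have : y < c by rewrite lt_neqAle c1 andbT; apply/eqP => E; apply: by_; rewrite E.
 by rewrite -blt bc ltNge c2.
have : c < y by rewrite lt_neqAle c2 andbT; apply/eqP => E; apply: by_; rewrite -E.
by rewrite -blt bc ltNge c1.
Qed.

Lemma a_fixed_bounded f fi q q' : inc_bij f fi -> (forall x, f x = x <-> b x = x) ->
 (forall x, a (f x) = iter 4 f (a x)) -> a q = q -> q < f q -> same_comp q q' -> a q' = q' -> q' <= f q.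
Proof.
move=> F fb af aq qf qq aq'; rewrite leNgt; apply/negP => lt.
have mono := iter_mono F (ltW qf).
have afn n : a (iter n f q) = iter (4 * n) f q by elim: n => [|n IH]; rewrite ?muln0 // iterS af IH -iterD mulnS.
have [bd|] := pselect (forall n, iter n f q <= q').
 have [e [fe /andP[qe eq'] _]] := iter_lim F (ltW qf) bd. apply: (qq e); last exact/fb.
 by rewrite ge_min qe le_max eq' orbT.
move=> /existsNP[n0 /negP]; rewrite -ltNge => h0.
have ex : exists n, q' < iter n f q by exists n0.
case: (ex_minnP ex) => n hn hmin.
case: n hn hmin => [|n] hn hmin; first by move: hn; rewrite ltNge (ltW (lt_trans qf lt)).
case: n hn hmin => [|n] hn hmin; first by move: hn; rewrite ltNge (ltW lt).
have : iter n.+1 f q <= q' by rewrite leNgt; apply/negP => /hmin; rewrite ltnn.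
have [_ _ ale] := A; rewrite -ale afn aq' => h; move: hn; rewrite ltNge => /negP; apply.
by apply: le_trans h; apply: mono; rewrite mulSn; lia.
Qed.

Lemma line_lemma x : b x = x.
Proof.
have [aK aiK ale] := A; have [bK biK ble] := B; have [gK giK gle] := G.
have Ai := inc_bij_sym A; have Gi := inc_bij_sym G; have Bi := inc_bij_sym B.
apply: contrapT => bx.
have [q [aq lim]] : exists q, a q = q /\ forall eps, 0 < eps -> exists N, forall n, (N <= n)%N -> `|iter n ai x - q| < eps.
 have [xa|ax] := leP x (ai x).
  have [p xp ap] := conj_inv_fix x A K a_cont aka. have aip := fix_inv A ap.
  have bd n : iter n ai x <= p by elim: n => //= n IH; rewrite -aip; have [_ _ ->] := Ai.
  have [q [aiq _ lim]] := iter_lim Ai xa bd; exists q; split; first exact: fix_inv Ai aiq.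
  move=> eps /[dup] eps0 /lim[N HN]; exists N => n /HN.
  by rewrite ltr_norml; move: (iter n ai x) => u; move: eps0; lra.
 have [p xp ap] := conj_inv_fix_below x A K a_cont aka. have aip := fix_inv A ap.
 have bd n : iter n (refl_fun ai) (- x) <= - p.
  rewrite iter_reflect opprK lerN2; elim: n => //= n IH; rewrite -aip; by have [_ _ ->] := Ai.
 have xa : - x <= refl_fun ai (- x) by rewrite /refl_fun opprK lerN2 ltW.
 have [q [aiq _ lim]] := iter_lim (inc_bij_reflect Ai) xa bd; exists (- q); split.
  apply: fix_inv Ai _; by rewrite -[in RHS]aiq /refl_fun opprK.
 move=> eps /[dup] eps0 /lim[N HN]; exists N => n /HN; rewrite iter_reflect opprK.
 by rewrite ltr_norml; move: (iter n ai x) => u; move: eps0; lra.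
have bq : b q <> q by move=> bq; apply: bx; exact: b_fixed_limit aq bq lim.
pose h := g \o g; have H : inc_bij h (gi \o gi) := inc_bij_comp G G.
have Hi := inc_bij_sym H; have [hK hiK _] := H.
have hfix y : exists2 p, y <= p & h p = p.
 by have [p yp gp] := conj_inv_fix y G K' g_cont gkg; exists p => //; rewrite /h /= !gp.
have hi_comm f : (forall x, h (f x) = f (h x)) -> forall x, (gi \o gi) (f x) = f ((gi \o gi) x).
 by move=> hf y; apply: (inc_inj H); rewrite hf !hiK.
have qh : same_comp q (h q).
 have [qhq|hqq] := leP q (h q).
  move=> c; rewrite (min_idPl qhq) (max_idPr qhq).
  exact: (no_b_fixed H gga ggb (hfix q) aq bq).
 move=> c; rewrite (min_idPr (ltW hqq)) (max_idPl (ltW hqq)).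
 rewrite -{2}(hK q); apply: (no_b_fixed Hi (hi_comm _ gga) (hi_comm _ ggb)).
 - have [p yp hp] := hfix (h q); exists p => //; exact: fix_inv H hp.
 - by rewrite -gga aq.
 - by rewrite -ggb => /(inc_inj H).
have Jg y : same_comp q y -> same_comp q (g y).
 move=> qy; apply: (same_comp_trans qy); apply: same_comp_sqrt G _.
 apply: (same_comp_trans (same_comp_sym qy)).
 by apply: (same_comp_trans qh); exact: same_comp_map H ggb qy.
have Jgi y : same_comp q y -> same_comp q (gi y).
 move=> qy; apply: (same_comp_trans qy); apply: same_comp_sqrt Gi _.
 apply: (same_comp_trans (same_comp_sym qy)).
 apply: (same_comp_trans (y := (gi \o gi) q)); last exact: same_comp_map Hi (hi_comm _ ggb) qy.
 by apply: same_comp_sym; rewrite -{2}(hK q); apply: same_comp_map Hi (hi_comm _ ggb) _.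
have Jnb y : same_comp q y -> b y <> y by move=> qy; apply: qy; rewrite ge_min le_max !lexx !orbT.
have Jb y : same_comp q y -> same_comp q (b y).
 by move=> qy; apply: (same_comp_trans qy); apply: same_comp_b; exact: Jnb.
have Jbi y : same_comp q y -> same_comp q (bi y).
 move=> qy; apply: (same_comp_trans qy); rewrite -{1}(biK y); apply: same_comp_sym.
 by apply: same_comp_b => h'; apply: (Jnb y qy); rewrite -[in RHS](biK y) -h' biK.
have Jself : same_comp q q by move=> c; rewrite minxx maxxx => /le_anti E; rewrite -E.
pose S := [set y | same_comp q y /\ a y = y].
have [u [qu Su]] : exists u, same_comp q u /\ forall y, S y -> y <= u.
 have [qb|bq'|E] := ltgtP q (b q); last by case: bq.
  exists (b q); split; first exact: Jb.
  by move=> y [qy ay]; apply: (a_fixed_bounded B _ ab aq qb qy ay).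
 exists (bi q); split; first exact: Jbi. move=> y [qy ay]; apply: (a_fixed_bounded Bi _ _ aq _ qy ay).
 - by move=> z; split=> [/(fix_inv Bi)//|/(fix_inv B)].
 - move=> z; apply: (can_inj (g := iter 4 bi) (f := iter 4 b)) => [t|]; first by rewrite /= !bK.
  by rewrite -ab biK /= !biK.
 - by rewrite -(inc_lt B) biK.
have hS : has_sup S by split; [exists q|exists u; move=> y Sy; exact: Su].
pose s := sup S.
have qs : q <= s by apply: sup_upper_bound.
have su : s <= u by apply: ge_sup => //; exact: hS.1.
have Js : same_comp q s by apply: (same_comp_sub qu _).1; rewrite qs.
have as_ : a s = s.
 apply: (closed_fix (S := S) a_cont) => [y []//|eps eps0].
 have [y Sy hy] := sup_adherent eps0 hS; exists y => //.
 rewrite distrC ger0_norm ?subr_ge0; last exact: sup_upper_bound. by rewrite ltrBlDr -ltrBlDl.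
have S1 : S (g (b (gi s))) by split; [exact/Jg/Jb/Jgi|rewrite -gbga as_].
have S2 : S (g (bi (gi s))).
 split; first exact/Jg/Jbi/Jgi. have := gbga (g (bi (gi s))); have E := inc_inj G; move=> h1.
 pose w := g (bi (gi s)); have gw : g (b (gi w)) = s by rewrite /w gK biK giK.
 have : g (b (gi (a w))) = g (b (gi w)) by rewrite gbga gw.
 by move=> /(inc_inj G)/(inc_inj B)/(inc_inj Gi).
have le1 : g (b (gi s)) <= s by exact: sup_upper_bound.
have le2 : g (bi (gi s)) <= s by exact: sup_upper_bound.
have le3 : s <= g (b (gi s)) by move: le2; rewrite -[leRHS]giK gle -ble biK -gle giK.
have E : g (b (gi s)) = s by apply/eqP; rewrite eq_le le1.
by apply: (Jnb (gi s) (Jgi s Js)); apply: (inc_inj G); rewrite E giK.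
Qed.

End line_lemma.

Section positive_functions.
Context {R : realType} {n : nat}.
Local Notation V := 'rV[R]_n.
Local Notation smooth_pos := (@smooth_on R [set y | 0 < y]).

Let smooth_pos_inv k : smooth_pos k (@GRing.inv R).
Proof. exact: (smooth_inv (f := id) (fun _ h => h) (smooth_id _ k)). Qed.

Let smooth_pos_sqrt k : smooth_pos k (@Num.sqrt R).
Proof.
have D (y : R) : 0 < y -> is_derive y (1 : R) Num.sqrt (1 / 2 * y^-1 * Num.sqrt y).
 move=> y0; have := is_derive1_sqrt y0; move=> h; apply: is_derive_eq => //.
 have s0 : Num.sqrt y != 0 by rewrite gt_eqF // sqrtr_gt0.
 rewrite -{2}(sqr_sqrtr (ltW y0)); move: (Num.sqrt y) s0 => z z0; field; exact: z0.
elim: k => [|k IH]; split=> //; try by move=> y y0; apply/differentiable_continuous/derivable1_diffP; case: (D y y0).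
exists (fun y => 1 / 2 * y^-1 * Num.sqrt y) => //.
exact: (smooth_mul (smooth_mul (smooth_cst _ k (1 / 2)) (smooth_pos_inv k)) IH).
Qed.

Lemma Ckp_quotient_sqrt (A : set R) k (F H : R -> V -> R) : (forall t x, A t -> 0 < F t x) ->
 (forall t x, A t -> 0 < H t x) -> Ckp A k F -> Ckp A k H -> Ckp A k (fun t x => Num.sqrt (F t x / H t x)).
Proof.
move=> F0 H0 CF CH; apply: Ckp_fun (smooth_pos_sqrt k); first by move=> t x At; apply: divr_gt0; [exact: F0|exact: H0].
by apply: Ckp_mul => //; exact: Ckp_fun H0 CH (smooth_pos_inv k).
Qed.

End positive_functions.

Section plane_actions.
Context {R : realType} {n : nat}.
Local Notation V := 'rV[R]_n.
Local Notation G r := (@Diffc0 R n r).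
Variables i0 i1 : 'I_n.
Hypothesis i01 : i1 != i0.

Definition mat2 : Type := (R * R) * (R * R).
Implicit Types (M : V -> mat2) (A B : mat2).

Definition m2_mul A B : mat2 := ((A.1.1 * B.1.1 + A.1.2 * B.2.1, A.1.1 * B.1.2 + A.1.2 * B.2.2),
  (A.2.1 * B.1.1 + A.2.2 * B.2.1, A.2.1 * B.1.2 + A.2.2 * B.2.2)).
Definition m2_det A : R := A.1.1 * A.2.2 - A.1.2 * A.2.1.
Definition m2_scale (k : R) A : mat2 := ((k * A.1.1, k * A.1.2), (k * A.2.1, k * A.2.2)).
Definition m2_1 : mat2 := ((1, 0), (0, 1)).
Definition m2_u A (u v : R) : R := A.1.1 * u + A.1.2 * v.
Definition m2_v A (u v : R) : R := A.2.1 * u + A.2.2 * v.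

Variable c : R.
Definition uu (x : V) : R := x 0 i0 - c.
Definition vv (x : V) : R := x 0 i1.
Definition put (u v : R) (x : V) : V := \row_j if j == i0 then c + u else if j == i1 then v else x 0 j.

Lemma uu_put u v x : uu (put u v x) = u.
Proof. by rewrite /uu mxE eqxx addrC addKr. Qed.
Lemma vv_put u v x : vv (put u v x) = v.
Proof. by rewrite /vv mxE (negbTE i01) eqxx. Qed.
Lemma put_put u v u' v' x : put u v (put u' v' x) = put u v x.
Proof. by apply/rowP => j; rewrite !mxE; case: eqP => // _; case: eqP. Qed.
Lemma put_id x : put (uu x) (vv x) x = x.
Proof.
apply/rowP => j; rewrite !mxE; case: eqP => [->|_]; first by rewrite addrC subrK.
by case: eqP => [->|].
Qed.

Definition nn (x : V) : R := uu x ^+ 2 + vv x ^+ 2.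
Definition QQ (x : V) : R := nn x + \sum_(j | (j != i0) && (j != i1)) x 0 j ^+ 2.

Lemma nn_put u v x : nn (put u v x) = u ^+ 2 + v ^+ 2.
Proof. by rewrite /nn uu_put vv_put. Qed.
Lemma QQ_put u v x : u ^+ 2 + v ^+ 2 = nn x -> QQ (put u v x) = QQ x.
Proof.
rewrite /QQ nn_put => ->; congr (_ + _); apply: eq_bigr => j /andP[/negbTE j0 /negbTE j1].
by rewrite mxE j0 j1.
Qed.
Lemma nn_ge0 x : 0 <= nn x.
Proof. by rewrite addr_ge0 ?sqr_ge0. Qed.
Lemma nn_le_QQ x : nn x <= QQ x.
Proof. by rewrite lerDl sumr_ge0 // => j _; exact: sqr_ge0. Qed.
Lemma uu_le_QQ x : uu x ^+ 2 <= QQ x.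
Proof. by apply: le_trans (nn_le_QQ x); rewrite lerDl sqr_ge0. Qed.

(* A matrix acts on the directions of the plane of the coordinates i0 and i1,
  preserving the distance to the centre (c, 0) of that plane. *)
Definition act M (x : V) : V := let w := m2_u (M x) (uu x) (vv x) in let z := m2_v (M x) (uu x) (vv x) in
 let l := Num.sqrt (nn x / (w ^+ 2 + z ^+ 2)) in put (l * w) (l * z) x.

Definition radial (T : Type) (f : V -> T) := forall u v x, u ^+ 2 + v ^+ 2 = nn x -> f (put u v x) = f x.

Lemma sq_sum0 (u v : R) : u ^+ 2 + v ^+ 2 = 0 -> u = 0 /\ v = 0.
Proof.
move=> /eqP; rewrite paddr_eq0 ?sqr_ge0 // !sqrf_eq0 => /andP[/eqP -> /eqP ->].
by [].
Qed.

Lemma m2_image_gt0 A (u v : R) : m2_det A != 0 -> u ^+ 2 + v ^+ 2 != 0 -> 0 < m2_u A u v ^+ 2 + m2_v A u v ^+ 2.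
Proof.
move=> dA uv; rewrite lt_neqAle addr_ge0 ?sqr_ge0 // andbT eq_sym.
apply: contra uv => /eqP/sq_sum0[a b]; rewrite /m2_u in a; rewrite /m2_v in b.
have hu : m2_det A * u = 0.
 rewrite /m2_det (_ : _ * u = A.2.2 * (A.1.1 * u + A.1.2 * v) - A.1.2 * (A.2.1 * u + A.2.2 * v)); last by ring.
 by rewrite a b !mulr0 subr0.
have hv : m2_det A * v = 0.
 rewrite /m2_det (_ : _ * v = A.1.1 * (A.2.1 * u + A.2.2 * v) - A.2.1 * (A.1.1 * u + A.1.2 * v)); last by ring.
 by rewrite a b !mulr0 subr0.
move/eqP: hu; rewrite mulf_eq0 (negbTE dA) /= => /eqP ->.
move/eqP: hv; rewrite mulf_eq0 (negbTE dA) /= => /eqP ->.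
by rewrite expr0n addr0.
Qed.

Lemma act_norm M x : m2_det (M x) != 0 -> let w := m2_u (M x) (uu x) (vv x) in let z := m2_v (M x) (uu x) (vv x) in
 let l := Num.sqrt (nn x / (w ^+ 2 + z ^+ 2)) in (l * w) ^+ 2 + (l * z) ^+ 2 = nn x.
Proof.
move=> dM w z l; have [E|nz] := eqVneq (nn x) 0.
 by rewrite /l E mul0r sqrtr0 !mul0r expr0n addr0.
have p := m2_image_gt0 dM nz; rewrite -/w -/z in p.
rewrite !exprMn -mulrDr sqr_sqrtr ?divfK ?gt_eqF //.
by rewrite divr_ge0 ?nn_ge0 // ltW.
Qed.

Lemma act_nn M x : m2_det (M x) != 0 -> nn (act M x) = nn x.
Proof. by move=> dM; rewrite /act nn_put act_norm. Qed.
Lemma act_QQ M x : m2_det (M x) != 0 -> QQ (act M x) = QQ x.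
Proof. by move=> dM; rewrite /act QQ_put // act_norm. Qed.
Lemma act_radial T (f : V -> T) M x : radial f -> m2_det (M x) != 0 -> f (act M x) = f x.
Proof. by move=> rf dM; rewrite /act rf // act_norm. Qed.

Lemma put_scale k N w z x : 0 < k -> put (Num.sqrt (N / ((k * w) ^+ 2 + (k * z) ^+ 2)) * (k * w))
   (Num.sqrt (N / ((k * w) ^+ 2 + (k * z) ^+ 2)) * (k * z)) x =
 put (Num.sqrt (N / (w ^+ 2 + z ^+ 2)) * w) (Num.sqrt (N / (w ^+ 2 + z ^+ 2)) * z) x.
Proof.
move=> k0; have -> : N / ((k * w) ^+ 2 + (k * z) ^+ 2) = k^-1 ^+ 2 * (N / (w ^+ 2 + z ^+ 2)).
 by rewrite !exprMn -mulrDr invfM exprVn mulrCA.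
rewrite sqrtrM ?sqr_ge0 // sqrtr_sqr gtr0_norm ?invr_gt0 //.
by congr put; rewrite mulrACA mulVf ?mul1r // gt_eqF.
Qed.

Lemma act_prop M M' x k : 0 < k -> M x = m2_scale k (M' x) -> act M x = act M' x.
Proof.
move=> k0 E; rewrite /act E.
have -> : m2_u (m2_scale k (M' x)) (uu x) (vv x) = k * m2_u (M' x) (uu x) (vv x) by rewrite /m2_u /=; ring.
have -> : m2_v (m2_scale k (M' x)) (uu x) (vv x) = k * m2_v (M' x) (uu x) (vv x) by rewrite /m2_v /=; ring.
exact: put_scale.
Qed.

Lemma act_id M x k : 0 < k -> M x = m2_scale k m2_1 -> act M x = x.
Proof.
move=> k0 E; rewrite (act_prop (M' := fun=> m2_1) k0 E) /act /m2_u /m2_v /= !mul1r !mul0r addr0 add0r -/(nn x).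
rewrite -[RHS]put_id; have [nx|nx] := eqVneq (nn x) 0; last by rewrite divff // sqrtr1 !mul1r.
by have [-> ->] := sq_sum0 nx; rewrite !mulr0.
Qed.

Lemma m2_detM A B : m2_det (m2_mul A B) = m2_det A * m2_det B.
Proof. rewrite /m2_det /=; ring. Qed.

Lemma act_comp M M' x : radial M -> m2_det (M x) != 0 -> m2_det (M' x) != 0 ->
 act M (act M' x) = act (fun x => m2_mul (M x) (M' x)) x.
Proof.
move=> rM dM dM'; rewrite {1}/act act_nn // (act_radial rM dM').
have [nx|nx] := eqVneq (nn x) 0; first by rewrite /act nx !mul0r sqrtr0 !mul0r put_put.
rewrite /act uu_put vv_put put_put.
set w := m2_u (M' x) _ _; set z := m2_v (M' x) _ _.
set l := Num.sqrt (nn x / (w ^+ 2 + z ^+ 2)); have p := m2_image_gt0 dM' nx; rewrite -/w -/z in p.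
have l0 : 0 < l by rewrite sqrtr_gt0 divr_gt0 // lt_neqAle eq_sym nn_ge0 andbT.
have -> : m2_u (m2_mul (M x) (M' x)) (uu x) (vv x) = m2_u (M x) w z by rewrite /m2_u /w /z /m2_u /m2_v /=; ring.
have -> : m2_v (m2_mul (M x) (M' x)) (uu x) (vv x) = m2_v (M x) w z by rewrite /m2_v /w /z /m2_u /m2_v /=; ring.
have -> : m2_u (M x) (l * w) (l * z) = l * m2_u (M x) w z by rewrite /m2_u; ring.
have -> : m2_v (M x) (l * w) (l * z) = l * m2_v (M x) w z by rewrite /m2_v; ring.
exact: put_scale.
Qed.

Section smoothness.
Variable S : set R.

Lemma Ckp_uu k : Ckp S k (fun _ => uu).
Proof.
apply: (Ckp_ext _ (Ckp_add (Ckp_coord S k i0) (Ckp_cst S k (- c)))) => t _.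
by [].
Qed.

Lemma Ckp_sqr k F : Ckp S k F -> Ckp S k (fun t (x : V) => F t x ^+ 2).
Proof.
move=> CF; apply: (Ckp_ext _ (Ckp_mul CF CF)) => t _; apply/funext => x.
by [].
Qed.

Lemma Ckp_nn k : Ckp S k (fun _ => nn).
Proof. by apply: Ckp_add; apply: Ckp_sqr; [exact: Ckp_uu|exact: Ckp_coord]. Qed.

Lemma Ckp_QQ k : Ckp S k (fun _ => QQ).
Proof.
apply: Ckp_add; first exact: Ckp_nn.
have H := @Ckp_sum R n S k _ (index_enum 'I_n)
 (fun j t x => ((j != i0) && (j != i1))%:R * x 0 j ^+ 2) (fun j => Ckp_scale _ (Ckp_sqr (Ckp_coord S k j))).
apply: (Ckp_ext _ H) => t _; apply/funext => x.
by rewrite [RHS]big_mkcond; apply: eq_bigr => j _; case: ifP; rewrite ?mul1r ?mul0r.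
Qed.

Lemma Ckp_act k (M : R -> V -> mat2) (chi : V -> R) : Ckp S k (fun t x => (M t x).1.1) -> Ckp S k (fun t x => (M t x).1.2) ->
 Ckp S k (fun t x => (M t x).2.1) -> Ckp S k (fun t x => (M t x).2.2) ->
 Ckp S k (fun _ => chi) -> (forall x, 0 <= chi x) -> (forall x, 0 < nn x + chi x) -> (forall t x, S t -> m2_det (M t x) != 0) ->
 (forall t x, S t -> chi x != 0 -> m2_u (M t x) (uu x) (vv x) ^+ 2 + m2_v (M t x) (uu x) (vv x) ^+ 2 = nn x) ->
 Ckpv S k (fun t => act (M t)).
Proof.
move=> C1 C2 C3 C4 Cchi chi0 nchi dM Mchi.
have Cw : Ckp S k (fun t x => m2_u (M t x) (uu x) (vv x)).
 by apply: Ckp_add; apply: Ckp_mul => //; [exact: Ckp_uu|exact: Ckp_coord].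
have Cz : Ckp S k (fun t x => m2_v (M t x) (uu x) (vv x)).
 by apply: Ckp_add; apply: Ckp_mul => //; [exact: Ckp_uu|exact: Ckp_coord].
have CN : Ckp S k (fun t x => m2_u (M t x) (uu x) (vv x) ^+ 2 + m2_v (M t x) (uu x) (vv x) ^+ 2 + chi x).
 by apply: Ckp_add Cchi; apply: Ckp_add; exact: Ckp_sqr.
have pN t x : S t -> 0 < m2_u (M t x) (uu x) (vv x) ^+ 2 + m2_v (M t x) (uu x) (vv x) ^+ 2 + chi x.
 move=> St; have [c0|c0] := eqVneq (chi x) 0; last by rewrite Mchi.
 rewrite c0 addr0; apply: m2_image_gt0; first exact: dM.
 by have := nchi x; rewrite c0 addr0 => /gt_eqF/negbT.
have Cl := Ckp_quotient_sqrt (fun _ x _ => nchi x) pN (Ckp_add (Ckp_nn k) Cchi) CN.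
pose l t x := Num.sqrt ((nn x + chi x) / (m2_u (M t x) (uu x) (vv x) ^+ 2 + m2_v (M t x) (uu x) (vv x) ^+ 2 + chi x)).
have E t x : S t -> act (M t) x = put (l t x * m2_u (M t x) (uu x) (vv x)) (l t x * m2_v (M t x) (uu x) (vv x)) x.
 move=> St; have [nx|nx] := eqVneq (nn x) 0.
  have [u0 v0] := sq_sum0 nx; rewrite /act u0 v0.
  have -> : m2_u (M t x) 0 0 = 0 by rewrite /m2_u !mulr0 addr0.
  have -> : m2_v (M t x) 0 0 = 0 by rewrite /m2_v !mulr0 addr0. by rewrite !mulr0.
 rewrite /act /l; have [c0|c0] := eqVneq (chi x) 0; first by rewrite c0 !addr0.
 by rewrite Mchi // !divff // gt_eqF.
move=> j; apply: (Ckp_ext (F := fun t x => put (l t x * m2_u (M t x) (uu x) (vv x)) (l t x * m2_v (M t x) (uu x) (vv x)) x 0 j)).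
 by move=> t St; apply/funext => x; rewrite E.
have [j0|j0] := eqVneq j i0.
 apply: (Ckp_ext _ (Ckp_add (Ckp_cst S k c) (Ckp_mul Cl Cw))) => t _.
 by apply/funext => x; rewrite mxE j0 eqxx.
have [j1|j1] := eqVneq j i1.
 apply: (Ckp_ext _ (Ckp_mul Cl Cz)) => t _. by apply/funext => x; rewrite mxE (negbTE j0) j1 eqxx.
apply: (Ckp_ext _ (Ckp_coord S k j)) => t _.
by apply/funext => x; rewrite mxE (negbTE j0) (negbTE j1).
Qed.

End smoothness.

Lemma act_Dc r (M Mi : R -> V -> mat2) (rho : R) : 0 <= rho -> (forall k, Ckpv unit_itv k (fun t => act (M t))) ->
 (forall k, Ckpv unit_itv k (fun t => act (Mi t))) -> (forall t x, 0 <= t <= 1 -> m2_det (M t x) != 0 /\ m2_det (Mi t x) != 0) ->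
 (forall t, radial (M t) /\ radial (Mi t)) ->
 (forall t x, 0 <= t <= 1 -> exists2 k, 0 < k & m2_mul (Mi t x) (M t x) = m2_scale k m2_1) ->
 (forall t x, 0 <= t <= 1 -> exists2 k, 0 < k & m2_mul (M t x) (Mi t x) = m2_scale k m2_1) ->
 (forall x, M 0 x = m2_1) -> (forall t x, rho <= QQ x -> M t x = m2_1) ->
 [/\ G r (act (M 1)), cancel (act (M 1)) (act (Mi 1)) & cancel (act (Mi 1)) (act (M 1))].
Proof.
move=> rho0 CM CMi dM rM inv1 inv2 M0 supp.
have K1 t : 0 <= t <= 1 -> cancel (act (M t)) (act (Mi t)).
 move=> t01 x; have [d1 d2] := dM t x t01; rewrite act_comp //; last exact: (rM t).2.
 by have [k k0 E] := inv1 t x t01; exact: (act_id (k := k)).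
have K2 t : 0 <= t <= 1 -> cancel (act (Mi t)) (act (M t)).
 move=> t01 x; have [d1 d2] := dM t x t01; rewrite act_comp //; last exact: (rM t).1.
 by have [k k0 E] := inv2 t x t01; exact: (act_id (k := k)).
have id1 x M' : M' x = m2_1 -> act M' x = x.
 by move=> E; apply: (act_id (k := 1)) => //; rewrite E /m2_scale !mul1r.
have one : 0 <= (1 : R) <= 1 by lra.
split; [|exact: K1|exact: K2].
pose rad := `|c| + rho + 1.
exists [set x : V | `|x| <= rad], (fun t => act (M t)); split => //.
- exact: ball_compact.
- apply/isotopyP; split=> [t t01|k _]; last exact: CM.
 have Crvt (F : R -> V -> V) : (forall k, Ckpv unit_itv k F) -> Crv r (F t).
  move=> CF k kr l; apply: (@Ckp_reparam _ _ unit_itv [set 0] k (fun s x => F s x 0 l) (fun=> t)) => //.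
   exact: cst_continuous.
  exact: CF.
 split; last first.
  move=> x /negP; rewrite -ltNge => hx; apply: id1; apply: supp.
  have rr : rho <= (rho + 1) ^+ 2 by rewrite expr2; nra. have [j xj] : exists j, rad < `|x 0 j|.
   apply: contrapT => /forallNP H; move: hx; rewrite ltNge => /negP; apply.
   apply: le_coord => [|j]; first by nonneg. by rewrite leNgt; apply/negP/H.
  apply: le_trans rr _; have rho1 : 0 <= rho + 1 by nonneg.
  have sq (y : R) : rho + 1 <= `|y| -> (rho + 1) ^+ 2 <= y ^+ 2.
   by move=> h; rewrite -[leRHS]real_normK ?num_real // lerXn2r ?nnegrE.
  have [E|j0] := eqVneq j i0.
   apply: le_trans (uu_le_QQ x); apply: sq; rewrite /uu -E.
   by have := lerB_dist (x 0 j) c; apply: le_trans; rewrite lerBrDr addrC addrA ltW.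
  have [E|j1] := eqVneq j i1.
   apply: le_trans (nn_le_QQ x); rewrite /nn; apply: (@le_trans _ _ (vv x ^+ 2)); last by rewrite lerDr sqr_ge0.
   apply: sq; rewrite /vv -E; apply: ltW; apply: le_lt_trans xj. by rewrite /rad -addrA lerDr.
  rewrite /QQ (bigD1 j) ?j0 //=; apply: (@le_trans _ _ (x 0 j ^+ 2)).
   apply: sq; apply: ltW; apply: le_lt_trans xj. by rewrite /rad -addrA lerDr.
  rewrite addrCA lerDl addr_ge0 ?nn_ge0 // sumr_ge0 // => i _; exact: sqr_ge0.
 apply/diffeoP; split; first exact: Crvt CM.
 by exists (act (Mi t)); split; [exact: K1|exact: K2|exact: Crvt CMi].
- by apply/funext => x; exact: id1.
Qed.

End plane_actions.

Section elements.
Context {R : realType} {n : nat}.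
Local Notation V := 'rV[R]_n.
Local Notation G := (@Diffc0 R n None).
Hypothesis n2 : (1 < n)%N.
Let i0 : 'I_n := Ordinal (ltnW n2).
Let i1 : 'I_n := Ordinal n2.
Let i01 : i1 != i0. Proof. by []. Qed.
Local Notation s := (@sstep R).
Local Notation put := (@put R n i0 i1).
Local Notation uu := (@uu R n i0).
Local Notation vv := (@vv R n i1).
Local Notation nn := (@nn R n i0 i1).
Local Notation QQ := (@QQ R n i0 i1).
Local Notation act := (@act R n i0 i1).

Lemma sstep_ge0 x : 0 <= s x.
Proof. by rewrite /sstep divr_ge0 ?addr_ge0 ?expneg_ge0. Qed.

Lemma sstep_le1 x : s x <= 1.
Proof.
have [x4|x4] := leP x 4^-1; first by rewrite sstep0.
rewrite /sstep ler_pdivrMr ?mul1r ?lerDl ?expneg_ge0 //.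
by rewrite ltr_pwDl ?expneg_ge0 // expneg_pos // subr_gt0.
Qed.

Variable c : R.

Local Notation S := (@unit_itv R).
Lemma Ckp_step k F : Ckp S k F -> Ckp S k (fun t (x : V) => s (F t x)).
Proof. by move=> CF; apply: Ckp_fun CF (sstep_smooth k). Qed.

Lemma Ckp_cut k (a : R) : Ckp S k (fun _ (x : V) => 1 - s (a * QQ c x)).
Proof.
have h := Ckp_step (Ckp_scale a (Ckp_QQ i0 i1 c S k)).
exact: Ckp_onem h.
Qed.

Let quarter (x : V) : V := put c (- vv x) (uu c x) x.
Let J : mat2 := ((0, -1), (1, 0)) : mat2 (R := R).
Let quarterE x : quarter x = act c (fun=> J) x.
Proof.
rewrite /act /m2_u /m2_v /= !mul0r !mul1r addr0 add0r mulN1r sqrrN [vv x ^+ 2 + _]addrC -/(nn c x).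
have [nx|nx] := eqVneq (nn c x) 0; last by rewrite divff // sqrtr1 !mul1r.
by have [u0 v0] := sq_sum0 nx; rewrite /quarter u0 v0 oppr0 !mulr0.
Qed.

Let detJ : m2_det J = 1. Proof. by rewrite /m2_det /=; ring. Qed.

Lemma cut_rotation (Rr : R) : 0 < Rr -> exists rot roti : V -> V,
 [/\ G rot, cancel rot roti, cancel roti rot, forall x, QQ c (rot x) = QQ c x &
  (forall x, QQ c x <= Rr / 4 -> rot x = quarter x) /\ forall x, 3 / 4 * Rr <= QQ c x -> rot x = x].
Proof.
move=> Rr0; pose tau (t : R) (x : V) : R := t * (1 - s (Rr^-1 * QQ c x)).
pose N t x := (1 - tau t x) ^+ 2 + tau t x ^+ 2.
have N0 t x : 0 < N t x.
 have h : N t x = 2 * (tau t x - 1 / 2) ^+ 2 + 1 / 2 by rewrite /N; field.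
 by rewrite h; have := sqr_ge0 (tau t x - 1 / 2); lra.
pose d t x := Num.sqrt (1 / N t x).
pose p t x := d t x * (1 - tau t x). pose q t x := d t x * tau t x.
have pq t x : p t x ^+ 2 + q t x ^+ 2 = 1.
 have -> : p t x ^+ 2 + q t x ^+ 2 = d t x ^+ 2 * N t x by rewrite /p /q /N; ring.
 by rewrite /d sqr_sqrtr ?divr_ge0 ?(ltW (N0 t x)) // divfK // gt_eqF.
pose M t x : mat2 := ((p t x, - q t x), (q t x, p t x)) : mat2 (R := R).
pose Mi t x : mat2 := ((p t x, q t x), (- q t x, p t x)) : mat2 (R := R).
have Ctau k : Ckp S k tau by apply: Ckp_mul; [exact: Ckp_param|exact: Ckp_cut].
have C1tau k : Ckp S k (fun t x => 1 - tau t x).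
 exact: Ckp_onem (Ctau k).
have CN k : Ckp S k N by apply: Ckp_add; exact: Ckp_sqr.
have Cd k : Ckp S k d by apply: Ckp_quotient_sqrt (Ckp_cst S k 1) (CN k) => t x _; [exact: ltr01|exact: N0].
have Cp k : Ckp S k p by exact: Ckp_mul.
have Cq k : Ckp S k q by exact: Ckp_mul.
have CNq k : Ckp S k (fun t x => - q t x).
 exact: Ckp_opp (Cq k).
have dM t x : m2_det (M t x) = 1 by rewrite /m2_det /= -[RHS](pq t x); ring.
have dMi t x : m2_det (Mi t x) = 1 by rewrite /m2_det /= -[RHS](pq t x); ring.
have sm (M' : R -> V -> mat2 (R := R)) : (forall k, [/\ Ckp S k (fun t x => (M' t x).1.1), Ckp S k (fun t x => (M' t x).1.2),
   Ckp S k (fun t x => (M' t x).2.1) & Ckp S k (fun t x => (M' t x).2.2)]) ->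
  (forall t x, m2_det (M' t x) = 1) -> (forall t x u v, m2_u (M' t x) u v ^+ 2 + m2_v (M' t x) u v ^+ 2 = u ^+ 2 + v ^+ 2) ->
  forall k, Ckpv unit_itv k (fun t => act c (M' t)).
 move=> CM' dM' iM' k; have [C1 C2 C3 C4] := CM' k.
 have h1 x : 0 < nn c x + 1 by rewrite ltr_wpDl // nn_ge0.
 have h2 t x : S t -> m2_det (M' t x) != 0 by rewrite dM' oner_eq0.
 exact: (@Ckp_act R n i0 i1 c S k M' (fun=> 1) C1 C2 C3 C4 (Ckp_cst S k 1) (fun=> ler01) h1 h2 (fun t x _ _ => iM' t x _ _)).
have one1 (x : mat2 (R := R)) : m2_scale 1 x = x.
 by case: x => [[? ?] [? ?]]; rewrite /m2_scale /= !mul1r.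
have at0 t x : tau t x = 0 -> M t x = @m2_1 R.
 by move=> E; rewrite /M /p /q /d /N E subr0 expr0n addr0 expr1n divr1 sqrtr1 !mulr0 oppr0 mulr1.
have R34 x : 3 / 4 * Rr <= QQ c x -> s (Rr^-1 * QQ c x) = 1.
 by move=> h; apply: sstep1; rewrite ler_pdivlMl // mulrC.
have [|||||||||GM K1 K2] := @act_Dc R n i0 i1 i01 c None M Mi (3 / 4 * Rr).
- by nonneg.
- apply: sm => // t x u v; rewrite /m2_u /m2_v /= -[RHS]mul1r -(pq t x); ring.
- apply: sm => // t x u v; rewrite /m2_u /m2_v /= -[RHS]mul1r -(pq t x); ring.
- by move=> t x _; rewrite dM dMi oner_eq0.
- move=> t; split => u v x h; rewrite /M /Mi /p /q /d /N /tau QQ_put //.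
- move=> t x _; exists 1 => //; rewrite one1 /m2_mul /m2_1 /= -(pq t x); congr ((_, _), (_, _)); ring.
- move=> t x _; exists 1 => //; rewrite one1 /m2_mul /m2_1 /= -(pq t x); congr ((_, _), (_, _)); ring.
- by move=> x; apply: at0; rewrite /tau mul0r.
- by move=> t x h; apply: at0; rewrite /tau R34 // subrr mulr0.
exists (act c (M 1)), (act c (Mi 1)); split=> //.
 by move=> x; rewrite act_QQ // dM oner_eq0.
split=> x hx.
 rewrite quarterE; apply: (act_prop i0 i1 c (@ltr01 R)). have s0 : s (Rr^-1 * QQ c x) = 0.
  apply: sstep0; rewrite ler_pdivrMl //; move: hx; lra.
 have t1 : tau 1 x = 1 by rewrite /tau s0 subr0 mulr1.
 rewrite one1 /M /p /q /d /N t1 subrr expr0n add0r expr1n divr1 sqrtr1 !mulr0 !mul1r. by [].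
by apply: (act_id i0 i1 c (@ltr01 R)); rewrite one1 at0 // /tau R34 // subrr mulr0.
Qed.

Lemma hyperbolic_unipotent : exists al b : V -> V,
 [/\ G al, G b, forall x, al (b x) = b (b (al x)), forall x, al (quarter (al x)) = quarter x &
  [/\ forall x, QQ c (al x) = QQ c x, forall x, QQ c (b x) = QQ c x, forall x, 24 <= QQ c x -> al x = x,
  forall x, 24 <= QQ c x -> b x = x & exists x, b x <> x]].
Proof.
pose rho (x : V) : R := s (nn c x) * (1 - s (32^-1 * QQ c x)).
pose sig (x : V) : R := s (nn c x - 1) * (1 - s (8^-1 * QQ c x)).
have s1 x : 0 <= 1 - s x by rewrite subr_ge0 sstep_le1.
have rho0 x : 0 <= rho x by rewrite mulr_ge0 // sstep_ge0.
have sig_rho x : sig x * (rho x - 1) = 0.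
 rewrite /sig; have [h|h] := leP (nn c x - 1) 4^-1; first by rewrite sstep0 // !mul0r.
 have [h'|h'] := leP (3 / 4) (8^-1 * QQ c x); first by rewrite (sstep1 h') subrr mulr0 mul0r.
 have r1 : s (nn c x) = 1 by apply: sstep1; lra.
 have r2 : s (32^-1 * QQ c x) = 0 by apply: sstep0; lra.
 by rewrite /rho r1 r2 subr0 mul1r subrr mulr0.
pose chi (x : V) : R := 1 - s (4 * nn c x).
have chi_rho x : chi x != 0 -> rho x = 0 /\ sig x = 0.
 move=> h; have h4 : 4 * nn c x < 3 / 4.
  by rewrite ltNge; apply: contra h => /sstep1 E; rewrite /chi E subrr.
 have r1 : s (nn c x) = 0 by apply: sstep0; lra.
 have r2 : s (nn c x - 1) = 0 by apply: sstep0; lra. by rewrite /rho /sig r1 r2 !mul0r.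
have Cchi k : Ckp S k (fun _ => chi).
 have h := Ckp_step (Ckp_scale 4 (Ckp_nn i0 i1 c S k)). exact: Ckp_onem h.
have nchi x : 0 < nn c x + chi x.
 have n0 := @nn_ge0 R n i0 i1 c x; have [h|h] := leP (4 * nn c x) 4^-1.
  by rewrite /chi sstep0 // subr0 ltr_wpDl.
 by have := s1 (4 * nn c x); rewrite -/(chi x); lra.
have Crho k : Ckp S k (fun _ => rho) by apply: Ckp_mul; [apply: Ckp_step; exact: Ckp_nn|exact: Ckp_cut].
have Csig k : Ckp S k (fun _ => sig).
 apply: Ckp_mul; last exact: Ckp_cut.
 by apply: Ckp_step; apply: (Ckp_add (Ckp_nn i0 i1 c S k) (Ckp_cst S k (-1))).
have Ctr k : Ckp S k (fun t x => 1 + t * rho x).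
 by apply: (Ckp_add (Ckp_cst S k 1) (Ckp_mul (Ckp_param S k) (Crho k))).
have Cts k : Ckp S k (fun t x => t * sig x) := Ckp_mul (Ckp_param S k) (Csig k).
have CNts k : Ckp S k (fun t x => - (t * sig x)).
 exact: Ckp_opp (Cts k).
have C0 k (a : R) : Ckp S k (fun _ (_ : V) => a) := Ckp_cst S k a.
pose Ma t x : mat2 := ((1 + t * rho x, 0), (0, 1)) : mat2 (R := R).
pose Mai t x : mat2 := ((1, 0), (0, 1 + t * rho x)) : mat2 (R := R).
pose Mb t x : mat2 := ((1, t * sig x), (0, 1)) : mat2 (R := R).
pose Mbi t x : mat2 := ((1, - (t * sig x)), (0, 1)) : mat2 (R := R).
have tr0 t x : 0 <= t <= 1 -> 0 < 1 + t * rho x by move=> /andP[t0 _]; rewrite ltr_pwDl // mulr_ge0.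
have da t x : m2_det (Ma t x) = 1 + t * rho x by rewrite /m2_det /=; ring.
have dai t x : m2_det (Mai t x) = 1 + t * rho x by rewrite /m2_det /=; ring.
have db t x : m2_det (Mb t x) = 1 by rewrite /m2_det /=; ring.
have dbi t x : m2_det (Mbi t x) = 1 by rewrite /m2_det /=; ring.
have sm (M' : R -> V -> mat2 (R := R)) : (forall k, [/\ Ckp S k (fun t x => (M' t x).1.1), Ckp S k (fun t x => (M' t x).1.2),
   Ckp S k (fun t x => (M' t x).2.1) & Ckp S k (fun t x => (M' t x).2.2)]) ->
  (forall t x, S t -> m2_det (M' t x) != 0) -> (forall t x, rho x = 0 -> sig x = 0 -> M' t x = @m2_1 R) ->
  forall k, Ckpv unit_itv k (fun t => act c (M' t)).
 move=> CM' dM' iM' k; have [C1 C2 C3 C4] := CM' k.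
 apply: (@Ckp_act R n i0 i1 c S k M' chi C1 C2 C3 C4 (Cchi k) (fun=> s1 _) nchi dM' _) => t x _ /chi_rho[r0 s0].
 by rewrite iM' // /m2_u /m2_v /= !mul1r !mul0r addr0 add0r.
have one1 (x : mat2 (R := R)) : m2_scale 1 x = x.
 by case: x => [[? ?] [? ?]]; rewrite /m2_scale /= !mul1r.
have rad24 x : 24 <= QQ c x -> rho x = 0 /\ sig x = 0.
 by move=> h; rewrite /rho /sig ![s (_^-1 * _)]sstep1 ?subrr ?mulr0 //; lra.
have id_a t x : rho x = 0 -> Ma t x = @m2_1 R by move=> E; rewrite /Ma E mulr0 addr0.
have id_b t x : sig x = 0 -> Mb t x = @m2_1 R by move=> E; rewrite /Mb E mulr0.
have rrho u v x : u ^+ 2 + v ^+ 2 = nn c x -> rho (put c u v x) = rho x.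
 by move=> h; rewrite /rho nn_put // QQ_put // h.
have rsig u v x : u ^+ 2 + v ^+ 2 = nn c x -> sig (put c u v x) = sig x.
 by move=> h; rewrite /sig nn_put // QQ_put // h.
have [|||||||||Ga _ _] := @act_Dc R n i0 i1 i01 c None Ma Mai 24.
- by [].
- apply: sm => [k|t x /tr0 h|t x h _]; [split; [exact: Ctr|exact: C0..]|by rewrite da gt_eqF|].
 exact: id_a.
- apply: sm => [k|t x /tr0 h|t x h _]; [split; [exact: C0|exact: C0|exact: C0|exact: Ctr]|by rewrite dai gt_eqF|].
 by rewrite /Mai h mulr0 addr0.
- by move=> t x /tr0 h; rewrite da dai gt_eqF.
- by move=> t; split=> u v x h; rewrite /Ma /Mai rrho.
- move=> t x /tr0 h; exists (1 + t * rho x) => //; rewrite /m2_mul /m2_scale /=.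
 congr ((_, _), (_, _)); ring.
- move=> t x /tr0 h; exists (1 + t * rho x) => //; rewrite /m2_mul /m2_scale /=.
 congr ((_, _), (_, _)); ring.
- by move=> x; rewrite /Ma mul0r addr0.
- by move=> t x /rad24[h _]; exact: id_a.
have [|||||||||Gb _ _] := @act_Dc R n i0 i1 i01 c None Mb Mbi 24.
- by [].
- apply: sm => [k|t x _|t x _ h]; [split; [exact: C0|exact: Cts|exact: C0|exact: C0]|by rewrite db oner_eq0|].
 exact: id_b.
- apply: sm => [k|t x _|t x _ h]; [split; [exact: C0|exact: CNts|exact: C0|exact: C0]|by rewrite dbi oner_eq0|].
 by rewrite /Mbi h mulr0 oppr0.
- by move=> t x _; rewrite db dbi oner_eq0.
- by move=> t; split=> u v x h; rewrite /Mb /Mbi rsig.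
- move=> t x _; exists 1 => //; rewrite one1 /m2_mul /m2_1 /=. congr ((_, _), (_, _)); ring.
- move=> t x _; exists 1 => //; rewrite one1 /m2_mul /m2_1 /=. congr ((_, _), (_, _)); ring.
- by move=> x; rewrite /Mb mul0r.
- by move=> t x /rad24[_ h]; exact: id_b.
have dan x : m2_det (Ma 1 x) != 0 by rewrite da gt_eqF // tr0 // ler01 lexx.
have dbn x : m2_det (Mb 1 x) != 0 by rewrite db oner_eq0.
have dJ : m2_det J != 0 by rewrite detJ oner_eq0.
have ra : radial i0 i1 c (Ma 1) by move=> u v x h; rewrite /Ma rrho.
have rb : radial i0 i1 c (Mb 1) by move=> u v x h; rewrite /Mb rsig.
have rJ : radial i0 i1 c (fun=> J) by [].
have dmul (A B : mat2 (R := R)) : m2_det A != 0 -> m2_det B != 0 -> m2_det (m2_mul A B) != 0.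
 by move=> a b; rewrite m2_detM mulf_neq0.
have rmul (A B : V -> mat2 (R := R)) : radial i0 i1 c A -> radial i0 i1 c B -> radial i0 i1 c (fun x => m2_mul (A x) (B x)).
 by move=> rA rB u v x h; rewrite rA // rB.
exists (act c (Ma 1)), (act c (Mb 1)); split=> //.
- move=> x; rewrite !act_comp //; try (first [exact: dmul|exact: rmul]).
 apply: (act_prop i0 i1 c (@ltr01 R)); rewrite one1 /m2_mul /=; congr ((_, _), (_, _)); try ring.
 apply/eqP; rewrite -subr_eq0; apply/eqP; rewrite -[RHS](sig_rho x); ring.
- move=> x; rewrite !quarterE !act_comp //; try (first [exact: dmul|exact: rmul]).
 have k0 : 0 < 1 + 1 * rho x by rewrite tr0 // ler01 lexx. apply: (act_prop i0 i1 c k0).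
 rewrite /m2_mul /m2_scale /=; congr ((_, _), (_, _)); ring.
split.
- by move=> x; rewrite act_QQ.
- by move=> x; rewrite act_QQ.
- by move=> x /rad24[h _]; apply: (act_id i0 i1 c (@ltr01 R)); rewrite one1 id_a.
- by move=> x /rad24[_ h]; apply: (act_id i0 i1 c (@ltr01 R)); rewrite one1 id_b.
pose x := put c 0 (4 / 3) 0.
have nx : nn c x = 16 / 9 by rewrite /x nn_put //; field.
have Qx : QQ c x = 16 / 9.
 rewrite /QQ nx big1 ?addr0 // => j /andP[/negbTE j0 /negbTE j1]. by rewrite !mxE j0 j1 expr0n.
have sx : sig x = 1 by rewrite /sig nx Qx sstep1 ?sstep0 ?subr0 ?mul1r //; lra.
exists x => E; have := congr1 (uu c) E; rewrite /act uu_put // /Mb sx /m2_u /m2_v /= /x uu_put // vv_put // nn_put //.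
rewrite !mul1r !mul0r !add0r => /eqP; rewrite mulf_eq0 sqrtr_eq0 => /orP[|/eqP]; last by lra.
rewrite leNgt => /negP; apply; apply: divr_gt0; lra.
Qed.

End elements.

Section configuration.
Context {R : realType}.

Lemma commute_disj (T : Type) (P : T -> Prop) (f g : T -> T) : injective f -> injective g ->
 (forall x, f x <> x -> P x) -> (forall x, P x -> g x = x) -> forall x, f (g x) = g (f x).
Proof.
move=> fi gi fP gP x; have [fx|fx] := pselect (f x = x); last first.
 have ffx : f (f x) <> f x by move=> /fi. by rewrite (gP x (fP x fx)) (gP _ (fP _ ffx)).
rewrite fx; apply: contrapT => ne; have gx := gi _ _ (gP _ (fP _ ne)).
by apply: ne; rewrite gx fx.
Qed.

Lemma sq_bound (u a : R) : 0 < a -> u ^+ 2 < a ^+ 2 -> - a < u < a.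
Proof.
move=> a0 h; rewrite -ltr_norml -(@ltr_pXn2r _ 2%N) ?nnegrE ?(ltW a0) //.
by rewrite real_normK ?num_real.
Qed.

Context {n : nat}.
Local Notation V := 'rV[R]_n.
Local Notation G := (@Diffc0 R n None).
Hypothesis n2 : (1 < n)%N.
Let i0 : 'I_n := Ordinal (ltnW n2).
Let i1 : 'I_n := Ordinal n2.
Let i01 : i1 != i0. Proof. by []. Qed.
Local Notation put := (@put R n i0 i1).
Local Notation uu := (@uu R n i0).
Local Notation vv := (@vv R n i1).
Local Notation QQ := (@QQ R n i0 i1).

Lemma uu_shift c c' x : uu c' x = uu c x + (c - c').
Proof. by rewrite /uu addrA subrK. Qed.

Lemma QQ_shift c c' x : QQ c' x = QQ c x + 2 * (c - c') * uu c x + (c - c') ^+ 2.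
Proof. by rewrite /QQ; move: (\sum_(j | _) _) => S; rewrite /nn (uu_shift c c'); ring. Qed.

Lemma uu_bound c x a : 0 < a -> QQ c x < a ^+ 2 -> - a < uu c x < a.
Proof. by move=> a0 h; apply: sq_bound => //; apply: le_lt_trans h; exact: uu_le_QQ. Qed.

(* al and b live near (26, 0), the rotation gam1 by pi / 2 about (20, 0) moves
  their support away from itself, kh is the rotation by pi / 2 about 0, and
  g = gam1 o (kh kh) gam1^-1 (kh kh)^-1 is inverted by kh kh. *)
Lemma group_elements : exists al b k k' g gi : V -> V,
 [/\ [/\ G al, G b, G k, G k' & G g], cancel g gi, cancel gi g, forall x, al (b x) = b (b (al x)) & 
  [/\ forall x, al (k (al x)) = k x, forall x, g (k' (g x)) = k' x,
   forall x, iter 4 g (al x) = al (iter 4 g x), forall x, iter 4 g (b x) = b (iter 4 g x) &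
   (forall x, iter 2 g (b (iter 2 gi (al x))) = al (iter 2 g (b (iter 2 gi x)))) /\ exists x, b x <> x]].
Proof.
have [al [b [Gal Gb alb alJ [Qal Qb sal sb [x0 bx0]]]]] := @hyperbolic_unipotent R n n2 26.
have p512 : (0 : R) < 512 by rewrite ltr0n.
have p6400 : (0 : R) < 6400 by rewrite ltr0n.
have [k [ki [Gk kK kiK Qk [kJ _]]]] := @cut_rotation R n n2 26 512 p512.
have [h [hi [Gh hK hiK Qh [hJ sh]]]] := @cut_rotation R n n2 20 512 p512.
have [kh [khi [Gkh khK khiK Qkh [khJ _]]]] := @cut_rotation R n n2 0 6400 p6400.
pose half c x : V := put c (- uu c x) (- vv x) x.
have half_uu c x : uu c (half c x) = - uu c x by rewrite /half uu_put.
have quarter2 c x : put c (- vv (put c (- vv x) (uu c x) x)) (uu c (put c (- vv x) (uu c x) x)) (put c (- vv x) (uu c x) x) = half c x.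
 by rewrite vv_put // uu_put // put_put.
have half2 c x : half c (half c x) = x by rewrite /half uu_put // vv_put // put_put !opprK put_id.
pose kk x := kh (kh x).
have kkE x : QQ 0 x <= 1600 -> kk x = half 0 x.
 move=> hx; rewrite /kk khJ ?Qkh; last by lra. by rewrite khJ ?quarter2 //; lra.
have sh' x : h x <> x -> QQ 20 x < 384 by move=> hx; rewrite ltNge; apply/negP => h'; apply: hx; apply: sh; lra.
have shi x : hi x <> x -> QQ 20 x < 384 by move=> hx; apply: sh' => h'; apply: hx; rewrite -{1}h' hK.
have near0 x : QQ 20 x < 384 -> QQ 0 x <= 1600.
 move=> hx; have /andP[_ u2] : - 20 < uu 20 x < 20.
  by apply: uu_bound => //; apply: lt_trans hx _; rewrite expr2; lra.
 by rewrite (QQ_shift 20); move: hx u2; move: (QQ 20 x) (uu 20 x) => q u; rewrite subr0; lra.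
pose gam2 x := kh (kh (hi (khi (khi x)))); pose gam2i x := kh (kh (h (khi (khi x)))).
pose g x := h (gam2 x); pose gi x := gam2i (hi x).
have gK : cancel g gi by move=> x; rewrite /g /gi /gam2 /gam2i hK !khK hiK !khiK.
have giK : cancel gi g by move=> x; rewrite /g /gi /gam2 /gam2i !khK hK !khiK hiK.
have gam2_id x : QQ 20 x <= 128 -> gam2 x = x.
 move=> hx; apply: contrapT => ne; pose y := khi (khi x). have xE : x = kk y by rewrite /kk /y !khiK.
 have /shi hy : hi y <> y by move=> E; apply: ne; rewrite /gam2 -/y E [RHS]xE.
 have /andP[u1 u2] : - 20 < uu 20 y < 20 by apply: uu_bound => //; apply: lt_trans hy _; rewrite expr2; lra.
 have : uu 0 x = - uu 0 y by rewrite xE kkE ?half_uu //; exact: near0. rewrite !(uu_shift 20 0) => E.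
 have ux : 12 ^+ 2 <= uu 20 x ^+ 2.
  have -> : uu 20 x = - (uu 20 y + 40) by move: E; lra.
  rewrite sqrrN; apply: lerXn2r; rewrite ?nnegrE; move: u1; lra.
 have := uu_le_QQ i0 i1 20 x; move: ux hx; rewrite expr2; lra.
have hE x : QQ 20 x <= 128 -> g x = put 20 (- vv x) (uu 20 x) x by move=> hx; rewrite /g gam2_id // hJ //; lra.
have gQ x : QQ 20 x <= 128 -> QQ 20 (g x) = QQ 20 x by move=> hx; rewrite /g gam2_id // Qh.
have g2E x : QQ 20 x <= 128 -> g (g x) = half 20 x by move=> hx; rewrite hE ?gQ // hE // quarter2.
have halfQ x : QQ 20 (half 20 x) = QQ 20 x by rewrite /half QQ_put // /nn !sqrrN.
have g4E x : QQ 20 x <= 128 -> iter 4 g x = x by move=> hx; rewrite /= (g2E x) // g2E ?halfQ // half2.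
have near20 x : QQ 26 x < 24 -> QQ 20 x <= 128.
 move=> hx; have /andP[_ u2] : - 5 < uu 26 x < 5.
  by apply: uu_bound => //; apply: lt_trans hx _; rewrite expr2; lra.
 have e6 : (26 - 20 : R) = 6 by lra.
 by rewrite (QQ_shift 26) e6 expr2; move: hx u2; move: (QQ 26 x) (uu 26 x) => q u; lra.
have sal' x : al x <> x -> QQ 26 x < 24 by move=> hx; rewrite ltNge; apply/negP => /sal.
have sb' x : b x <> x -> QQ 26 x < 24 by move=> hx; rewrite ltNge; apply/negP => /sb.
have [ali [_ alK _]] := Dc_inv Gal; have [bi [_ bK _]] := Dc_inv Gb.
have al_inj := can_inj alK; have b_inj := can_inj bK; have g_inj := can_inj gK.
have iter_inj m : injective (iter m g) by elim: m => // m IH x y /= /g_inj/IH.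
have Gg2 : G gam2.
 have [khi' [Gkhi' khK' khiK']] := Dc_inv Gkh; have [hi' [Ghi' hK' hiK']] := Dc_inv Gh.
 have -> : gam2 = kh \o (kh \o (hi' \o (khi' \o khi'))).
  apply/funext => x; rewrite /gam2 /=; have E y : khi y = khi' y by rewrite -[y in RHS]khiK khK'.
  by rewrite !E; do 2 congr kh; rewrite -[X in _ = hi' X]hiK hK'.
 do ![apply: Dc_comp => //].
exists al, b, k, kk, g, gi; split=> //.
- split=> //; first exact: (Dc_comp Gkh Gkh). exact: (Dc_comp Gh Gg2).
split.
- move=> x; have [hx|hx] := leP (QQ 26 x) 128.
  by rewrite kJ ?Qal ?alJ ?kJ //; lra.
 have s24 : 24 <= QQ 26 x by move: hx; lra. by rewrite (sal x) // sal // Qk.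
- move=> x; have kk_inj : injective (fun x => kk (kk x)).
  by apply: (can_inj (g := fun x => khi (khi (khi (khi x))))) => y; rewrite /kk !khK.
 have hi_inj : injective hi := can_inj hiK. have comm := commute_disj hi_inj kk_inj shi _.
 rewrite /g /gam2 -/(kk _) -/(kk (hi _)) /kk !khK hK -/(kk _) -/(kk (kk _)).
 have {comm} -> : kk (kk (hi (khi (khi x)))) = hi (kk (kk (khi (khi x)))).
  rewrite comm // => y /near0 hy; rewrite (kkE y) // kkE; first exact: half2.
  by rewrite /half QQ_put // /nn !sqrrN.
 by rewrite hiK /kk !khiK.
- move=> x; apply/esym; apply: (commute_disj al_inj (iter_inj 4%N) sal') => y /near20; exact: g4E.
- move=> x; apply/esym; apply: (commute_disj b_inj (iter_inj 4%N) sb') => y /near20; exact: g4E.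
split; last by exists x0.
move=> x; have inj1 : injective (fun x => iter 2 g (b (iter 2 gi x))).
 move=> y z /iter_inj/b_inj /=; have gi_inj := can_inj giK; by move=> /gi_inj/gi_inj.
apply/esym; apply: (commute_disj al_inj inj1 sal') => y hy.
apply: contrapT => ne; pose z := iter 2 gi y.
have yz : y = g (g z) by rewrite /z /= !giK.
have /sb' hz : b z <> z by move=> E; apply: ne; rewrite -/z E [RHS]yz.
have /andP[u1 u2] : - 5 < uu 26 y < 5 by apply: uu_bound => //; apply: lt_trans hy _; rewrite expr2; lra.
have /andP[u3 u4] : - 5 < uu 26 z < 5 by apply: uu_bound => //; apply: lt_trans hz _; rewrite expr2; lra.
have : uu 20 y = - uu 20 z by rewrite yz g2E ?half_uu //; exact: near20.
by rewrite !(uu_shift 26 20); move: u1 u2 u3 u4; lra.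
Qed.

End configuration.

Section abelian_maps.
Context {Y : Type}.

Record am_group := AbelianMaps { am_set :> set (Y -> Y); am_id : am_set id;
 am_comp : forall u v, am_set u -> am_set v -> am_set (u \o v); am_inv : forall u, am_set u -> exists2 v, am_set v & v \o u = id;
 am_comm : forall u v, am_set u -> am_set v -> u \o v = v \o u }.

Definition am_elt (A : am_group) := {u : Y -> Y | am_set A u}.

HB.instance Definition _ (A : am_group) := gen_eqMixin (am_elt A).
HB.instance Definition _ (A : am_group) := gen_choiceMixin (am_elt A).

Section zmodule.
Variable A : am_group.
Definition am_zero : am_elt A := exist _ id (am_id A).
Definition am_add (u v : am_elt A) : am_elt A := exist _ (sval u \o sval v) (am_comp (svalP u) (svalP v)).
Definition am_opp (u : am_elt A) : am_elt A := let w := cid2 (am_inv (svalP u)) in exist _ (s2val w) (s2valP w).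

Lemma am_addA : associative am_add. Proof. by move=> u v w; exact: eq_exist. Qed.
Lemma am_addC : commutative am_add.
Proof. by move=> u v; apply: eq_exist; exact: am_comm (svalP u) (svalP v). Qed.
Lemma am_add0 : left_id am_zero am_add. Proof. by move=> [u hu]; exact: eq_exist. Qed.
Lemma am_addN : left_inverse am_zero am_opp am_add.
Proof. by move=> u; apply: eq_exist; rewrite /am_opp /=; case: cid2. Qed.
End zmodule.

HB.instance Definition _ (A : am_group) := GRing.isZmodule.Build (am_elt A) (@am_addA A) (@am_addC A) (@am_add0 A) (@am_addN A).

End abelian_maps.

Section homomorphisms.
Context {R : realType} {n : nat} (r : regularity) {Y : Type}.
Local Notation V := 'rV[R]_n.
Local Notation G := (@Diffc0 R n r).
Hypotheses (n2 : (1 < n)%N) (rn : r <> Some n.+1).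
Variable phi : (V -> V) -> Y -> Y.
Hypotheses (phiM : forall f g, G f -> G g -> phi (f \o g) = phi f \o phi g) (phi_inj : forall f, G f -> injective (phi f)).

Let n0 : (0 < n)%N. Proof. exact: ltnW. Qed.

Lemma phi1 : phi id = id.
Proof.
have h := phiM (Dc_id r) (Dc_id r); apply/funext => y.
by apply: (phi_inj (Dc_id r)); have := congr1 (fun f => f y) h.
Qed.

Lemma phi_comm f g : G f -> G g -> (forall x, f (g x) = g (f x)) -> phi f \o phi g = phi g \o phi f.
Proof. by move=> Gf Gg fg; rewrite -!phiM //; congr phi; apply/funext. Qed.

Lemma abelian_trivial : (forall f g, G f -> G g -> phi f \o phi g = phi g \o phi f) -> forall f, G f -> phi f = id.
Proof.
move=> comm f Gf; pose S := [set u | exists2 h, G h & phi h = u].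
have Sid : S id by exists id; [exact: Dc_id|exact: phi1].
have Scomp u v : S u -> S v -> S (u \o v).
 by move=> [h Gh <-] [k Gk <-]; exists (h \o k); [exact: Dc_comp|exact: phiM].
have Sinv u : S u -> exists2 v, S v & v \o u = id.
 move=> [h Gh <-]; have [hi [Ghi hK _]] := Dc_inv Gh. exists (phi hi); first by exists hi.
 by rewrite -phiM // -phi1; congr phi; apply/funext.
have Scomm u v : S u -> S v -> u \o v = v \o u by move=> [h Gh <-] [k Gk <-]; exact: comm.
pose A := AbelianMaps Sid Scomp Sinv Scomm.
have Sphi h : G h -> am_set A (phi h) by move=> Gh; exists h.
pose chi (h : V -> V) : am_elt A := if pselect (G h) is left Gh then exist _ (phi h) (Sphi h Gh) else 0.
have chiE h (Gh : G h) : sval (chi h) = phi h by rewrite /chi; case: pselect.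
have hchi : additive_on r chi.
 move=> h k Gh Gk; have Ghk := Dc_comp Gh Gk.
 have : sval (chi (h \o k)) = sval (chi h + chi k) by rewrite chiE // phiM // /= !chiE.
 by case: (chi (h \o k)) (chi h + chi k) => [u hu] [v hv] /= E; exact: eq_exist.
by rewrite -chiE // (Dc_perfect n0 rn hchi Gf).
Qed.

Lemma shrink (M delta : R) (x0 : V) : 0 < delta -> exists2 sg, G sg & forall x, `|x| <= M -> `|sg x - x0| < delta.
Proof.
move=> d0; pose M1 := Num.max M 1; have M10 : 0 < M1 by rewrite lt_max ltr01 orbT.
pose a := Num.max 1 (2 * M1 / delta).
have a1 : 1 <= a by rewrite le_max lexx.
have a0 : 0 < a by lra.
have ad : M1 / a < delta.
 rewrite ltr_pdivrMr //; apply: (@lt_le_trans _ _ (2 * M1)); first by rewrite mulr_natl mulr2n ltrDl.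
 by rewrite -ler_pdivrMl // mulrC le_max lexx orbT.
have [D GD DE] := @dilation_Dc R n r a M1 a1.
have [Di [GDi DK _]] := Dc_inv GD.
have [t Gt tE] := @transl_Dc R n r x0 M1.
have xa (x : V) : `|x| <= M -> `|a^-1 *: x| <= M1 / a.
 move=> xM; rewrite normrZ gtr0_norm ?invr_gt0 // mulrC ler_wpM2r ?invr_ge0 ?(ltW a0) //.
 by rewrite le_max xM.
have M1a : M1 / a <= M1 by rewrite ler_pdivrMr // ler_peMr // ltW.
exists (t \o Di); first exact: Dc_comp.
move=> x xM; have -> /= : (t \o Di) x = a^-1 *: x + x0.
 rewrite /= -tE; last by exact: (le_trans (xa x xM) M1a).
 by congr t; rewrite -[RHS]DK DE ?scalerKV ?gt_eqF //; exact: (le_trans (xa x xM) M1a).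
by rewrite addrK; exact: le_lt_trans (xa x xM) ad.
Qed.

Lemma kernel_trivial b : G b -> phi b = id -> (exists x, b x <> x) -> forall f, G f -> phi f = id.
Proof.
move=> Gb pb [x0 bx0]; apply: abelian_trivial => f k Gf Gk.
have [bi [Gbi bK biK]] := Dc_inv Gb.
have d1 : 0 < `|b x0 - x0| / 3 by rewrite divr_gt0 // normr_gt0 subr_eq0; apply/eqP.
have cb := Dc_cont Gb.
have /(@cvgrPdist_lt _ _ _ _ (nbhs_filter _))/(_ _ d1)/nbhs_ballP[d /= d0 Hd] := cb x0.
pose delta := Num.min d (`|b x0 - x0| / 3).
have delta0 : 0 < delta by rewrite lt_min d0.
pose P x := `|x - x0| < delta.
have Pb x : P x -> ~ P (b x).
 rewrite /P !lt_min => /andP[xd _] /andP[_ h2].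
 have h1 : `|b x0 - b x| < `|b x0 - x0| / 3 by apply: Hd; rewrite -ball_normE /= distrC.
 have := ler_normD (b x0 - b x) (b x - x0); rewrite addrA subrK; move: h1 h2; lra.
have [Mf _ sf] := Dc_supp Gf; have [Mk _ sk] := Dc_supp Gk.
have [sg Gsg sgE] := shrink (Num.max Mf Mk) x0 delta0.
have [si [Gsi sK siK]] := Dc_inv Gsg.
pose f' := sg \o (f \o si); pose k' := sg \o (k \o si).
have Gf' : G f' by do ![apply: Dc_comp => //].
have Gk' : G k' by do ![apply: Dc_comp => //].
have supp h M : (forall x, M < `|x| -> h x = x) -> M <= Num.max Mf Mk -> forall x, (sg \o (h \o si)) x <> x -> P x.
 move=> sh MM x hx; rewrite -[x]siK; apply: sgE; apply: le_trans MM.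
 by rewrite leNgt; apply/negP => /sh E; apply: hx; rewrite /= E siK.
have [fi' [Gfi' fK' fiK']] := Dc_inv Gf'.
have [ki' [_ kK' _]] := Dc_inv Gk'.
pose w := b \o (fi' \o bi); have Gw : G w by do ![apply: Dc_comp => //].
have pw : phi w = phi fi'.
 have pbi : phi bi = id.
  have := phiM Gbi Gb; rewrite (_ : bi \o b = id) ?phi1 ?pb; last exact/funext. by [].
 by rewrite /w (phiM Gb (Dc_comp Gfi' Gbi)) (phiM Gfi' Gbi) pb pbi.
have [wi [_ wK _]] := Dc_inv Gw.
have comm' : forall x, k' (w x) = w (k' x).
 apply: (commute_disj (P := P) (can_inj kK') (can_inj wK)) => [x|x Px].
  by apply: (supp k Mk sk); rewrite le_max lexx orbT.
 rewrite /w /=; have E : f' (bi x) = bi x.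
  apply: contrapT => /(supp f Mf sf _ (bi x)) h.
  by apply: (@Pb (bi x)); [apply: h; rewrite le_max lexx|rewrite biK].
 by rewrite -{1}E fK' biK.
have := phi_comm Gk' Gw comm'; rewrite pw => E1.
have cf : phi f' \o phi k' = phi k' \o phi f'.
 have ff : phi f' \o phi fi' = id by rewrite -phiM // -phi1; congr phi; apply/funext.
 have ff' : phi fi' \o phi f' = id by rewrite -phiM // -phi1; congr phi; apply/funext.
 apply/funext => y /=; have h1 z : phi f' (phi fi' z) = z by have := congr1 (fun u => u z) ff.
 have h2 z : phi fi' (phi f' z) = z by have := congr1 (fun u => u z) ff'.
 have h3 z : phi k' (phi fi' z) = phi fi' (phi k' z) by have := congr1 (fun u => u z) E1.
 by rewrite -{1}(h2 y) h3 h1.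
have fE : f = si \o (f' \o sg) by apply/funext => x; rewrite /f' /= sK sK.
have kE : k = si \o (k' \o sg) by apply/funext => x; rewrite /k' /= sK sK.
have ss : phi sg \o phi si = id by rewrite -phiM // -phi1; congr phi; apply/funext.
have Gfs : G (f' \o sg) by exact: Dc_comp.
have Gks : G (k' \o sg) by exact: Dc_comp.
apply/funext => y; rewrite fE kE (phiM Gsi Gfs) (phiM Gsi Gks) (phiM Gf' Gsg) (phiM Gk' Gsg) /=.
have ssE z : phi sg (phi si z) = z by have := congr1 (fun h => h z) ss.
by rewrite !ssE; congr (phi si _); have := congr1 (fun h => h (phi sg y)) cf.
Qed.

End homomorphisms.

Section lifted_action.
Context {R : realType}.

Definition line_diffeo (L : R -> R) := exists Li L' : R -> R,
 [/\ cancel L Li, cancel Li L, forall x : R, is_derive x 1 L (L' x), continuous L' &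
  ({mono L : x y / x <= y} /\ forall x, 0 < L' x) \/ {mono L : x y /~ x <= y}].

(* [lift u L]: the map [L] of the line lifts [u]; lifts differ by multiples of
  the period [tau], which is 0 for actions on the line itself. *)
Record lifting (Y : Type) (H : set (Y -> Y)) (lift : (Y -> Y) -> (R -> R) -> Prop) (tau : R) : Prop := Lifting {
 tau_ge0 : 0 <= tau; lift_inj : forall u, H u -> injective u; lift_ex : forall u, H u -> exists L, lift u L;
 lift_diffeo : forall u L, H u -> lift u L -> line_diffeo L;
 lift_comp : forall u v L M, lift u L -> lift v M -> lift (u \o v) (L \o M);
 lift_shift : forall u L (m : int), lift u L -> lift u (fun x => L x + m%:~R * tau);
 lift_uniq : forall u L L', H u -> lift u L -> lift u L' -> exists m : int, forall x, L' x = L x + m%:~R * tau;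
 lift_per : forall u L, H u -> lift u L -> {mono L : x y / x <= y} -> forall x, L (x + tau) = L x + tau; lift_id : lift id id;
 lift_faithful : forall u, H u -> lift u id -> u = id }.

Lemma per_int (L : R -> R) tau (m : int) x : (forall x, L (x + tau) = L x + tau) -> L (x + m%:~R * tau) = L x + m%:~R * tau.
Proof.
move=> per; have pos (k : nat) y : L (y + k%:R * tau) = L y + k%:R * tau.
 elim: k => [|k IH]; first by rewrite !mul0r !addr0. by rewrite -natr1 mulrDl mul1r addrA per IH addrA.
case: m => k; first exact: pos.
rewrite NegzE mulrNz mulNr; apply/eqP; rewrite eq_sym subr_eq -pos.
by rewrite subrK.
Qed.

Lemma comm_translation (L M : R -> R) tau (m : int) x0 : 0 <= tau ->
 {mono L : x y / x <= y} -> (forall x, L (x + tau) = L x + tau) -> L x0 = x0 ->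
 (forall x, L (M x) = M (L x) + m%:~R * tau) -> m%:~R * tau = 0.
Proof.
move=> tau0 Lle per Lx0 LM; have [->|tn0] := eqVneq tau 0; first by rewrite mulr0.
have tp : 0 < tau by lra.
pose y := M x0; have Ly : L y = y + m%:~R * tau by rewrite /y LM Lx0.
pose k := Num.floor ((y - x0) / tau).
have /andP[k1 k2] := floor_itv ((y - x0) / tau); rewrite -/k in k1 k2.
rewrite ler_pdivlMr // in k1; rewrite ltr_pdivrMr // intrD mulrDl mul1r in k2.
have k1' : x0 + k%:~R * tau <= y by lra.
have k2' : y < x0 + k%:~R * tau + tau by lra.
have Lx : L (x0 + k%:~R * tau) = x0 + k%:~R * tau by rewrite per_int // Lx0.
have h1 : x0 + k%:~R * tau <= L y by rewrite -[leLHS]Lx Lle.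
have h2 : L y < x0 + k%:~R * tau + tau by rewrite -[X in X + tau]Lx -per (leW_mono Lle).
have [m0|m0|->] := ltgtP m 0; last by rewrite mul0r.
 have m1 : m <= - 1 by []. have : m%:~R * tau <= (- 1)%:~R * tau by rewrite ler_pM2r // ler_int.
 rewrite mulrNz mulr1z mulN1r; move: h1 k2'; rewrite Ly; move: (k%:~R * tau) (m%:~R * tau) => u v; lra.
have m1 : 1 <= m by [].
have : 1%:~R * tau <= m%:~R * tau by rewrite ler_pM2r // ler_int.
rewrite mulr1z mul1r; move: h2 k1'; rewrite Ly; move: (k%:~R * tau) (m%:~R * tau) => u v; lra.
Qed.

Context {n : nat} (r : regularity) {Y : Type}.
Local Notation V := 'rV[R]_n.
Local Notation G := (@Diffc0 R n r).
Hypotheses (n2 : (1 < n)%N) (rn : r <> Some n.+1).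
Variables (H : set (Y -> Y)) (lift : (Y -> Y) -> (R -> R) -> Prop) (tau : R).
Hypothesis HL : lifting H lift tau.
Variable phi : (V -> V) -> Y -> Y.
Hypotheses (phiH : forall f, G f -> H (phi f)) (phiM : forall f g, G f -> G g -> phi (f \o g) = phi f \o phi g).

Let phi_inj f (Gf : G f) := lift_inj HL (phiH Gf).

Definition reversing f := exists2 L, lift (phi f) L & {mono L : x y /~ x <= y}.

Lemma mono_dec_absurd (L : R -> R) : {mono L : x y / x <= y} -> {mono L : x y /~ x <= y} -> False.
Proof. by move=> a b; have := a 0 1; rewrite b ler01 ler10. Qed.

Lemma reversing_lift f L : G f -> lift (phi f) L -> reversing f -> {mono L : x y /~ x <= y}.
Proof.
move=> Gf lL [M lM dM]; have [m E] := lift_uniq HL (phiH Gf) lM lL.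
by move=> x y; rewrite !E lerD2r dM.
Qed.

Lemma pres_lift f L : G f -> lift (phi f) L -> ~ reversing f -> {mono L : x y / x <= y}.
Proof.
move=> Gf lL nr; have [Li [L' [_ _ _ _ [[]//|d]]]] := lift_diffeo HL (phiH Gf) lL.
by case: nr; exists L.
Qed.

Lemma not_reversing f : G f -> ~ reversing f.
Proof.
pose chi f : 'I_2 := if `[< reversing f >] then 1%R else 0%R.
have hchi : additive_on r chi.
 move=> f1 f2 G1 G2; have G12 := Dc_comp G1 G2.
 have [L1 l1] := lift_ex HL (phiH G1); have [L2 l2] := lift_ex HL (phiH G2).
 have l12 : lift (phi (f1 \o f2)) (L1 \o L2) by rewrite phiM //; exact: (lift_comp HL).
 have dich h L : G h -> lift (phi h) L -> {mono L : x y / x <= y} /\ ~ reversing h \/ {mono L : x y /~ x <= y} /\ reversing h.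
  move=> Gh lL; have [rv|nr] := pselect (reversing h); [right|left]; split=> //.
   exact: (reversing_lift Gh lL rv).
  exact: (pres_lift Gh lL nr).
 have t01 : (0 <= 1 :> R) = true by rewrite ler01. have t10 : (1 <= 0 :> R) = false by rewrite ler10.
 by case: (dich _ _ G1 l1) => -[a1 b1]; case: (dich _ _ G2 l2) => -[a2 b2];
  case: (dich _ _ G12 l12) => -[a12 b12]; rewrite /chi ?(asboolT b1) ?(asboolF b1) ?(asboolT b2)
   ?(asboolF b2) ?(asboolT b12) ?(asboolF b12); (try exact: val_inj); have := a12 0 1; rewrite /= a1 a2 t01 t10.
move=> Gf rf; have := Dc_perfect (ltnW n2) rn hchi Gf.
by rewrite /chi; case: asboolP.
Qed.

Lemma hom_trivial f : G f -> phi f = id.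
Proof.
have GN h : Diffc0 None h -> G h by apply: Dc_le.
have [al [b [k [k' [g [gi [[Gal Gb Gk Gk' Gg] gK giK alb [alk gkg g4a g4b [gbga bx]]]]]]]]] := @group_elements R n n2.
have {Gal}Gal := GN _ Gal; have {Gb}Gb := GN _ Gb; have {Gk}Gk := GN _ Gk; have {Gk'}Gk' := GN _ Gk'.
have {Gg}Gg := GN _ Gg.
have Ggi : G gi.
 have [g' [Gg' g'K g'iK]] := Dc_inv Gg; rewrite (_ : gi = g') //.
 by apply/funext => x; rewrite -[x in RHS]giK g'K.
apply: (kernel_trivial n2 rn phiM phi_inj Gb _ bx).
have inc h : G h -> exists L Li, lift (phi h) L /\ inc_bij L Li.
 move=> Gh; have [L lL] := lift_ex HL (phiH Gh); have [Li [L' [a c _ _ _]]] := lift_diffeo HL (phiH Gh) lL.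
 by exists L, Li; split=> //; split=> //; exact: pres_lift lL (not_reversing Gh).
have per h L : G h -> lift (phi h) L -> forall x (m : int), L (x + m%:~R * tau) = L x + m%:~R * tau.
 move=> Gh lL x m; apply: per_int; apply: (lift_per HL (phiH Gh) lL).
 exact: pres_lift lL (not_reversing Gh).
have rel h1 h2 L1 L2 : G h1 -> lift (phi h1) L1 -> lift (phi h2) L2 -> (forall x, h1 x = h2 x) ->
  exists m : int, forall x, L2 x = L1 x + m%:~R * tau.
 by move=> G1 l1 l2 E; apply: (lift_uniq HL (phiH G1) l1); rewrite (_ : h1 = h2) //; exact/funext.
have lc h1 h2 L1 L2 : G h1 -> G h2 -> lift (phi h1) L1 -> lift (phi h2) L2 -> lift (phi (h1 \o h2)) (L1 \o L2).
 by move=> G1 G2 l1 l2; rewrite phiM //; exact: (lift_comp HL).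
have [A [Ai [lA IA]]] := inc _ Gal; have [B0 [B0i [lB0 IB0]]] := inc _ Gb.
have [K [Ki [lK IK]]] := inc _ Gk; have [K' [K'i [lK' IK']]] := inc _ Gk'.
have [Q [Qi [lQ IQ]]] := inc _ Gg; have [P0 [P0i [lP0 IP0]]] := inc _ Ggi.
have perA := per _ _ Gal lA; have perB0 := per _ _ Gb lB0; have perK := per _ _ Gk lK.
have perK' := per _ _ Gk' lK'; have perQ := per _ _ Gg lQ.
have GGb := Dc_comp Gb Gb; have GGal := Dc_comp Gal Gal; have GGg := Dc_comp Gg Gg.
have [i1 e1] : exists m : int, forall x, B0 (B0 (A x)) = A (B0 x) + m%:~R * tau.
 by apply: (rel _ _ _ _ (Dc_comp Gal Gb) (lc _ _ _ _ Gal Gb lA lB0) (lc _ _ _ _ GGb Gal (lc _ _ _ _ Gb Gb lB0 lB0) lA)).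
pose B x := B0 x + (- i1)%:~R * tau.
have lB : lift (phi b) B := lift_shift HL (- i1) lB0.
have AB x : A (B x) = B (B (A x)) by rewrite /B perA perB0 e1 mulrNz mulNr addrK.
have perB := per _ _ Gb lB.
clearbody B.
have [i2 e2] : exists m : int, forall x, K x = A (K (A x)) + m%:~R * tau.
 have GkA := Dc_comp Gk Gal.
 by apply: (rel _ _ _ _ (Dc_comp Gal GkA) (lc _ _ _ _ Gal GkA lA (lc _ _ _ _ Gk Gal lK lA)) lK).
pose a x := A (A x) + i2%:~R * tau.
have la : lift (phi (al \o al)) a := lift_shift HL i2 (lc _ _ _ _ Gal Gal lA lA).
have perA2 := per _ _ GGal la.
have aka x : a (K (a x)) = K x.
 have e2' y : A (K (A y)) = K y - i2%:~R * tau by rewrite [in RHS]e2 addrK.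
 rewrite /a perK !perA e2' -mulNr -mulrNz perA e2' mulrNz mulNr; ring.
have ab x : a (B x) = iter 4 B (a x) by rewrite /a /= !AB !perB.
have [i3 e3] : exists m : int, forall x, K' x = Q (K' (Q x)) + m%:~R * tau.
 have GkQ := Dc_comp Gk' Gg.
 by apply: (rel _ _ _ _ (Dc_comp Gg GkQ) (lc _ _ _ _ Gg GkQ lQ (lc _ _ _ _ Gk' Gg lK' lQ)) lK').
pose g2 x := Q (Q x) + i3%:~R * tau.
have lg2 : lift (phi (g \o g)) g2 := lift_shift HL i3 (lc _ _ _ _ Gg Gg lQ lQ).
have perg2 := per _ _ GGg lg2.
have gkg2 x : g2 (K' (g2 x)) = K' x.
 have e3' y : Q (K' (Q y)) = K' y - i3%:~R * tau by rewrite [in RHS]e3 addrK.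
 rewrite /g2 perK' !perQ e3' -mulNr -mulrNz perQ e3' mulrNz mulNr; ring.
have full h L : G h -> lift (phi h) L -> exists Li L' : R -> R, [/\ inc_bij L Li, forall x : R, is_derive x 1 L (L' x), continuous L' & forall x, 0 < L' x].
 move=> Gh lL; have mL := pres_lift Gh lL (not_reversing Gh).
 have [Li [L' [c1 c2 d cL' [[_ p]|dec]]]] := lift_diffeo HL (phiH Gh) lL.
  by exists Li, L'.
 by case: (mono_dec_absurd mL dec).
have [ai [da [Ia a_der da_c da_p]]] := full _ _ GGal la.
have [bi [db [Ib b_der db_c db_p]]] := full _ _ Gb lB.
have [gi2 [dg [Ig g_der _ _]]] := full _ _ GGg lg2.
have cont (L L' : R -> R) : (forall x : R, is_derive x 1 L (L' x)) -> continuous L.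
 by move=> d x; apply/differentiable_continuous/derivable1_diffP; case: (d x).
have [_ _ a_le] := Ia; have [_ _ g_le] := Ig; have [g2K gi2K _] := Ig.
have [pa _ fa] := conj_inv_fix 0 Ia IK (cont _ _ a_der) aka.
have [pg _ fg] := conj_inv_fix 0 Ig IK' (cont _ _ g_der) gkg2.
have per1 L : (forall x (m : int), L (x + m%:~R * tau) = L x + m%:~R * tau) -> forall x, L (x + tau) = L x + tau.
 by move=> h x; have := h x 1; rewrite mulr1z mul1r.
have tau0 := tau_ge0 HL.
have comm_a h L : G h -> lift (phi h) L -> (forall x, al (h x) = h (al x)) -> forall x, L (a x) = a (L x).
 move=> Gh lL hal; have perL := per _ _ Gh lL.
 have [m e] : exists m : int, forall x, L (A x) = A (L x) + m%:~R * tau.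
  by apply: (rel _ _ _ _ (Dc_comp Gal Gh) (lc _ _ _ _ Gal Gh lA lL) (lc _ _ _ _ Gh Gal lL lA)).
 have e' x : a (L x) = L (a x) + (- (m + m))%:~R * tau by rewrite /a perL e e perA mulrNz mulNr intrD; ring.
 have z := comm_translation tau0 a_le (per1 _ perA2) fa e'. by move=> x; rewrite e' z addr0.
have G4 : G (iter 4 g) by have := Dc_comp GGg GGg.
have l4 : lift (phi (iter 4 g)) (g2 \o g2) := lc _ _ _ _ GGg GGg lg2 lg2.
have gga x : g2 (g2 (a x)) = a (g2 (g2 x)) by apply: (comm_a _ _ G4 l4) => y; rewrite g4a.
have ggb x : g2 (g2 (B x)) = B (g2 (g2 x)).
 have [m e] : exists m : int, forall x, g2 (g2 (B x)) = B (g2 (g2 x)) + m%:~R * tau.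
  apply: (rel _ _ _ _ (Dc_comp Gb G4) (lc _ _ _ _ Gb G4 lB l4) (lc _ _ _ _ G4 Gb l4 lB)) => y.
  by rewrite /= -[LHS]g4b.
 have g4le : {mono g2 \o g2 : x y / x <= y} by move=> y z /=; rewrite !g_le.
 have per4 y : (g2 \o g2) (y + tau) = (g2 \o g2) y + tau by rewrite /= !(per1 _ perg2).
 have f4 : (g2 \o g2) pg = pg by rewrite /= !fg.
 by rewrite e (comm_translation tau0 g4le per4 f4 e) addr0.
have gbga2 x : g2 (B (gi2 (a x))) = a (g2 (B (gi2 x))).
 have GGgi := Dc_comp Ggi Ggi; pose P := P0 \o P0.
 have lP : lift (phi (gi \o gi)) P := lc _ _ _ _ Ggi Ggi lP0 lP0.
 have [m e] : exists m : int, forall x, x = g2 (P x) + m%:~R * tau.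
  have lgP := lc _ _ _ _ GGg GGgi lg2 lP. apply: (lift_uniq HL (phiH (Dc_comp GGg GGgi)) lgP).
  rewrite (_ : _ \o _ = id); first by rewrite (phi1 phiM phi_inj); exact: (lift_id HL).
  by apply/funext => y /=; rewrite !giK.
 pose P' y := P y + m%:~R * tau. have lP' : lift (phi (gi \o gi)) P' := lift_shift HL m lP.
 have P'E : gi2 = P' by apply/funext => y; rewrite [in LHS](e y) -perg2 g2K.
 have GbP := Dc_comp Gb GGgi; have Gall := Dc_comp GGg GbP.
 have lall : lift (phi ((g \o g) \o (b \o (gi \o gi)))) (g2 \o (B \o gi2)).
  by rewrite P'E; exact: (lc _ _ _ _ GGg GbP lg2 (lc _ _ _ _ Gb GGgi lB lP')).
 by apply: (comm_a _ _ Gall lall) => y; rewrite /= -[LHS]gbga.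
have BE := line_lemma Ia Ib a_der b_der da_c db_c da_p db_p ab Ig IK IK' (cont _ _ g_der) aka gkg2 gga ggb gbga2.
by apply: (lift_faithful HL (phiH Gb)); rewrite (_ : id = B) //; apply/funext => x; rewrite BE.
Qed.

End lifted_action.

Section line_instance.
Context {R : realType}.

Lemma Cr1_derive (f : R -> R) : Cr (Some 1%N) f -> exists2 f' : R -> R, (forall x : R, is_derive x 1 f (f' x)) & continuous f'.
Proof.
move=> cf; have [_ df] := cf [::]; have [c1 _] := cf [:: 1].
exists (fun x => 'D_1 f x); last exact: c1.
move=> x; have /derivable1_diffP d := df isT x; by [].
Qed.

Lemma mono_of_derive (L L' : R -> R) : (forall x : R, is_derive x 1 L (L' x)) -> (forall x, 0 < L' x) -> {mono L : x y / x <= y}.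
Proof.
move=> d p; apply: le_mono => x y xy.
have fc : {within `[x, y], continuous L} by apply: derivable_within_continuous => z _; have [] := d z.
have [c _ E] := @MVT R L L' x y xy (fun z _ => d z) fc.
by rewrite -subr_gt0 E mulr_gt0 // subr_gt0.
Qed.

Lemma line_diffeo_inv (L Li L' Li' : R -> R) : cancel L Li -> cancel Li L ->
 (forall x : R, is_derive x 1 L (L' x)) -> continuous L' -> (forall x : R, is_derive x 1 Li (Li' x)) -> line_diffeo L.
Proof.
move=> K1 K2 d c di.
have nz x : L' x != 0.
 apply/eqP => E; have h := is_derive1_comp (di (L x)) (d x). have : L' x * Li' (L x) = 1.
  have e1 : Li \o L = id by apply/funext. have h2 := is_derive_id x (1 : R); rewrite -e1 in h2.
  by rewrite mulrC -(derive_val (is_derive := h)) (derive_val (is_derive := h2)).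
 by rewrite E mul0r => /eqP; rewrite eq_sym oner_eq0.
have sgn x y : 0 < L' x -> L' y < 0 -> False.
 move=> px py; pose u := Num.min x y; pose v := Num.max x y.
 have uv : u <= v by rewrite ge_min le_max lexx.
 have hc : {within `[u, v], continuous L'} by apply: continuous_subspaceT.
 have hm : Num.min (L' u) (L' v) <= 0 <= Num.max (L' u) (L' v).
  have px' := ltW px; have py' := ltW py.
  by rewrite /u /v; case: (leP x y) => _; rewrite ge_min le_max px' py' ?orbT.
 by have [t _ /eqP] := IVT uv hc hm; rewrite (negbTE (nz t)).
exists Li, L'; split=> //.
have [p0|n0|E] := ltgtP 0 (L' 0); last by have := nz 0; rewrite -E eqxx.
 have pos x : 0 < L' x by have := nz x; case: (ltgtP (L' x) 0) => // h _; case: (sgn 0 x).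
 by left; split=> //; exact: mono_of_derive pos.
have neg x : L' x < 0 by have := nz x; case: (ltgtP (L' x) 0) => // h _; case: (sgn x 0).
right; have dN : forall x : R, is_derive x 1 (fun x => - L x) (- L' x) by move=> x; exact: is_deriveN.
have pN x : 0 < - L' x by rewrite oppr_gt0.
by move=> x y; rewrite -lerN2 (mono_of_derive dN pN).
Qed.

Lemma line_lifting : lifting (@Diff1_line R) (fun u L => u = L) 0.
Proof.
split=> //.
- by move=> u [_ [g [ug _ _]]]; exact: can_inj ug.
- by move=> u _; exists u.
- move=> u L [cu [g [ug gu cg]]] <-. have [u' du cu'] := Cr1_derive cu; have [g' dg _] := Cr1_derive cg.
 exact: line_diffeo_inv ug gu du cu' dg.
- by move=> u v L M -> ->.
- by move=> u L m ->; apply/funext => x; rewrite mulr0 addr0.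
- by move=> u L L' _ -> ->; exists 0 => x; rewrite mulr0 addr0.
- by move=> u L _ _ _ x; rewrite !addr0.
Qed.

End line_instance.

Section antiderivative.
Context {R : realType}.
Local Notation mu := (@lebesgue_measure R).

Lemma constant_of_derive0 (f : R -> R) (a b : R) : (forall x, a < x < b -> is_derive x (1 : R) f 0) ->
 forall x y, a < x < b -> a < y < b -> f x = f y.
Proof.
move=> d; suff H x y : a < x < b -> a < y < b -> x < y -> f x = f y.
 by move=> x y xi yi; case: (ltgtP x y) => [h|h|->] //; [exact: H|apply/esym; exact: H].
move=> /andP[ax xb] /andP[ay yb] xy.
have dd z : z \in `[x, y] -> is_derive z (1 : R) f 0.
 rewrite in_itv /= => /andP[z1 z2]; apply: d; rewrite (lt_le_trans ax) //=; exact: le_lt_trans yb.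
have fc : {within `[x, y], continuous f} by apply: derivable_within_continuous => z zi; have [] := dd z zi.
have dd' z : z \in `]x, y[ -> is_derive z (1 : R) f 0.
 by rewrite in_itv /= => /andP[z1 z2]; apply: dd; rewrite in_itv /= (ltW z1) (ltW z2).
have [c _] := @MVT R f (fun=> 0) x y xy dd' fc.
by rewrite mul0r => /eqP; rewrite subr_eq0 => /eqP ->.
Qed.

Lemma antiderivative (f : R -> R) : continuous f -> exists F : R -> R, forall x : R, is_derive x 1 F (f x).
Proof.
move=> cf; pose I (N : nat) (x : R) : R := (\int[mu]_(t in [set` `[- N%:R, x]]) (f t))%R.
pose B N x := I N x - I N 0.
have dI N (x : R) : - N%:R < x -> is_derive x (1 : R) (B N) (f x).
 move=> Nx; have xu : x < x + 1 by lra. have int : mu.-integrable `[- N%:R, x + 1] (EFin \o f).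
  apply: continuous_compact_integrable; first exact: segment_compact. exact: continuous_subspaceT.
 have [d1 d2] := continuous_FTC1_closed xu int Nx (cf x).
 have h : is_derive x (1 : R) (I N) (f x) by split=> //; rewrite -derive1E.
 have := is_deriveB h (is_derive_cst (I N 0) x 1); rewrite subr0. by [].
have BE N M (x : R) : (N <= M)%N -> - N.+1%:R < x < N.+1%:R -> B N.+1 x = B M.+1 x.
 move=> NM xN; have z0 : - N.+1%:R < (0 : R) < N.+1%:R by lra.
 have hd (y : R) : - N.+1%:R < y < N.+1%:R -> is_derive y 1 (fun x => B N.+1 x - B M.+1 x) 0.
  move=> /andP[y1 _]; have y2 : - M.+1%:R < y by apply: le_lt_trans y1; rewrite lerN2 ler_nat.
  by have := is_deriveB (dI _ _ y1) (dI _ _ y2); rewrite subrr.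
 have := constant_of_derive0 hd xN z0. by rewrite /B !subrr => /eqP; rewrite subr_eq0 => /eqP.
pose nx (x : R) := Num.truncn `|x|.
have nxP (x : R) : - (nx x).+1%:R < x < (nx x).+1%:R.
 by rewrite -ltr_norml; have /andP[] := truncn_itv (normr_ge0 x).
exists (fun x => B (nx x).+1 x) => x.
have xn := nxP x; pose N := (nx x).+1.
have x2 : - N.+1%:R < x by have /andP[h _] := xn; apply: lt_trans h; rewrite ltrN2 ltr_nat.
apply: near_eq_is_derive (dI _ _ x2) => //.
apply/nbhs_ballP; exists 1 => //= y; rewrite -ball_normE /= => xy.
apply/esym; apply: BE => //.
have /andP[h1 _] := truncn_itv (normr_ge0 y); rewrite -ltnS -(ltr_nat R) -/(nx y).
apply: le_lt_trans h1 _; have h2 : `|x| < N%:R by rewrite ltr_norml.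
by have := ler_normB x (x - y); rewrite subKr -natr1; move: h2 xy; lra.
Qed.

End antiderivative.

Section circle_instance.
Context {R : realType}.
Local Notation tau := (pi *+ 2 : R).
Local Notation cp := (@circle_param R).

Lemma tau_gt0 : 0 < tau. Proof. by rewrite pmulrn_lgt0 // pi_gt0. Qed.

Lemma circle_eq (z w : circle R) : sval z = sval w -> z = w.
Proof. by case: z w => [z pz] [w pw] /= zw; apply: eq_exist. Qed.

Lemma cparam_per (t : R) (m : int) : cp (t + m%:~R * tau) = cp t.
Proof.
have pos (k : nat) s : cp (s + k%:R * tau) = cp s.
 elim: k s => [|k IH] s; first by rewrite mul0r addr0.
 rewrite -natr1 mulrDl mul1r addrA -[RHS]IH; apply: circle_eq. by rewrite /= cosD2pi sinD2pi.
case: m => k; first exact: pos.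
by rewrite NegzE mulrNz mulNr -(pos k.+1) subrK.
Qed.

Lemma cparam_eq (s t : R) : cp s = cp t -> exists m : int, s = t + m%:~R * tau.
Proof.
move=> st; have [ec es] : cos s = cos t /\ sin s = sin t by have /(congr1 sval) [] := st.
have tp := tau_gt0; pose m := Num.floor ((s - t) / tau).
have /andP[m1 m2] := floor_itv ((s - t) / tau); rewrite -/m in m1 m2.
rewrite ler_pdivlMr // in m1; rewrite ltr_pdivrMr // intrD mulrDl mul1r in m2.
exists m; pose e : R := s - t - m%:~R * tau.
have e0 : 0 <= e by rewrite subr_ge0.
have e1 : e < tau by rewrite ltrBlDl.
have ce : cos e = 1.
 have h : cp e = cp (s - t) by rewrite -(cparam_per e m) /e subrK.
 have /(congr1 sval) [-> _] := h. by rewrite cosB ec es -!expr2 cos2Dsin2.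
have : sin (e / 2) = 0.
 have h : cos e = 1 - sin (e / 2) ^+ 2 *+ 2.
  have {1}-> : e = (e / 2) *+ 2 by rewrite -mulr_natr divfK.
  by rewrite cos_mulr2n cos2sin2 mulrnBl; move: (sin _ ^+ 2) => w; ring.
 move: h; rewrite ce => h; apply/eqP; rewrite -sqrf_eq0; apply/eqP.
 by move: h; move: (sin _ ^+ 2) => w; lra.
move=> s0; suff : e = 0 by rewrite /e => h; move: h; move: (m%:~R * tau) => w; lra.
apply/eqP; rewrite eq_le e0 andbT leNgt; apply/negP => ep.
suff : 0 < sin (e / 2) by rewrite s0 ltxx.
apply: sin_gt0_pi; rewrite divr_gt0 //= ltr_pdivrMr //.
by lra.
Qed.

Lemma cparam_surj (z : circle R) : exists t, cp t = z.
Proof.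
case: z => -[x y] /= z1; have /eqP h := z1; rewrite /= in h.
have xb : -1 <= x <= 1.
 by rewrite -ler_norml -(@ler_pXn2r _ 2) ?nnegrE // expr1n real_normK ?num_real // -h lerDl sqr_ge0.
have hs : sin (acos x) = `|y| by rewrite sin_acos // -h [x ^+ 2 + _]addrC addrK sqrtr_sqr.
have [y0|y0] := leP 0 y.
 by exists (acos x); apply: circle_eq; rewrite /= acosK // hs ger0_norm.
by exists (- acos x); apply: circle_eq; rewrite /= cosN sinN acosK // hs ltr0_norm // opprK.
Qed.

Lemma circle_components (u : circle R -> circle R) : C1_circle u -> exists X Y X' Y' : R -> R,
 [/\ forall t, sval (u (cp t)) = (X t, Y t), forall t : R, is_derive t 1 X (X' t),
   forall t : R, is_derive t 1 Y (Y' t), continuous X' & continuous Y'].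
Proof.
rewrite /C1_circle; set c := (fun t : R => _) => cc.
have [_ dc] := cc [::]; have [c1 _] := cc [:: 1].
exists (fun t => (c t).1), (fun t => (c t).2), (fun t => ('D_1 c t).1), (fun t => ('D_1 c t).2).
have dd t : (fun h : R => h^-1 *: (c (h *: 1 + t) - c t)) @ 0^' --> 'D_1 c t by have /derivable1_diffP := dc isT t.
split.
- by move=> t; rewrite -/(c t); case: (c t).
- move=> t; have q : (fun h : R => h^-1 *: ((c (h *: 1 + t)).1 - (c t).1)) @ 0^' --> ('D_1 c t).1.
  exact: (cvg_comp _ _ (dd t) cvg_fst).
 by split; [exact: cvgP q|exact: cvg_lim q].
- move=> t; have q : (fun h : R => h^-1 *: ((c (h *: 1 + t)).2 - (c t).2)) @ 0^' --> ('D_1 c t).2.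
  exact: (cvg_comp _ _ (dd t) cvg_snd).
 by split; [exact: cvgP q|exact: cvg_lim q].
- by move=> t; exact: (cvg_comp _ _ (c1 isT t) cvg_fst).
- by move=> t; exact: (cvg_comp _ _ (c1 isT t) cvg_snd).
Qed.

Lemma constant_on_line (f : R -> R) : (forall x : R, is_derive x 1 f 0) -> forall x y, f x = f y.
Proof.
move=> d x y; pose b := `|x| + `|y| + 1.
apply: (@constant_of_derive0 _ f (- b) b) => //; rewrite -ltr_norml /b.
 by have := normr_ge0 y; lra.
by have := normr_ge0 x; lra.
Qed.

(* The angle of the curve [(X, Y)] is an antiderivative of [X Y' - Y X']. *)
Lemma C1_lift (u : circle R -> circle R) : C1_circle u -> exists L L' : R -> R,
 [/\ forall t, u (cp t) = cp (L t), forall t : R, is_derive t 1 L (L' t) & continuous L'].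
Proof.
move=> /circle_components[X [Y [X' [Y' [E dX dY cX' cY']]]]].
have N t : X t * X t + Y t * Y t = 1 by have := svalP (u (cp t)); rewrite E /= => /eqP <-; rewrite !expr2.
have O t : X t * X' t + Y t * Y' t = 0.
 have e1 : (fun t => X t * X t + Y t * Y t) = cst 1 by apply/funext.
 have h1 := is_deriveD (is_deriveM (dX t) (dX t)) (is_deriveM (dY t) (dY t)).
 have h2 := is_derive_cst (1 : R) t 1; rewrite -e1 in h2.
 have := derive_val (is_derive := h1); rewrite (derive_val (is_derive := h2)) /GRing.scale /=.
 by move: (X t * X' t) (Y t * Y' t) => a b; lra.
pose W t := X t * Y' t - Y t * X' t.
have cW : continuous W.
 move=> t; apply: cvgB; apply: cvgM; [exact: (is_derive_cont dX)|exact: cY'|exact: (is_derive_cont dY)|exact: cX'].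
have [F dF] := antiderivative cW; have [t0 Et0] := cparam_surj (u (cp 0)).
pose L (t : R) := F t + (t0 - F 0).
have dL (t : R) : is_derive t 1 L (W t) by have := is_deriveD (dF t) (is_derive_cst (t0 - F 0) t 1); rewrite addr0.
exists L, W; split=> //.
have L0 : L 0 = t0 by rewrite /L addrC subrK.
have [X0 Y0] : X 0 = cos t0 /\ Y 0 = sin t0 by have := congr1 sval Et0; rewrite E /= => -[-> ->].
have dc (t : R) : is_derive t 1 (fun t => cos (L t)) (W t * - sin (L t)).
 by have := is_derive1_comp (is_derive_cos (L t)) (dL t); rewrite mulrC.
have ds (t : R) : is_derive t 1 (fun t => sin (L t)) (W t * cos (L t)).
 by have := is_derive1_comp (is_derive_sin (L t)) (dL t); rewrite mulrC.
have X'E t : X' t = - (Y t * W t).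
 rewrite /W; have h1 := N t; have h2 := O t. apply/eqP; rewrite -subr_eq0; apply/eqP.
 rewrite -[X in X - _]mul1r -h1. transitivity (X t * (X t * X' t + Y t * Y' t)); first ring.
 by rewrite h2 mulr0.
have Y'E t : Y' t = X t * W t.
 rewrite /W; have h1 := N t; have h2 := O t. apply/eqP; rewrite -subr_eq0; apply/eqP.
 rewrite -[X in X - _]mul1r -h1. transitivity (Y t * (X t * X' t + Y t * Y' t)); first ring.
 by rewrite h2 mulr0.
have dp (t : R) : is_derive t 1 (fun t => X t * cos (L t) + Y t * sin (L t)) 0.
 have := is_deriveD (is_deriveM (dX t) (dc t)) (is_deriveM (dY t) (ds t)).
 rewrite /GRing.scale /= X'E Y'E; set d := (X in is_derive _ _ _ X).
 have -> : d = 0 by rewrite /d; ring. by [].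
have dq (t : R) : is_derive t 1 (fun t => Y t * cos (L t) - X t * sin (L t)) 0.
 have := is_deriveB (is_deriveM (dY t) (dc t)) (is_deriveM (dX t) (ds t)).
 rewrite /GRing.scale /= X'E Y'E; set d := (X in is_derive _ _ _ X).
 have -> : d = 0 by rewrite /d; ring. by [].
move=> t; apply: circle_eq; rewrite E /=.
have p1 := constant_on_line dp t 0; have q0 := constant_on_line dq t 0.
rewrite /= L0 X0 Y0 -!expr2 cos2Dsin2 in p1.
rewrite /= L0 X0 Y0 [sin t0 * _]mulrC subrr in q0.
have cs := cos2Dsin2 (L t); move: p1 q0 cs; move: (cos (L t)) (sin (L t)) => c s p1 q0 cs.
congr pair.
 rewrite -[LHS]mulr1 -cs; transitivity (c * (X t * c + Y t * s) - s * (Y t * c - X t * s)); first ring.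
 by rewrite p1 q0; ring.
rewrite -[LHS]mulr1 -cs; transitivity (s * (X t * c + Y t * s) + c * (Y t * c - X t * s)); first ring.
by rewrite p1 q0; ring.
Qed.

Lemma int_valued_constant (h : R -> R) : continuous h -> (forall x, exists m : int, h x = m%:~R) -> forall x y, h x = h y.
Proof.
move=> ch hi; suff H x y : x <= y -> h x = h y.
 by move=> x y; have [/H|/ltW/H] := leP x y.
move=> xy; have [m Em] := hi x; have [k Ek] := hi y.
apply/eqP; apply: contraT => ne; have mk : m != k by apply: contraNneq ne => mk; rewrite Em Ek mk.
pose j := Num.min m k; pose v : R := j%:~R + 2^-1.
have hv : Num.min (h x) (h y) <= v <= Num.max (h x) (h y).
 rewrite Em Ek /v /j ge_min le_max; have [mk'|mk'|E] := ltgtP m k; last by rewrite E eqxx in mk.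
  have : m + 1 <= k by lia.
  by rewrite -(ler_int R) intrD => h1; apply/andP; split; apply/orP; [left|right]; move: h1; lra.
 have : k + 1 <= m by lia.
 by rewrite -(ler_int R) intrD => h1; apply/andP; split; apply/orP; [right|left]; move: h1; lra.
have hc : {within `[x, y], continuous h} by apply: continuous_subspaceT.
have [t _ ht] := IVT xy hc hv; have [i Ei] := hi t.
have : (2 * i)%:~R = (2 * j + 1)%:~R :> R by rewrite !intrD !intrM -Ei ht /v; move: (j%:~R : R) => w; lra.
by move/eqP; rewrite eqr_int => /eqP; lia.
Qed.

Definition clift (u : circle R -> circle R) (L : R -> R) := (forall t, u (cp t) = cp (L t)) /\ continuous L.

Lemma clift_uniq u L L' : clift u L -> clift u L' -> exists m : int, forall x, L' x = L x + m%:~R * tau.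
Proof.
move=> [EL cL] [EL' cL']; have tp := tau_gt0; have tn : tau != 0 by rewrite gt_eqF.
pose h x := (L' x - L x) / tau.
have ch : continuous h by move=> x; apply: cvgM; [apply: cvgB; [exact: cL'|exact: cL]|exact: cvg_cst].
have hi x : exists m : int, h x = m%:~R.
 have [|m Em] := @cparam_eq (L' x) (L x); first by rewrite -EL -EL'.
 by exists m; rewrite /h Em addrC addKr mulfK.
have [m Em] := hi 0; exists m => x.
by rewrite -Em (int_valued_constant ch hi 0 x) /h divfK // addrC subrK.
Qed.

Lemma circle_lifting : lifting (@Diff1_circle R) clift tau.
Proof.
have comp u v L M : clift u L -> clift v M -> clift (u \o v) (L \o M).
 move=> [uL cL] [vM cM]; split=> [t|t]; first by rewrite /= vM uL. exact: continuous_comp (cM t) (cL _).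
have shift u L (m : int) : clift u L -> clift u (fun x => L x + m%:~R * tau).
 move=> [uL cL]; split=> [t|t]; first by rewrite cparam_per.
 by apply: cvgD; [exact: cL|exact: cvg_cst].
have lid : clift id id by split=> // t; exact: cvg_id.
split=> //.
- exact/ltW/tau_gt0.
- by move=> u [_ [g [ug _ _]]]; exact: can_inj ug.
- move=> u [cu _]; have [L [L' [EL dL _]]] := C1_lift cu.
 by exists L; split=> //; exact: is_derive_cont dL.
- move=> u L [cu [g [ug gu cg]]] lL. have [L1 [L' [EL1 dL1 cL']]] := C1_lift cu.
 have [m Em] : exists m : int, forall x, L x = L1 x + m%:~R * tau.
  by apply: (clift_uniq (u := u)) => //; split=> //; exact: is_derive_cont dL1.
 have dL (t : R) : is_derive t 1 L (L' t).
  have -> : L = fun x => L1 x + m%:~R * tau by apply/funext.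
  by have := is_deriveD (dL1 t) (is_derive_cst (m%:~R * tau) t 1); rewrite addr0.
 have [M0 [M' [EM0 dM0 _]]] := C1_lift cg.
 have lM0 : clift g M0 by split=> //; exact: is_derive_cont dM0.
 have e1 : g \o u = id by apply/funext. have e2 : u \o g = id by apply/funext.
 have lgu := comp _ _ _ _ lM0 lL; rewrite e1 in lgu.
 have [k Ek] := clift_uniq lgu lid; rewrite /= in Ek. pose M := fun x => M0 x + k%:~R * tau.
 have lM : clift g M by exact: shift. have ML : cancel L M by [].
 have lug := comp _ _ _ _ lL lM; rewrite e2 in lug.
 have [j Ej] := clift_uniq lid lug; rewrite /= in Ej.
 have j0 : j%:~R * tau = 0 by have := Ej (L 0); rewrite ML => /eqP; rewrite eq_sym -subr_eq0 addrC addKr => /eqP.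
 have LM : cancel M L by move=> x; rewrite Ej j0 addr0. have dM (t : R) : is_derive t 1 M (M' t).
  by have := is_deriveD (dM0 t) (is_derive_cst (k%:~R * tau) t 1); rewrite addr0.
 exact: line_diffeo_inv ML LM dL cL' dM.
- by move=> u L L' _; exact: clift_uniq.
- move=> u L [_ [g [ug _ _]]] [EL cL] Lle t; have tp := tau_gt0.
 have [|m Em] := @cparam_eq (L (t + tau)) (L t).
  by rewrite -!EL -[X in t + X]mul1r -[1]/(1%:~R) cparam_per.
 have Llt := leW_mono Lle. have : L t < L (t + tau) by rewrite Llt ltrDl.
 rewrite Em ltrDl pmulr_lgt0 // ltr0z => m0. have [->|m1] := eqVneq m 1; first by rewrite mul1r.
 have m2 : 2 <= m by lia. have m2' : 2%:~R * tau <= m%:~R * tau by rewrite ler_pM2r // ler_int.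
 have tt : t <= t + tau by lra.
 have hc : {within `[t, t + tau], continuous L} by apply: continuous_subspaceT.
 have hv : Num.min (L t) (L (t + tau)) <= L t + tau <= Num.max (L t) (L (t + tau)).
  rewrite Em ge_min le_max lerDl (ltW tp) /= lerD2l; apply/orP; right. by lra.
 have [s _ Es] := IVT tt hc hv. have ts : t < s by rewrite -Llt Es ltrDl. have st : s < t + tau.
  rewrite -Llt Es Em ltrD2l; apply: lt_le_trans m2'. by lra.
 have [|i Ei] := @cparam_eq s t.
  by apply: (can_inj ug); rewrite !EL Es -[X in L t + X]mul1r -[1]/(1%:~R) cparam_per.
 move: ts st; rewrite Ei ltrDl pmulr_lgt0 // ltr0z ltrD2l.
 by move=> i0; rewrite -[X in _ < X -> _]mul1r ltr_pM2r // -[1]/(1%:~R) ltr_int; lia.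
- move=> u _ [Eu _]; apply/funext => z; have [t <-] := cparam_surj z. by [].
Qed.

End circle_instance.

Theorem theorem1p5 (R : realType) (n : nat) (r : regularity)
    (hn : (2 <= n)%N) (hr : r <> Some n.+1) :
  (forall phi : ('rV[R]_n -> 'rV[R]_n) -> (circle R -> circle R),
     group_hom (Diffc0 r) (@Diff1_circle R) phi ->
     trivial_hom (Diffc0 r) phi) /\
  (forall phi : ('rV[R]_n -> 'rV[R]_n) -> (R -> R),
     group_hom (Diffc0 r) (@Diff1_line R) phi ->
     trivial_hom (Diffc0 r) phi).
Proof.
split=> phi [phiH phiM] f Gf.
  exact: (hom_trivial hn hr circle_lifting phiH phiM Gf).
exact: (hom_trivial hn hr line_lifting phiH phiM Gf).
Qed.
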